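(* A language $L \subseteq \{0,1\}^*$ is in $\mathsf{PSPACE}$ if and only if there exist a verifier $V$ with randomness complexity $r(n)=O(\log n)$ and query complexity $q(n)=O(1)$ (over the binary alphabet), together with polynomial-time computable functions $\pi^{\mathsf{start}}, \pi^{\mathsf{goal}} \colon \{0,1\}^* \to \{0,1\}^*$, such that for every input $x \in \{0,1\}^*$ (with $n=|x|$): \begin{itemize} \item (Completeness) If $x \in L$, there exists a reconfiguration sequence $(\pi^{(1)},\ldots,\pi^{(T)})$ from $\pi^{\mathsf{start}}(x)$ to $\pi^{\mathsf{goal}}(x)$ over $\{0,1\}^{\mathrm{poly}(n)}$ such that $\Pr[V^{\pi^{(t)}}(x)=1]=1$ for every $t \in \{1,\ldots,T\}$. \item (Soundness) If $x \notin L$, then for every reconfiguration sequence $(\pi^{(1)},\ldots,\pi^{(T)})$ from $\pi^{\mathsf{start}}(x)$ to $\pi^{\mathsf{goal}}(x)$ over $\{0,1\}^{\mathrm{poly}(n)}$ there exists $t \in \{1,\ldots,T\}$ with $\Pr[V^{\pi^{(t)}}(x)=1] < \frac12$. \end{itemize} Here probabilities are over the random bits of $V$.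
   Context: A verifier with randomness complexity $r\colon\mathbb{N}\to\mathbb{N}$ and query complexity $q\colon\mathbb{N}\to\mathbb{N}$ is a probabilistic polynomial-time algorithm $V$ that, on input $x$, tosses $r(|x|)$ random bits and uses them to generate a sequence of $q(|x|)$ positions $I=(i_1,\ldots,i_q)$ and a circuit $D\colon\{0,1\}^q\to\{0,1\}$; given oracle access to a proof string $\pi$, its output is $V^{\pi}(x) := D(\pi|_I)$, where $\pi|_I$ is the restriction of $\pi$ to the positions in $I$. For strings $\pi^{\mathsf{start}},\pi^{\mathsf{goal}}\in\Sigma^m$, a reconfiguration sequence from $\pi^{\mathsf{start}}$ to $\pi^{\mathsf{goal}}$ over $\Sigma^m$ is a finite sequence $(\pi^{(1)},\ldots,\pi^{(T)})$ of strings in $\Sigma^m$ with $\pi^{(1)}=\pi^{\mathsf{start}}$, $\pi^{(T)}=\pi^{\mathsf{goal}}$, and $\pi^{(t)}$, $\pi^{(t+1)}$ differing in at most one position for every $t\in\{1,\ldots,T-1\}$. *)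

(* Defs.v *)
From mathcomp Require Import all_boot.
Set Implicit Arguments. Unset Strict Implicit. Unset Printing Implicit Defensive.

(* Tape symbols: [Some b] for bit b, [None] for blank. *)
Record TM := mkTM {
  tm_Q : finType;
  tm_start : tm_Q;
  tm_halt : tm_Q -> bool;
  tm_accept : tm_Q -> bool;
  (* new state, symbol written, move (true = right, false = left) *)
  tm_delta : tm_Q -> option bool -> tm_Q * option bool * bool
}.

(* configuration: state, cells left of head (nearest first), head cell,
   cells right of head. The lists only contain cells visited so far. *)
Definition config (M : TM) :=
  (tm_Q M * seq (option bool) * option bool * seq (option bool))%type.

Definition init_config (M : TM) (x : seq bool) : config M :=
  match x with
  | [::] => (@tm_start M, [::], None, [::])
  | b :: x' => (@tm_start M, [::], Some b, map Some x')
  end.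

Definition step (M : TM) (c : config M) : config M :=
  let '(q, l, a, r) := c in
  if @tm_halt M q then c else
  let '(q', b, mv) := @tm_delta M q a in
  if mv then
    match r with
    | [::] => (q', b :: l, None, [::])
    | a' :: r' => (q', b :: l, a', r')
    end
  else
    match l with
    | [::] => (q', [::], None, b :: r)
    | a' :: l' => (q', l', a', b :: r)
    end.

Definition run (M : TM) (t : nat) (x : seq bool) : config M :=
  iter t (step (M:=M)) (init_config M x).

Definition cfg_state (M : TM) (c : config M) : tm_Q M := c.1.1.1.

Definition cfg_space (M : TM) (c : config M) : nat :=
  let '(_, l, _, r) := c in size l + 1 + size r.

Fixpoint read_out (s : seq (option bool)) : seq bool :=
  match s with
  | Some b :: s' => b :: read_out s'
  | _ => [::]
  end.

Definition cfg_output (M : TM) (c : config M) : seq bool :=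
  let '(_, _, a, r) := c in read_out (a :: r).

Definition poly_bound (k n : nat) : nat := n ^ k + k.

Definition PolyTime (f : seq bool -> seq bool) : Prop :=
  exists (M : TM) (k : nat), forall x : seq bool,
    exists t, t <= poly_bound k (size x) /\
      @tm_halt M (cfg_state (run M t x)) /\ cfg_output (run M t x) = f x.

Definition inPSPACE (L : seq bool -> Prop) : Prop :=
  exists (M : TM) (k : nat), forall x : seq bool,
    exists t, @tm_halt M (cfg_state (run M t x)) /\
      (forall t', t' <= t -> cfg_space (run M t' x) <= poly_bound k (size x)) /\
      (@tm_accept M (cfg_state (run M t x)) <-> L x).

Definition pair_enc (x y : seq bool) : seq bool :=
  flatten (map (fun b => [:: b; b]) x) ++ [:: false; true] ++ y.

Definition bin_val (s : seq bool) : nat := foldr (fun (b : bool) (n : nat) => (b : nat) + n.*2) 0 s.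

(* verifier output encoding: pairs "0b" = bit b, "1?" = separator *)
Fixpoint tokens (s : seq bool) : seq (option bool) :=
  match s with
  | false :: b :: s' => Some b :: tokens s'
  | true :: _ :: s' => None :: tokens s'
  | _ => [::]
  end.

Fixpoint split_blocks (t : seq (option bool)) (acc : seq bool) : seq (seq bool) :=
  match t with
  | [::] => [:: acc]
  | None :: t' => acc :: split_blocks t' [::]
  | Some b :: t' => split_blocks t' (rcons acc b)
  end.

(* decode a verifier output into (query positions I, truth table of D) *)
Definition decode (s : seq bool) : seq nat * seq bool :=
  let bs := split_blocks (tokens s) [::] in
  (map bin_val (take (size bs).-1 bs), last [::] bs).

(* The verifier is a poly-time function Vf; on input x and random string R it
   outputs (I, D) = decode (Vf (pair_enc x R)).  D : {0,1}^q -> {0,1} is given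
   by its truth table, indexed by the little-endian value of pi|_I. *)
Definition verifier_output (Vf : seq bool -> seq bool) (x R : seq bool) :=
  decode (Vf (pair_enc x R)).

Definition verifier_accepts (Vf : seq bool -> seq bool) (x R pi : seq bool) : bool :=
  let '(Is, D) := verifier_output Vf x R in
  nth false D (bin_val (map (nth false pi) Is)).

Definition verifier_shape (Vf : seq bool -> seq bool) (r q : nat -> nat) : Prop :=
  forall (x : seq bool) (R : (r (size x)).-tuple bool),
    size (verifier_output Vf x R).1 = q (size x) /\
    size (verifier_output Vf x R).2 = 2 ^ q (size x).

(* number of random strings on which V^pi(x) accepts;
   Pr[V^pi(x)=1] = acc_count / 2^(r |x|) *)
Definition acc_count (Vf : seq bool -> seq bool) (r : nat -> nat) (x pi : seq bool) : nat :=
  #|[pred R : (r (size x)).-tuple bool | verifier_accepts Vf x R pi]|.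

Definition accepts_surely Vf r x pi : Prop := acc_count Vf r x pi = 2 ^ r (size x).
Definition accepts_lt_half Vf r x pi : Prop := (acc_count Vf r x pi).*2 < 2 ^ r (size x).

Definition hamming (u v : seq bool) : nat := count (fun p => p.1 != p.2) (zip u v).

Definition reconf_seq (m : nat) (a b : seq bool) (s : seq (seq bool)) : Prop :=
  s <> [::] /\ head [::] s = a /\ last [::] s = b /\
  all (fun u => size u == m) s /\
  (forall t, t.+1 < size s -> hamming (nth [::] s t) (nth [::] s t.+1) <= 1).

(* Main.v *)
Require Import Defs.
From Stdlib Require Import FunctionalExtensionality Classical_Prop.
From mathcomp Require Import all_boot all_order all_algebra.
From mathcomp Require Import zify ring lra.
Set Implicit Arguments. Unset Strict Implicit. Unset Printing Implicit Defensive.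

(** Let [F] be the step function of a machine deciding [L] in polynomial space, on bit strings, with the
accepting configuration as a fixed point [g]. The relation "equal or one step of [F] apart" is symmetric,
so along any walk from a string [s] every string reaches [g] iff [s] does. A proof string consists of four
flags, two blocks [X1], [X2] that should encode states in a code of constant distance, and assignment
testers (PCPs of proximity) for "[X1] and [X2] encode adjacent states" and "[Xi] encodes a state"; a flag
frees one block at a time to be rewritten. If the verifier rejects rarely, the blocks are close to unique
codewords, and changing one bit does not change the decoded states, hence every reconfiguration sequence
that is accepted throughout is a walk from the initial configuration to [g]. The testers are obtained from
a tableau of the computation by iterating Dinur's gap amplification [log m] times, where every test carries
a link to a bit of the input word. Conversely, sure acceptance is decided by running over the polynomially
many random strings, and reachability by Savitch's recursion, evaluated as a quantified formula. *)

(** Gap amplification alone would forget the word: it makes an unsatisfiable system robustly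
    unsatisfiable but says nothing about how a proof relates to the two encoded states. The links
    repair this. A round preserves the distribution of their labels, and passing from a proof to the
    decoded proof of the previous round costs at most a constant times the rejection rate; that rate
    halves on the way back, so the total loss is a geometric series. The links of the final instance
    therefore measure a relative Hamming distance.

    The second obstacle is that every map has to be polynomial-time on concrete machines. Data are
    coded as trees with unary numbers, so that numeric loops are cheap, and constants of enormous
    size (opinions, truth tables, long-code positions) live in fixed finite types, where any
    function at all is a table lookup.

    The expanders come from zig-zag products over a Cayley graph of the 8-dimensional space over the
    field with 37 elements, whose spectrum is bounded by a counting argument on commuting
    projections instead of characters. *)

Notation str := (seq bool) (only parsing).

(** * Stack programs and their compilation to Turing machines *)

(* The three stacks are named by [option bool], which is already a [finType]. *)
Definition reg := option bool.
Definition r1 : reg := None.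
Definition r2 : reg := Some false.
Definition r3 : reg := Some true.

Definition store := (str * str * str)%type.
Definition getr (s : store) (r : reg) : str :=
  let '(a, b, c) := s in
  match r with None => a | Some false => b | Some true => c end.
Definition setr (s : store) (r : reg) (v : str) : store :=
  let '(a, b, c) := s in
  match r with
  | None => (v, b, c) | Some false => (a, v, c) | Some true => (a, b, v)
  end.
Definition tot (s : store) : nat :=
  let '(a, b, c) := s in size a + size b + size c.
Definition pushr s r b := setr s r (b :: getr s r).
Definition popr s r := setr s r (behead (getr s r)).

Inductive prog :=
| Skip
| Push of reg & bool
| Seq of prog & prog
(* pop a stack and branch on the popped symbol: empty, 0, 1 *)
| Match of reg & prog & prog & prog
(* pop a stack, and repeat as long as the popped symbol is 1 *)
| While of reg & prog.

Definition pick A (o : option bool) (e z u : A) : A :=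
  match o with None => e | Some false => z | Some true => u end.

Inductive exec : prog -> store -> store -> nat -> Prop :=
| exec_skip s : exec Skip s s 0
| exec_push s r b : exec (Push r b) s (pushr s r b) 1
| exec_seq p q s s' s'' n n' : exec p s s' n -> exec q s' s'' n' ->
    exec (Seq p q) s s'' (n + n')
| exec_match r pe p0 p1 s s' n :
    exec (pick (ohead (getr s r)) pe p0 p1) (popr s r) s' n ->
    exec (Match r pe p0 p1) s s' n.+1
| exec_stop r p s : ohead (getr s r) <> Some true ->
    exec (While r p) s (popr s r) 1
| exec_loop r p s s' s'' n n' : ohead (getr s r) = Some true ->
    exec p (popr s r) s' n -> exec (While r p) s' s'' n' ->
    exec (While r p) s s'' (n + n').+1.

(* the same semantics, where the total height of the stacks never exceeds [m] *)
Inductive sexec (m : nat) : prog -> store -> store -> nat -> Prop :=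
| sexec_skip s : tot s <= m -> sexec m Skip s s 0
| sexec_push s r b : tot s < m -> sexec m (Push r b) s (pushr s r b) 1
| sexec_seq p q s s' s'' n n' : sexec m p s s' n -> sexec m q s' s'' n' ->
    sexec m (Seq p q) s s'' (n + n')
| sexec_match r pe p0 p1 s s' n : tot s <= m ->
    sexec m (pick (ohead (getr s r)) pe p0 p1) (popr s r) s' n ->
    sexec m (Match r pe p0 p1) s s' n.+1
| sexec_stop r p s : tot s <= m -> ohead (getr s r) <> Some true ->
    sexec m (While r p) s (popr s r) 1
| sexec_loop r p s s' s'' n n' : tot s <= m -> ohead (getr s r) = Some true ->
    sexec m p (popr s r) s' n -> sexec m (While r p) s' s'' n' ->
    sexec m (While r p) s s'' (n + n').+1.

Lemma tot_push s r b : tot (pushr s r b) = (tot s).+1.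
Proof. by case: s => [[a c] d]; case: r => [[]|] /=; lia. Qed.

Lemma tot_pop s r : tot (popr s r) <= tot s.
Proof.
case: s => [[a c] d]; case: r => [[]|] /=; rewrite size_behead; lia.
Qed.

Lemma exec_tot p s s' n : exec p s s' n -> tot s' <= tot s + n.
Proof.
elim=> {p s s' n} //=.
- by move=> s; lia.
- by move=> s r b; rewrite tot_push; lia.
- by move=> p q s s' s'' n n' _ h _ h'; lia.
- by move=> r pe p0 p1 s s' n _ h; have := tot_pop s r; lia.
- by move=> r p s _; have := tot_pop s r; lia.
- by move=> r p s s' s'' n n' _ _ h _ h'; have := tot_pop s r; lia.
Qed.

Lemma exec_sexec p s s' n m : exec p s s' n -> tot s + n <= m -> sexec m p s s' n.
Proof.
move=> h; elim: h m => {p s s' n}.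
- by move=> s m hm; apply: sexec_skip; lia.
- by move=> s r b m hm; apply: sexec_push; lia.
- move=> p q s s' s'' n n' h ih h' ih' m hm.
  have ht := exec_tot h.
  by apply: (@sexec_seq m p q s s'); [apply: ih | apply: ih']; lia.
- move=> r pe p0 p1 s s' n h ih m hm; have hp := tot_pop s r.
  by apply: sexec_match; [lia | apply: ih; lia].
- by move=> r p s hs m hm; apply: sexec_stop => //; lia.
- move=> r p s s' s'' n n' hs h ih h' ih' m hm; have hp := tot_pop s r.
  have ht := exec_tot h.
  by apply: (@sexec_loop m r p s s') => //; [lia | apply: ih; lia | apply: ih'; lia].
Qed.

Lemma sexec_end m p s s' n : sexec m p s s' n -> tot s' <= m.
Proof.
elim=> {p s s' n} //.
- by move=> s r b hs; rewrite tot_push.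
- by move=> r p s hs _; exact: leq_trans (tot_pop s r) hs.
Qed.

Inductive instr := IPush of reg & bool | IPop of reg & nat & nat & nat | IJmp of nat.

Fixpoint compile (p : prog) (b : nat) : seq instr :=
  match p with
  | Skip => [::]
  | Push r v => [:: IPush r v]
  | Seq p q => let cp := compile p b in cp ++ compile q (b + size cp)
  | Match r pe p0 p1 =>
      let ce := compile pe b.+1 in
      let b0 := (b.+1 + size ce).+1 in
      let c0 := compile p0 b0 in
      let b1 := (b0 + size c0).+1 in
      let c1 := compile p1 b1 in
      IPop r b.+1 b0 b1 :: ce ++ IJmp (b1 + size c1) :: c0 ++ IJmp (b1 + size c1) :: c1
  | While r p =>
      let cp := compile p b.+1 in
      let e := (b.+1 + size cp).+1 in
      IPop r e e b.+1 :: rcons cp (IJmp b)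
  end.

Definition fstep (C : seq instr) (c : nat * store) : nat * store :=
  let '(pc, s) := c in
  match nth (IJmp pc) C pc with
  | IPush r b => (pc.+1, pushr s r b)
  | IPop r e z u => (pick (ohead (getr s r)) e z u, popr s r)
  | IJmp l => (l, s)
  end.

Inductive freach (C : seq instr) (m : nat) : nat -> nat * store -> nat * store -> Prop :=
| freach0 c : tot c.2 <= m -> freach C m 0 c c
| freachS k c c' : tot c.2 <= m -> c.1 < size C -> freach C m k (fstep C c) c' ->
    freach C m k.+1 c c'.

Lemma freach_trans C m k k' c c' c'' :
  freach C m k c c' -> freach C m k' c' c'' -> freach C m (k + k') c c''.
Proof.
move=> h; elim: h k' => // {}k {}c {}c' hm hs h ih k' h'.
by rewrite addSn; apply: freachS => //; exact: ih.
Qed.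

Lemma freach1 C m c c' : tot c.2 <= m -> tot c'.2 <= m -> c.1 < size C ->
  fstep C c = c' -> freach C m 1 c c'.
Proof. by move=> h h' hs e; apply: freachS => //; rewrite e; exact: freach0. Qed.

(** Each source step costs at most two instructions: the push or pop itself and the jump that closes
    a branch of [Match] or a round of [While]. The context [u], [v] is arbitrary because compiled
    code contains absolute addresses and is used in the middle of larger code. *)
Lemma compile_correct m p s s' n : sexec m p s s' n -> forall C u v,
  C = u ++ compile p (size u) ++ v ->
  exists2 k, k <= n.*2 &
    freach C m k (size u, s) (size u + size (compile p (size u)), s').
Proof.
elim=> {p s s' n}.
- by move=> s hs C u v ->; exists 0 => //=; rewrite addn0; exact: freach0.
- move=> s r b hs C u v ->; exists 1 => //=; apply: freach1 => //=.
  + exact: ltnW.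
  + by rewrite tot_push.
  + by rewrite !size_cat /=; lia.
  + by rewrite nth_cat ltnn subnn /= addn1.
- move=> p q s s' s'' n n' hp ihp hq ihq C u v eC /=.
  have [k hk h1] := ihp C u (compile q (size u + size (compile p (size u))) ++ v)
     ltac:(by rewrite eC /= -?catA).
  have [k' hk' h2] := ihq C (u ++ compile p (size u)) v
     ltac:(by rewrite eC /= size_cat -?catA).
  exists (k + k'); first lia.
  rewrite size_cat in h2; apply: freach_trans h1 _.
  by rewrite size_cat addnA.
- move=> r pe p0 p1 s s' n hs hx ih C u v eC.
  set ce := compile pe (size u).+1.
  set b0 := ((size u).+1 + size ce).+1.
  set c0 := compile p0 b0.
  set b1 := (b0 + size c0).+1.
  set c1 := compile p1 b1.
  have eC' : C = u ++ (IPop r (size u).+1 b0 b1 :: ce ++ IJmp (b1 + size c1) :: c0 ++ IJmp (b1 + size c1) :: c1) ++ v by [].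
  have e1 : fstep C (size u, s) = (pick (ohead (getr s r)) (size u).+1 b0 b1, popr s r).
    by rewrite /fstep eC' nth_cat ltnn subnn.
  have szC : size u < size C by rewrite eC' !size_cat /=; lia.
  have pm : tot (popr s r) <= m by exact: leq_trans (tot_pop s r) hs.
  have hend : size u + size (compile (Match r pe p0 p1) (size u)) = b1 + size c1.
    by rewrite /= -/ce -/b0 -/c0 -/b1 -/c1 !size_cat /= !size_cat /= /b1 /b0; lia.
  rewrite hend; have s'm := sexec_end hx.
  case E : (ohead (getr s r)) e1 hx ih => [[]|]; rewrite /pick => e1 hx ih.
  + set U := u ++ IPop r (size u).+1 b0 b1 :: ce ++ IJmp (b1 + size c1) :: c0 ++ [:: IJmp (b1 + size c1)].
    have szu : size U = b1 by rewrite /U !size_cat /= !size_cat /= !size_cat /= /b1 /b0; lia.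
    have eU : C = U ++ compile p1 (size U) ++ v.
      by rewrite szu -/c1 eC' /U -?catA /= -?catA /= -?catA.
    have [k hk h] := ih C U v eU.
    exists k.+1; first lia.
    by rewrite szu in h; apply: freachS => //; rewrite e1.
  + set U := u ++ IPop r (size u).+1 b0 b1 :: ce ++ [:: IJmp (b1 + size c1)].
    have szu : size U = b0 by rewrite /U !size_cat /= !size_cat /= /b0; lia.
    have eU : C = U ++ compile p0 (size U) ++ (IJmp (b1 + size c1) :: c1 ++ v).
      by rewrite szu -/c0 eC' /U -?catA /= -?catA /= -?catA.
    have [k hk h] := ih C U _ eU.
    exists k.+2; first lia.
    rewrite szu in h; apply: freachS => //; rewrite e1.
    rewrite -addn1; apply: freach_trans h _; apply: freach1 => //=.
      by rewrite eC' !size_cat /= !size_cat /= !size_cat /= -/c0 /b0; lia.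
    rewrite -/c0.
    have -> : C = (u ++ IPop r (size u).+1 b0 b1 :: ce ++ IJmp (b1 + size c1) :: c0) ++ IJmp (b1 + size c1) :: c1 ++ v.
      by rewrite eC' -?catA /= -?catA /= -?catA.
    have sz2 : b0 + size c0 = size (u ++ IPop r (size u).+1 b0 b1 :: ce ++ IJmp (b1 + size c1) :: c0).
      by rewrite !size_cat /= !size_cat /= /b0; lia.
    by rewrite sz2 nth_cat ltnn subnn.
  + have [k hk h] := ih C (u ++ [:: IPop r (size u).+1 b0 b1]) (IJmp (b1 + size c1) :: c0 ++ IJmp (b1 + size c1) :: c1 ++ v)
     ltac:(rewrite eC' /ce !size_cat /= addn1 -?catA /= -?catA /= -?catA //).
    exists k.+2; first lia.
    have szu : size (u ++ [:: IPop r (size u).+1 b0 b1]) = (size u).+1 by rewrite size_cat addn1.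
    rewrite szu in h; apply: freachS => //; rewrite e1.
    rewrite -addn1; apply: freach_trans h _; apply: freach1 => //=.
      by rewrite eC' !size_cat /= !size_cat /=  -/ce; lia.
    rewrite -/ce.
    have -> : C = (u ++ IPop r (size u).+1 b0 b1 :: ce) ++ IJmp (b1 + size c1) :: c0 ++ IJmp (b1 + size c1) :: c1 ++ v.
      by rewrite eC' -?catA /= -?catA /= -?catA.
    have sz2 : (size u).+1 + size ce = size (u ++ IPop r (size u).+1 b0 b1 :: ce).
      by rewrite !size_cat /=; lia.
    by rewrite sz2 nth_cat ltnn subnn.
- move=> r p s hs hh C u v eC; exists 1 => //=.
  have pm : tot (popr s r) <= m by exact: leq_trans (tot_pop s r) hs.
  apply: freach1 => //=; first by rewrite eC !size_cat /=; lia.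
  rewrite eC nth_cat ltnn subnn /= size_rcons.
  by case E: (ohead (getr s r)) hh => [[]|] // _; rewrite /=; f_equal; lia.
- move=> r p s s' s'' n n' hs hh hp ihp hw ihw C u v eC.
  set cp := compile p (size u).+1.
  set e := ((size u).+1 + size cp).+1.
  have eC' : C = u ++ (IPop r e e (size u).+1 :: rcons cp (IJmp (size u))) ++ v by [].
  have [k hk h] := ihp C (u ++ [:: IPop r e e (size u).+1]) (IJmp (size u) :: v)
     ltac:(rewrite eC' /cp !size_cat /= addn1 -?catA /= cat_rcons //).
  have [k' hk' h'] := ihw C u v eC.
  have szu : size (u ++ [:: IPop r e e (size u).+1]) = (size u).+1 by rewrite size_cat addn1.
  exists (k + k'.+1).+1; first lia.
  rewrite szu -/cp in h.
  apply: freachS => //=; first by rewrite eC' !size_cat /=; lia.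
  rewrite {2}eC' nth_cat ltnn subnn /= hh /=.
  apply: freach_trans h _.
  apply: freachS => /=.
  + exact: sexec_end hp.
  + by rewrite eC' !size_cat /= size_rcons; lia.
  have eC2 : C = (u ++ IPop r e e (size u).+1 :: cp) ++ IJmp (size u) :: v.
    by rewrite eC' -?catA /= cat_rcons.
  have sz2 : (size u).+1 + size cp = size (u ++ IPop r e e (size u).+1 :: cp).
    by rewrite !size_cat /=; lia.
  have -> : nth (IJmp ((size u).+1 + size cp)) C ((size u).+1 + size cp) = IJmp (size u).
    by rewrite eC2 sz2 nth_cat ltnn subnn.
  by [].
Qed.

(** * Machines on a tape indexed by the integers *)

Import Order.TTheory GRing.Theory Num.Theory.
Definition atape := int -> option bool.
Definition upd (T : atape) (p : int) v : atape := fun i => if i == p then v else T i.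

Definition aconf (M : TM) := (tm_Q M * int * atape)%type.

Definition astep (M : TM) (c : aconf M) : aconf M :=
  let '(q, p, T) := c in
  if @tm_halt M q then c else
  let '(q', b, mv) := @tm_delta M q (T p) in
  (q', if mv then (p + 1)%R else (p - 1)%R, upd T p b).

(** Reading the lists with [nth None] forgets how many blanks have been visited, which makes the
    comparison with a total tape exact. The lengths, needed for the space count, are bounded
    separately by [inwin]. *)
Definition rep (M : TM) (c : config M) (d : aconf M) : Prop :=
  let '(q, l, a, r) := c in let '(q', p, T) := d in
  [/\ q = q', a = T p, forall i : nat, nth None l i = T (p - 1 - i%:Z)%R
    & forall i : nat, nth None r i = T (p + 1 + i%:Z)%R].

(* the visited cells lie in [-B, B] *)
Definition inwin (M : TM) (B : nat) (c : config M) (d : aconf M) : Prop :=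
  let '(q, l, a, r) := c in let '(q', p, T) := d in
  ((- B%:Z <= p - (size l)%:Z) && (p + (size r)%:Z <= B%:Z))%R.

Lemma rep_step M (c : config M) d : rep c d -> rep (step c) (astep d).
Proof.
case: c => [[[q l] a] r]; case: d => [[q' p] T] /= [<- -> hl hr].
case: (tm_halt q); first by split.
case: (tm_delta q (T p)) => [[q2 b] []].
- case: r hr => [|a' r'] hr; split => //.
  + by move: (hr 0); rewrite /upd /= addr0; case: eqP => //; lia.
  + move=> [|i] /=; rewrite /upd; first by case: eqP => //; lia.
    by rewrite hl; case: eqP; [lia | move=> _; f_equal; lia].
  + move=> i; rewrite /upd nth_nil; case: eqP; first lia.
    by move=> _; move: (hr i.+1); rewrite nth_nil => ->; f_equal; lia.
  + by move: (hr 0); rewrite /upd /= addr0; case: eqP => //; lia.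
  + move=> [|i] /=; rewrite /upd; first by case: eqP => //; lia.
    by rewrite hl; case: eqP; [lia | move=> _; f_equal; lia].
  + move=> i; rewrite /upd; case: eqP; first lia.
    by move=> _; move: (hr i.+1) => /= ->; f_equal; lia.
- case: l hl => [|a' l'] hl; split => //.
  + by move: (hl 0); rewrite /upd /= subr0; case: eqP => //; lia.
  + move=> i; rewrite /upd nth_nil; case: eqP; first lia.
    by move=> _; move: (hl i.+1); rewrite nth_nil => ->; f_equal; lia.
  + move=> [|i] /=; rewrite /upd; first by case: eqP => //; lia.
    by rewrite hr; case: eqP; [lia | move=> _; f_equal; lia].
  + by move: (hl 0); rewrite /upd /= subr0; case: eqP => //; lia.
  + move=> i; rewrite /upd; case: eqP; first lia.
    by move=> _; move: (hl i.+1) => /= ->; f_equal; lia.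
  + move=> [|i] /=; rewrite /upd; first by case: eqP => //; lia.
    by rewrite hr; case: eqP; [lia | move=> _; f_equal; lia].
Qed.

Definition apos (M : TM) (d : aconf M) : int := d.1.2.

Lemma inwin_step M B (c : config M) d : rep c d -> inwin B c d ->
  (`|apos (astep d)| <= B)%N -> inwin B (step c) (astep d).
Proof.
case: c => [[[q l] a] r]; case: d => [[q' p] T] /= [<- -> hl hr].
case: (tm_halt q) => //.
case: (tm_delta q (T p)) => [[q2 b] []]; rewrite /apos /=.
- by case: r {hr} => [|a' r'] /=; lia.
- by case: l {hl} => [|a' l'] /=; lia.
Qed.

Definition ainit (M : TM) (x : str) : aconf M :=
  (@tm_start M, 0%R, fun i => if i is Posz n then nth None (map Some x) n else None).

Lemma rep_init M x : rep (init_config M x) (ainit M x).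
Proof.
have e1 i : (0 - 1 - Posz i)%R = Negz i by lia.
have e2 i : (0 + 1 + Posz i)%R = Posz i.+1 by lia.
by case: x => [|b x] /=; split => // i; rewrite ?e1 ?e2 ?nth_nil.
Qed.

Lemma inwin_init M B x : size x <= B -> inwin B (init_config M x) (ainit M x).
Proof. by case: x => [|b x] /=; rewrite ?size_map; lia. Qed.

Definition areach (M : TM) (B k : nat) (c d : aconf M) : Prop :=
  d = iter k (@astep M) c /\ forall j, j <= k -> `|apos (iter j (@astep M) c)| <= B.

Lemma areach0 M B (c : aconf M) : `|apos c| <= B -> areach B 0 c c.
Proof. by move=> h; split => // j; rewrite leqn0 => /eqP ->. Qed.

Lemma areach_trans M B k k' (c d e : aconf M) :
  areach B k c d -> areach B k' d e -> areach B (k + k') c e.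
Proof.
move=> [-> h] [-> h']; split; first by rewrite addnC iterD.
move=> j hj; case: (leqP j k) => hjk; first exact: h.
have -> : j = (j - k) + k by lia.
by rewrite iterD; apply: h'; lia.
Qed.

Lemma areach1 M B (c d : aconf M) : `|apos c| <= B -> `|apos d| <= B ->
  astep c = d -> areach B 1 c d.
Proof.
by move=> h h' e; split; rewrite /= ?e // => -[|[|j]] //= _; rewrite ?e.
Qed.

Lemma run_areach M B x k (d : aconf M) : size x <= B -> areach B k (ainit M x) d ->
  rep (run M k x) d /\ forall t, t <= k -> cfg_space (run M t x) <= B.*2.+1.
Proof.
move=> hx [-> hB].
have H : forall t, t <= k -> rep (run M t x) (iter t (@astep M) (ainit M x))
     /\ inwin B (run M t x) (iter t (@astep M) (ainit M x)).
  elim=> [|t IH] ht; first by split; [exact: rep_init | exact: inwin_init].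
  have [h1 h2] := IH (ltnW ht).
  split; first exact: rep_step.
  by apply: inwin_step => //; have := hB t.+1 ht.
split; first by have [] := H k (leqnn k).
move=> t /H [_]; case: (run M t x) => [[[q l] a] r].
by case: (iter _ _ _) => [[q' p] T] /=; lia.
Qed.

(** * Three stacks on one tape *)

Section Sim.

(** The first stack has its bottom at cell 0 and grows to the right, so the initial tape with input
    [x] already is the first stack holding [rev x]. The other two share the negative side on
    alternate cells, from -3 and from -4 downward, and -1 and -2 stay blank as markers. *)
Definition cel (r : reg) (k : nat) : int :=
  match r with
  | None => (k%:Z - 1)%R
  | Some false => (- 1 - k.*2%:Z)%R
  | Some true => (- 2 - k.*2%:Z)%R
  end.

Definition bot (l : str) (k : nat) : option bool := nth None (map Some (rev l)) k.

(* [cel r k.+1] holds the k-th element from the bottom of stack r; the cells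
   [cel r 0] stay blank and are used to find the way back. *)
Definition tape (s : store) : atape := fun i =>
  match i with
  | Posz n => bot (getr s r1) n
  | Negz n => if n < 2 then None else
      if odd n then bot (getr s r3) (n - 2)./2 else bot (getr s r2) (n - 2)./2
  end.

Lemma bot_cons b l k : bot (b :: l) k = if k == size l then Some b else bot l k.
Proof.
rewrite /bot rev_cons map_rcons nth_rcons size_map size_rev.
case: ltngtP => // h; rewrite nth_default // size_map size_rev; lia.
Qed.

Lemma bot_oversize l k : size l <= k -> bot l k = None.
Proof. by move=> h; rewrite /bot nth_default // size_map size_rev. Qed.

Lemma bot_some l k : k < size l -> exists b, bot l k = Some b.
Proof.
move=> h; exists (nth false (rev l) k).
by rewrite /bot (nth_map false) // size_rev.
Qed.

Lemma bot_top b l : bot (b :: l) (size l) = Some b.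
Proof. by rewrite bot_cons eqxx. Qed.

Lemma tape_cel0 s r : tape s (cel r 0) = None.
Proof. by case: r => [[]|]. Qed.

Lemma tape_cel s r k : tape s (cel r k.+1) = bot (getr s r) k.
Proof.
case: r => [[]|]; rewrite /cel.
- have -> : (- 2 - (k.+1).*2%:Z)%R = Negz k.*2.+3 by lia.
  by rewrite /tape /= odd_double /=; congr (bot _ _); lia.
- have -> : (- 1 - (k.+1).*2%:Z)%R = Negz k.*2.+2 by lia.
  by rewrite /tape /= odd_double /=; congr (bot _ _); lia.
- by have -> : (k.+1%:Z - 1)%R = Posz k by lia.
Qed.

Lemma celP (i : int) : i = (-1)%R \/ i = (-2)%R \/ exists r k, i = cel r k.+1.
Proof.
case: i => [n|[|[|n]]]; [| by left | by right; left |].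
  by right; right; exists r1, n => /=; lia.
right; right; have := odd_double_half n; case: (odd n) => /= h.
- by exists r3, n./2 => /=; lia.
- by exists r2, n./2 => /=; lia.
Qed.

Lemma cel_inj r k r' k' : cel r k.+1 = cel r' k'.+1 -> r = r' /\ k = k'.
Proof. by case: r => [[]|]; case: r' => [[]|] /= h; split => //; lia. Qed.

Lemma cel_pre r k : cel r k.+1 <> (-1)%R /\ cel r k.+1 <> (-2)%R.
Proof. by case: r => [[]|] /=; lia. Qed.

Lemma get_set s r r' v : getr (setr s r v) r' = if r == r' then v else getr s r'.
Proof. by case: s => [[a b] c]; case: r => [[]|]; case: r' => [[]|]. Qed.

Lemma tape_push s r b :
  tape (pushr s r b) = upd (tape s) (cel r (size (getr s r)).+1) (Some b).
Proof.
apply: functional_extensionality => i; rewrite /upd.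
case: (celP i) => [->|[->|[r' [k ->]]]].
- by case: eqP => // h; have [] := cel_pre r (size (getr s r)); rewrite h.
- by case: eqP => // h; have [] := cel_pre r (size (getr s r)); rewrite h.
rewrite !tape_cel get_set; case: eqP => [<-|ne].
  rewrite bot_cons; case: eqP => [->|ne]; first by rewrite eqxx.
  by case: eqP => // /cel_inj [].
by case: eqP => // /cel_inj [h _]; case: ne; rewrite h.
Qed.

Lemma tape_pop s r v l : getr s r = v :: l ->
  tape (popr s r) = upd (tape s) (cel r (size l).+1) None.
Proof.
move=> e; apply: functional_extensionality => i; rewrite /upd.
case: (celP i) => [->|[->|[r' [k ->]]]].
- by case: eqP => // h; have [] := cel_pre r (size l); rewrite h.
- by case: eqP => // h; have [] := cel_pre r (size l); rewrite h.
rewrite !tape_cel get_set e; case: eqP => [<-|ne].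
  rewrite e bot_cons; case: (k =P size l) => [->|ne]; first by rewrite eqxx bot_oversize.
  by case: eqP => // /cel_inj [].
by case: eqP => // /cel_inj [h _]; case: ne; rewrite h.
Qed.

Lemma upd_id T p : upd T p (T p) = T.
Proof. by apply: functional_extensionality => i; rewrite /upd; case: eqP => [->|]. Qed.

Lemma popr_empty s r : getr s r = [::] -> popr s r = s.
Proof. by case: s => [[a b] c]; case: r => [[]|] /= ->. Qed.

Variable C : seq instr.
Notation N := (size C).

Definition stage := (option bool + option bool)%type.
Definition sHome : stage := inl None.
Definition sScan : stage := inl (Some false).
Definition sPop : stage := inl (Some true).
Definition sBack v : stage := inr v.

(** A state holds the number of moves still to be made blindly, their direction, the program counter
    and the stage: at cell 0, walking out to the first blank above a stack, standing on the symbol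
    to be popped, or walking back with the popped symbol in memory. *)
Definition smQ := ('I_5 * bool * 'I_N.+2 * stage)%type.

Definition outw (r : reg) : bool := r == r1.
Definition stride (r : reg) : nat := if r is None then 1 else 2.
Definition homed (r : reg) : nat := if r is Some true then 2 else 1.

Definition go (cnt : nat) (dir : bool) (pc : 'I_N.+2) (sg : stage) a :
  smQ * option bool * bool := ((inord cnt.-1, dir, pc, sg), a, dir).

Definition scan_act (r : reg) (pc : 'I_N.+2) (b : option bool) (sg : stage)
    (a : option bool) :=
  if a is Some _ then go (stride r) (outw r) pc sScan a
  else go (stride r) (~~ outw r) pc sg b.

(** Cell 0 is itself the bottom cell of the first stack, which is therefore scanned at once; the
    bottoms of the other two lie 3 and 4 cells to the left. *)
Definition home_act (r : reg) (pc : 'I_N.+2) b sg (a : option bool) :=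
  match r with
  | None => scan_act r pc b sg a
  | Some false => go 3 false pc sScan a
  | Some true => go 4 false pc sScan a
  end.

Definition back_act (r : reg) (pc : 'I_N.+2) v (tgt : 'I_N.+2) (a : option bool) :=
  if a is Some _ then go (stride r) (~~ outw r) pc (sBack v) a
  else go (homed r) true tgt sHome a.

(** Every transition has to move the head, so a jump goes one cell to the right and returns by means
    of the move counter. *)
Definition sm_delta (q : smQ) (a : option bool) : smQ * option bool * bool :=
  let '(cnt, dir, pc, sg) := q in
  if 0 < cnt then ((inord cnt.-1, dir, pc, sg), a, dir) else
  match nth (IJmp 0) C pc with
  | IJmp l => ((inord 1, false, inord l, sHome), a, true)
  | IPush r b =>
    match sg with
    | inl None => home_act r pc (Some b) (sBack None) a
    | inl (Some _) => scan_act r pc (Some b) (sBack None) a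
    | inr v => back_act r pc v (inord pc.+1) a
    end
  | IPop r e z u =>
    match sg with
    | inl None => home_act r pc None sPop a
    | inl (Some false) => scan_act r pc None sPop a
    | inl (Some true) =>
        if a is Some _ then go (stride r) (~~ outw r) pc (sBack a) None
        else go (homed r) true (inord e) sHome a
    | inr v => back_act r pc v (inord (pick v e z u)) a
    end
  end.

(** Two addresses beyond the code are halting: [N] is the ordinary end of the program and [N.+1],
    the value [ord_max], is the accepting one. *)
Definition smTM : TM := @mkTM smQ (ord0, false, inord 0, sHome)
  (fun q => let '(cnt, dir, pc, sg) := q in [&& cnt == ord0, sg == sHome & N <= pc])
  (fun q => let '(cnt, dir, pc, sg) := q in pc == ord_max)
  sm_delta.

Definition aS (dir : bool) (pc : nat) sg (p : int) T : aconf smTM :=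
  ((ord0, dir, inord pc, sg), p, T).

Definition dz (dir : bool) (n : nat) : int := if dir then Posz n else (- Posz n)%R.

Lemma go_run B cnt dir (pc : 'I_N.+2) sg p T : cnt < 5 -> `|p| <= B ->
  (`|p + dz dir cnt| <= B)%R ->
  areach B cnt (((inord cnt, dir, pc, sg), p, T) : aconf smTM)
     ((ord0, dir, pc, sg), (p + dz dir cnt)%R, T).
Proof.
elim: cnt p => [|cnt IH] p hc hp hp'.
  have -> : (inord 0 : 'I_5) = ord0 by apply: val_inj; rewrite /= inordK.
  have -> : (p + dz dir 0)%R = p by rewrite /dz; case: (dir); lia.
  exact: areach0.
have e : astep (((inord cnt.+1, dir, pc, sg), p, T) : aconf smTM)
   = ((inord cnt, dir, pc, sg), (p + dz dir 1)%R, T).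
  rewrite /= -val_eqE /= inordK //= upd_id.
  by rewrite /dz; case: (dir) => /=.
have hp1 : `|(p + dz dir 1)%R| <= B by move: hp'; rewrite /dz; case: (dir); lia.
rewrite -add1n; apply: areach_trans (areach1 _ _ e) _ => //.
have -> : (p + dz dir cnt.+1)%R = ((p + dz dir 1) + dz dir cnt)%R.
  by rewrite /dz; case: (dir); lia.
apply: IH => //; first exact: ltnW.
by move: hp'; rewrite /dz; case: (dir); lia.
Qed.

Lemma act_run B d (pc : 'I_N.+2) sg p T cnt dir (pc' : 'I_N.+2) sg' b :
  0 < cnt < 6 -> `|p| <= B -> (`|p + dz dir cnt| <= B)%R ->
  ~~ (@tm_halt smTM (ord0, d, pc, sg)) ->
  sm_delta (ord0, d, pc, sg) (T p) = go cnt dir pc' sg' b ->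
  areach B cnt (((ord0, d, pc, sg), p, T) : aconf smTM)
     ((ord0, dir, pc', sg'), (p + dz dir cnt)%R, upd T p b).
Proof.
case: cnt => // cnt hc hp hp' hh hd.
have e : astep (((ord0, d, pc, sg), p, T) : aconf smTM)
   = ((inord cnt, dir, pc', sg'), (p + dz dir 1)%R, upd T p b).
  rewrite /astep (negPf hh) [tm_delta _ _]hd /go /=.
  by rewrite /dz; case: (dir).
have hp1 : `|(p + dz dir 1)%R| <= B by move: hp'; rewrite /dz; case: (dir); lia.
rewrite -add1n; apply: areach_trans (areach1 _ _ e) _ => //.
have -> : (p + dz dir cnt.+1)%R = ((p + dz dir 1) + dz dir cnt)%R.
  by rewrite /dz; case: (dir); lia.
apply: go_run => //.
by move: hp'; rewrite /dz; case: (dir); lia.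
Qed.

Lemma cel_out r k : (cel r k + dz (outw r) (stride r))%R = cel r k.+1.
Proof. by case: r => [[]|] /=; rewrite /dz /=; lia. Qed.

Lemma cel_in r k : (cel r k.+1 + dz (~~ outw r) (stride r))%R = cel r k.
Proof. by case: r => [[]|] /=; rewrite /dz /=; lia. Qed.

Lemma cel_home r : (cel r 0 + dz true (homed r))%R = 0%R.
Proof. by case: r => [[]|] /=; rewrite /dz /=; lia. Qed.

Lemma cel_bound r k B : k.*2 + 2 <= B -> `|cel r k| <= B.
Proof. by case: r => [[]|] /=; lia. Qed.

Definition op_reg (i : instr) := match i with IPush r _ => r | IPop r _ _ _ => r | _ => r1 end.
Definition is_op (i : instr) := if i is IJmp _ then false else true.
Definition op_wr (i : instr) := if i is IPush _ b then Some b else None.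
Definition op_next (i : instr) := if i is IPush _ b then sBack None else sPop.

Lemma stride_bd r : 0 < stride r < 6. Proof. by case: r => [[]|]. Qed.
Lemma homed_bd r : 0 < homed r < 6. Proof. by case: r => [[]|]. Qed.

Section OneOp.
Variables (pc : nat) (i : instr).
Hypotheses (pcN : pc < N) (ei : nth (IJmp 0) C pc = i) (oi : is_op i).
Notation r := (op_reg i).

Lemma pcK : (inord pc : 'I_N.+2) = pc :> nat.
Proof. by rewrite inordK // ltnS ltnW // ltnW. Qed.

Lemma pc_nohalt d sg : ~~ (@tm_halt smTM (ord0, d, inord pc, sg)).
Proof. by rewrite /= pcK leqNgt pcN !andbF. Qed.

Lemma scan_run B d s k : k.+1 <= size (getr s r) -> (size (getr s r)).*2 + 4 <= B ->
  areach B (stride r) (aS d pc sScan (cel r k.+1) (tape s))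
      (aS (outw r) pc sScan (cel r k.+2) (tape s)).
Proof.
move=> hk hB; rewrite /aS -(cel_out _ k.+1) -{2}(upd_id (tape s) (cel r k.+1)).
apply: act_run; rewrite ?stride_bd ?pc_nohalt // ?cel_out; try (by apply: cel_bound; lia).
rewrite /= pcK ei tape_cel; have [b ->] := bot_some hk.
by case: (i) oi.
Qed.

Lemma scan_all B d s k : k <= size (getr s r) -> (size (getr s r)).*2 + 4 <= B ->
  exists d', areach B (stride r * (size (getr s r) - k)) (aS d pc sScan (cel r k.+1) (tape s))
      (aS d' pc sScan (cel r (size (getr s r)).+1) (tape s)).
Proof.
move=> hk hB; move e: (size (getr s r) - k) => n.
elim: n k d hk e => [|n IH] k d hk e.
  exists d; have -> : k = size (getr s r) by lia.
  by rewrite muln0; apply: areach0; apply: cel_bound; lia.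
have [||d' h] := IH k.+1 (outw r); try lia.
exists d'; rewrite mulnS; apply: areach_trans h.
by apply: scan_run; lia.
Qed.

Lemma back_all B d s k v (tgt : 'I_N.+2) : k <= size (getr s r) ->
  (size (getr s r)).*2 + 4 <= B ->
  (forall a, sm_delta (ord0, d, inord pc, sBack v) a = back_act r (inord pc) v tgt a) ->
  exists d', areach B (stride r * k + homed r) (aS d pc (sBack v) (cel r k) (tape s))
      ((ord0, d', tgt, sHome), 0%R, tape s).
Proof.
move=> hk hB hd; elim: k d hk hd => [|k IH] d hk hd.
  exists true; rewrite muln0 add0n /aS -(cel_home r) -{2}(upd_id (tape s) (cel r 0)).
  apply: act_run; rewrite ?homed_bd ?pc_nohalt ?cel_home //; first by apply: cel_bound; lia.
  by rewrite hd tape_cel0.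
have [||d' h] := IH (~~ outw r); [lia| by []|].
exists d'; rewrite mulnS -addnA; apply: areach_trans h.
rewrite /aS -(cel_in r k) -{2}(upd_id (tape s) (cel r k.+1)).
apply: act_run; rewrite ?stride_bd ?pc_nohalt // ?cel_in; try (by apply: cel_bound; lia).
by rewrite hd tape_cel; have [b ->] := bot_some hk.
Qed.

Lemma home_scan B d s : (size (getr s r)).*2 + 5 <= B ->
  exists2 k, k <= 4 & exists d', exists2 sg, (sg = sScan \/ sg = sHome /\ r = r1) &
  areach B k (aS d pc sHome 0%R (tape s)) (aS d' pc sg (cel r 1) (tape s)).
Proof.
move=> hB.
have pr n b : r <> r1 -> sm_delta (ord0, d, inord pc, sHome) (tape s 0%R) =
    go n false (inord pc) sScan b -> 0 < n < 6 -> (0 + dz false n)%R = cel r 1 -> tape s 0%R = b ->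
   areach B n (aS d pc sHome 0%R (tape s)) (aS false pc sScan (cel r 1) (tape s)).
  move=> nr hd hn e eb; rewrite /aS -e -{2}(upd_id (tape s) 0%R).
  apply: act_run; rewrite ?pc_nohalt ?e //; first by apply: cel_bound; lia.
  by rewrite hd eb.
case er : r pr => [[]|] pr.
- exists 4 => //; exists false, sScan; first by left.
  apply: (pr 4 (tape s 0%R)) => //.
  by rewrite /= pcK ei; case: (i) er oi => //= [r0 b0 ->|r0 e z u ->].
- exists 3 => //; exists false, sScan; first by left.
  apply: (pr 3 (tape s 0%R)) => //.
  by rewrite /= pcK ei; case: (i) er oi => //= [r0 b0 ->|r0 e z u ->].
- by exists 0 => //; exists d, sHome; [right | apply: areach0].
Qed.

(* the head has reached the first blank cell of the stack and turns back *)
Lemma to_turn B d s : (size (getr s r)).*2 + 8 <= B ->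
  exists2 k, k <= (size (getr s r)).*2 + 6 & exists d',
  areach B k (aS d pc sHome 0%R (tape s))
    (aS d' pc (op_next i) (cel r (size (getr s r)))
      (upd (tape s) (cel r (size (getr s r)).+1) (op_wr i))).
Proof.
move=> hB; have [|k hk [d1 [sg hsg h]]] := @home_scan B d s; first lia.
have turn d2 sg2 : (sg2 = sScan \/ sg2 = sHome /\ r = r1) -> areach B (stride r)
   (aS d2 pc sg2 (cel r (size (getr s r)).+1) (tape s))
   (aS (~~ outw r) pc (op_next i) (cel r (size (getr s r)))
      (upd (tape s) (cel r (size (getr s r)).+1) (op_wr i))).
  move=> hs; rewrite /aS -(cel_in r (size (getr s r))).
  apply: act_run; rewrite ?stride_bd ?pc_nohalt // ?cel_in; try (by apply: cel_bound; lia).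
  rewrite /= pcK ei tape_cel bot_oversize //.
  case: hs => [->|[-> er]]; first by case: (i) oi.
  by case: (i) oi er => //= [r0 b0|r0 e z u] _ ->.
case: (posnP (size (getr s r))) => hs.
  exists (k + stride r); first by have := stride_bd r; case: r => [[]|] /=; lia.
  exists (~~ outw r); apply: areach_trans h _.
  by rewrite -{1}hs; apply: turn.
have step1 : exists d2, areach B (stride r) (aS d1 pc sg (cel r 1) (tape s)) (aS d2 pc sScan (cel r 2) (tape s)).
  exists (outw r); case: hsg => [->|[-> er]]; first by apply: scan_run; lia.
  rewrite /aS -(cel_out _ 1) -{2}(upd_id (tape s) (cel r 1)).
  apply: act_run; rewrite ?stride_bd ?pc_nohalt // ?cel_out; try (by apply: cel_bound; lia).
  rewrite /= pcK ei tape_cel; have [b ->] := bot_some hs.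
  by case: (i) oi er => //= [r0 b0|r0 e z u] _ ->.
case: step1 => d2 h2.
have [||d3 h3] := @scan_all B d2 s 1; try lia.
exists (k + stride r + stride r * (size (getr s r) - 1) + stride r).
  have : stride r <= 2 by case: r => [[]|].
  nia.
exists (~~ outw r); apply: areach_trans (turn d3 sScan _); last by left.
by apply: areach_trans h3; apply: areach_trans h2.
Qed.

End OneOp.

(** One instruction walks to the first blank above a stack and back. Stacks two and three use every
    other cell, so each direction crosses about [2 * m] cells. *)
Lemma instr_run B m d pc s pc' s' : pc < N -> fstep C (pc, s) = (pc', s') ->
  tot s <= m -> tot s' <= m -> m.*2 + 8 <= B ->
  exists2 k, k <= 4 * m + 12 & exists d',
  areach B k (aS d pc sHome 0%R (tape s)) (aS d' pc' sHome 0%R (tape s')).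
Proof.
move=> pcN; rewrite /fstep (set_nth_default (IJmp 0)) //.
case ei : (nth (IJmp 0) C pc) => [r b|r e z u|l] [<- <-] hs hs' hB.
- have szs : (size (getr s r)).+1 <= m.
    by move: hs'; rewrite tot_push; case: (s) => [[a1 a2] a3]; case: (r) => [[]|] /=; lia.
  have [|k hk [d1 h]] := @to_turn pc _ pcN ei isT B d s; first by rewrite /=; lia.
  rewrite /op_next /op_wr /op_reg -tape_push in h hk.
  have hd d0 a : sm_delta (ord0, d0, inord pc, sBack None) a =
      back_act r (inord pc) None (inord pc.+1) a.
    by rewrite /= pcK // ei.
  have [||d2 h2] := @back_all pc (IPush r b) pcN isT B d1 (pushr s r b) (size (getr s r)) None
       (inord pc.+1) _ _ (hd d1).
  + by rewrite get_set eqxx /=.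
  + by rewrite get_set eqxx /=; lia.
  exists (k + (stride r * size (getr s r) + homed r)).
    by have := stride_bd r; case: (r) szs hk => [[]|] /=; lia.
  by exists d2; apply: areach_trans h h2.
- have szs : size (getr s r) <= m.
    by move: hs; case: (s) => [[a1 a2] a3]; case: (r) => [[]|] /=; lia.
  have [|k hk [d1 h]] := @to_turn pc _ pcN ei isT B d s; first by rewrite /=; lia.
  rewrite /op_next /op_wr /op_reg in h hk.
  have eb : upd (tape s) (cel r (size (getr s r)).+1) None = tape s.
    by rewrite -{2}(upd_id (tape s) (cel r (size (getr s r)).+1)) tape_cel bot_oversize.
  rewrite eb in h.
  case eg : (getr s r) szs h hk => [|v l] szs h hk.
    exists (k + homed r); first by case: (r) hk => [[]|] /=; lia.
    rewrite /= (popr_empty eg).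
    exists true; apply: areach_trans h _.
    rewrite /aS -(cel_home r) -{2}(upd_id (tape s) (cel r 0)).
    apply: act_run; rewrite ?homed_bd ?pc_nohalt ?cel_home //; first by apply: cel_bound; lia.
    by rewrite /= pcK // ei tape_cel0.
  have h1 : areach B (stride r) (aS d1 pc sPop (cel r (size l).+1) (tape s))
       (aS (~~ outw r) pc (sBack (Some v)) (cel r (size l)) (tape (popr s r))).
    rewrite (tape_pop eg) /aS -(cel_in r (size l)).
    apply: act_run; rewrite ?stride_bd ?pc_nohalt // ?cel_in; try (by apply: cel_bound; move: szs => /=; lia).
    by rewrite /= pcK // ei tape_cel eg bot_top.
  have hd d0 a : sm_delta (ord0, d0, inord pc, sBack (Some v)) a =
      back_act r (inord pc) (Some v) (inord (pick (Some v) e z u)) a.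
    by rewrite /= pcK // ei.
  have gp : getr (popr s r) r = l by rewrite get_set eqxx eg.
  have [||d2 h2] := @back_all pc (IPop r e z u) pcN isT B (~~ outw r) (popr s r) (size l) (Some v)
       _ _ _ (hd (~~ outw r)).
  + by rewrite /= gp.
  + by rewrite /= gp; move: szs => /=; lia.
  exists (k + stride r + (stride r * size l + homed r)).
    by move: szs hk => /=; case: (r) => [[]|] /=; lia.
  by exists d2; apply: areach_trans h2; apply: areach_trans h1.
- exists (1 + 1); first lia.
  exists false.
  have -> : aS false l sHome 0%R (tape s) = ((ord0, false, inord l, sHome), (0 + dz true 1 + dz false 1)%R, tape s) by [].
  have e : astep (aS d pc sHome 0%R (tape s)) = ((inord 1, false, inord l, sHome), (0 + dz true 1)%R, tape s).
    rewrite /astep /aS (negPf (pc_nohalt pcN _ _)) /= pcK // ei.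
    by rewrite upd_id.
  apply: areach_trans (areach1 _ _ e) _; rewrite /apos /=; try lia.
  by apply: go_run => //; rewrite /dz; lia.
Qed.

Lemma freach_areach B m k pc s pc' s' d : m.*2 + 8 <= B ->
  freach C m k (pc, s) (pc', s') ->
  exists2 k', k' <= k * (4 * m + 12) & exists d',
  areach B k' (aS d pc sHome 0%R (tape s)) (aS d' pc' sHome 0%R (tape s')).
Proof.
move=> hB; elim: k pc s d => [|k IH] pc s d h.
  by inversion h; subst; exists 0 => //; exists d; apply: areach0.
have [hs hN h'] : [/\ tot s <= m, pc < N & freach C m k (fstep C (pc, s)) (pc', s')].
  by inversion h.
case E : (fstep C (pc, s)) h' => [pc1 s1] h'.
have hs1 : tot s1 <= m by inversion h'.
have [k1 hk1 [d1 h1]] := instr_run d hN E hs hs1 hB.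
have [k2 hk2 [d2 h2]] := IH _ _ d1 h'.
exists (k1 + k2); first by rewrite mulSn; lia.
by exists d2; apply: areach_trans h1 h2.
Qed.

End Sim.

Lemma tape_input x : tape (rev x, [::], [::]) =
  fun i => if i is Posz n then nth None (map Some x) n else None.
Proof.
apply: functional_extensionality => -[n|n] /=; first by rewrite /bot revK.
by rewrite /bot !nth_nil; case: ifP => // _; case: ifP.
Qed.

(* popping the first stack at the end turns its top bit into acceptance *)
Definition decide (p : prog) : seq instr :=
  let c := compile p 0 in rcons c (IPop r1 (size c).+1 (size c).+1 (size c).+2).

Lemma read_out_map (l : str) : read_out (map Some l) = l.
Proof. by elim: l => //= b l ->. Qed.

Lemma read_out_ext (u v : seq (option bool)) :
  (forall i, nth None u i = nth None v i) -> read_out u = read_out v.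
Proof.
elim: u v => [|a u IH] [|b v] h //=.
- by case: b h => // b /(_ 0).
- by case: a h => // a /(_ 0).
- have /= := h 0 => ->; case: b h => // b h; f_equal.
  by apply: IH => i; have := h i.+1.
Qed.

(** The reversals reflect that the bottom of the first stack is the leftmost cell of the input, and
    that the output is read from cell 0 to the right. The height never exceeds [size x + n], which
    bounds the cost of each instruction. *)
Theorem prog_TM p : exists M : TM,
  (forall x y s2 s3 n, exec p (rev x, [::], [::]) (rev y, s2, s3) n ->
    exists t, [/\ t <= (n.*2) * (4 * (size x + n) + 12),
       @tm_halt M (cfg_state (run M t x)) & cfg_output (run M t x) = y]).
Proof.
exists (smTM (compile p 0)) => x y s2 s3 n h.
have hs : sexec (size x + n) p (rev x, [::], [::]) (rev y, s2, s3) n.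
  by apply: (exec_sexec h); rewrite /= size_rev; lia.
have [k hk hf] := compile_correct hs (C := compile p 0) (u := [::]) (v := [::])
    ltac:(by rewrite cats0).
rewrite add0n in hf.
have hB : (size x + n).*2 + 8 <= (size x + n).*2 + 8 by [].
have [k' hk' [d' ha]] := freach_areach false hB hf.
rewrite tape_input in ha.
have ei : aS (compile p 0) false (size ([::] : seq instr)) sHome 0%R (fun i => if i is Posz n then nth None (map Some x) n else None)
   = ainit (smTM (compile p 0)) x by [].
rewrite ei in ha; have [|hr _] := run_areach _ ha; first lia.
exists k'; split.
- by nia.
- move: hr; rewrite /cfg_state; case: (run _ k' x) => [[[q l] a] r] /= [-> _ _ _].
  by rewrite eqxx /= inordK.
- move: hr; rewrite /cfg_output; case: (run _ k' x) => [[[q l] a] r] [_ ea _ er].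
  rewrite -(read_out_map y); apply: read_out_ext => -[|i].
    by rewrite /= ea /= /bot revK.
  have -> : nth None (a :: r) i.+1 = nth None r i by [].
  by rewrite er (_ : (0 + 1 + Posz i)%R = Posz i.+1) //= /bot revK.
Qed.

(** The number [n] of steps may be exponential here; only the height [m] of the stacks enters the
    space bound. *)
Theorem prog_TM_decide p : exists M : TM,
  (forall x b s1 s2 s3 n m, size x <= m ->
     sexec m p (rev x, [::], [::]) (b :: s1, s2, s3) n ->
    exists t, [/\ @tm_halt M (cfg_state (run M t x)),
       forall t', t' <= t -> cfg_space (run M t' x) <= (m.*2 + 8).*2.+1
      & @tm_accept M (cfg_state (run M t x)) = b]).
Proof.
exists (smTM (decide p)) => x b s1 s2 s3 n m hx h.
set c := compile p 0.
have [k hk hf] := compile_correct h (C := decide p) (u := [::])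
   (v := [:: IPop r1 (size c).+1 (size c).+1 (size c).+2]) ltac:(by rewrite /decide -cats1).
rewrite add0n -/c in hf.
have hm := sexec_end h.
have hf2 : freach (decide p) m (k + 1) (size (@nil instr), (rev x, [::], [::]))
    ((size c).+1 + b, (s1, s2, s3)).
  apply: freach_trans hf _; apply: freach1 => //=.
  - by move: hm => /=; lia.
  - by rewrite /decide size_rcons.
  - by rewrite nth_rcons ltnn eqxx /=; case: (b); rewrite /= ?addn1 ?addn0.
have [k' hk' [d' ha]] := freach_areach false (leqnn _) hf2.
rewrite tape_input in ha.
have ei : aS (decide p) false (size ([::] : seq instr)) sHome 0%R (fun i => if i is Posz n then nth None (map Some x) n else None)
   = ainit (smTM (decide p)) x by [].
rewrite ei in ha; have [|hr hsp] := run_areach _ ha; first lia.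
have szd : size (decide p) = (size c).+1 by rewrite size_rcons.
exists k'; split => //.
- move: hr; rewrite /cfg_state; case: (run _ k' x) => [[[q l] a] r] /= [-> _ _ _].
  by rewrite eqxx /= inordK szd; case: (b); lia.
- move: hr; rewrite /cfg_state; case: (run _ k' x) => [[[q l] a] r] /= [-> _ _ _].
  by rewrite -val_eqE /= inordK szd; case: (b); lia.
Qed.

(** * Polynomial time on structured data *)

(** A base of at least 2 makes the family monotone in the exponent and closed under sums, products
    and composition without exceptions for small [n]. *)
Definition pb (k n : nat) := (n + 2) ^ k.

Definition polyb (g : nat -> nat) := exists k, forall n, g n <= pb k n.

Lemma leq_pb k k' n n' : k <= k' -> n <= n' -> pb k n <= pb k' n'.
Proof.
move=> hk hn; apply: (@leq_trans ((n + 2) ^ k')); first by rewrite leq_pexp2l //; lia.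
by rewrite /pb; case: k' {hk} => // k'; rewrite leq_exp2r //; lia.
Qed.

Lemma pb_gt0 k n : 0 < pb k n.
Proof. by rewrite expn_gt0; lia. Qed.

Lemma pbD k l n : pb k n * pb l n = pb (k + l) n.
Proof. by rewrite /pb expnD. Qed.

Lemma polyb_le g h : (forall n, g n <= h n) -> polyb h -> polyb g.
Proof. by move=> gh [k hk]; exists k => n; exact: leq_trans (gh n) (hk n). Qed.

Lemma polyb_pb k : polyb (pb k). Proof. by exists k. Qed.

Lemma polyb_const c : polyb (fun=> c).
Proof.
exists c => n; apply: (leq_trans (ltnW (ltn_expl c (ltnSn 1)))).
by rewrite /pb; case: c => // c; rewrite leq_exp2r //; lia.
Qed.

Lemma polyb_id : polyb id.
Proof. by exists 1 => n; rewrite /pb expn1; lia. Qed.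

Lemma polyb_mul g h : polyb g -> polyb h -> polyb (fun n => g n * h n).
Proof. by move=> [k hk] [l hl]; exists (k + l) => n; rewrite -pbD leq_mul. Qed.

Lemma polyb_add g h : polyb g -> polyb h -> polyb (fun n => g n + h n).
Proof.
move=> [k hk] [l hl]; exists (k + l).+1 => n.
apply: (leq_trans (leq_add (hk n) (hl n))).
have h1 := leq_pb (leq_addr l k) (leqnn n); have h2 := leq_pb (leq_addl k l) (leqnn n).
rewrite {3}/pb expnS -/(pb _ _); nia.
Qed.

Lemma polyb_comp k h : polyb h -> polyb (fun n => pb k (h n)).
Proof.
move=> [l hl]; exists ((l + 2) * k) => n.
apply: (@leq_trans (pb k (pb l n))); first exact: leq_pb.
rewrite {1 3}/pb expnM; case: k => // k; rewrite leq_exp2r //.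
have := pb_gt0 l n; rewrite /pb expnD => hp; nia.
Qed.

Ltac poly := do ?[apply: polyb_add | apply: polyb_mul | exact: polyb_const
  | exact: polyb_pb | exact: polyb_id | apply: polyb_comp].

Lemma polyb_poly_bound g : polyb g -> exists k, forall n, g n <= poly_bound k n.
Proof.
move=> [k hk]; exists (2 * k + 3 ^ k) => n; apply: (leq_trans (hk n)).
rewrite /pb /poly_bound; case: (ltnP n 2) => hn.
  apply: (@leq_trans (3 ^ k)); last lia.
  by case: k {hk} => // k; rewrite leq_exp2r //; lia.
apply: (@leq_trans (n ^ (2 * k + 3 ^ k))); last lia.
apply: (@leq_trans (n ^ (2 * k))); last by rewrite leq_pexp2l //; lia.
by rewrite expnM; case: k {hk} => // k; rewrite leq_exp2r //; nia.
Qed.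

Inductive tree := Leaf | Node of tree & tree.

(** The preorder code is prefix-free: a program finds the end of a tree on top of a stack by itself,
    whatever lies below. *)
Fixpoint tb (t : tree) : str :=
  match t with Leaf => [:: false] | Node a b => true :: tb a ++ tb b end.

Class enc (A : Type) := EncT { toT : A -> tree; toT_inj : injective toT }.

#[export] Instance enc_tree : enc tree := {| toT := id; toT_inj := @inj_id tree |}.

Lemma unitT_inj : injective (fun _ : unit => Leaf).
Proof. by case=> -[]. Qed.
#[export] Instance enc_unit : enc unit := EncT unitT_inj.

Definition boolT (b : bool) := if b then Node Leaf Leaf else Leaf.
Lemma boolT_inj : injective boolT.
Proof. by do 2 case. Qed.
#[export] Instance enc_bool : enc bool := EncT boolT_inj.

(** Numbers are unary, so a loop whose length is a computed number is polynomial in the size of the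
    data. *)
Fixpoint natT (n : nat) := if n is n'.+1 then Node Leaf (natT n') else Leaf.
Lemma natT_inj : injective natT.
Proof. by elim=> [|n IH] [|m] //= [/IH ->]. Qed.
#[export] Instance enc_nat : enc nat := EncT natT_inj.

Lemma pairT_inj A B `{enc A, enc B} :
  injective (fun p : A * B => Node (toT p.1) (toT p.2)).
Proof. by move=> [a b] [a' b'] /= [e1 e2]; congr (_, _); exact: toT_inj. Qed.
#[export] Instance enc_pair A B `{enc A, enc B} : enc (A * B) := EncT (@pairT_inj A B _ _).

Fixpoint seqT A `{enc A} (s : seq A) : tree :=
  if s is x :: s' then Node (toT x) (seqT s') else Leaf.
Lemma seqT_inj A `{enc A} : injective (@seqT A _).
Proof. by elim=> [|x s IH] [|y s'] //= [e1 /IH ->]; congr (_ :: _); exact: toT_inj. Qed.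
#[export] Instance enc_seq A `{enc A} : enc (seq A) := EncT (@seqT_inj A _).

Lemma finT_inj (T : finType) : injective (fun x : T => natT (enum_rank x)).
Proof. by move=> x y /natT_inj /val_inj /enum_rank_inj. Qed.
Definition enc_fin (T : finType) : enc T := EncT (@finT_inj T).

Definition esz A `{enc A} (a : A) := size (tb (toT a)).

Lemma tb_gt0 t : 0 < size (tb t). Proof. by case: t. Qed.
Lemma esz_gt0 A `{enc A} (a : A) : 0 < esz a. Proof. exact: tb_gt0. Qed.

Lemma esz_pair A B `{enc A, enc B} (a : A) (b : B) : esz (a, b) = (esz a + esz b).+1.
Proof. by rewrite /esz /= size_cat. Qed.

Lemma esz_cons A `{enc A} (a : A) (s : seq A) : esz (a :: s) = (esz a + esz s).+1.
Proof. by rewrite /esz /= size_cat. Qed.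

Lemma esz_nat (n : nat) : esz n = n.*2.+1.
Proof. by rewrite /esz; elim: n => //= n ->. Qed.

(** The program acts on the top of the first stack and leaves everything below it, and both other
    stacks, as they were. This is what allows intermediate values to be parked while another program
    runs. *)
Definition PT A B `{enc A, enc B} (f : A -> B) : Prop :=
  exists (p : prog) (k : nat), forall a u v w, exists2 n, n <= pb k (esz a) &
    exec p (tb (toT a) ++ u, v, w) (tb (toT (f a)) ++ u, v, w) n.

Lemma PT_intro A B `{enc A, enc B} (f : A -> B) p g : polyb g ->
  (forall a u v w, exists2 n, n <= g (esz a) &
    exec p (tb (toT a) ++ u, v, w) (tb (toT (f a)) ++ u, v, w) n) -> PT f.
Proof.
move=> [k hk] h; exists p, k => a u v w; have [n hn hx] := h a u v w.
by exists n => //; exact: leq_trans hn (hk _).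
Qed.

Lemma PT_esz A B `{enc A, enc B} (f : A -> B) : PT f ->
  exists2 g, polyb g & forall a, esz (f a) <= g (esz a).
Proof.
move=> [p [k h]]; exists (fun n => n + pb k n).
  by apply: polyb_add (polyb_pb k); exact: polyb_id.
move=> a; have [n hn /exec_tot] := h a [::] [::] [::].
by rewrite /= !cats0 /esz in hn *; lia.
Qed.

Lemma PT_eszk A B `{enc A, enc B} (f : A -> B) : PT f ->
  exists k, forall a, esz (f a) <= pb k (esz a).
Proof.
by move=> /PT_esz [g [k hk] h]; exists k => a; exact: leq_trans (h a) (hk _).
Qed.

Declare Scope prog_scope.
Notation "p ;; q" := (Seq p q) (at level 85, right associativity) : prog_scope.
Local Open Scope prog_scope.

(* saved words: every bit is followed by a 1, a 0 marks the end *)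
Fixpoint toks (bs v : str) := if bs is b :: bs' then toks bs' (true :: b :: v) else v.
Fixpoint rtoks (bs v : str) := if bs is b :: bs' then true :: b :: rtoks bs' v else v.

Lemma toks_cat a b v : toks (a ++ b) v = toks b (toks a v).
Proof. by elim: a v => //=. Qed.

(** The third stack holds in unary the number of subtrees still to be read: a node raises it by one,
    a leaf lowers it by one. *)
Definition MoveL := While r3 (Match r1 Skip (Push r2 false;; Push r2 true)
  (Push r2 true;; Push r2 true;; Push r3 true;; Push r3 true)).
Definition MoveP := Push r2 false;; Push r3 false;; Push r3 true;; MoveL.
Definition DelL := While r3 (Match r1 Skip Skip (Push r3 true;; Push r3 true)).
Definition DelP := Push r3 false;; Push r3 true;; DelL.
Definition RestP := While r2 (Match r2 Skip (Push r1 false) (Push r1 true)).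
Definition Copy1 := While r2 (Match r2 Skip (Push r1 false;; Push r3 false;; Push r3 true)
   (Push r1 true;; Push r3 true;; Push r3 true)).
Definition Copy2 := While r3 (Match r3 Skip (Push r2 false;; Push r2 true)
   (Push r2 true;; Push r2 true)).
Definition SaveP := MoveP;; Push r3 false;; Copy1;; Push r2 false;; Copy2.

Lemma exec_eq p s s' n n' : exec p s s' n -> n = n' -> exec p s s' n'.
Proof. by move=> h <-. Qed.

Lemma push_seq r b q s s' n : exec q (pushr s r b) s' n -> exec (Push r b;; q) s s' n.+1.
Proof. by move=> h; apply: (@exec_seq _ _ _ (pushr s r b) _ 1) h; exact: exec_push. Qed.

Lemma MoveL_run t u v w s' n : exec MoveL (u, toks (tb t) v, w) s' n ->
  exists2 n', n' <= n + 7 * size (tb t) &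
  exec MoveL (tb t ++ u, v, true :: w) s' n'.
Proof.
elim: t u v w n => [|a IHa b IHb] u v w n h.
  exists (1 + 1 + n).+2; first by rewrite /=; lia.
  apply: (@exec_loop r3 _ _ (u, true :: false :: v, w) s' (1 + 1).+1 n) => //.
  apply: exec_match => /=.
  by apply: push_seq; exact: exec_push.
rewrite /= toks_cat in h.
have [n1 hn1 h1] := IHb _ _ _ _ h.
have [n2 hn2 h2] := IHa _ _ _ _ h1.
exists (5 + n2).+1; first by rewrite /= size_cat; lia.
apply: (@exec_loop r3 _ _ (tb a ++ tb b ++ u, true :: true :: v, true :: true :: w) s' 5 n2) => //.
  apply: exec_match => /=.
  by do 3 apply: push_seq; rewrite /pushr /= -catA; exact: exec_push.
Qed.

Lemma MoveP_run t u v w : exists2 n, n <= 4 + 7 * size (tb t) &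
  exec MoveP (tb t ++ u, v, w) (u, toks (tb t) (false :: v), w) n.
Proof.
have h0 : exec MoveL (u, toks (tb t) (false :: v), false :: w) (u, toks (tb t) (false :: v), w) 1.
  exact: exec_stop.
have [n hn h] := MoveL_run h0.
by exists n.+3; [lia | do 3 apply: push_seq].
Qed.

Lemma DelL_run t u v w s' n : exec DelL (u, v, w) s' n ->
  exists2 n', n' <= n + 4 * size (tb t) & exec DelL (tb t ++ u, v, true :: w) s' n'.
Proof.
elim: t u v w n => [|a IHa b IHb] u v w n h.
  exists (0 + n).+2; first by rewrite /=; lia.
  apply: (@exec_loop r3 _ _ (u, v, w) s' 1 n) => //.
  by apply: exec_match => /=; exact: exec_skip.
have [n1 hn1 h1] := IHb _ _ _ _ h.
have [n2 hn2 h2] := IHa _ _ _ _ h1.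
exists (3 + n2).+1; first by rewrite /= size_cat; lia.
apply: (@exec_loop r3 _ _ (tb a ++ tb b ++ u, v, true :: true :: w) s' 3 n2) => //.
apply: exec_match => /=.
by apply: push_seq; rewrite /pushr /= -catA; exact: exec_push.
Qed.

Lemma DelP_run t u v w : exists2 n, n <= 3 + 4 * size (tb t) &
  exec DelP (tb t ++ u, v, w) (u, v, w) n.
Proof.
have h0 : exec DelL (u, v, false :: w) (u, v, w) 1 by exact: exec_stop.
have [n hn h] := DelL_run t h0.
by exists n.+2; [lia | do 2 apply: push_seq].
Qed.

Lemma RestP_run bs u v w :
  exec RestP (u, toks bs (false :: v), w) (bs ++ u, v, w) (1 + 3 * size bs).
Proof.
elim/last_ind: bs u => [|bs b IH] u; first exact: exec_stop.
rewrite -cats1 toks_cat /=.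
apply: exec_eq (_ : (2 + (1 + 3 * size bs)).+1 = _); last by rewrite size_cat /=; lia.
apply: (@exec_loop r2 _ _ (b :: u, toks bs (false :: v), w)) => //.
  by apply: exec_match => /=; case: b; exact: exec_push.
by rewrite -catA; exact: IH.
Qed.

Lemma Copy1_run bs u v w : exec Copy1 (u, toks bs (false :: v), w)
  (bs ++ u, v, rtoks bs w) (1 + 5 * size bs).
Proof.
elim/last_ind: bs u w => [|bs b IH] u w; first exact: exec_stop.
have -> : rtoks (rcons bs b) w = rtoks bs (true :: b :: w).
  by elim: (bs) => //= c l ->.
rewrite -cats1 toks_cat /=.
apply: exec_eq (_ : (4 + (1 + 5 * size bs)).+1 = _); last by rewrite size_cat /=; lia.
apply: (@exec_loop r2 _ _ (b :: u, toks bs (false :: v), true :: b :: w)) => //.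
  by apply: exec_match => /=; case: b; do 2 apply: push_seq; exact: exec_push.
by rewrite -catA; exact: IH.
Qed.

Lemma Copy2_run bs u v w : exec Copy2 (u, v, rtoks bs (false :: w))
  (u, toks bs v, w) (1 + 4 * size bs).
Proof.
elim: bs v => [|b bs IH] v; first exact: exec_stop.
apply: exec_eq (_ : (3 + (1 + 4 * size bs)).+1 = _); last by rewrite /=; lia.
apply: (@exec_loop r3 _ _ (u, true :: b :: v, rtoks bs (false :: w))) => //.
by apply: exec_match => /=; case: b; apply: push_seq; exact: exec_push.
Qed.

Lemma SaveP_run t u v w : exists2 n, n <= 8 + 16 * size (tb t) &
  exec SaveP (tb t ++ u, v, w) (tb t ++ u, toks (tb t) (false :: v), w) n.
Proof.
have [n hn h] := MoveP_run t u v w.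
exists (n + ((1 + 5 * size (tb t)) + (1 + 4 * size (tb t)).+1).+1); first lia.
apply: exec_seq h _; apply: push_seq.
apply: exec_seq (Copy1_run _ _ _ _) _; apply: push_seq.
exact: Copy2_run.
Qed.

Section Rules.
Context {A B C : Type} {eA : enc A} {eB : enc B} {eC : enc C}.

Lemma PT_cast (f : A -> B) : (forall a, toT (f a) = toT a) -> PT f.
Proof.
move=> h; apply: (@PT_intro _ _ _ _ _ Skip (fun=> 0)); first exact: polyb_const.
by move=> a u v w; exists 0 => //; rewrite h; exact: exec_skip.
Qed.

Lemma PT_comp (f : A -> B) (g : B -> C) : PT f -> PT g -> PT (fun a => g (f a)).
Proof.
move=> hf; have [h [k hk] hh] := PT_esz hf; case: hf => p [kp hp] [q [kq hq]].
apply: (@PT_intro _ _ _ _ _ (p;; q) (fun n => pb kp n + pb kq (pb k n))).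
  by apply: polyb_add; [exact: polyb_pb | exact/polyb_comp/polyb_pb].
move=> a u v w; have [n hn h1] := hp a u v w.
have [n' hn' h2] := hq (f a) u v w.
exists (n + n'); last exact: exec_seq h1 h2.
apply: leq_add => //; apply: leq_trans hn' _; apply: leq_pb => //.
exact: leq_trans (hh a) (hk _).
Qed.

Lemma PT_pair (f : A -> B) (g : A -> C) : PT f -> PT g -> PT (fun a => (f a, g a)).
Proof.
move=> [p [kp hp]] [q [kq hq]].
apply: (@PT_intro _ _ _ _ _ (SaveP;; q;; RestP;; p;; Push r1 true)
  (fun n => (8 + 16 * n) + (pb kq n + ((1 + 3 * n) + (pb kp n + 1))))).
  poly.
move=> a u v w.
have [n1 hn1 h1] := SaveP_run (toT a) u v w.
have [n2 hn2 h2] := hq a u (toks (tb (toT a)) (false :: v)) w.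
have [n4 hn4 h4] := hp a (tb (toT (g a)) ++ u) v w.
exists (n1 + (n2 + ((1 + 3 * size (tb (toT a))) + (n4 + 1)))).
  by move: hn2 hn4; rewrite /esz; lia.
apply: exec_seq h1 _; apply: exec_seq h2 _. apply: exec_seq (RestP_run _ _ _ _) _; apply: exec_seq h4 _.
by rewrite /= -catA; exact: exec_push.
Qed.

Lemma PT_const (c : B) : PT (fun _ : A => c).
Proof.
pose pushall := fix pa bs := if bs is b :: bs' then pa bs';; Push r1 b else Skip.
have hpa bs u v w : exec (pushall bs) (u, v, w) (bs ++ u, v, w) (size bs).
  elim: bs => [|b bs IH]; first exact: exec_skip.
  by rewrite /= -addn1; apply: exec_seq IH _; exact: exec_push.
apply: (@PT_intro _ _ _ _ _ (DelP;; pushall (tb (toT c)))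
  (fun n => 3 + 4 * n + size (tb (toT c)))).
  poly.
move=> a u v w; have [n hn h] := DelP_run (toT a) u v w.
exists (n + size (tb (toT c))); first by rewrite /esz; lia.
exact: exec_seq h (hpa _ _ _ _).
Qed.

Lemma PT_fst_ : PT (fun p : A * B => p.1).
Proof.
apply: (@PT_intro _ _ _ _ _ (Match r1 Skip Skip (MoveP;; DelP;; RestP))
  (fun n => 20 + 20 * n)).
  poly.
move=> [a b] u v w.
have [n1 hn1 h1] := MoveP_run (toT a) (tb (toT b) ++ u) v w.
have [n2 hn2 h2] := DelP_run (toT b) u (toks (tb (toT a)) (false :: v)) w.
exists (n1 + (n2 + (1 + 3 * size (tb (toT a))))).+1; first by rewrite esz_pair /esz; lia.
apply: exec_match; rewrite /= -catA.
apply: exec_seq h1 _; apply: exec_seq h2 _; exact: RestP_run.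
Qed.

Lemma PT_snd_ : PT (fun p : A * B => p.2).
Proof.
apply: (@PT_intro _ _ _ _ _ (Match r1 Skip Skip DelP) (fun n => 20 + 20 * n)).
  poly.
move=> [a b] u v w.
have [n1 hn1 h1] := DelP_run (toT a) (tb (toT b) ++ u) v w.
exists n1.+1; first by rewrite esz_pair /esz; lia.
by apply: exec_match; rewrite /= -catA.
Qed.

End Rules.

(** A single rule for case analysis on every type whose code is either a leaf or a pair, as told by
    the view [vw]; booleans, numbers, lists and trees are instances. *)
Lemma PT_case A X Y Z C `{enc A, enc X, enc Y, enc Z, enc C} (l : A -> X)
    (vw : X -> option (Y * Z)) (f : A -> C) (g : (Y * Z) * A -> C) :
  (forall x, toT x = if vw x is Some y then toT y else Leaf) ->
  PT l -> PT f -> PT g ->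
  PT (fun a => if vw (l a) is Some y then g (y, a) else f a).
Proof.
move=> hvw hl [pf [kf hf]] [pg [kg hg]].
have hp : PT (fun a : A => (l a, a)) by apply: PT_pair => //; exact: PT_cast.
have [h [k hk] hh] := PT_esz hp; case: hp => p [kp hp].
(* Removing the tag of the pair and the tag of [l a] leaves either the code of [a] or those of [y],
   [z], [a]; in the second case two node tags turn them into the code of [((y, z), a)]. *)
apply: (@PT_intro _ _ _ _ _ (p;; Match r1 Skip Skip
    (Match r1 Skip pf (Push r1 true;; Push r1 true;; pg)))
  (fun n => pb kp n + (4 + (pb kf n + pb kg (pb k n))))).
  poly.
move=> a u v w; have [n hn h1] := hp a u v w.
have := hvw (l a); case E : (vw (l a)) => [[y z]|] eT.
- have [n2 hn2 h2] := hg ((y, z), a) u v w.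
  exists (n + n2.+4).
    rewrite leq_add //.
    have : pb kg (esz (y, z, a)) <= pb kg (pb k (esz a)).
      apply: leq_pb => //; apply: leq_trans (hk _); apply: leq_trans (hh a).
      have eL : esz (l a) = (esz y + esz z).+1 by rewrite /esz eT /= size_cat.
      by rewrite !esz_pair eL; lia.
    by move: hn2; lia.
  apply: exec_seq h1 _; apply: exec_match; rewrite /= eT /=.
  apply: exec_match => /=; do 2 apply: push_seq.
  exact: h2.
- have [n2 hn2 h2] := hf a u v w.
  exists (n + n2.+2); first by rewrite leq_add //; lia.
  apply: exec_seq h1 _; apply: exec_match; rewrite /= eT /=.
  by apply: exec_match.
Qed.

Lemma nseqS_cat n v : nseq n.+1 true ++ v = nseq n true ++ true :: v.
Proof. by elim: n => //= n ->. Qed.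

(** A polynomial-time step may double its data, so the size of all iterates has to be bounded
    separately. The counter is a block of ones on the second stack above a zero, consumed by
    [While]. *)
Lemma PT_iter A S `{enc A, enc S} (n : A -> nat) (s0 : A -> S) (g : S -> S) :
  PT n -> PT s0 -> PT g ->
  (exists k, forall a i, i <= n a -> esz (iter i g (s0 a)) <= pb k (esz a)) ->
  PT (fun a => iter (n a) g (s0 a)).
Proof.
move=> hn hs [pg [kg hg]] [k hk].
have [hN [kN hkN] hhN] := PT_esz hn.
have [p [kp hp]] := PT_pair hn hs.
pose CountL := While r1 (Match r1 Skip Skip Skip;; Push r2 true).
have hC m u v w : exec CountL (tb (natT m) ++ u, v, w) (u, nseq m true ++ v, w) (1 + 3 * m).
  elim: m v => [|m IH] v; first exact: exec_stop.
  apply: exec_eq (_ : ((1 + 1) + (1 + 3 * m)).+1 = _); last lia.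
  apply: (@exec_loop r1 _ _ (tb (natT m) ++ u, true :: v, w)) => //.
    apply: (@exec_seq _ _ _ (tb (natT m) ++ u, v, w) _ 1 1); last exact: exec_push.
    by apply: exec_match => /=; exact: exec_skip.
  rewrite nseqS_cat.
  exact: IH.
have hW m s u v w K : (forall i, i < m -> pb kg (esz (iter i g s)) <= K) ->
   exists2 t, t <= 1 + m * K.+1 &
   exec (While r2 pg) (tb (toT s) ++ u, nseq m true ++ false :: v, w)
     (tb (toT (iter m g s)) ++ u, v, w) t.
  elim: m s => [|m IH] s hK; first by exists 1 => //; exact: exec_stop.
  have [t1 ht1 h1] := hg s u (nseq m true ++ false :: v) w.
  have [|t2 ht2 h2] := IH (g s); first by move=> i hi; rewrite -iterSr; apply: hK.
  exists (t1 + t2).+1; first by have := hK 0 isT; move: ht1 ht2; rewrite /= mulSn; lia.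
  by rewrite iterSr; apply: (@exec_loop r2 pg _ (tb (toT (g s)) ++ u, nseq m true ++ false :: v, w) _ t1 t2).
apply: (@PT_intro _ _ _ _ _ (p;; Match r1 Skip Skip
    (Push r2 false;; CountL;; While r2 pg))
  (fun n => pb kp n + (4 + (3 * pb kN n + (1 + pb kN n * (pb kg (pb k n) + 1)))))).
  poly.
move=> a u v w; have [t1 ht1 h1] := hp a u v w.
have hna : n a <= pb kN (esz a).
  by apply: leq_trans (hkN _); apply: leq_trans (hhN a); rewrite esz_nat; lia.
have [|t2 ht2 h2] := hW (n a) (s0 a) u v w (pb kg (pb k (esz a))).
  by move=> i hi; apply: leq_pb => //; apply: hk; lia.
exists (t1 + ((1 + 3 * n a) + t2).+2).
  by rewrite leq_add //; move: ht2 hna; nia.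
apply: exec_seq h1 _; apply: exec_match; rewrite /= -catA.
apply: push_seq; apply: exec_seq (hC _ _ _ _) _.
exact: h2.
Qed.

Lemma PT_ext A B `{enc A, enc B} (f g : A -> B) : (forall a, f a = g a) -> PT f -> PT g.
Proof. by move=> e; have -> : f = g by exact: functional_extensionality. Qed.

Lemma PT_id {A} `{enc A} : PT (fun a : A => a). Proof. exact: PT_cast. Qed.

Lemma PT_fst {A B C} `{enc A, enc B, enc C} (h : A -> B * C) : PT h -> PT (fun a => (h a).1).
Proof. by move=> hh; apply: (PT_comp hh); exact: PT_fst_. Qed.

Lemma PT_snd {A B C} `{enc A, enc B, enc C} (h : A -> B * C) : PT h -> PT (fun a => (h a).2).
Proof. by move=> hh; apply: (PT_comp hh); exact: PT_snd_. Qed.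

Lemma PT_app2 {A B C D} `{enc A, enc B, enc C, enc D} (F : B -> C -> D) (f : A -> B) (g : A -> C) :
  PT (fun p : B * C => F p.1 p.2) -> PT f -> PT g -> PT (fun a => F (f a) (g a)).
Proof. by move=> hF hf hg; exact: (PT_comp (PT_pair hf hg) hF). Qed.

Lemma PT_if {A B} `{enc A, enc B} (c : A -> bool) (f g : A -> B) : PT c -> PT f -> PT g ->
  PT (fun a => if c a then f a else g a).
Proof.
move=> hc hf hg.
pose vw (b : bool) := if b then Some (tt, tt) else None.
have hf' : PT (fun p : (unit * unit) * A => f p.2) by apply: PT_comp hf; exact: PT_snd_.
have h := @PT_case _ _ _ _ _ _ _ _ _ _ c vw g (fun p => f p.2) _ hc hg hf'.
by move: (h ltac:(by case)); apply: PT_ext => a; rewrite /vw; case: (c a).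
Qed.

Lemma PT_caseL {A B C} `{enc A, enc B, enc C} (l : A -> seq B) (f : A -> C) (g : (B * seq B) * A -> C) :
  PT l -> PT f -> PT g -> PT (fun a => if l a is x :: xs then g ((x, xs), a) else f a).
Proof.
move=> hl hf hg.
pose vw (s : seq B) := if s is x :: xs then Some (x, xs) else None.
have h := @PT_case _ _ _ _ _ _ _ _ _ _ l vw f g _ hl hf hg.
by move: (h ltac:(by case)); apply: PT_ext => a; rewrite /vw; case: (l a).
Qed.

Lemma PT_caseN {A C} `{enc A, enc C} (n : A -> nat) (f : A -> C) (g : nat * A -> C) :
  PT n -> PT f -> PT g -> PT (fun a => if n a is m.+1 then g (m, a) else f a).
Proof.
move=> hn hf hg.
pose vw (s : nat) := if s is m.+1 then Some (tt, m) else None.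
have hg' : PT (fun p : (unit * nat) * A => g (p.1.2, p.2)).
  by apply: (PT_comp _ hg); apply: PT_pair; [apply: PT_snd; exact: PT_fst_ | exact: PT_snd_].
have h := @PT_case _ _ _ _ _ _ _ _ _ _ n vw f _ _ hn hf hg'.
by move: (h ltac:(by case)); apply: PT_ext => a; rewrite /vw; case: (n a).
Qed.

Lemma PT_cons {A B} `{enc A, enc B} (f : A -> B) (g : A -> seq B) : PT f -> PT g -> PT (fun a => f a :: g a).
Proof.
move=> hf hg; have hc : PT (fun p : B * seq B => p.1 :: p.2) by apply: PT_cast; case.
exact: PT_app2 hc hf hg.
Qed.

Lemma PT_S {A} `{enc A} (f : A -> nat) : PT f -> PT (fun a => (f a).+1).
Proof.
move=> hf; have hc : PT (fun p : unit * nat => p.2.+1) by apply: PT_cast => -[[]].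
by apply: (PT_comp (PT_pair (PT_const tt) hf) hc).
Qed.

Lemma PT_pred {A} `{enc A} (f : A -> nat) : PT f -> PT (fun a => (f a).-1).
Proof.
move=> hf; have := PT_caseN hf (PT_const 0) (g := fst) PT_fst_.
by apply: PT_ext => a; case: (f a).
Qed.

Lemma PT_behead {A B} `{enc A, enc B} (f : A -> seq B) : PT f -> PT (fun a => behead (f a)).
Proof.
move=> hf; have := PT_caseL hf (PT_const [::]) (g := fun p => p.1.2) (PT_snd PT_fst_).
by apply: PT_ext => a; case: (f a).
Qed.

Lemma PT_head {A B} `{enc A, enc B} (d : A -> B) (f : A -> seq B) : PT d -> PT f -> PT (fun a => head (d a) (f a)).
Proof.
move=> hd hf; have := PT_caseL hf hd (g := fun p => p.1.1) (PT_fst PT_fst_).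
by apply: PT_ext => a; case: (f a).
Qed.

Lemma size_esz A `{enc A} (s : seq A) : size s < esz s.
Proof. by elim: s => // x s IH; rewrite esz_cons /=; lia. Qed.

Lemma PT_size {A B} `{enc A, enc B} (f : A -> seq B) : PT f -> PT (fun a => size (f a)).
Proof.
move=> hf; apply: (PT_comp hf) => {f hf}.
pose p := Seq (Push r2 false) (Seq (While r1 (Seq DelP (Push r2 true)))
   (Seq (Push r1 false) (While r2 (Seq (Push r1 false) (Push r1 true))))).
have h1 (s : seq B) u v w : exists2 n, n <= 5 * esz s &
    exec (While r1 (Seq DelP (Push r2 true))) (tb (toT s) ++ u, v, w) (u, nseq (size s) true ++ v, w) n.
  elim: s v => [|x s IH] v; first by exists 1 => //; exact: exec_stop.
  have [n hn hx] := IH (true :: v).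
  have [n' hn' hx'] := DelP_run (toT x) (tb (toT s) ++ u) v w.
  exists ((n' + 1) + n).+1; first by rewrite esz_cons; move: hn'; rewrite /esz in hn *; lia.
  rewrite (nseqS_cat (size s)).
  apply: (@exec_loop r1 _ _ (tb (toT s) ++ u, true :: v, w) _ _ n) => //.
  apply: (@exec_seq _ _ _ (tb (toT s) ++ u, v, w) _ n' 1); last exact: exec_push.
  by rewrite /popr /= -catA.
have h2 m (k : nat) u v w : exec (While r2 (Seq (Push r1 false) (Push r1 true)))
   (tb (natT k) ++ u, nseq m true ++ false :: v, w) (tb (natT (k + m)) ++ u, v, w) (1 + 3 * m).
  elim: m k => [|m IH] k; first by rewrite addn0; exact: exec_stop.
  apply: exec_eq (_ : (2 + (1 + 3 * m)).+1 = _); last lia.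
  apply: (@exec_loop r2 _ _ (tb (natT k.+1) ++ u, nseq m true ++ false :: v, w)) => //.
    by apply: push_seq; exact: exec_push.
  by rewrite addnS -addSn; exact: IH.
apply: (@PT_intro _ _ _ _ _ p (fun n => 10 + 10 * n)); first by poly.
move=> s u v w; have [n hn hx] := h1 s u (false :: v) w.
exists (n + (1 + 3 * size s).+1).+1.
  have hsz : size s < esz s by exact: size_esz.
  by move: hn; lia.
apply: push_seq; apply: exec_seq hx _; apply: push_seq.
exact: (h2 (size s) 0).
Qed.

Lemma PT_iterc A S `{enc A, enc S} (n : A -> nat) (s0 : A -> S) (f : A * S -> S) :
  PT n -> PT s0 -> PT f ->
  (exists k, forall a i, i <= n a -> esz (iter i (fun s => f (a, s)) (s0 a)) <= pb k (esz a)) ->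
  PT (fun a => iter (n a) (fun s => f (a, s)) (s0 a)).
Proof.
move=> hn hs hf [k hk].
have hg : PT (fun p : A * S => (p.1, f p)) by apply: PT_pair; [exact: PT_fst_ | exact: hf].
have e a i : iter i (fun p : A * S => (p.1, f p)) (a, s0 a) = (a, iter i (fun s => f (a, s)) (s0 a)).
  by elim: i => //= i ->.
have := PT_snd (PT_iter hn (PT_pair PT_id hs) hg _).
move=> /(_ _) h; have : PT (fun a => (iter (n a) (fun p : A * S => (p.1, f p)) (a, s0 a)).2).
  apply: h.
  have [k' hk'] : polyb (fun n => (n + pb k n) + 1) by poly.
  exists k' => a i hi; apply: leq_trans (hk' _); rewrite e esz_pair.
  by have := hk a i hi; lia.
by apply: PT_ext => a; rewrite e.
Qed.

Lemma esz_nil A `{enc A} : esz ([::] : seq A) = 1. Proof. by []. Qed.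

Lemma esz_drop A {eA : enc A} i (s : seq A) : esz (drop i s) <= esz s.
Proof.
elim: s i => // x s IH [|i] //; rewrite esz_cons; apply: leq_trans (IH i) _; lia.
Qed.

Lemma esz_take A {eA : enc A} i (s : seq A) : esz (take i s) <= esz s.
Proof.
elim: s i => // x s IH [|i]; first by rewrite take0 esz_nil esz_cons.
by rewrite /= !esz_cons; have := IH i; lia.
Qed.

Lemma PT_foldl A S E `{enc A, enc S, enc E} (l : A -> seq E) (s0 : A -> S) (f : A * (S * E) -> S) :
  PT l -> PT s0 -> PT f ->
  (exists k, forall a i, i <= size (l a) ->
     esz (foldl (fun s e => f (a, (s, e))) (s0 a) (take i (l a))) <= pb k (esz a)) ->
  PT (fun a => foldl (fun s e => f (a, (s, e))) (s0 a) (l a)).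
Proof.
move=> hl hs hf [k hk].
pose g (p : A * (S * seq E)) : S * seq E :=
  if p.2.2 is x :: xs then (f (p.1, (p.2.1, x)), xs) else p.2.
have hg : PT g.
  have := @PT_caseL (A * (S * seq E)) E (S * seq E) _ _ _ (fun p => p.2.2) (fun p => p.2)
    (fun q => (f (q.2.1, (q.2.2.1, q.1.1)), q.1.2)) _ _ _.
  apply; first by apply: PT_snd; exact: PT_snd_.
    exact: PT_snd_.
  apply: PT_pair; last by apply: PT_snd; exact: PT_fst_.
  apply: (PT_comp _ hf); apply: PT_pair; first by apply: PT_fst; exact: PT_snd_.
  apply: PT_pair; last by apply: PT_fst; exact: PT_fst_.
  by apply: PT_fst; apply: PT_snd; exact: PT_snd_.
have e a i : i <= size (l a) -> iter i (fun s => g (a, s)) (s0 a, l a) =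
   (foldl (fun s e => f (a, (s, e))) (s0 a) (take i (l a)), drop i (l a)).
  elim: i => [|i IH] hi; first by rewrite take0 drop0.
  rewrite iterS IH; last exact: ltnW.
  have [x0 _] : exists x0 : E, true by case: (l a) hi => // x0 l' _; exists x0.
  rewrite /g /= (drop_nth x0) // (take_nth x0) // -cats1 foldl_cat //.
have [gl [kl hkl] hhl] := PT_esz hl.
have hi := PT_iterc (PT_size hl) (PT_pair hs hl) hg _.
have : PT (fun a => (iter (size (l a)) (fun s => g (a, s)) (s0 a, l a)).1).
  apply: PT_fst; apply: hi.
  have [k' hk'] : polyb (fun n => (pb k n + pb kl n) + 1) by poly.
  exists k' => a i hi; apply: leq_trans (hk' _); rewrite e // esz_pair.
  have h1 := hk a i hi.
  have h2 : esz (drop i (l a)) <= esz (l a) by exact: esz_drop.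
  by have h3 := leq_trans (hhl a) (hkl _); lia.
by apply: PT_ext => a; rewrite e //= take_size.
Qed.

(** If a step adds to the accumulator an amount that does not depend on the accumulator, the sizes
    grow linearly in the length of the list, and the bound required by [PT_foldl] is automatic. *)
Lemma PT_foldl_add A S E `{enc A, enc S, enc E} (l : A -> seq E) (s0 : A -> S) (f : A * (S * E) -> S) :
  PT l -> PT s0 -> PT f ->
  (exists k, forall a s e, esz (f (a, (s, e))) <= esz s + pb k (esz a + esz e)) ->
  PT (fun a => foldl (fun s e => f (a, (s, e))) (s0 a) (l a)).
Proof.
move=> hl hs hf [k hk]; apply: PT_foldl => //.
have [gl [kl hkl] hhl] := PT_esz hl; have [gs [ks hks] hhs] := PT_esz hs.
have [k' hk'] : polyb (fun n => pb ks n + pb kl n * pb k (n + pb kl n)) by poly.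
exists k' => a i hi; apply: leq_trans (hk' _).
have key (s : S) (u : seq E) M : (forall x, x <= M -> pb k (esz a + x) <= pb k (esz a + M)) ->
    esz u <= M ->
    esz (foldl (fun s e => f (a, (s, e))) s u) <= esz s + size u * pb k (esz a + M).
  move=> hm; elim: u s => [|x u IH] s hu /=; first lia.
  rewrite esz_cons in hu.
  have := IH (f (a, (s, x))) ltac:(lia); have := hk a s x; have := hm (esz x) ltac:(lia).
  by rewrite mulSn; lia.
have h2 : esz (take i (l a)) <= esz (l a) by exact: esz_take.
have h3 : esz (l a) <= pb kl (esz a) by exact: leq_trans (hhl a) (hkl _).
have h4 : esz (s0 a) <= pb ks (esz a) by exact: leq_trans (hhs a) (hks _).
have := key (s0 a) (take i (l a)) (pb kl (esz a)) _ (leq_trans h2 h3).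
move=> /(_ ltac:(by move=> x hx; apply: leq_pb; lia)) h5; apply: leq_trans h5 _.
apply: leq_add => //; apply: leq_mul => //.
have hsz : size (l a) < esz (l a) by exact: size_esz.
by rewrite size_take; case: ltnP; lia.
Qed.

Lemma PT_rev {A B} `{enc A, enc B} (f : A -> seq B) : PT f -> PT (fun a => rev (f a)).
Proof.
move=> hf; have := @PT_foldl_add A (seq B) B _ _ _ f (fun=> [::]) (fun p => p.2.2 :: p.2.1) hf (PT_const _) _ _.
move=> h; have : PT (fun a => foldl (fun s e => e :: s) [::] (f a)).
  apply: h; first by apply: PT_cons; [apply: PT_snd | apply: PT_fst]; exact: PT_snd_.
  exists 2 => a s e; rewrite esz_cons /pb /= expnS expn1; nia.
apply: PT_ext => a; rewrite -[RHS]cats0.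
by elim: (f a) [::] => //= x s IH u; rewrite IH rev_cons cat_rcons.
Qed.

Lemma PT_map {A B C} `{enc A, enc B, enc C} (l : A -> seq B) (h : A * B -> C) : PT l -> PT h ->
  PT (fun a => [seq h (a, b) | b <- l a]).
Proof.
move=> hl hh; have [g [k hk] hhh] := PT_esz hh.
have := PT_rev (@PT_foldl_add A (seq C) B _ _ _ l (fun=> [::]) (fun p => h (p.1, p.2.2) :: p.2.1) hl (PT_const _) _ _).
move=> Hm; have : PT (fun a => rev (foldl (fun s e => h (a, e) :: s) [::] (l a))).
  apply: Hm.
    apply: PT_cons; last by apply: PT_fst; exact: PT_snd_.
    by apply: (PT_comp _ hh); apply: PT_pair; [exact: PT_fst_ | apply: PT_snd; exact: PT_snd_].
  have [k' hk'] : polyb (fun n => pb k (n + 1) + 1) by poly.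
  exists k' => a s e; rewrite esz_cons /=.
  rewrite addnC -addnS leq_add2l -addn1.
  apply: leq_trans (hk' _); have h1 := leq_trans (hhh (a, e)) (hk _).
  by rewrite esz_pair -addn1 in h1; lia.
apply: PT_ext => a.
rewrite -[RHS]revK; congr rev; rewrite -map_rev -[RHS]cats0.
by elim: (l a) [::] => //= x s IH u; rewrite IH rev_cons map_rcons cat_rcons.
Qed.

Lemma PT_cat {A B} `{enc A, enc B} (f g : A -> seq B) : PT f -> PT g -> PT (fun a => f a ++ g a).
Proof.
move=> hf hg.
have := @PT_foldl_add A (seq B) B _ _ _ (fun a => rev (f a)) g (fun p => p.2.2 :: p.2.1) (PT_rev hf) hg _ _.
move=> h; have : PT (fun a => foldl (fun s e => e :: s) (g a) (rev (f a))).
  apply: h; first by apply: PT_cons; [apply: PT_snd | apply: PT_fst]; exact: PT_snd_.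
  exists 2 => a s e; rewrite esz_cons /pb /= expnS expn1; nia.
apply: PT_ext => a; rewrite -{2}(revK (f a)).
by elim: (rev (f a)) (g a) => //= x s IH u; rewrite IH rev_cons cat_rcons.
Qed.

Lemma esz_cat {B} `{enc B} (s t : seq B) : (esz (s ++ t)).+1 = esz s + esz t.
Proof. by elim: s => //= x s IH; rewrite !esz_cons; lia. Qed.

Lemma PT_flatten {A B} `{enc A, enc B} (f : A -> seq (seq B)) : PT f -> PT (fun a => flatten (f a)).
Proof.
move=> hf.
have hc : PT (fun p : A * (seq B * seq B) => p.2.1 ++ p.2.2).
  by apply: PT_cat; [apply: PT_fst | apply: PT_snd]; exact: PT_snd_.
have := @PT_foldl_add A (seq B) (seq B) _ _ _ f (fun=> [::]) _ hf (PT_const _) hc _.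
move=> h; have : PT (fun a => foldl (fun s e => s ++ e) [::] (f a)).
  apply: h; exists 1 => a s e; have h1 : (esz (s ++ e)).+1 = esz s + esz e by exact: esz_cat.
  by rewrite /pb expn1 /=; lia.
apply: PT_ext => a; rewrite -[RHS]cat0s.
elim: (f a) ([::] : seq B) => [|x s IH] u /=; first by rewrite cats0.
by rewrite IH catA.
Qed.

Lemma PT_drop {A B} `{enc A, enc B} (i : A -> nat) (f : A -> seq B) : PT i -> PT f -> PT (fun a => drop (i a) (f a)).
Proof.
move=> hi hf; have [k hk] := PT_eszk hf.
have := @PT_iter A (seq B) _ _ i f behead hi hf (PT_behead PT_id) _.
have e (s : seq B) n : iter n behead s = drop n s.
  by elim: n s => [|n IH] s; rewrite ?drop0 // iterSr IH; case: s.
move=> h; have : PT (fun a => iter (i a) behead (f a)).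
  apply: h; exists k => a n _; apply: leq_trans (hk a); rewrite e.
  exact: esz_drop.
by apply: PT_ext => a; rewrite e.
Qed.

Lemma PT_nth {A B} `{enc A, enc B} (d : A -> B) (f : A -> seq B) (i : A -> nat) :
  PT d -> PT f -> PT i -> PT (fun a => nth (d a) (f a) (i a)).
Proof.
move=> hd hf hi; have := PT_head hd (PT_drop hi hf).
by apply: PT_ext => a; rewrite -nth0 nth_drop addn0.
Qed.

Lemma PT_filter {A B} `{enc A, enc B} (l : A -> seq B) (h : A * B -> bool) : PT l -> PT h ->
  PT (fun a => [seq b <- l a | h (a, b)]).
Proof.
move=> hl hh.
have := PT_flatten (PT_map hl (PT_if hh (PT_cons PT_snd_ (PT_const [::])) (PT_const [::]))).
apply: PT_ext => a.
by elim: (l a) => //= x s ->; case: (h (a, x)).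
Qed.

Lemma PT_iota0 {A} `{enc A} (n : A -> nat) : PT n -> PT (fun a => iota 0 (n a)).
Proof.
move=> hn; have [k hk] := PT_eszk hn.
have := PT_rev (@PT_iter A (seq nat) _ _ n (fun=> [::]) (fun s => size s :: s) hn (PT_const _) (PT_cons (PT_size PT_id) PT_id) _).
have e i : iter i (fun s : seq nat => size s :: s) [::] = rev (iota 0 i).
  elim: i => // i IH; rewrite iterS IH size_rev size_iota.
  by rewrite -addn1 iotaD rev_cat add0n.
move=> h; have : PT (fun a => rev (iter (n a) (fun s : seq nat => size s :: s) [::])).
  apply: h.
  have [k' hk'] : polyb (fun n => 1 + pb k n * (2 * pb k n + 2)) by poly.
  exists k' => a i hi; apply: leq_trans (hk' _).
  have hn' : n a <= pb k (esz a) by have := hk a; rewrite esz_nat; lia.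
  have : esz (iter i (fun s : seq nat => size s :: s) [::]) <= 1 + i * (2 * n a + 2).
    elim: i hi => // i IH hi; rewrite iterS esz_cons esz_nat e size_rev size_iota -e.
    by have := IH (ltnW hi); rewrite mulSn; lia.
  move=> h1; apply: leq_trans h1 _; rewrite leq_add2l; apply: leq_mul; lia.
by apply: PT_ext => a; rewrite e revK.
Qed.

Lemma PT_add {A} `{enc A} (f g : A -> nat) : PT f -> PT g -> PT (fun a => f a + g a).
Proof.
move=> hf hg; have [k hk] := PT_eszk hf; have [l hl] := PT_eszk hg.
have := @PT_iter A nat _ _ f g S hf hg (PT_S PT_id) _.
have e n m : iter n S m = n + m by elim: n => //= n ->.
move=> h; have : PT (fun a => iter (f a) S (g a)).
  apply: h; have [k' hk'] : polyb (fun n => pb k n + pb l n) by poly.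
  exists k' => a i hi; apply: leq_trans (hk' _).
  by have := hk a; have := hl a; rewrite e !esz_nat; lia.
by apply: PT_ext => a; rewrite e.
Qed.

Lemma PT_sub {A} `{enc A} (f g : A -> nat) : PT f -> PT g -> PT (fun a => f a - g a).
Proof.
move=> hf hg; have [k hk] := PT_eszk hf.
have := @PT_iter A nat _ _ g f predn hg hf (PT_pred PT_id) _.
have e n m : iter n predn m = m - n by elim: n => /= [|n ->]; lia.
move=> h; have : PT (fun a => iter (g a) predn (f a)).
  apply: h; exists k => a i hi; apply: leq_trans (hk _).
  by rewrite e !esz_nat; lia.
by apply: PT_ext => a; rewrite e.
Qed.

Lemma PT_eq0 {A} `{enc A} (f : A -> nat) : PT f -> PT (fun a => f a == 0).
Proof.
move=> hf.
have : PT (fun a => if f a is m.+1 then false else true).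
  exact: (@PT_caseN A bool _ _ f (fun=> true) (fun=> false) hf (PT_const _) (PT_const _)).
by apply: PT_ext => a; case: (f a).
Qed.

Lemma PT_leq {A} `{enc A} (f g : A -> nat) : PT f -> PT g -> PT (fun a => f a <= g a).
Proof. by move=> hf hg; exact: PT_eq0 (PT_sub hf hg). Qed.

Lemma PT_andb {A} `{enc A} (f g : A -> bool) : PT f -> PT g -> PT (fun a => f a && g a).
Proof. by move=> hf hg; exact: PT_if hf hg (PT_const false). Qed.

Lemma PT_orb {A} `{enc A} (f g : A -> bool) : PT f -> PT g -> PT (fun a => f a || g a).
Proof. by move=> hf hg; exact: PT_if hf (PT_const true) hg. Qed.

Lemma PT_negb {A} `{enc A} (f : A -> bool) : PT f -> PT (fun a => ~~ f a).
Proof. by move=> hf; exact: PT_if hf (PT_const false) (PT_const true). Qed.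

Lemma PT_eqb {A} `{enc A} (f g : A -> bool) : PT f -> PT g -> PT (fun a => f a == g a).
Proof.
move=> hf hg; have := PT_if hf hg (PT_negb hg).
by apply: PT_ext => a; case: (f a); case: (g a).
Qed.

Lemma PT_addb {A} `{enc A} (f g : A -> bool) : PT f -> PT g -> PT (fun a => f a (+) g a).
Proof.
move=> hf hg; have := PT_if hf (PT_negb hg) hg.
by apply: PT_ext => a; case: (f a); case: (g a).
Qed.

Lemma PT_eqn {A} `{enc A} (f g : A -> nat) : PT f -> PT g -> PT (fun a => f a == g a).
Proof.
move=> hf hg; have := PT_andb (PT_leq hf hg) (PT_leq hg hf).
by apply: PT_ext => a; rewrite -eqn_leq.
Qed.

Lemma PT_mul {A} `{enc A} (f g : A -> nat) : PT f -> PT g -> PT (fun a => f a * g a).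
Proof.
move=> hf hg; have [k hk] := PT_eszk hf; have [l hl] := PT_eszk hg.
have := @PT_iterc A nat _ _ f (fun=> 0) (fun p => g p.1 + p.2) hf (PT_const 0)
  (PT_add (PT_comp PT_fst_ hg) PT_snd_) _.
have e a n : iter n (fun m => g a + m) 0 = n * g a by elim: n => //= n ->; rewrite mulSn.
move=> h; have : PT (fun a => iter (f a) (fun m => g a + m) 0).
  apply: h; have [k' hk'] : polyb (fun n => 2 * (pb k n * pb l n) + 1) by poly.
  exists k' => a i hi; apply: leq_trans (hk' _).
  by have := hk a; have := hl a; rewrite e !esz_nat; nia.
by apply: PT_ext => a; rewrite e.
Qed.

Lemma PT_exp {A} `{enc A} k (f : A -> nat) : PT f -> PT (fun a => f a ^ k).
Proof.
move=> hf; elim: k => [|k IH]; first exact: PT_const.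
have := PT_mul hf IH; by apply: PT_ext => a; rewrite expnS.
Qed.

(** The quotient is found by counting the [i] below the dividend with [i.+1 * g a <= f a], a search
    that unary numbers make affordable. *)
Lemma PT_div {A} `{enc A} (f g : A -> nat) : PT f -> PT g -> PT (fun a => f a %/ g a).
Proof.
move=> hf hg.
have h : PT (fun a => size [seq i <- iota 0 (f a) | i.+1 * g a <= f a]).
  apply: PT_size.
  apply: (@PT_filter A nat _ _ (fun a => iota 0 (f a)) (fun p => p.2.+1 * g p.1 <= f p.1)).
    exact: PT_iota0.
  apply: PT_leq; last exact: PT_comp PT_fst_ hf.
  by apply: PT_mul; [apply: PT_S; exact: PT_snd_ | exact: PT_comp PT_fst_ hg].
have := PT_if (PT_eq0 hg) (PT_const 0) h.
apply: PT_ext => a.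
case: eqP => [->|/eqP]; rewrite ?divn0 // -lt0n => hp.
rewrite size_filter (eq_count (a2 := fun i => i < f a %/ g a)); last first.
  by move=> i; rewrite /= -(leq_divRL _ _ hp).
have hle : f a %/ g a <= f a by exact: leq_div.
have -> : iota 0 (f a) = iota 0 (f a %/ g a) ++ iota (f a %/ g a) (f a - f a %/ g a).
  by have := iotaD 0 (f a %/ g a) (f a - f a %/ g a); rewrite subnKC // add0n.
rewrite count_cat.
rewrite (_ : count _ (iota 0 _) = f a %/ g a); last first.
  rewrite -[RHS](size_iota 0) -[RHS](count_predT); apply: eq_in_count => i.
  by rewrite mem_iota => /andP [_ ->].
rewrite (_ : count _ (iota _ _) = 0) ?addn0 //; apply/eqP.
rewrite -leqn0 leqNgt -has_count; apply/hasPn => i; rewrite mem_iota; lia.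
Qed.

Lemma PT_mod {A} `{enc A} (f g : A -> nat) : PT f -> PT g -> PT (fun a => f a %% g a).
Proof.
move=> hf hg; have := PT_sub hf (PT_mul (PT_div hf hg) hg).
apply: PT_ext => a.
by rewrite {1}(divn_eq (f a) (g a)) addKn.
Qed.

Lemma PT_map2 {A B C} `{enc A, enc B, enc C} (l : A -> seq B) (h : A -> B -> C) : PT l ->
  PT (fun p : A * B => h p.1 p.2) -> PT (fun a => [seq h a b | b <- l a]).
Proof. exact: PT_map. Qed.

Lemma PT_filter2 {A B} `{enc A, enc B} (l : A -> seq B) (h : A -> B -> bool) : PT l ->
  PT (fun p : A * B => h p.1 p.2) -> PT (fun a => [seq b <- l a | h a b]).
Proof. exact: PT_filter. Qed.

Lemma PT_take {A B} `{enc A, enc B} (i : A -> nat) (f : A -> seq B) :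
  PT i -> PT f -> PT (fun a => take (i a) (f a)).
Proof.
move=> hi hf; have h := PT_rev (PT_drop (PT_sub (PT_size hf) hi) (PT_rev hf)).
by apply: PT_ext h => a; rewrite drop_rev revK; case: (leqP (i a) (size (f a))) => h;
  [rewrite subKn | rewrite (take_oversize (ltnW h)) take_oversize //; lia].
Qed.

Lemma PT_double {A} `{enc A} (f : A -> nat) : PT f -> PT (fun a => (f a).*2).
Proof. by move=> h; apply: PT_ext (PT_add h h) => a; rewrite addnn. Qed.

Lemma PT_comp2 A B C (eA : enc A) (eB : enc B) (eC : enc C) (g : B -> C) : PT g -> forall f : A -> B, PT f -> PT (fun a => g (f a)).
Proof. by move=> hg f hf; exact: PT_comp hf hg. Qed.

Lemma PT_app3 {A B C D E} `{enc A, enc B, enc C, enc D, enc E} (F : B -> C -> D -> E)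
  (f : A -> B) (g : A -> C) (h : A -> D) :
  PT (fun p : B * C * D => F p.1.1 p.1.2 p.2) -> PT f -> PT g -> PT h -> PT (fun a => F (f a) (g a) (h a)).
Proof. by move=> hF hf hg hh; exact: (PT_comp (PT_pair (PT_pair hf hg) hh) hF). Qed.

Ltac pt_hook := fail.
Ltac pt1 :=
  cbv beta;
  match goal with
  | |- forall _, _ => intro
  | h : PT ?g |- PT ?g => exact h
  | |- PT (fun _ => ?c) => exact: PT_const
  | |- PT (fun a => a) => exact: PT_id
  | |- _ => pt_hook
  | |- @PT ?A ?B ?e1 ?e2 ?f => lazymatch f with (fun _ => _) => fail | _ => change (@PT A B e1 e2 (fun a => f a)) end
  | |- PT (fun a => (_ , _)) => apply: PT_pair
  | |- PT (fun a => fst (@?f a)) => apply: PT_fst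
  | |- PT (fun a => snd (@?f a)) => apply: PT_snd
  | |- PT (fun a => if _ then _ else _) => apply: PT_if
  | |- PT (fun a => @?f a :: @?g a) => apply: PT_cons
  | |- PT (fun a => (@?f a).+1) => apply: PT_S
  | |- PT (fun a => (@?f a).-1) => apply: PT_pred
  | |- PT (fun a => size (@?f a)) => apply: PT_size
  | |- PT (fun a => behead (@?f a)) => apply: PT_behead
  | |- PT (fun a => rev (@?f a)) => apply: PT_rev
  | |- PT (fun a => head _ _) => apply: PT_head
  | |- PT (fun a => nth _ _ _) => apply: PT_nth
  | |- PT (fun a => flatten _) => apply: PT_flatten
  | |- PT (fun a => _ ++ _) => apply: PT_cat
  | |- PT (fun a => drop _ _) => apply: PT_drop
  | |- PT (fun a => take _ _) => apply: PT_take
  | |- PT (fun a => iota 0 _) => apply: PT_iota0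
  | |- PT (fun a => map (@?h a) (@?l a)) => apply: (@PT_map2 _ _ _ _ _ _ l h)
  | |- PT (fun a => filter (@?h a) (@?l a)) => apply: (@PT_filter2 _ _ _ _ l h)
  | |- PT (fun a => _ + _) => apply: PT_add
  | |- PT (fun a => _ - _) => apply: PT_sub
  | |- PT (fun a => _ * _) => apply: PT_mul
  | |- PT (fun a => _ %/ _) => apply: PT_div
  | |- PT (fun a => _ %% _) => apply: PT_mod
  | |- PT (fun a => _ ^ _) => apply: PT_exp
  | |- PT (fun a => _.*2) => apply: PT_double
  | |- PT (fun a => @eq_op (Datatypes_nat__canonical__eqtype_Equality) _ _) => apply: PT_eqn
  | |- PT (fun a => @eq_op (Datatypes_bool__canonical__eqtype_Equality) _ _) => apply: PT_eqb
  | |- PT (fun a => _ <= _) => apply: PT_leq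
  | |- PT (fun a => _ && _) => apply: PT_andb
  | |- PT (fun a => _ || _) => apply: PT_orb
  | |- PT (fun a => ~~ _) => apply: PT_negb
  | |- PT (fun a => _ (+) _) => apply: PT_addb
  | h : PT ?g |- PT (fun a => ?g _) => apply: (PT_comp2 h)
  | h : PT (fun p => ?F p.1 p.2) |- PT (fun a => ?F _ _) => apply: (PT_app2 h)
  | h : PT (fun p => ?F p.1.1 p.1.2 p.2) |- PT (fun a => ?F _ _ _) => apply: (PT_app3 h)
  end.
Ltac pt := repeat pt1.

Fixpoint eqt (x t : tree) : bool :=
  match x, t with
  | Leaf, Leaf => true | Node a b, Node c d => eqt a c && eqt b d | _, _ => false
  end.

Lemma eqtP x t : reflect (x = t) (eqt x t).
Proof.
apply: (iffP idP) => [|<-]; last by elim: x => //= a -> b ->.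
by elim: x t => [|a IHa b IHb] [|c d] //= /andP [/IHa -> /IHb ->].
Qed.

Lemma PT_eqt t : PT (fun x : tree => eqt x t).
Proof.
pose vw (x : tree) := if x is Node a b then Some (a, b) else None.
have hvw x : toT x = if vw x is Some y then toT y else Leaf by case: x.
elim: t => [|c IHc d IHd].
  apply: PT_ext (@PT_case tree _ _ _ bool _ _ _ _ _ id vw (fun=> true) (fun=> false) hvw
    PT_id (PT_const _) (PT_const _)).
  by case.
have hg : PT (fun p : (tree * tree) * tree => eqt p.1.1 c && eqt p.1.2 d).
  apply: PT_andb; first exact: (PT_comp (PT_fst PT_fst_) IHc).
  exact: (PT_comp (PT_snd PT_fst_) IHd).
apply: PT_ext (@PT_case tree _ _ _ bool _ _ _ _ _ id vw (fun=> false) _ hvw PT_id (PT_const _) hg).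
by case.
Qed.

(** A table lookup: the code of the argument is compared with the constant code of each element. The
    type may be astronomically large, as long as it is fixed before the input. *)
Lemma PT_finite (T : finType) {eT : enc T} B {eB : enc B} (f : T -> B) : PT f.
Proof.
case: (pickP (xpredT : pred T)) => [d _|h0]; last by exists Skip, 0 => a; have := h0 a.
have h l : PT (fun a : T => foldr (fun c r => if eqt (toT a) (toT c) then f c else r) (f d) l).
  elim: l => [|c l IH]; first exact: PT_const.
  apply: PT_if IH; last exact: PT_const.
  by apply: (PT_comp _ (PT_eqt (toT c))); exact: PT_cast.
apply: PT_ext (h (enum T)) => a; have : a \in enum T by rewrite mem_enum.
elim: (enum T) => // c l IH; rewrite inE /=; case: eqtP => [e _|ne].
  by congr f; apply: toT_inj.
by case/orP => [/eqP e|/IH //]; case: ne; rewrite e.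
Qed.

(** * Between raw bit strings and coded lists *)

Definition ReadL := While r3 (Match r1 Skip (Seq (Push r2 false) (Seq (Push r2 true) (Push r3 true)))
   (Seq (Push r2 true) (Seq (Push r2 true) (Push r3 true)))).
Definition BuildL := While r2 (Match r2 Skip (Seq (Push r1 false) (Push r1 true))
   (Seq (Push r1 false) (Seq (Push r1 false) (Seq (Push r1 true) (Push r1 true))))).
Definition ReadP := Seq (Push r3 true) (Seq ReadL (Seq (Push r1 false) BuildL)).

Lemma ReadL_run x v : exists2 n, n <= 6 * size x + 3 &
  exec ReadL (x, v, [:: true]) ([::], toks x v, [::]) n.
Proof.
elim: x v => [|b x IH] v.
  exists (1 + 1).+1 => //; apply: (@exec_loop r3 _ _ ([::], v, [::])) => //.
    by apply: exec_match => /=; exact: exec_skip.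
  exact: exec_stop.
have [n hn h] := IH (true :: b :: v).
exists (4 + n).+1; first by rewrite /=; lia.
apply: (@exec_loop r3 _ _ (x, true :: b :: v, [:: true])) => //.
by apply: exec_match => /=; case: b {h}; do 2 apply: push_seq; exact: exec_push.
Qed.

Lemma BuildL_run x l : exists2 n, n <= 6 * size x + 1 &
  exec BuildL (tb (toT (l : str)), toks x [::], [::]) (tb (toT (x ++ l)), [::], [::]) n.
Proof.
elim/last_ind: x l => [|x b IH] l; first by exists 1 => //; exact: exec_stop.
have [n hn h] := IH (b :: l).
exists ((if b then 5 else 3) + n).+1; first by rewrite size_rcons; case: (b); lia.
rewrite -cats1 toks_cat -catA.
apply: (@exec_loop r2 _ _ (tb (toT (b :: l)), toks x [::], [::])) => //.
case: b {h}; apply: exec_match; rewrite /=; by do ?apply: push_seq; exact: exec_push.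
Qed.

Lemma ReadP_run x : exists2 n, n <= 12 * size x + 6 &
  exec ReadP (rev x, [::], [::]) (tb (toT (rev x)), [::], [::]) n.
Proof.
have [n hn h] := ReadL_run (rev x) [::]; have [n' hn' h'] := BuildL_run (rev x) [::].
rewrite size_rev in hn hn'.
exists (n + n'.+1).+1; first lia.
apply: push_seq; apply: exec_seq h _; apply: push_seq.
by rewrite cats0 in h'.
Qed.

Definition WriteL := While r1 (Match r1 Skip (Seq (Push r2 false) (Push r2 true))
   (Seq (Match r1 Skip Skip Skip) (Seq (Match r1 Skip Skip Skip) (Seq (Push r2 true) (Push r2 true))))).
Definition WriteP := Seq (Push r2 false) (Seq WriteL RestP).

Lemma WriteL_run (y : str) v w : exists2 n, n <= 6 * size y + 1 &
  exec WriteL (tb (toT y), v, w) ([::], toks y v, w) n.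
Proof.
elim: y v => [|b y IH] v; first by exists 1 => //; exact: exec_stop.
have [n hn h] := IH (true :: b :: v).
exists ((if b then 5 else 3) + n).+1; first by rewrite /=; case: (b); lia.
apply: (@exec_loop r1 _ _ (tb (toT y), true :: b :: v, w)) => //.
case: b {h}; apply: exec_match => /=; last by apply: push_seq; exact: exec_push.
apply: (@exec_seq _ _ _ (false :: tb (seqT y), v, w) _ 1 3).
  by apply: exec_match; exact: exec_skip.
apply: (@exec_seq _ _ _ (tb (seqT y), v, w) _ 1 2).
  by apply: exec_match; exact: exec_skip.
by apply: push_seq; exact: exec_push.
Qed.

Lemma size_bool_esz (x : str) : size x < esz x <= 4 * size x + 1.
Proof.
elim: x => // b x IH; rewrite esz_cons /=.
have : esz b <= 3 by case: b.
have := esz_gt0 b; lia.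
Qed.

Theorem PT_PolyTime (f : str -> str) : PT f -> PolyTime f.
Proof.
move=> hf.
(* The reader delivers the code of [rev x], and the final stack must hold the output reversed. *)
have hg : PT (fun z : str => rev (f (rev z))).
  by apply: PT_rev; apply: (PT_comp _ hf); apply: PT_rev; exact: PT_id.
case: (PT_eszk hg) => ke hke; case: hg => p [k hp].
have [M hM] := prog_TM (Seq ReadP (Seq p WriteP)).
pose T n := (12 * n + 6) + (pb k (4 * n + 1) + ((6 * pb ke (4 * n + 1) + 1) + (1 + 3 * pb ke (4 * n + 1))).+1).
have [|K hK] := @polyb_poly_bound (fun n => (T n).*2 * (4 * (n + T n) + 12)).
  have hT : polyb T.
    rewrite /T; apply: polyb_add; first by poly.
    apply: polyb_add; first by poly.
    by apply: (@polyb_le _ (fun n => 1 + ((6 * pb ke (4 * n + 1) + 1) + (1 + 3 * pb ke (4 * n + 1)))));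
      [move=> n; lia | poly].
  apply: (@polyb_le _ (fun n => 2 * T n * (4 * (n + T n) + 12))); first by move=> n; lia.
  case: hT => kT hkT; apply: (@polyb_le _ (fun n => 2 * pb kT n * (4 * (n + pb kT n) + 12))); last by poly.
  by move=> n; have := hkT n; move: (T n) (pb kT n) => u v huv; nia.
exists M, K => x.
have [n1 hn1 h1] := ReadP_run x.
have [n2 hn2 h2] := hp (rev x) [::] [::] [::].
rewrite !cats0 revK in h2.
have [n3 hn3 h3] := WriteL_run (rev (f x)) [:: false] [::].
have hx : esz (rev x) <= 4 * size x + 1.
  by have /andP [_] := size_bool_esz (rev x); rewrite size_rev.
have hfx : size (rev (f x)) <= pb ke (4 * size x + 1).
  have := hke (rev x); rewrite revK => h.
  apply: leq_trans (leq_trans h (leq_pb (leqnn ke) hx)).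
  by have /andP [/ltnW] := size_bool_esz (rev (f x)).
have h4 := RestP_run (rev (f x)) [::] [::] [::].
have hE : exec (Seq ReadP (Seq p WriteP)) (rev x, [::], [::]) (rev (f x), [::], [::])
   (n1 + (n2 + (n3 + (1 + 3 * size (rev (f x)))).+1)).
  apply: exec_seq h1 _; apply: exec_seq h2 _; apply: push_seq.
  apply: exec_seq h3 _; move: h4; by rewrite cats0.
have [t [ht hh ho]] := hM _ _ _ _ _ hE.
exists t; split => //; apply: leq_trans ht (leq_trans _ (hK _)).
have hn2' := leq_trans hn2 (leq_pb (leqnn k) hx).
have hle : n1 + (n2 + (n3 + (1 + 3 * size (rev (f x)))).+1) <= T (size x).
  by rewrite /T; lia.
move: (n1 + _) hle => m hm; nia.
Qed.

#[export] Instance enc_ob : enc (option bool) := enc_fin (option bool).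
#[export] Instance enc_Q (M : TM) : enc (tm_Q M) := enc_fin (tm_Q M).
#[export] Instance enc_config (M : TM) : enc (config M) :=
  @enc_pair _ _ (@enc_pair _ _ (@enc_pair _ _ (enc_Q M) _) _) _.

Lemma PT_step (M : TM) : PT (@step M).
Proof.
pose dl (c : config M) := @tm_delta M c.1.1.1 c.1.2.
have hq : PT (@tm_halt M) by exact: PT_finite.
have hd : PT (fun p : tm_Q M * option bool => @tm_delta M p.1 p.2) by exact: PT_finite.
have hdl : PT dl by rewrite /dl; pt.
apply: (@PT_ext _ _ _ _ (fun c : config M => if @tm_halt M c.1.1.1 then c else
  if (dl c).2 then ((dl c).1.1, (dl c).1.2 :: c.1.1.2, head None c.2, behead c.2)
  else ((dl c).1.1, behead c.1.1.2, head None c.1.1.2, (dl c).1.2 :: c.2))); last by pt.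
move=> [[[q l] a] r]; rewrite /dl /=; case: (tm_halt q) => //.
by case: (tm_delta q a) => [[q' b] []] /=; [case: r | case: l].
Qed.

Lemma PT_init (M : TM) : PT (init_config M).
Proof.
have h : PT (@Some bool) by exact: PT_finite.
apply: (@PT_ext _ _ _ _ (fun x => (@tm_start M, [::], head None (map Some x), behead (map Some x)) : config M)); last by pt.
by case.
Qed.

Lemma PT_read_out : PT read_out.
Proof.
pose f (p : seq (option bool) * ((bool * str) * option bool)) : bool * str :=
  if p.2.1.1 || ~~ isSome p.2.2 then (true, p.2.1.2) else (false, odflt false p.2.2 :: p.2.1.2).
have hf : PT f.
  have h1 : PT (@isSome bool) by exact: PT_finite.
  have h2 : PT (odflt false) by exact: PT_finite.
  by rewrite /f; pt.
have h : PT (fun s : seq (option bool) => foldl (fun t e => f (s, (t, e))) (false, [::]) s).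
  apply: PT_foldl_add => //; [exact: PT_id | exact: PT_const |].
  exists 3 => a [d s] e; rewrite /f /=.
  have h2 : 8 <= pb 3 (esz a + esz e).
    by apply: (@leq_trans (2 ^ 3)) => //; rewrite /pb leq_exp2r //; lia.
  case: ifP => _; rewrite !esz_pair ?esz_cons.
    by have : esz true = 3 by []; have := esz_gt0 d; lia.
  have : esz (odflt false e) <= 3 by case: e {h2} => [[]|].
  by have := esz_gt0 d; have : esz false = 1 by []; lia.
apply: PT_ext (PT_rev (PT_snd h)) => s.
suff H d acc (s0 : seq (option bool)) : rev (foldl (fun t e => f (s, (t, e))) (d, acc) s0).2 =
   rev acc ++ (if d then [::] else read_out s0) by rewrite H.
elim: s0 d acc => [|e s0 IH] d acc /=; first by case: d; rewrite cats0.
rewrite /f /=; case: d => /=; first by rewrite IH.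
by case: e => [b|] /=; rewrite IH //= rev_cons cat_rcons.
Qed.

Lemma esz_fin (T : finType) (x : T) : @esz T (enc_fin T) x = (enum_rank x).*2.+1.
Proof. exact: (esz_nat (enum_rank x)). Qed.

Lemma config_space (M : TM) (c : config M) : esz c <= 2 * #|tm_Q M| + 20 + 8 * cfg_space c.
Proof.
have hs (s : seq (option bool)) : esz s <= 1 + 8 * size s.
  elim: s => // a s IH; rewrite esz_cons /=.
  have h7 : esz a <= 7; last by lia.
  by rewrite esz_fin; have := ltn_ord (enum_rank a); rewrite {2}card_option card_bool; lia.
case: c => [[[q l] a] r]; rewrite !esz_pair /=.
have := hs l; have := hs r; have := hs [:: a]; rewrite esz_cons /=.
have : esz q <= 2 * #|tm_Q M| + 1.
  by rewrite esz_fin -addn1 leq_add2r -mul2n leq_mul2l /= ltnW // ltn_ord.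
have : esz ([::] : seq (option bool)) = 1 by [].
rewrite /=; lia.
Qed.

Lemma space_step (M : TM) (c : config M) : cfg_space (step c) <= (cfg_space c).+1.
Proof.
case: c => [[[q l] a] r] /=; case: (tm_halt q) => /=; first lia.
case: (tm_delta q a) => [[q' b] []]; first by case: r => [|? ?] /=; lia.
by case: l => [|? ?] /=; lia.
Qed.

Lemma space_init (M : TM) x : cfg_space (init_config M x) <= (size x).+1.
Proof. by case: x => //= b x; rewrite size_map; lia. Qed.

Lemma run_halted (M : TM) x t n : @tm_halt M (cfg_state (run M t x)) -> t <= n ->
  run M n x = run M t x.
Proof.
move=> h /subnKC <-; elim: (n - t) => [|k IH]; first by rewrite addn0.
have -> : run M (t + k.+1) x = step (run M (t + k) x) by rewrite addnS.
by rewrite IH; move: h; rewrite /cfg_state; case: (run M t x) => [[[q l] a] r] /= ->.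
Qed.

Lemma PT_poly_bound A `{enc A} (f : A -> nat) k : PT f -> PT (fun a => poly_bound k (f a)).
Proof. by move=> hf; apply: PT_add; [exact: PT_exp | exact: PT_const]. Qed.

(** The machine is iterated for the whole time bound; a halted configuration is a fixed point of
    [step], so overshooting the halting time does no harm. One step adds at most one cell, which
    bounds the iterates. *)
Theorem PolyTime_PT (f : str -> str) : PolyTime f -> PT f.
Proof.
move=> [M [k hM]].
have h : PT (fun x : str => iter (poly_bound k (size x)) (@step M) (init_config M x)).
  apply: PT_iter.
  - by apply: PT_poly_bound; apply: PT_size; exact: PT_id.
  - exact: PT_init.
  - exact: PT_step.
  - have [k' hk'] : polyb (fun n => 2 * #|tm_Q M| + 20 + 8 * (n + 1 + (pb k n + k))) by poly.
    exists k' => x i hi; apply: leq_trans (hk' _).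
    apply: leq_trans (config_space _) _.
    rewrite leq_add2l leq_mul2l /=.
    have : cfg_space (iter i (@step M) (init_config M x)) <= (size x).+1 + i.
      elim: i {hi} => [|i IH]; first by rewrite addn0; exact: space_init.
      by rewrite iterS; apply: leq_trans (space_step _) _; lia.
    have /andP [/ltnW hx _] := size_bool_esz x.
    have hp : poly_bound k (size x) <= pb k (esz x) + k; last by lia.
    by rewrite /poly_bound leq_add2r /pb; case: (k) => // k1; rewrite leq_exp2r //; lia.
have ho : PT (@cfg_output M).
  apply: PT_ext (PT_comp (PT_cons (PT_snd PT_fst_) PT_snd_) PT_read_out : PT (fun c : config M => read_out (c.1.2 :: c.2))).
  by move=> [[[q l] a] r].
apply: PT_ext (PT_comp h ho) => x.
have [t [ht [hh <-]]] := hM x.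
by rewrite -/(run M _ x) (run_halted hh ht).
Qed.

(* A space-bounded iteration of a polynomial-time map may run for exponentially many rounds. *)
Theorem PSPACE_loop S `{enc S} (s0 : str -> S) (g : S -> S) (stop acc : S -> bool)
    (L : str -> Prop) :
  PT s0 -> PT g -> PT stop -> PT acc ->
  (forall s, stop s -> g s = s) ->
  (exists k, forall x, exists T, [/\ stop (iter T g (s0 x)),
     forall i, i <= T -> esz (iter i g (s0 x)) <= pb k (esz x)
     & acc (iter T g (s0 x)) <-> L x]) ->
  inPSPACE L.
Proof.
move=> hs0 hg hstop hacc gstop [k hk].
have hs0' : PT (fun z : str => s0 (rev z)) by apply: (PT_comp _ hs0); exact: PT_rev PT_id.
case: hs0' => [p0 [k0 hp0]].
case: hg => [pg [kg hpg]]; case: (PT_pair hstop PT_id) => [ps [ks hps]].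
case: hacc => [pa [ka hpa]].
(* The body computes [(stop s, s)] and strips the tags. A one is put on the second stack only when
   [stop] fails, and this symbol drives the outer loop. *)
pose body := Seq ps (Match r1 Skip Skip (Match r1 Skip (Seq pg (Push r2 true))
   (Seq (Match r1 Skip Skip Skip) (Match r1 Skip Skip Skip)))).
pose W := While r2 body.
have [M hM] := prog_TM_decide (Seq ReadP (Seq p0 (Seq (Push r2 true) (Seq W pa)))).
pose mm n := 20 * n + 20 + (pb k0 n + (2 * pb k n + (pb kg (pb k n) + (pb ks (pb k n) + pb ka (pb k n))))).
have hmm : polyb mm by rewrite /mm; poly.
have [K hK] : exists K, forall n, ((mm (4 * n + 1)).*2 + 8).*2.+1 <= poly_bound K n.
  apply: polyb_poly_bound; case: hmm => km hkm.
  apply: (@polyb_le _ (fun n => 4 * pb km (4 * n + 1) + 17)); last by poly.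
  by move=> n; have := hkm (4 * n + 1); lia.
exists M, K => x; have [T0 [hT0 hsz0 hL0]] := hk x.
(* The loop ends at the first state satisfying [stop], so [T0] is replaced by the least such time;
   by [gstop] the state there is the same. *)
have [T [hT hmin hsz hL]] : exists T, [/\ stop (iter T g (s0 x)),
     forall i, i < T -> ~~ stop (iter i g (s0 x)),
     forall i, i <= T -> esz (iter i g (s0 x)) <= pb k (esz x)
     & acc (iter T g (s0 x)) <-> L x].
  have ex : exists i, stop (iter i g (s0 x)) by exists T0.
  case: (ex_minnP ex) => T hT hmin; exists T; split => //.
  - by move=> i; apply: contraL => /hmin; rewrite -leqNgt.
  - by move=> i hi; apply: hsz0; apply: leq_trans hi (hmin _ hT0).
  - have <- : iter T0 g (s0 x) = iter T g (s0 x); last by [].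
    rewrite -(subnK (hmin _ hT0)) iterD.
    by elim: (T0 - T) => //= j ->; exact: gstop.
have hx : esz (rev x) <= 4 * size x + 1.
  by have /andP [_] := size_bool_esz (rev x); rewrite size_rev.
have hx2 : esz x <= 4 * size x + 1 by have /andP [_] := size_bool_esz x.
have hx1 : size x <= esz x by have /andP [/ltnW] := size_bool_esz x.
set N := 4 * size x + 1 in hx hx2 *.
set m := mm N.
have hmk : pb k (esz x) <= pb k N by exact: leq_pb.
have sz i : i <= T -> esz (iter i g (s0 x)) <= pb k N.
  by move=> hi; exact: leq_trans (hsz i hi) hmk.
have hW i : i <= T -> exists n,
   sexec m W (tb (toT (iter (T - i) g (s0 x))), [:: true], [::]) (tb (toT (iter T g (s0 x))), [::], [::]) n.
  elim: i => [|i IH] hi.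
    rewrite subn0; set s := iter T g (s0 x).
    have [n1 hn1 h1] := hps s [::] [::] [::]; rewrite !cats0 hT in h1.
    have hb : exec body (tb (toT s), [::], [::]) (tb (toT s), [::], [::]) (n1 + 4).
      apply: exec_seq h1 _; apply: exec_match => /=; apply: exec_match => /=.
      apply: (@exec_seq _ _ _ (false :: tb (toT s), [::], [::]) _ 1 1); by apply: exec_match; exact: exec_skip.
    have hs := sz T (leqnn T); rewrite -/s in hs.
    have hn1' := leq_trans hn1 (leq_pb (leqnn ks) hs).
    exists ((n1 + 4) + 1).+1.
    apply: (@sexec_loop m r2 body _ (tb (toT s), [::], [::])) => //.
    - by rewrite /= -/(esz s) /m /mm; lia.
    - by apply: (exec_sexec hb); rewrite /= -/(esz s) /m /mm; lia.
    - by apply: sexec_stop => //=; rewrite -/(esz s) /m /mm; lia.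
  have [n IHn] := IH (ltnW hi).
  have eT : T - i = (T - i.+1).+1 by lia.
  rewrite eT iterS in IHn; set s := iter (T - i.+1) g (s0 x) in IHn *.
  have hns : stop s = false by apply/negbTE; apply: hmin; lia.
  have [n1 hn1 h1] := hps s [::] [::] [::]; rewrite !cats0 hns in h1.
  have [n2 hn2 h2] := hpg s [::] [::] [::]; rewrite !cats0 in h2.
  have hb : exec body (tb (toT s), [::], [::]) (tb (toT (g s)), [:: true], [::]) (n1 + (n2 + 1).+2).
    apply: exec_seq h1 _; apply: exec_match => /=; apply: exec_match => /=.
    by apply: exec_seq h2 _; exact: exec_push.
  have hs : esz s <= pb k N by apply: sz; lia.
  have hn1' := leq_trans hn1 (leq_pb (leqnn ks) hs).
  have hn2' := leq_trans hn2 (leq_pb (leqnn kg) hs).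
  exists ((n1 + (n2 + 1).+2) + n).+1.
  apply: (@sexec_loop m r2 body _ (tb (toT (g s)), [:: true], [::])) => //.
  - by rewrite /= -/(esz s) /m /mm; lia.
  - by apply: (exec_sexec hb); rewrite /= -/(esz s) /m /mm; lia.
have [n1 hn1 h1] := ReadP_run x.
have [n2 hn2 h2] := hp0 (rev x) [::] [::] [::]; rewrite !cats0 revK in h2.
have [n3 h3] := hW T (leqnn T); rewrite subnn /= in h3.
have [n4 hn4 h4] := hpa (iter T g (s0 x)) [::] [::] [::]; rewrite !cats0 in h4.
have hn2' := leq_trans hn2 (leq_pb (leqnn k0) hx).
have hn4' := leq_trans hn4 (leq_pb (leqnn ka) (sz T (leqnn T))).
have sT := sz T (leqnn T); have s00 := sz 0 (leq0n T).
have [b [l eb]] : exists b l, tb (toT (acc (iter T g (s0 x)))) = b :: l /\ b = acc (iter T g (s0 x)).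
  by case: (acc _) => /=; [exists true, [:: false; false] | exists false, [::]].
case: eb => el eb; rewrite el in h4.
have hfin : sexec m (Seq ReadP (Seq p0 (Seq (Push r2 true) (Seq W pa)))) (rev x, [::], [::]) (b :: l, [::], [::])
   (n1 + (n2 + (1 + (n3 + n4)))).
  apply: sexec_seq.
    by apply: (exec_sexec h1); rewrite /= size_rev /m /mm /N; lia.
  apply: sexec_seq.
    have e : tot (tb (toT (rev x)), [::], [::]) = esz (rev x) by rewrite /= !addn0.
    by apply: (exec_sexec h2); rewrite e /m /mm; move: hx hn2'; lia.
  apply: (@sexec_seq m _ _ _ (tb (toT (s0 x)), [:: true], [::])).
    apply: (@sexec_push m (tb (toT (s0 x)), [::], [::]) r2 true); rewrite /= -/(esz (s0 x)) /m /mm.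
    by move: s00; rewrite /=; lia.
  apply: sexec_seq h3 _.
  by apply: (exec_sexec h4); rewrite /= -/(esz (iter T g (s0 x))) /m /mm; lia.
have [|t [ht1 ht2 ht3]] := hM x b l [::] [::] _ m _ hfin; first by rewrite /m /mm /N; lia.
exists t; split => //; split; last by rewrite ht3 eb.
by move=> t' /ht2 h; exact: leq_trans h (hK _).
Qed.

Lemma PT_fin A `{enc A} (T : finType) `{enc T} B `{enc B} (f : A -> T) (F : T -> B) :
  PT f -> PT (fun a => F (f a)).
Proof. by move=> hf; apply: (PT_comp hf); exact: PT_finite. Qed.

(** The function is assembled by overwriting one argument after another; each overwriting is a map
    between fixed finite types. *)
Lemma PT_ffun A `{enc A} (I T : finType) (eF : enc {ffun I -> T}) (eT : enc T) (f : A -> I -> T) :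
  (forall i, PT (fun a => f a i)) -> PT (fun a => [ffun i => f a i]).
Proof.
move=> hf; case: (pickP (fun _ : I => true)) => [i0 _|hI]; last first.
  case: (pickP (fun _ : {ffun I -> T} => true)) => [g _|hF].
    apply: (@PT_ext _ _ _ _ (fun=> g)); last exact: PT_const.
    by move=> a; apply/ffunP => i; have := hI i.
  have h (a : A) : False by have := hF [ffun i => f a i].
  have e : (fun a : A => [ffun i => f a i]) = (fun a : A => False_rect _ (h a)).
    by apply: functional_extensionality => a; case: (h a).
  by rewrite e; exists Skip, 0 => a; case: (h a).
suff h (l : seq I) : exists g : A -> {ffun I -> T}, @PT A {ffun I -> T} H eF g /\ forall a i, i \in l -> g a i = f a i.
  have [g [hg hgf]] := h (enum I); apply: PT_ext hg => a.
  by apply/ffunP => i; rewrite ffunE hgf // mem_enum.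
elim: l => [|i l [g [hg hgf]]].
  exists (fun a => [ffun=> f a i0]); split => //.
  exact: (PT_comp (hf i0) (PT_finite (fun t => [ffun=> t] : {ffun I -> T}))).
exists (fun a => [ffun j => if j == i then f a i else g a j]); split.
  have hF : @PT _ _ (@enc_pair _ _ eT eF) eF (fun p : T * {ffun I -> T} => [ffun j => if j == i then p.1 else p.2 j]).
    exact: (@PT_finite (T * {ffun I -> T})%type).
  exact: (PT_comp (PT_pair (hf i) hg) hF).
move=> a j; rewrite inE ffunE => /orP [/eqP ->|hj]; first by rewrite eqxx.
by case: eqP => [->|_] //; exact: hgf.
Qed.

Lemma PT_forall A `{enc A} (I : finType) (P : A -> pred I) :
  (forall i, PT (fun a => P a i)) -> PT (fun a => [forall i, P a i]).
Proof.
move=> hP; pose eF := enc_fin {ffun I -> bool}.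
apply: PT_ext (PT_comp (PT_ffun eF hP) (@PT_finite _ eF _ _ (fun g : {ffun I -> bool} => [forall i, g i]))) => a.
by apply: eq_forallb => i; rewrite ffunE.
Qed.

Lemma PT_enum_map A `{enc A} (T : Type) B `{enc B} (l : seq T) (f : A -> T -> B) :
  (forall t, PT (fun a => f a t)) -> PT (fun a => [seq f a t | t <- l]).
Proof. by move=> hf; elim: l => [|t l IH] /=; [exact: PT_const | exact: PT_cons]. Qed.

Lemma PT_index {A} `{enc A} (f : A -> nat) (l : A -> seq nat) : PT f -> PT l ->
  PT (fun a => index (f a) (l a)).
Proof.
move=> hf hl; apply: (@PT_ext _ _ _ _ (fun a => find (fun b => b) [seq x == f a | x <- l a])).
  by move=> a; rewrite find_map.
have h : PT (fun l : str => find (fun b => b) l).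
  apply: (@PT_ext _ _ _ _ (fun l : str => size [seq i <- iota 0 (size l) | ~~ has id (take i.+1 l)])).
    move=> s; rewrite size_filter; elim: s => //= b s IH.
    rewrite take0 /= orbF; case: b => /=.
      by rewrite add0n; elim: (iota 1 _) => //= i r ->.
    rewrite -IH -[1]/(1 + 0) iotaDl count_map; congr (_ + _); apply: eq_count => i.
  have hh : PT (fun s : str => has id s).
    apply: (@PT_ext _ _ _ _ (fun s : str => 0 < size [seq b <- s | b])); last by pt.
    by move=> s; rewrite size_filter -has_count.
  by pt.
by pt.
Qed.

Ltac pt_hook ::= match goal with |- PT (fun a => index _ _) => apply: PT_index end.

Lemma PT_nat_fin B `{enc B} (F : nat -> B) (K : nat) (d : B) : (forall n, K <= n -> F n = d) -> PT F.
Proof.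
move=> hF; apply: (@PT_ext _ _ _ _ (fun n => nth d [seq F i | i <- iota 0 K] n)); last by pt.
move=> n; case: (ltnP n K) => hn; first by rewrite (nth_map 0) ?size_iota // nth_iota.
by rewrite nth_default ?hF // size_map size_iota.
Qed.

Lemma PT_mktuple A `{enc A} n (T : finType) (eF : enc (n.-tuple T)) (eT : enc T) (f : A -> 'I_n -> T) :
  (forall i, PT (fun a => f a i)) -> PT (fun a => [tuple f a i | i < n]).
Proof.
move=> hf; pose e2 := enc_fin {ffun 'I_n -> T}.
apply: PT_ext (PT_comp (PT_ffun e2 hf) (@PT_finite _ e2 _ _ (fun g : {ffun 'I_n -> T} => [tuple g i | i < n]))) => a.
by apply: eq_from_tnth => i; rewrite !tnth_mktuple ffunE.
Qed.

(** * Expander graphs *)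

Lemma eqW (x y : rat) : x = y -> (x <= y)%R. Proof. by move->. Qed.

Lemma sum_pair (A B : finType) (F : A * B -> rat) :
  (\sum_p F p = \sum_a \sum_b F (a, b))%R.
Proof. by rewrite pair_bigA; apply: eq_bigr; case. Qed.

Section Inner.
Local Open Scope ring_scope.
Variable V : finType.
Implicit Types f g h : V -> rat.

Definition ip f g : rat := \sum_v f v * g v.
Definition nrm f : rat := ip f f.

Lemma ipC f g : ip f g = ip g f.
Proof. by apply: eq_bigr => v _; rewrite mulrC. Qed.

Lemma ipDl f g h : ip (fun v => f v + g v) h = ip f h + ip g h.
Proof. by rewrite -big_split; apply: eq_bigr => v _; rewrite mulrDl. Qed.

Lemma ipZl c f h : ip (fun v => c * f v) h = c * ip f h.
Proof. by rewrite /ip mulr_sumr; apply: eq_bigr => v _; rewrite mulrA. Qed.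

Lemma eq_ip f f' g g' : f =1 f' -> g =1 g' -> ip f g = ip f' g'.
Proof. by move=> e e'; apply: eq_bigr => v _; rewrite e e'. Qed.

Lemma ipDD f g f' g' : ip (fun v => f v + g v) (fun v => f' v + g' v) =
  ip f f' + ip f g' + ip g f' + ip g g'.
Proof.
rewrite /ip -!big_split; apply: eq_bigr => v _ /=; ring.
Qed.

Lemma nrm_ge0 f : 0 <= nrm f.
Proof. by apply: sumr_ge0 => v _; rewrite -expr2 sqr_ge0. Qed.

(** Expand the norm of [c f - s g] for [s = 1] and [s = -1] and divide by [c]. *)
Lemma ip_young c f g : 0 < c -> 2 * `|ip f g| <= c * nrm f + nrm g / c.
Proof.
move=> c0.
have key s : s ^+ 2 = 1 -> 2 * (s * ip f g) <= c * nrm f + nrm g / c.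
  move=> hs.
  have : 0 <= nrm (fun v => c * f v - s * g v) / c by rewrite divr_ge0 ?nrm_ge0 ?ltW.
  have -> : nrm (fun v => c * f v - s * g v) = c ^+ 2 * nrm f - 2 * c * (s * ip f g) + nrm g.
    rewrite /nrm /ip !mulr_sumr -sumrB -big_split; apply: eq_bigr => v _ /=.
    have : s * s = 1 by rewrite -expr2.
    move: (f v) (g v) => a b e; transitivity (c ^+ 2 * (a * a) - 2 * c * (s * (a * b)) + (s * s) * (b * b)); first by ring.
    by rewrite e; ring.
  move=> h; have e : (c ^+ 2 * nrm f - 2 * c * (s * ip f g) + nrm g) / c
     = c * nrm f - 2 * (s * ip f g) + nrm g / c by field; rewrite gt_eqF.
  by move: h; rewrite e; lra.
have h1 := key 1 (expr1n _ _); have h2 := key (-1) (sqrrN 1 : (-1) ^+ 2 = 1 ^+ 2 :> rat).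
by case: (lerP 0 (ip f g)) => h; [rewrite ger0_norm | rewrite ltr0_norm] => //; lra.
Qed.

End Inner.

Section Rot.
Local Open Scope ring_scope.
Variables (V L : finType) (rot : V * L -> V * L).
Hypothesis rotK : involutive rot.
Hypothesis L0 : (0 < #|L|)%N.
Implicit Types f g : V -> rat.

Definition nb v l := (rot (v, l)).1.
Definition avg f v : rat := #|L|%:R^-1 * \sum_l f (nb v l).

(** The rotation map permutes the half-edges and is its own inverse, hence averaging over neighbours
    is a symmetric operator. *)
Lemma avg_sa f g : ip (avg f) g = ip f (avg g).
Proof.
have e f' g' : ip (avg f') g' = #|L|%:R^-1 * \sum_(p : V * L) f' (rot p).1 * g' p.1.
  rewrite /ip sum_pair mulr_sumr.
  by apply: eq_bigr => v _; rewrite /avg -mulrA mulr_suml.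
rewrite e ipC e (reindex_inj (inv_inj rotK)); congr (_ * _).
by apply: eq_bigr => p _; rewrite rotK mulrC.
Qed.

Lemma avg_sum f : \sum_v avg f v = \sum_v f v.
Proof.
have h := avg_sa f (fun=> 1).
have e1 g : ip g (fun=> 1) = \sum_v g v by apply: eq_bigr => v _; rewrite mulr1.
rewrite -e1 h -e1; apply: eq_ip => // v.
rewrite /avg sumr_const -[X in X *+ _]/(1 : rat) mulVf //.
by rewrite pnatr_eq0 -lt0n.
Qed.

Lemma avg_add f g v : avg (fun v => f v + g v) v = avg f v + avg g v.
Proof. by rewrite /avg big_split mulrDr. Qed.

Lemma avg_scale c f v : avg (fun v => c * f v) v = c * avg f v.
Proof. by rewrite /avg -mulr_sumr mulrCA. Qed.

Definition spec (lam : rat) :=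
  forall f, \sum_v f v = 0 -> `|ip f (avg f)| <= lam * nrm f.

(** Polarisation: the bound on the quadratic form is used at [f + t g] and [f - t g], where [g] is
    the average of [f], and the two are subtracted; [t = 1 / lam] gives the operator norm. *)
Lemma spec_norm lam f : 0 < lam -> spec lam -> \sum_v f v = 0 ->
  nrm (avg f) <= lam ^+ 2 * nrm f.
Proof.
move=> l0 hs hf; set g := avg f.
have hg : \sum_v g v = 0 by rewrite avg_sum.
have hq t : 4 * t * nrm g <= lam * (2 * nrm f + 2 * (t ^+ 2 * nrm g)).
  pose p s v := f v + s * g v.
  have sp s : \sum_v p s v = 0 by rewrite big_split /= -mulr_sumr hf hg mulr0 addr0.
  have eQ s : ip (p s) (avg (p s)) = ip f g + s * (2 * nrm g) + s ^+ 2 * ip g (avg g).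
    rewrite (_ : ip (p s) (avg (p s)) = ip (p s) (fun v => g v + s * avg g v)); last first.
      by apply: eq_ip => // v; rewrite /p avg_add avg_scale.
    rewrite ipDl ipZl ipC ipDl ipZl [ip g (fun v => g v + _)]ipC ipDl ipZl.
    have -> : ip (avg g) f = nrm g by rewrite avg_sa /nrm -/g; apply: eq_ip.
    by rewrite [ip (avg g) g]ipC (ipC g f) -/(nrm g); ring.
  have eN s : nrm (p s) = nrm f + s * (2 * ip f g) + s ^+ 2 * nrm g.
    rewrite /nrm ipDl ipZl ipC ipDl ipZl [ip g (fun v => f v + _)]ipC ipDl ipZl (ipC g f); ring.
  have := hs _ (sp t); have := hs _ (sp (- t)); rewrite !eQ !eN !ler_norml.
  move=> /andP [h1 h2] /andP [h3 h4]; rewrite sqrrN in h1 h2; lra.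
have := hq lam^-1.
have e1 : lam^-1 ^+ 2 * nrm g = lam^-1 * (lam^-1 * nrm g) by rewrite expr2 mulrA.
rewrite e1 => h; have h' : nrm g * lam^-1 <= lam * nrm f.
  have e2 : lam * (2 * nrm f + 2 * (lam^-1 * (lam^-1 * nrm g))) = 2 * (lam * nrm f) + 2 * (lam^-1 * nrm g).
    by field; rewrite gt_eqF.
  by move: h; rewrite e2; lra.
by move: h'; rewrite -ler_pdivlMr ?invr_gt0 // invrK expr2; rewrite mulrAC mulrC mulrA.
Qed.

(** With [c] the mean of [f] and [g = f - c], the sum over the edges is [2 d (nrm g - ip g (avg g))]
    for degree [d], and the spectral bound 1/2 leaves [d * nrm g]. In this form the expansion
    survives merging of vertices. *)
Lemma spec_gap f : spec (1 / 2) ->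
  exists c, #|L|%:R * (\sum_v (f v - c) ^+ 2) <= \sum_v \sum_l (f v - f (nb v l)) ^+ 2.
Proof.
move=> hs; pose c := #|V|%:R^-1 * \sum_v f v; exists c; pose g v := f v - c.
have hg : \sum_v g v = 0.
  rewrite big_split /= sumr_const /c.
  case: (posnP #|V|) => [V0|V0].
    by rewrite V0 mulr0n addr0 big1 // => v; have := card0_eq V0 v.
  rewrite mulNrn -[_ *+ #|xpredT|]mulr_natl (_ : #|xpredT| = #|V|) // mulrA divff ?mul1r ?subrr //.
  by rewrite pnatr_eq0 -lt0n.
have e : \sum_v \sum_l (f v - f (nb v l)) ^+ 2 = #|L|%:R * (2 * nrm g - 2 * ip g (avg g)).
  have -> : \sum_v \sum_l (f v - f (nb v l)) ^+ 2 =
     \sum_(p : V * L) (g p.1 ^+ 2 + g (rot p).1 ^+ 2 - 2 * (g p.1 * g (rot p).1)).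
    rewrite sum_pair.
    by apply: eq_bigr => v _; apply: eq_bigr => l _; rewrite /g /nb; ring.
  rewrite sumrB -mulr_sumr big_split /=.
  have -> : \sum_(p : V * L) g (rot p).1 ^+ 2 = \sum_(p : V * L) g p.1 ^+ 2.
    by rewrite [RHS](reindex_inj (inv_inj rotK)).
  have -> : \sum_(p : V * L) g p.1 ^+ 2 = #|L|%:R * nrm g.
    rewrite sum_pair /= /nrm /ip mulr_sumr.
    by apply: eq_bigr => v _; rewrite sumr_const mulr_natl expr2.
  have -> : \sum_(p : V * L) g p.1 * g (rot p).1 = #|L|%:R * ip g (avg g).
    rewrite sum_pair /= /ip mulr_sumr.
    apply: eq_bigr => v _; rewrite /avg -mulr_sumr mulrCA; congr (_ * _).
    by rewrite mulrA divff ?mul1r // pnatr_eq0 -lt0n.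
  by ring.
rewrite e ler_pM2l ?ltr0n //.
have := hs g hg; rewrite ler_norml => /andP [_ h].
have -> : \sum_v (f v - c) ^+ 2 = nrm g by apply: eq_bigr => v _; rewrite expr2.
by lra.
Qed.

End Rot.

(** * The zig-zag product *)

Section ZigZag.
Local Open Scope ring_scope.
Variables (V L : finType).
Let K := (L * L)%type.
Variables (rot : V * K -> V * K) (rotH : (K * K) * L -> (K * K) * L).
Hypotheses (rotK : involutive rot) (rotHK : involutive rotH) (L0 : (0 < #|L|)%N).

Definition rot2 (p : V * (K * K)) : V * (K * K) :=
  let '(v, (e1, e2)) := p in
  let '(v1, e1') := rot (v, e1) in
  let '(v2, e2') := rot (v1, e2) in (v2, (e2', e1')).

Lemma rot2K : involutive rot2.
Proof.
case=> v [e1 e2]; rewrite /rot2; case E1: (rot (v, e1)) => [v1 e1'].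
case E2: (rot (v1, e2)) => [v2 e2'].
have := rotK (v1, e2); rewrite E2 => ->.
by have := rotK (v, e1); rewrite E1 => ->.
Qed.

(** The square of [rot] has label set [K * K], the vertex set of [rotH]. The product again has label
    set [K = L * L], so the construction can be repeated with the same small graph. *)
Definition zz (p : (V * (K * K)) * K) : (V * (K * K)) * K :=
  let '((v, h), (a, b)) := p in
  let '(h1, a1) := rotH (h, a) in
  let '(v2, h2) := rot2 (v, h1) in
  let '(h3, b1) := rotH (h2, b) in ((v2, h3), (b1, a1)).

Lemma zzK : involutive zz.
Proof.
case=> [[v h] [a b]]; rewrite /zz; case E1: (rotH (h, a)) => [h1 a1].
case E2: (rot2 (v, h1)) => [v2 h2]; case E3: (rotH (h2, b)) => [h3 b1].
have := rotHK (h2, b); rewrite E3 => ->.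
have := rot2K (v, h1); rewrite E2 => ->.
by have := rotHK (h, a); rewrite E1 => ->.
Qed.

(** Split [f] into [P], constant on each cloud, and [O], of sum zero on each cloud. The middle step
    is a permutation of the vertices; on [P] it acts as the square of the large graph, and the small
    graph shrinks [O] by [lH]. Young's inequality with weight [1 / lH] turns the cross term into the
    summand [lH]. *)
Lemma zz_spec (lG lH : rat) : 0 < lG -> 0 < lH -> spec rot lG -> spec rotH lH ->
  spec zz (lG ^+ 2 + lH + lH ^+ 2).
Proof.
move=> lG0 lH0 hG hH f hf.
have K0 : (0 < #|{: K}|)%N by rewrite card_prod muln_gt0 L0.
have KK0 : (0 < #|{: K * K}|)%N by rewrite card_prod muln_gt0 K0.
have KKn0 : #|{: K * K}|%:R != 0 :> rat by rewrite pnatr_eq0 -lt0n.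
pose B (g : V * (K * K) -> rat) p := avg rotH (fun h => g (p.1, h)) p.2.
pose At (g : V * (K * K) -> rat) p := g (rot2 p).
pose pa v := #|{: K * K}|%:R^-1 * \sum_h f (v, h).
pose P (p : V * (K * K)) := pa p.1.
pose O p := f p - P p.
pose r := B O.
have Bsa g g' : ip (B g) g' = ip g (B g').
  rewrite /ip !sum_pair.
  apply: eq_bigr => v _; exact: (avg_sa rotHK (fun h => g (v, h)) (fun h => g' (v, h))).
have Asa g g' : ip (At g) g' = ip g (At g').
  rewrite /ip [RHS](reindex_inj (inv_inj rot2K)); apply: eq_bigr => p _.
  by rewrite /At rot2K.
have Anrm g : nrm (At g) = nrm g.
  by rewrite /nrm /ip [RHS](reindex_inj (inv_inj rot2K)).
have eZ p : avg zz f p = B (At (B f)) p.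
  case: p => v h; rewrite /avg /B /At /avg /nb /=.
  rewrite card_prod natrM invfM -mulrA; congr (_ * _).
  rewrite mulr_sumr sum_pair.
  apply: eq_bigr => a _; rewrite mulr_sumr; case: (rotH (h, a)) => [[e1 e2] a1] /=.
  case: (rot (v, e1)) => v1 e1' /=; case: (rot (v1, e2)) => v2 e2' /=.
  by apply: eq_bigr => b _; congr (_ * f _); case: (rotH _).
have eB p : B f p = P p + r p.
  rewrite /r /B (_ : avg rotH (fun h => f (p.1, h)) p.2 =
     avg rotH (fun h => P (p.1, h) + O (p.1, h)) p.2); last first.
    by rewrite /avg; congr (_ * _); apply: eq_bigr => l _; rewrite /O addrC subrK.
  rewrite avg_add; congr (_ + _); rewrite /avg /P /= sumr_const -[pa _ *+ _]mulr_natl mulrA.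
  by rewrite mulVf ?mul1r // pnatr_eq0 -lt0n.
have O0 v : \sum_h O (v, h) = 0.
  rewrite /O /P /= sumrB sumr_const -[pa _ *+ _]mulr_natl /pa mulrA divff // mul1r subrr //.
have orth : nrm f = nrm P + nrm O.
  have e : ip P O = 0.
    rewrite /ip sum_pair big1 // => v _.
    by rewrite /P /= -mulr_sumr O0 mulr0.
  rewrite /nrm (eq_ip (f' := fun p => P p + O p) (g' := fun p => P p + O p)); try by move=> p; rewrite /O addrC subrK.
  by rewrite ipDD (ipC O P) e; ring.
have hr : nrm r <= lH ^+ 2 * nrm O.
  rewrite /nrm /ip !sum_pair mulr_sumr.
  apply: ler_sum => v _.
  exact: (spec_norm rotHK L0 lH0 hH (O0 v)).
have hP : ip P (At P) <= lG ^+ 2 * nrm P /\ 0 <= ip P (At P).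
  have spa : \sum_v pa v = 0.
    by rewrite /pa -mulr_sumr -sum_pair hf mulr0.
  have e1 : ip P (At P) = #|{: K * K}|%:R * nrm (avg rot pa).
    have -> : nrm (avg rot pa) = ip pa (avg rot (avg rot pa)) by rewrite -(avg_sa rotK).
    rewrite /ip sum_pair mulr_sumr.
    apply: eq_bigr => v _; rewrite /P /= -mulr_sumr mulrCA; congr (_ * _).
    rewrite /At /avg /nb card_prod natrM.
    rewrite (sum_pair (fun i => pa (rot2 (v, i)).1)).
    have hc : #|{: K}|%:R != 0 :> rat by rewrite pnatr_eq0 -lt0n.
    rewrite -[RHS]mulrA [X in _ = _ * X]mulrA divff // mul1r mulr_sumr; apply: eq_bigr => e1 _ /=.
    rewrite mulrA divff // mul1r; case: (rot (v, e1)) => v1 e1' /=.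
    by apply: eq_bigr => e2 _; case: (rot (v1, e2)).
  have e2 : nrm P = #|{: K * K}|%:R * nrm pa.
    rewrite /nrm /ip sum_pair mulr_sumr.
    by apply: eq_bigr => v _; rewrite /P /= sumr_const mulr_natl.
  rewrite e1 e2; split; last by rewrite mulr_ge0 ?ler0n ?nrm_ge0.
  rewrite mulrCA ler_wpM2l ?ler0n //; exact: (spec_norm rotK K0 lG0 hG spa).
have -> : ip f (avg zz f) = ip P (At P) + 2 * ip r (At P) + ip r (At r).
  rewrite (eq_ip (f' := f) (g' := B (At (B f)))) // -Bsa.
  rewrite (eq_ip (f' := fun p => P p + r p) (g' := fun p => At P p + At r p)) //; last by move=> p; rewrite /At eB.
  by rewrite ipDD -(Asa P r) (ipC (At P) r); ring.
have h1 := ip_young r (At P) (divr_gt0 ltr01 lH0); rewrite Anrm in h1.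
have h2 := ip_young r (At r) ltr01; rewrite Anrm divr1 mul1r in h2.
have hlr : nrm r / lH <= lH * nrm O.
  rewrite ler_pdivrMr //; apply: le_trans hr _; rewrite expr2; lra.
have h1' : 2 * `|ip r (At P)| <= lH * nrm O + lH * nrm P.
  apply: le_trans h1 _; rewrite div1r [lH^-1 * _]mulrC invrK [nrm P * _]mulrC; lra.
have h2' : `|ip r (At r)| <= lH ^+ 2 * nrm O by lra.
case: hP => hP1 hP2.
have nP : 0 <= nrm P by exact: nrm_ge0.
have nO : 0 <= nrm O by exact: nrm_ge0.
have q1 : 0 <= lG ^+ 2 * nrm O by rewrite mulr_ge0 // sqr_ge0.
have q2 : 0 <= lH ^+ 2 * nrm P by rewrite mulr_ge0 // sqr_ge0.
rewrite orth; apply: le_trans (ler_normD _ _) _.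
apply: (le_trans (lerD (ler_normD _ _) (lexx _))); rewrite normrM ger0_norm //.
rewrite (ger0_norm hP2); lra.
Qed.

End ZigZag.

(** * Sums of commuting projections *)

Section Commuting.
Local Open Scope ring_scope.
Variables (V X : finType) (P : X -> (V -> rat) -> V -> rat).
Hypotheses (Psa : forall x f g, ip (P x f) g = ip f (P x g))
  (Pid : forall x f v, P x (P x f) v = P x f v)
  (PC : forall x y f v, P x (P y f) v = P y (P x f) v)
  (Plin : forall x (I : seq X) (F : X -> V -> rat) v,
     P x (fun v => \sum_(i <- I) F i v) v = \sum_(i <- I) P x (F i) v)
  (Pext : forall x f g, f =1 g -> P x f =1 P x g).

Definition prodP (s : seq X) f := foldr P f s.

(** In a joint eigenbasis at most [k] of the projections could be nonzero on a component of [f].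
    Without diagonalising: the induction hypothesis for [P x f] and the remaining projections bounds
    the sum [A] on the range of each [P x]; adding these up bounds [nrm (A f)] by [k] times
    [ip (A f) f], and Young's inequality finishes. *)
Lemma commuting_bound k (S : seq X) f : uniq S ->
  (forall s, uniq s -> size s = k.+1 -> {subset s <= S} -> prodP s f =1 fun=> 0) ->
  ip (fun v => \sum_(x <- S) P x f v) f <= k%:R * nrm f.
Proof.
elim: k S f => [|k IH] S f uS hS.
  rewrite mul0r /ip big1 // => v _.
  rewrite (_ : \sum_(x <- S) P x f v = 0) ?mul0r // big_seq big1 // => x xS.
  by have := hS [:: x] isT erefl; apply=> y; rewrite inE => /eqP ->.
set A := fun g v => \sum_(x <- S) P x g v.
have sumip (F : X -> V -> rat) g : ip (fun v => \sum_(x <- S) F x v) g = \sum_(x <- S) ip (F x) g.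
  rewrite /ip exchange_big /=; apply: eq_bigr => v _; exact: mulr_suml.
have PP x : x \in S -> ip (A (P x f)) (P x f) <= k.+1%:R * ip (P x f) f.
  move=> xS.
  have e1 : ip (P x f) f = nrm (P x f).
    by rewrite /nrm [in RHS]Psa ipC; apply: eq_ip => // v; rewrite Pid.
  rewrite e1 /A.
  rewrite (eq_ip (f' := fun v => P x f v + \sum_(y <- rem x S) P y (P x f) v) (g' := P x f)) //; last first.
    by move=> v; rewrite (big_rem x) //= Pid.
  rewrite ipDl -natr1 mulrDl mul1r addrC lerD2r; apply: IH; first exact: rem_uniq.
  move=> s us ss sS v.
  have xs : x \notin s by apply/negP => /sS; rewrite mem_rem_uniq // inE eqxx.
  have eP : forall s g w, prodP s (P x g) w = P x (prodP s g) w.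
    by elim=> [|y s' IHs] g w //=; rewrite -PC; apply: Pext => u; exact: IHs.
  rewrite eP; apply: (hS (x :: s)); rewrite /= ?xs ?us ?ss //.
  by move=> y; rewrite inE => /orP [/eqP -> //|/sS]; rewrite mem_rem_uniq // inE => /andP [].
have eA : nrm (A f) <= k.+1%:R * ip (A f) f.
  have -> : nrm (A f) = \sum_(x <- S) ip (A (P x f)) (P x f).
    rewrite /nrm {2}/A ipC sumip; apply: eq_bigr => x _.
    rewrite -[LHS]/(ip (P x f) (A f)) ipC -[RHS]Psa.
    rewrite (_ : ip (P x (A (P x f))) f = ip (A (P x f)) f); last first.
      apply: eq_ip => // v; rewrite /A Plin; apply: eq_bigr => y _.
      by rewrite PC; apply: Pext => w; rewrite Pid.
    rewrite -Psa; apply: eq_ip => // v; rewrite /A Plin; apply: eq_bigr => y _; exact: PC.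
  rewrite /A sumip mulr_sumr big_seq [X in _ <= X]big_seq; apply: ler_sum => x xS; exact: PP.
have kp : 0 < k.+1%:R :> rat by rewrite ltr0n.
have := ip_young f (A f) kp; rewrite ipC => h.
have h' := le_trans (ler_wpM2l (ler0n _ 2) (ler_norm _)) h.
have e2 : nrm (A f) / k.+1%:R <= ip (A f) f by rewrite ler_pdivrMr // mulrC.
rewrite -[X in X <= _]/(ip (A f) f); move: h' e2.
by move: (ip _ _) (_ * nrm f) (nrm _ / _) => a b c; lra.
Qed.

End Commuting.

(** * The base graph over the field with 37 elements *)

Section BaseGraph.
Local Open Scope ring_scope.

Definition LH : finType := ('F_37 * 'F_37)%type.
Definition KH : finType := (LH * LH)%type.
Definition VH : finType := (KH * KH)%type.

Definition vecH (x y : 'F_37) : VH :=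
  (((y, y * x), (y * x ^+ 2, y * x ^+ 3)),
   ((y * x ^+ 4, y * x ^+ 5), (y * x ^+ 6, y * x ^+ 7))).

Definition addH (u v : VH) : VH :=
  let '(((a0, a1), (a2, a3)), ((a4, a5), (a6, a7))) := u in
  let '(((b0, b1), (b2, b3)), ((b4, b5), (b6, b7))) := v in
  (((a0 + b0, a1 + b1), (a2 + b2, a3 + b3)), ((a4 + b4, a5 + b5), (a6 + b6, a7 + b7))).

(* The neighbours of [h] are the points of the lines through [h] whose directions lie
   on the moment curve. *)
Definition rotH (p : VH * LH) : VH * LH :=
  let '(h, (x, y)) := p in (addH h (vecH x y), (x, - y)).

Lemma addHA u v w : addH u (addH v w) = addH (addH u v) w.
Proof.
case: u => [[[a0 a1] [a2 a3]] [[a4 a5] [a6 a7]]].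
case: v => [[[b0 b1] [b2 b3]] [[b4 b5] [b6 b7]]].
by case: w => [[[c0 c1] [c2 c3]] [[c4 c5] [c6 c7]]]; rewrite /addH !addrA.
Qed.

Lemma addHC u v : addH u v = addH v u.
Proof.
case: u => [[[a0 a1] [a2 a3]] [[a4 a5] [a6 a7]]].
case: v => [[[b0 b1] [b2 b3]] [[b4 b5] [b6 b7]]].
by rewrite /addH; do 3!congr (_, _); rewrite addrC.
Qed.

Lemma vecHD x y z : addH (vecH x y) (vecH x z) = vecH x (y + z).
Proof. by rewrite /addH /vecH !mulrDl. Qed.

Lemma addH0 u x : addH u (vecH x 0) = u.
Proof.
case: u => [[[a0 a1] [a2 a3]] [[a4 a5] [a6 a7]]].
by rewrite /addH /vecH !mul0r !addr0.
Qed.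

Lemma addHK u x y : addH (addH u (vecH x y)) (vecH x (- y)) = u.
Proof. by rewrite -addHA vecHD subrr addH0. Qed.

Lemma rotHK : involutive rotH.
Proof. by case=> h [x y]; rewrite /rotH addHK opprK. Qed.

Definition PH (x : 'F_37) (f : VH -> rat) (h : VH) : rat :=
  37^-1 * \sum_(y : 'F_37) f (addH h (vecH x y)).

Lemma PH_inv x f h y : PH x f (addH h (vecH x y)) = PH x f h.
Proof.
rewrite /PH; congr (_ * _).
rewrite [RHS](reindex_inj (addrI y)); apply: eq_bigr => z _.
by rewrite -addHA vecHD.
Qed.

Lemma PH_sa x f g : ip (PH x f) g = ip f (PH x g).
Proof.
rewrite /ip /PH.
under eq_bigr do rewrite -mulrA mulr_suml.
under [RHS]eq_bigr do rewrite mulrCA mulr_sumr.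
rewrite -!mulr_sumr; congr (_ * _).
rewrite exchange_big [RHS]exchange_big /= [RHS](reindex_inj oppr_inj); apply: eq_bigr => y _.
have inj : injective (fun h => addH h (vecH x y)).
  by apply: (can_inj (g := fun h => addH h (vecH x (- y)))) => h; exact: addHK.
by rewrite [RHS](reindex_inj inj); apply: eq_bigr => h _; rewrite addHK.
Qed.

Lemma PH_id x f h : PH x (PH x f) h = PH x f h.
Proof.
rewrite {1}/PH (eq_bigr (fun=> PH x f h)); last by move=> y _; exact: PH_inv.
by rewrite sumr_const card_ord -[PH x f h *+ _]mulr_natl mulrA mulVf ?mul1r.
Qed.

Lemma PH_C x y f h : PH x (PH y f) h = PH y (PH x f) h.
Proof.
rewrite /PH; congr (_ * _); rewrite -!mulr_sumr; congr (_ * _).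
rewrite exchange_big; apply: eq_bigr => a _; apply: eq_bigr => b _.
by rewrite -!addHA (addHC (vecH x b)).
Qed.

Lemma PH_lin x (I : seq 'F_37) (F : 'F_37 -> VH -> rat) h :
  PH x (fun h => \sum_(i <- I) F i h) h = \sum_(i <- I) PH x (F i) h.
Proof. by rewrite /PH exchange_big /= mulr_sumr. Qed.

Lemma PH_ext x f g : f =1 g -> PH x f =1 PH x g.
Proof. by move=> e h; rewrite /PH; congr (_ * _); apply: eq_bigr => y _. Qed.

Lemma PH_sum x f : \sum_h PH x f h = \sum_h f h.
Proof.
have e1 g : ip g (fun=> 1) = \sum_v g v by apply: eq_bigr => v _; rewrite mulr1.
rewrite -e1 PH_sa -e1; apply: eq_ip => // v.
by rewrite /PH sumr_const card_ord mulVf.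
Qed.

Lemma prodPH_inv (s : seq 'F_37) f x h y : x \in s ->
  prodP PH s f (addH h (vecH x y)) = prodP PH s f h.
Proof.
elim: s h => //= z s IH h; rewrite inE => /orP [/eqP <-|xs]; first exact: PH_inv.
rewrite /PH; congr (_ * _); apply: eq_bigr => w _.
by rewrite -addHA (addHC (vecH x y)) addHA IH.
Qed.

(** Points of the moment curve with 8 distinct parameters form a basis, because their matrix is a
    Vandermonde matrix; hence every translation decomposes into steps along the 8 lines. *)
Lemma span_moment (s : seq 'F_37) (z : VH) : uniq s -> size s = 8%N ->
  exists c : 'I_8 -> 'F_37, forall h,
    addH h z = foldl addH h [seq vecH (nth 0 s (nat_of_ord i)) (c i) | i : 'I_8 <- enum 'I_8].
Proof.
move=> us ss.
pose a : 'rV['F_37]_8 := \row_i nth 0 s i.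
pose zr : 'cV['F_37]_8 := \col_i
  nth 0 [:: z.1.1.1; z.1.1.2; z.1.2.1; z.1.2.2; z.2.1.1; z.2.1.2; z.2.2.1; z.2.2.2] i.
have hu : Vandermonde 8 a \in unitmx.
  rewrite unitmxE det_Vandermonde unitfE; apply/prodf_neq0 => i _; apply/prodf_neq0 => j ij.
  rewrite !mxE subr_eq0 nth_uniq ?ss //; by rewrite gtn_eqF.
pose cc := invmx (Vandermonde 8 a) *m zr.
have hz : Vandermonde 8 a *m cc = zr by rewrite mulKVmx.
have [c hi] : exists c : 'I_8 -> 'F_37, forall i : 'I_8,
    \sum_(j < 8) nth 0 s j ^+ i * c j = zr i 0.
  exists (fun i => cc i 0) => i.
  by rewrite -hz !mxE; apply: eq_bigr => j _; rewrite !mxE.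
exists c => h.
have -> : enum 'I_8 = [:: inord 0; inord 1; inord 2; inord 3; inord 4; inord 5; inord 6; inord 7].
  by apply: (inj_map val_inj); rewrite val_enum_ord /= !inordK.
have sumE (F : 'I_8 -> 'F_37) : \sum_j F j = F (inord 0) + F (inord 1) + F (inord 2) + F (inord 3)
   + F (inord 4) + F (inord 5) + F (inord 6) + F (inord 7).
  rewrite !big_ord_recr big_ord0 /= add0r.
  by do 7?[congr (_ + _)]; congr F; apply: val_inj; rewrite /= inordK.
have hz0 := hi (inord 0); have hz1 := hi (inord 1); have hz2 := hi (inord 2); have hz3 := hi (inord 3).
have hz4 := hi (inord 4); have hz5 := hi (inord 5); have hz6 := hi (inord 6); have hz7 := hi (inord 7).
move: hz0 hz1 hz2 hz3 hz4 hz5 hz6 hz7; rewrite !sumE !mxE !inordK //=.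
case: (z) => [[[z0 z1] [z2 z3]] [[z4 z5] [z6 z7]]] /=.
case: h => [[[a0 a1] [a2 a3]] [[a4 a5] [a6 a7]]] /=.
move=> <- <- <- <- <- <- <- <-; rewrite /addH /vecH !expr0 !expr1 !mul1r.
by rewrite !addrA !(mulrC (c _)) !inordK.
Qed.

(** The product of 8 line averages is invariant along 8 independent directions, hence constant, and
    averaging preserves the sum, which is zero. *)
Lemma prodPH_zero (s : seq 'F_37) f : uniq s -> size s = 8%N -> \sum_h f h = 0 ->
  prodP PH s f =1 fun=> 0.
Proof.
move=> us ss hf h0; set g := prodP PH s f.
have gc h z : g (addH h z) = g h.
  have [c ->] := span_moment z us ss.
  elim: (enum 'I_8) h => //= i l IH h; rewrite IH; apply: prodPH_inv.
  by rewrite mem_nth // ss.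
have gs : \sum_h g h = 0.
  rewrite /g -[RHS]hf; elim: (s) => //= x l IH; by rewrite PH_sum.
pose opp (u : VH) : VH := let '(((b0, b1), (b2, b3)), ((b4, b5), (b6, b7))) := u in
  (((- b0, - b1), (- b2, - b3)), ((- b4, - b5), (- b6, - b7))).
have ge h : g h = g h0.
  rewrite -(gc h0 (addH (opp h0) h)) addHA; congr g.
  case: (h) (h0) => [[[a0 a1] [a2 a3]] [[a4 a5] [a6 a7]]] [[[b0 b1] [b2 b3]] [[b4 b5] [b6 b7]]].
  by rewrite /addH /opp !subrr !add0r.
move: gs; rewrite (eq_bigr (fun=> g h0)) // sumr_const -[g h0 *+ _]mulr_natl => /eqP.
rewrite mulf_eq0 pnatr_eq0 => /orP [|/eqP //].
by rewrite -leqn0 leqNgt (_ : 0 < #|_|)%N //; apply/card_gt0P; exists h0.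
Qed.

(** The average over neighbours is 1/37 times the sum of the 37 line projections, and that sum is at
    most 7 on functions of sum zero. The prime 37 is the least one with [7 / p <= 1 / 5]. *)
Lemma specH : spec rotH (1 / 5).
Proof.
move=> f hf.
have e : ip f (avg rotH f) = 37^-1 * ip (fun v => \sum_(x <- enum 'F_37) PH x f v) f.
  rewrite ipC /ip mulr_sumr; apply: eq_bigr => h _; rewrite mulrA; congr (_ * _).
  rewrite /avg /nb card_prod !card_ord natrM invfM -mulrA big_enum /= -mulr_sumr sum_pair.
  by congr (_ * _); rewrite mulr_sumr.
have h1 : ip (fun v => \sum_(x <- enum 'F_37) PH x f v) f <= 7 * nrm f.
  apply: (commuting_bound PH_sa PH_id PH_C PH_lin PH_ext (enum_uniq _)).
  by move=> s us ss _; apply: prodPH_zero.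
have h2 : 0 <= ip (fun v => \sum_(x <- enum 'F_37) PH x f v) f.
  rewrite /ip; under eq_bigr do rewrite mulr_suml.
  rewrite exchange_big sumr_ge0 // => x _; rewrite -/(ip (PH x f) f).
  have -> : ip (PH x f) f = nrm (PH x f); last exact: nrm_ge0.
  by rewrite /nrm [in RHS]PH_sa ipC; apply: eq_ip => // v; rewrite PH_id.
have := nrm_ge0 f; rewrite e; move: h1 h2; move: (nrm f) (ip (fun v => \sum_(x <- enum 'F_37) PH x f v) f) => b a h1 h2 h3.
by rewrite ger0_norm ?mulr_ge0 ?invr_ge0 ?ler0n; lra.
Qed.

End BaseGraph.

Fixpoint VG (t : nat) : finType := if t is t'.+1 then (VG t' * VH)%type else unit.
Fixpoint rotG (t : nat) : VG t * KH -> VG t * KH :=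
  match t with
  | 0 => id
  | t'.+1 => zz (rotG (t := t')) rotH
  end.
Arguments rotG : clear implicits.

Lemma rotGK t : involutive (rotG t).
Proof. by elim: t => //= t IH; apply: zzK => //; exact: rotHK. Qed.

(** The value 1/2 is preserved by the recursion because [1/4 + 1/5 + 1/25 < 1/2]. The first graph
    has one vertex, where a function of sum zero vanishes. *)
Lemma specG t : spec (rotG t) (1 / 2)%R.
Proof.
elim: t => [|t IH] /=.
  move=> f hf; rewrite (_ : ip _ _ = 0)%R ?normr0 ?mulr_ge0 ?nrm_ge0 //.
  rewrite /ip big1 // => -[] _; move: hf; rewrite (bigD1 tt) //= big1 ?addr0; last by case.
  by move=> ->; rewrite mul0r.
have hl : (0 < #|LH|)%N by rewrite card_prod !card_ord.
have h2 : (0 < 1 / 2 :> rat)%R by [].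
have h5 : (0 < 1 / 5 :> rat)%R by [].
have h := zz_spec (@rotGK t) rotHK hl h2 h5 IH specH.
move=> f hf; apply: le_trans (h f hf) _; apply: ler_wpM2r; first exact: nrm_ge0.
by rewrite !expr2; lra.
Qed.

(** * Expanders of every size as computable tables *)

#[export] Instance enc_LH : enc LH := enc_fin LH.
#[export] Instance enc_KH : enc KH := enc_fin KH.
#[export] Instance enc_VH : enc VH := enc_fin VH.

Definition nV : nat := #|VH|.
Definition nK : nat := #|KH|.
Arguments rotH : simpl never.

Lemma VH_gt1 : 1 < nV.
Proof. by rewrite /nV !card_prod !card_ord. Qed.
Lemma KH_gt0 : 0 < nK.
Proof. by rewrite /nK !card_prod !card_ord. Qed.
Lemma rankV (h : VH) : (enum_rank h : nat) < nV. Proof. exact: ltn_ord. Qed.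
Lemma rankK (h : KH) : (enum_rank h : nat) < nK. Proof. exact: ltn_ord. Qed.
Lemma lt_pair i j N H : i < N -> j < H -> i * H + j < N * H.
Proof. by move=> hi hj; nia. Qed.

Definition h0 : VH := vecH 0%R 0%R.
Definition gtab := seq (seq (nat * KH)).

Definition look (T : gtab) (v : nat) (a : KH) : nat * KH :=
  nth (0, a) (nth [::] T v) (enum_rank a).

Definition zzn (T : gtab) (w : nat) (a : KH) : nat * KH :=
  let r1 := rotH (nth h0 (enum VH) (w %% nV), a.1) in
  let p1 := look T (w %/ nV) r1.1.1 in
  let p2 := look T p1.1 r1.1.2 in
  let r3 := rotH ((p2.2, p1.2), a.2) in
  (p2.1 * nV + enum_rank r3.1, (r3.2, r1.2)).

Definition tab_step (T : gtab) : gtab :=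
  [seq [seq zzn T w a | a <- enum KH] | w <- iota 0 (size T * nV)].

Definition tab0 : gtab := [:: [seq (0, a) | a <- enum KH]].
Definition tabG t := iter t tab_step tab0.

(** Each product multiplies the number of rows by [nV], which exceeds 1, so [s] rounds reach size
    [s]; growth stops there, so a table never exceeds [s * nV] rows when [s] is positive. *)
Definition exT (s : nat) : gtab :=
  iter s (fun T => if size T < s then tab_step T else T) tab0.

(** A graph on exactly [s] vertices arises by merging the rows of the table modulo [s]. A label
    names a copy, [l %/ nK], and an edge at it, [l %% nK]; there are at most [nV] copies, hence
    [nV * nK] labels, and labels of absent copies become loops in [exEntry]. *)
Definition Dex : nat := nV * nK.

Definition exEntry (T : gtab) (s v l : nat) : nat * nat :=
  let a := nth h0.1 (enum KH) (l %% nK) in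
  let j := v + (l %/ nK) * s in
  if j < size T then
    let p := look T j a in (p.1 %% s, (p.1 %/ s) * nK + enum_rank p.2)
  else (v, l).

Definition expd (s : nat) : seq (seq (nat * nat)) :=
  [seq [seq exEntry (exT s) s v l | l <- iota 0 Dex] | v <- iota 0 s].

Definition exN (s v l : nat) : nat * nat := nth (0, 0) (nth [::] (expd s) v) l.

Local Opaque VH KH.

Lemma nth_enum_rank' (T : finType) (d x : T) : nth d (enum T) (enum_rank x) = x.
Proof. exact: nth_enum_rank. Qed.

Lemma look_map v n (F : nat -> KH -> nat * KH) a : v < n ->
  look [seq [seq F w a | a <- enum KH] | w <- iota 0 n] v a = F v a.
Proof.
move=> hv; rewrite /look (nth_map 0) ?size_iota // nth_iota // add0n.
by rewrite (nth_map a) ?nth_enum_rank' // -cardE ltn_ord.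
Qed.

Fixpoint cV (t : nat) : VG t -> nat :=
  match t with
  | 0 => fun=> 0
  | t'.+1 => fun p => cV p.1 * nV + enum_rank p.2
  end.

Lemma size_tabG t : size (tabG t) = nV ^ t.
Proof. by elim: t => // t IH; rewrite /tabG iterS size_map size_iota IH expnSr. Qed.

Lemma cV_lt t (v : VG t) : cV v < nV ^ t.
Proof.
elim: t v => [|t IH] v //=; case: v => v h /=; rewrite expnSr.
exact: lt_pair (IH v) (rankV h).
Qed.

Lemma cV_surj t i : i < nV ^ t -> exists v : VG t, cV v = i.
Proof.
elim: t i => [|t IH] i hi; first by exists tt; rewrite expn0 in hi; case: i hi.
have hV : 0 < nV by exact: ltnW VH_gt1.
rewrite expnSr in hi.
have [|v hv] := IH (i %/ nV); first by rewrite ltn_divLR.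
exists (v, enum_val (Ordinal (ltn_pmod i hV))).
by rewrite /= hv enum_valK /= -divn_eq.
Qed.

Lemma look_tabG t (v : VG t) a : look (tabG t) (cV v) a =
  (cV (rotG t (v, a)).1, (rotG t (v, a)).2).
Proof.
elim: t v a => [|t IH] v a.
  by rewrite /look /= (nth_map a) ?nth_enum_rank' // -cardE ltn_ord.
rewrite /tabG iterS -/(tabG t) /tab_step look_map; last first.
  by have := cV_lt v; rewrite size_tabG -expnSr.
case: v => v h; case: a => a b; rewrite /zzn /= -/VG.
have hV : 0 < nV by exact: ltnW VH_gt1.
rewrite divnMDl // (divn_small (rankV _)) addn0 modnMDl (modn_small (rankV _)).
rewrite nth_enum_rank'; case: (rotH (h, a)) => [[e1 e2] a1] /=.
rewrite IH; case: (rotG t (v, e1)) => [v1 e1'] /=.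
rewrite IH; case: (rotG t (v1, e2)) => [v2 e2'] /=.
by case: (rotH _) => h3 b1.
Qed.

Local Open Scope ring_scope.

Lemma sum_mul (N H : nat) (F : nat -> rat) :
  \sum_(k < N * H) F k = \sum_(i < N) \sum_(j < H) F (i * H + j)%N.
Proof.
elim: N => [|N IH]; first by rewrite mul0n !big_ord0.
rewrite big_ord_recr /= -IH mulSn addnC -!(big_mkord xpredT) /=.
rewrite (big_cat_nat _ (n := N * H)) //=; last exact: leq_addr.
congr (_ + _); rewrite -{1}(add0n (N * H)%N) big_addn addKn big_mkord.
by apply: eq_bigr => i _; rewrite addnC.
Qed.

Lemma sum_enum (T : finType) (F : nat -> rat) : \sum_(x : T) F (enum_rank x) = \sum_(j < #|T|) F j.
Proof.
rewrite (reindex (enum_rank : T -> 'I_#|T|)) //=.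
by exists enum_val => x _; [exact: enum_rankK | exact: enum_valK].
Qed.

Lemma sum_cV t (F : nat -> rat) : \sum_(v : VG t) F (cV v) = \sum_(i < nV ^ t) F i.
Proof.
elim: t F => [|t IH] F.
  by rewrite /= big_const card_unit /= big_ord_recl big_ord0 /= .
rewrite expnSr sum_mul sum_pair -(IH (fun i => \sum_(j < nV) F (i * nV + j)%N)).
apply: eq_bigr => v _; rewrite -(sum_enum VH (fun j => F (cV v * nV + j)%N)).
by apply: eq_bigr.
Qed.

Lemma tabG_inv t v a : (v < nV ^ t)%N ->
  ((look (tabG t) v a).1 < nV ^ t)%N /\
  look (tabG t) (look (tabG t) v a).1 (look (tabG t) v a).2 = (v, a).
Proof.
move=> /cV_surj [w <-]; rewrite look_tabG /=; split; first exact: cV_lt.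
by rewrite look_tabG -surjective_pairing rotGK.
Qed.

Lemma tabG_gap t (f : nat -> rat) : exists c,
  nK%:R * (\sum_(v < nV ^ t) (f v - c) ^+ 2) <=
  \sum_(v < nV ^ t) \sum_(a : KH) (f v - f (look (tabG t) v a).1) ^+ 2.
Proof.
have [c hc] := spec_gap (@rotGK t) KH_gt0 (fun v => f (cV v)) (@specG t).
exists c; move: hc; rewrite (sum_cV t (fun i => (f i - c) ^+ 2)).
rewrite -(sum_cV t (fun i => \sum_(a : KH) (f i - f (look (tabG t) i a).1) ^+ 2)).
move=> h; apply: (le_trans h); apply: eqW.
by apply: eq_bigr => v _; apply: eq_bigr => a _; rewrite look_tabG.
Qed.

Local Close Scope ring_scope.

Lemma exT_tabG s : 0 < s -> exists t, [/\ exT s = tabG t, s <= nV ^ t & nV ^ t <= s * nV].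
Proof.
move=> s0.
have H i : exists t, [/\ iter i (fun T => if size T < s then tab_step T else T) tab0 = tabG t,
   (s <= nV ^ t) || (i < nV ^ t) & nV ^ t <= s * nV].
  elim: i => [|i [t [e h1 h2]]].
    by exists 0; split => //; rewrite ?orbT // expn0; have := VH_gt1; nia.
  rewrite iterS e size_tabG; case: ltnP => h.
    exists t.+1; split => //; last by rewrite expnSr leq_mul2r (ltnW h) orbT.
    apply/orP; right; move: h1; rewrite leqNgt h /= expnSr => h1.
    by move: h1 VH_gt1; move: (nV ^ t) => M; nia.
  by exists t; split => //; rewrite h.
have [t [e h1 h2]] := H s; exists t; split => //.
by case/orP: h1 => // /ltnW.
Qed.

Lemma exNE s v l : v < s -> l < Dex -> exN s v l = exEntry (exT s) s v l.
Proof.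
move=> hv hl; rewrite /exN /expd (nth_map 0) ?size_iota // nth_iota // add0n.
by rewrite (nth_map 0) ?size_iota // nth_iota // add0n.
Qed.

Theorem exN_inv s v l : v < s -> l < Dex ->
  [/\ (exN s v l).1 < s, (exN s v l).2 < Dex & exN s (exN s v l).1 (exN s v l).2 = (v, l)].
Proof.
move=> hv hl; have s0 : 0 < s by exact: leq_ltn_trans hv.
have [t [e h1 h2]] := exT_tabG s0.
rewrite (exNE hv hl) /exEntry e size_tabG.
have K0 := KH_gt0.
case: (ltnP (v + l %/ nK * s) (nV ^ t)) => hj; last first.
  by split => //=; rewrite exNE // /exEntry e size_tabG ltnNge hj.
set a := nth _ _ _; set j := v + _.
have [hp1 hp2] := tabG_inv a hj.
case E : (look (tabG t) j a) hp1 hp2 => [w b] /= hw hwb.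
have hws : w %/ s < nV by rewrite ltn_divLR //; apply: leq_trans hw _; rewrite mulnC.
have hD : w %/ s * nK + enum_rank b < Dex.
  exact: lt_pair hws (rankK b).
split => //; first by rewrite ltn_mod.
rewrite exNE ?ltn_mod // /exEntry e size_tabG.
rewrite divnMDl // (divn_small (rankK _)) addn0 modnMDl (modn_small (rankK _)).
rewrite nth_enum_rank' addnC -divn_eq hw hwb /= /j.
have -> : (v + l %/ nK * s) %% s = v by rewrite addnC modnMDl modn_small.
have -> : (v + l %/ nK * s) %/ s = l %/ nK by rewrite addnC divnMDl // (divn_small hv) addn0.
rewrite /a (_ : (enum_rank (nth h0.1 (enum KH) (l %% nK)) : nat) = l %% nK) -?divn_eq //.
have hm : l %% nK < nK by rewrite ltn_mod.
by rewrite -[nth _ _ _]/(nth h0.1 (enum KH) (Ordinal hm)) -enum_val_nth enum_valK.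
Qed.

Local Open Scope ring_scope.

(** Lift [f] to the table by reduction modulo [s]. The first [s] rows already give the left side,
    the edges of all copies together give the right side, and the loops contribute zero. *)
Theorem exN_gap s (f : nat -> rat) : (0 < s)%N -> exists c,
  \sum_(v < s) (f v - c) ^+ 2 <= \sum_(v < s) \sum_(l < Dex) (f v - f (exN s v l).1) ^+ 2.
Proof.
move=> s0; have [t [e h1 h2]] := exT_tabG s0.
pose F j := f (j %% s)%N.
have [c hc] := tabG_gap t F; exists c.
have K0 := KH_gt0.
set N := (nV ^ t)%N in h1 h2 hc.
have sq (x : rat) : 0 <= x ^+ 2 by exact: sqr_ge0.
apply: (@le_trans _ _ (nK%:R * \sum_(v < N) (F v - c) ^+ 2)).
  apply: (@le_trans _ _ (\sum_(v < N) (F v - c) ^+ 2)).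
    rewrite -!(big_mkord xpredT (fun i => (F i - c) ^+ 2)).
    rewrite (big_cat_nat _ (n := s)) //= ler_wpDr ?sumr_ge0 //.
    rewrite big_mkord; apply: ler_sum => i _; by rewrite /F modn_small.
  by rewrite ler_peMl ?sumr_ge0 // ler1n.
apply: (le_trans hc).
pose G j a := if (j < N)%N then (F j - F (look (tabG t) j a).1) ^+ 2 else 0.
have -> : \sum_(v < N) \sum_a (F v - F (look (tabG t) v a).1) ^+ 2 = \sum_(v < nV * s) \sum_a G v a.
  rewrite -(big_mkord xpredT (fun j => \sum_a (F j - F (look (tabG t) j a).1) ^+ 2)).
  rewrite -(big_mkord xpredT (fun j => \sum_a G j a)).
  rewrite [RHS](big_cat_nat _ (n := N)) //=; last by rewrite mulnC.
  rewrite [X in _ + X]big_nat_cond [X in _ + X]big1 ?addr0.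
    by apply: eq_big_nat => j /andP [_ hj]; apply: eq_bigr => a _; rewrite /G hj.
  by move=> j /andP [/andP [hj _] _]; rewrite big1 // => a _; rewrite /G ltnNge hj.
rewrite (sum_mul nV s (fun j => \sum_a G j a)) exchange_big /=.
apply: ler_sum => v _.
rewrite (sum_mul nV nK (fun l => (f v - f (exN s v l).1) ^+ 2)).
apply: ler_sum => i _.
rewrite -(sum_enum _ (fun b => (f v - f (exN s v (i * nK + b)).1) ^+ 2)).
apply: ler_sum => a _; rewrite /G; case: ifP => // hj.
rewrite exNE //; last exact: lt_pair (ltn_ord i) (rankK a).
rewrite /exEntry e size_tabG -/N.
rewrite divnMDl // (divn_small (rankK _)) addn0 modnMDl (modn_small (rankK _)) nth_enum_rank'.
rewrite [(v + i * s)%N]addnC hj /= /F.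
by rewrite modnMDl (modn_small (ltn_ord v)).
Qed.

Local Close Scope ring_scope.

Lemma PT_look A `{enc A} (T : A -> gtab) (v : A -> nat) (a : A -> KH) :
  PT T -> PT v -> PT a -> PT (fun x => look (T x) (v x) (a x)).
Proof.
move=> hT hv ha; apply: PT_nth.
- by pt.
- by pt.
- exact: (PT_comp ha (PT_finite (fun a : KH => enum_rank a : nat))).
Qed.

Lemma PT_zzn : PT (fun p : gtab * (nat * KH) => zzn p.1 p.2.1 p.2.2).
Proof.
have ha : PT (fun p : gtab * (nat * KH) => p.2.2) by pt.
have hr1 : PT (fun p : gtab * (nat * KH) => rotH (nth h0 (enum VH) (p.2.1 %% nV), p.2.2.1)).
  apply: (@PT_app2 _ VH KH _ _ _ _ _ (fun h a => rotH (h, a.1))) ; [exact: PT_finite | by pt | by pt].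
set r1 := fun p => _ in hr1.
have hp1 : PT (fun p => look p.1 (p.2.1 %/ nV) (r1 p).1.1).
  apply: PT_look; [by pt | by pt |].
  exact: (PT_comp (PT_fst hr1) (PT_finite (fun h : VH => h.1))).
set p1 := fun p => _ in hp1.
have hp2 : PT (fun p => look p.1 (p1 p).1 (r1 p).1.2).
  apply: PT_look; [exact: PT_fst_ | exact: (PT_fst hp1) |].
  exact: (PT_comp (PT_fst hr1) (PT_finite (fun h : VH => h.2))).
set p2 := fun p => _ in hp2.
have hr3 : PT (fun p => rotH (((p2 p).2, (p1 p).2), p.2.2.2)).
  have hf : PT (fun p => ((p2 p).2, (p1 p).2) : VH).
    by apply: (@PT_app2 _ KH KH VH _ _ _ _ (fun a b => (a, b)) _ _ _ (PT_snd hp2) (PT_snd hp1)); exact: PT_finite.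
  by apply: (@PT_app2 _ VH KH _ _ _ _ _ (fun h a => rotH (h, a.2)) _ _ _ hf ha); exact: PT_finite.
set r3 := fun p => _ in hr3.
have : PT (fun p => ((p2 p).1 * nV + (enum_rank (r3 p).1 : nat), ((r3 p).2, (r1 p).2) : KH)).
  apply: PT_pair.
    apply: PT_add; first by apply: PT_mul; [exact: (PT_fst hp2) | exact: PT_const].
    exact: (PT_comp (PT_fst hr3) (PT_finite (fun a : VH => enum_rank a : nat))).
  exact: (PT_comp (PT_pair (PT_snd hr3) (PT_snd hr1)) (PT_finite (fun q : LH * LH => q : KH))).
by [].
Qed.

Lemma PT_tab_step : PT tab_step.
Proof.
apply: PT_map2; first by pt.
apply: PT_map2; first by pt.
by apply: (PT_comp _ PT_zzn : PT (fun q : gtab * nat * KH => zzn (q.1.1, (q.1.2, q.2)).1 _ _)); pt.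
Qed.

Lemma esz_seq_le A `{enc A} (s : seq A) M : (forall a, List.In a s -> esz a <= M) ->
  esz s <= 1 + size s * M.+1.
Proof.
elim: s => // a s IH hs; rewrite esz_cons /= mulSn.
have h1 := hs a (or_introl erefl); have h2 := IH (fun b hb => hs b (or_intror hb)); lia.
Qed.

Lemma tabG_esz t : esz (tabG t) <= 1 + nV ^ t * (1 + nK * (2 * nV ^ t + 2 * nK + 10)).+1.
Proof.
apply: leq_trans (@esz_seq_le _ _ _ (1 + nK * (2 * nV ^ t + 2 * nK + 10)) _) _; last by rewrite size_tabG.
have ent (p : nat * KH) : p.1 < nV ^ t -> esz p <= 2 * nV ^ t + 2 * nK + 9.
  case: p => n a /= hn; rewrite esz_pair esz_nat esz_fin.
  by have := rankK a; lia.
case: t ent => [|t] ent row.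
  case=> [<-|//]; apply: leq_trans (@esz_seq_le _ _ _ (2 * nV ^ 0 + 2 * nK + 9) _) _; last by rewrite size_map -cardE -/nK (addnS _ 9).
  by move=> p /List.in_map_iff [a [<- _]]; apply: ent.
rewrite /tabG iterS -/(tabG t) => /List.in_map_iff [w [<- hw]].
apply: leq_trans (@esz_seq_le _ _ _ (2 * nV ^ t.+1 + 2 * nK + 9) _) _; last by rewrite size_map -cardE -/nK (addnS _ 9).
move=> p /List.in_map_iff [a [<- _]]; apply: ent.
have hw' : w < nV ^ t.+1.
  have : w \in iota 0 (size (tabG t) * nV).
    by move: hw; elim: (iota _ _) => //= u l IH [->|/IH]; rewrite inE ?eqxx // => ->; rewrite orbT.
  by rewrite mem_iota size_tabG -expnSr.
have := (tabG_inv a hw').1; rewrite /tabG iterS -/(tabG t) /tab_step look_map //.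
by rewrite size_tabG -expnSr.
Qed.

Theorem PT_expd : PT expd.
Proof.
have hT : PT exT.
  apply: (@PT_iterc nat gtab _ _ id (fun=> tab0) (fun p => if size p.2 < p.1 then tab_step p.2 else p.2)).
  - by pt.
  - by pt.
  - by have h := PT_tab_step; pt.
  - have [k' hk'] : polyb (fun n => 1 + (n + 1) * nV * (2 + nK * (2 * ((n + 1) * nV) + 2 * nK + 10))) by poly.
    exists k' => s i hi; apply: leq_trans (hk' _).
    have [t [-> h]] : exists t, iter i (fun T => if size T < s then tab_step T else T) tab0 = tabG t
        /\ nV ^ t <= (s + 1) * nV.
      elim: i {hi} => [|i [t [e h]]].
        by exists 0; split => //; rewrite expn0; have := VH_gt1; nia.
      rewrite iterS e size_tabG; case: ltnP => hh; last by exists t.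
      by exists t.+1; split => //; rewrite expnSr leq_mul2r; apply/orP; right; lia.
    apply: leq_trans (tabG_esz t) _; rewrite esz_nat leq_add2l.
    have h2 : nV ^ t <= (s.*2.+1 + 1) * nV by apply: leq_trans h _; rewrite leq_mul2r; apply/orP; right; lia.
    apply: leq_mul => //; rewrite -addn1 addnAC leq_add2l leq_mul2l; apply/orP; right; lia.
have hE : PT (fun q : ((gtab * nat) * nat) * nat => exEntry q.1.1.1 q.1.1.2 q.1.2 q.2).
  pose Q := (((gtab * nat) * nat) * nat)%type.
  have hj : PT (fun q : Q => q.1.2 + (q.2 %/ nK) * q.1.1.2) by pt.
  have hTT : PT (fun q : Q => q.1.1.1) by pt.
  have hp : PT (fun q : Q => look q.1.1.1 (q.1.2 + (q.2 %/ nK) * q.1.1.2) (nth h0.1 (enum KH) (q.2 %% nK))).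
    by apply: PT_look; pt.
  apply: PT_if.
  - by apply: PT_leq; [exact: PT_S hj | exact: PT_size hTT].
  - apply: PT_pair; first by apply: PT_mod; [exact: (PT_fst hp) | pt].
    apply: PT_add.
      by apply: PT_mul; [apply: PT_div; [exact: (PT_fst hp) | pt] | exact: PT_const].
    exact: (PT_comp (PT_snd hp) (PT_finite (fun a : KH => enum_rank a : nat))).
  - by pt.
have hE2 : PT (fun p : gtab * nat => [seq [seq exEntry p.1 p.2 v l | l <- iota 0 Dex] | v <- iota 0 p.2]).
  by apply: PT_map2; [pt | apply: PT_map2; [pt | exact: hE]].
exact: (PT_comp (PT_pair hT PT_id) hE2).
Qed.

Local Transparent VH KH.

Local Close Scope ring_scope.
(** * The inner test *)

Local Open Scope ring_scope.

Definition br (b : bool) : rat := b%:R.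

Lemma br_ge0 b : 0 <= br b. Proof. by case: b. Qed.
Lemma br_le1 b : br b <= 1. Proof. by case: b. Qed.
Lemma br_negb b : br (~~ b) = 1 - br b. Proof. by case: b. Qed.
Lemma br_or a b : br (a || b) <= br a + br b. Proof. by case: a; case: b. Qed.
Lemma br_imp (a b : bool) : (a -> b) -> br a <= br b.
Proof. by case: a; case: b => // /(_ isT). Qed.

Definition E (X : finType) (F : X -> rat) : rat := (\sum_x F x) / #|X|%:R.

Section Expect.
Variables X Y : finType.
Implicit Types F G : X -> rat.

Lemma card_inv_ge0 : 0 <= #|X|%:R^-1 :> rat. Proof. by rewrite invr_ge0 ler0n. Qed.

Lemma E_le F G : (forall x, F x <= G x) -> E F <= E G.
Proof. by move=> h; apply: ler_wpM2r; [exact: card_inv_ge0 | apply: ler_sum]. Qed.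

Lemma eq_E F G : F =1 G -> E F = E G.
Proof. by move=> h; congr (_ / _); apply: eq_bigr => x _. Qed.

Lemma E_add F G : E (fun x => F x + G x) = E F + E G.
Proof. by rewrite /E big_split mulrDl. Qed.

Lemma E_scale c F : E (fun x => c * F x) = c * E F.
Proof. by rewrite /E -mulr_sumr mulrA. Qed.

Lemma E_ge0 F : (forall x, 0 <= F x) -> 0 <= E F.
Proof. by move=> h; rewrite mulr_ge0 ?card_inv_ge0 ?sumr_ge0. Qed.

Lemma E_const c : (0 < #|X|)%N -> E (fun _ : X => c) = c.
Proof.
move=> h; rewrite /E sumr_const -[c *+ _]mulr_natl mulrC mulrA mulVf ?mul1r //.
by rewrite pnatr_eq0 -lt0n.
Qed.

Lemma E_sub F G : E (fun x => F x - G x) = E F - E G.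
Proof. by rewrite /E sumrB mulrBl. Qed.

Lemma E_inj (h : X -> X) F : injective h -> E (fun x => F (h x)) = E F.
Proof. by move=> hi; rewrite /E [in RHS](reindex_inj hi). Qed.

Lemma E_pair (F : X * Y -> rat) : E F = E (fun x => E (fun y => F (x, y))).
Proof.
rewrite /E sum_pair card_prod natrM invfM mulrCA mulrC; congr (_ * _).
by rewrite mulr_suml.
Qed.

Lemma E_swap (F : X -> Y -> rat) : E (fun x => E (F x)) = E (fun y => E (fun x => F x y)).
Proof.
rewrite /E -!mulr_suml exchange_big /= -!mulrA; congr (_ * _); exact: mulrC.
Qed.

Lemma E_exists F c : (0 < #|X|)%N -> E F < c -> exists x, F x < c.
Proof.
move=> h0 h; apply/existsP; apply: contraTT h; rewrite negb_exists => /forallP hx.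
rewrite -leNgt -(E_const c h0); apply: E_le => x; by rewrite leNgt hx.
Qed.

End Expect.

Lemma E_bij (X Y : finType) (h : X -> Y) (F : Y -> rat) : bijective h ->
  E (fun x => F (h x)) = E F.
Proof.
move=> hb; rewrite /E (bij_eq_card hb); congr (_ / _).
by rewrite [RHS](reindex h) //; exact: onW_bij.
Qed.

(** * Hadamard words and the long code *)

Section Gadget.
Variable I : finType.

Definition xf (J : finType) (f g : {ffun J -> bool}) : {ffun J -> bool} :=
  [ffun x => f x (+) g x].
Notation "f +^ g" := (xf f g) (at level 50, left associativity).
Definition zf (J : finType) : {ffun J -> bool} := [ffun=> false].

Lemma xfA (J : finType) (f g h : {ffun J -> bool}) : f +^ (g +^ h) = f +^ g +^ h.
Proof. by apply/ffunP => x; rewrite !ffunE addbA. Qed.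
Lemma xfC (J : finType) (f g : {ffun J -> bool}) : f +^ g = g +^ f.
Proof. by apply/ffunP => x; rewrite !ffunE addbC. Qed.
Lemma xf0 (J : finType) (f : {ffun J -> bool}) : f +^ zf J = f.
Proof. by apply/ffunP => x; rewrite !ffunE addbF. Qed.
Lemma x0f (J : finType) (f : {ffun J -> bool}) : zf J +^ f = f.
Proof. by rewrite xfC xf0. Qed.
Lemma xff (J : finType) (f : {ffun J -> bool}) : f +^ f = zf J.
Proof. by apply/ffunP => x; rewrite !ffunE addbb. Qed.
Lemma xfI (J : finType) (f : {ffun J -> bool}) : injective (xf f).
Proof. by move=> g h e; rewrite -(x0f g) -(xff f) -xfA e xfA xff x0f. Qed.
Lemma xf_gt0 (J : finType) : (0 < #|{ffun J -> bool}|)%N.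
Proof. by apply/card_gt0P; exists (zf J). Qed.

(** [Sg] are the messages, [TT] the pairs of messages at the two ends of a walk, and [UU] the
    positions of the long code of such a pair, that is, all Boolean functions on pairs. *)
Definition Sg := {ffun I -> bool}.
Definition TT := (Sg * Sg)%type.
Definition UU := {ffun TT -> bool}.

Definition had (a z : Sg) : bool := \big[addb/false]_i (a i && z i).
Definition mulU (f g : UU) : UU := [ffun x => f x && g x].
Definition lin1 (z : Sg) : UU := [ffun p => had p.1 z].
Definition lin2 (z : Sg) : UU := [ffun p => had p.2 z].

Lemma UU_gt0 : (0 < #|{: UU}|)%N. Proof. exact: xf_gt0. Qed.
Lemma Sg_gt0 : (0 < #|{: Sg}|)%N. Proof. exact: xf_gt0. Qed.

(** Adding [x0] to the argument flips the value, so the mean equals one minus itself. *)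
Lemma halves (J : finType) (l : {ffun J -> bool} -> bool) x0 :
  (forall x y, l (x +^ y) = l x (+) l y) -> l x0 ->
  E (fun x => br (l x)) = 1 / 2.
Proof.
move=> hl h0; have h : E (fun x => br (l x)) = E (fun x => 1 - br (l x)).
  rewrite -(E_inj _ (@xfI _ x0)); apply: eq_E => x.
  by rewrite hl h0 addTb br_negb.
move: h; rewrite E_sub E_const; last exact: xf_gt0.
by move=> h; lra.
Qed.

Lemma hadD a z z' : had a (z +^ z') = had a z (+) had a z'.
Proof.
rewrite /had -big_split; apply: eq_bigr => i _.
by rewrite !ffunE; case: (a i); case: (z i); case: (z' i).
Qed.

Lemma had_dist a b : a != b -> E (fun z => br (had a z != had b z)) = 1 / 2.
Proof.
move=> ne; have [i hi] : exists i, a i != b i.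
  apply/existsP; apply: contraNT ne; rewrite negb_exists => /forallP h.
  by apply/eqP/ffunP => i; have := h i; rewrite negbK => /eqP.
rewrite (eq_E (G := fun z => br (had a z (+) had b z))); last first.
  by move=> z; case: (had a z); case: (had b z).
apply: (halves (x0 := [ffun j => j == i])).
  by move=> x y; rewrite !hadD; case: (had a x); case: (had a y); case: (had b x); case: (had b y).
have e c : had c [ffun j => j == i] = c i.
  rewrite /had (bigD1 i) //= ffunE eqxx andbT big1 ?addbF // => j /negPf hj.
  by rewrite ffunE hj andbF.
by rewrite !e; case: (a i) (b i) hi => [] [].
Qed.

Definition distA (A : Sg -> bool) (a : Sg) : rat := E (fun z => br (A z != had a z)).

Lemma had_unique A a b : distA A a < 1 / 4 -> distA A b < 1 / 4 -> a = b.
Proof.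
move=> ha hb; apply/eqP; apply: contraT => /had_dist h.
have : E (fun z => br (had a z != had b z)) <= distA A a + distA A b.
  rewrite -E_add; apply: E_le => z.
  by case: (A z); case: (had a z); case: (had b z).
by lra.
Qed.

(** * Linearity testing by majority decoding *)

Section BLR.
Variables (Pi : UU -> bool) (rho : rat).
Hypothesis blr : E (fun p : UU * UU => br (Pi p.1 (+) Pi p.2 != Pi (p.1 +^ p.2))) <= rho.
Hypothesis rho6 : 6 * rho < 1.

Definition vote (x r : UU) : bool := Pi (x +^ r) (+) Pi r.
Definition cvote x : rat := E (fun r => br (vote x r)).
Definition maj x : bool := 1 / 2 < cvote x.

Lemma blrE : E (fun x => E (fun y => br (Pi x (+) Pi y != Pi (x +^ y)))) <= rho.
Proof. by move: blr; rewrite E_pair. Qed.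

Lemma addxx_r (x r s : UU) : (x +^ r) +^ (x +^ s) = r + s.
Proof. by rewrite -xfA (xfC r) -xfA (xfC s) xfA xff x0f. Qed.

Lemma vote_agree x : E (fun r => E (fun s => br (vote x r != vote x s))) <= 2 * rho.
Proof.
have h1 : E (fun r => E (fun s => br (Pi (x +^ r) (+) Pi (x +^ s) != Pi (r +^ s)))) <= rho.
  rewrite -[X in X <= _](_ : E (fun r => E (fun s => br (Pi (x +^ r) (+) Pi (x +^ s) != Pi ((x +^ r) +^ (x +^ s))))) = _).
    rewrite (E_inj (fun r => E (fun s => br (Pi r (+) Pi (x +^ s) != Pi (r +^ (x +^ s))))) (@xfI _ x)).
    rewrite (eq_E (G := fun r => E (fun s => br (Pi r (+) Pi s != Pi (r +^ s))))); first exact: blrE.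
    by move=> r; rewrite (E_inj (fun s => br (Pi r (+) Pi s != Pi (r +^ s))) (@xfI _ x)).
  by apply: eq_E => r; apply: eq_E => s; rewrite addxx_r.
have h2 := blrE.
have : E (fun r => E (fun s => br (vote x r != vote x s))) <=
   E (fun r => E (fun s => br (Pi (x +^ r) (+) Pi (x +^ s) != Pi (r +^ s)))) +
   E (fun r => E (fun s => br (Pi r (+) Pi s != Pi (r +^ s)))).
  rewrite -E_add; apply: E_le => r; rewrite -E_add; apply: E_le => s.
  rewrite /vote; case: (Pi (x +^ r)); case: (Pi (x +^ s)); case: (Pi r); case: (Pi s); by case: (Pi (r +^ s)).
by lra.
Qed.

(** Two votes disagree with probability [2 c (1 - c)], where [c] is the fraction of votes for 1; the
    minority fraction is at most this, since the majority fraction is at least 1/2. *)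
Lemma maj_strong x : E (fun r => br (vote x r != maj x)) <= 2 * rho.
Proof.
have h := vote_agree x; set c := cvote x.
have e1 : E (fun r => E (fun s => br (vote x r != vote x s))) = 2 * (c * (1 - c)).
  rewrite (eq_E (G := fun r => (1 - c) * br (vote x r) + c * (1 - br (vote x r)))).
    by rewrite E_add !E_scale E_sub (E_const _ UU_gt0) -/(cvote x) -/c; ring.
  have b1 : br true = 1 by []. have b0 : br false = 0 by [].
  move=> r; case: (vote x r); rewrite ?b1 ?b0.
    rewrite (eq_E (G := fun s => 1 - br (vote x s))); last by move=> s; rewrite -br_negb; case: (vote x s).
    by rewrite E_sub (E_const _ UU_gt0) -/(cvote x) -/c; ring.
  rewrite (eq_E (G := fun s => br (vote x s))); last by move=> s; case: (vote x s).
  by rewrite -/(cvote x) -/c; ring.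
have c0 : 0 <= c by apply: E_ge0 => r; exact: br_ge0.
have c1 : c <= 1 by rewrite -(E_const 1 UU_gt0); apply: E_le => r; exact: br_le1.
rewrite e1 in h; rewrite /maj -/c; case: ltrP => hc.
  rewrite (eq_E (G := fun r => 1 - br (vote x r))); last by move=> s; rewrite -br_negb; case: (vote x s).
  by rewrite E_sub (E_const _ UU_gt0) -/(cvote x) -/c; nra.
rewrite (eq_E (G := fun r => br (vote x r))); last by move=> s; case: (vote x s).
by rewrite -/(cvote x) -/c; nra.
Qed.

(** Because [6 * rho < 1], some [r] makes the three votes, for [x] at [r], for [y] at [x + r] and
    for [x + y] at [r], all agree with their majorities; the values of [Pi] in them cancel. *)
Lemma maj_lin x y : maj (x +^ y) = maj x (+) maj y.
Proof.
have hy : E (fun r => br (vote y (x +^ r) != maj y)) <= 2 * rho.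
  by rewrite (E_inj (fun r => br (vote y r != maj y)) (@xfI _ x)); exact: maj_strong.
have h : E (fun r => br (vote x r != maj x) + (br (vote y (x +^ r) != maj y) + br (vote (x +^ y) r != maj (x +^ y)))) < 1.
  rewrite !E_add; apply: le_lt_trans (lerD (maj_strong x) (lerD hy (maj_strong (x +^ y)))) _.
  by have -> : 2 * rho + (2 * rho + 2 * rho) = 6 * rho by ring.
have [r] := E_exists UU_gt0 h.
rewrite /vote.
have -> : y +^ (x +^ r) = (x +^ y) +^ r by rewrite xfA (xfC y).
case: (Pi (x +^ r)); case: (Pi r); case: (Pi (x +^ y +^ r)); case: (maj x); case: (maj y); by case: (maj (x +^ y)).
Qed.

(** Where [Pi x] differs from the majority, at least half of the votes differ from [Pi x], while on
    average over [x] only a fraction [rho] of them does. *)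
Lemma maj_dist : E (fun x => br (Pi x != maj x)) <= 2 * rho.
Proof.
have h1 : E (fun x => E (fun r => br (vote x r != Pi x))) <= rho.
  rewrite E_swap (eq_E (G := fun r => E (fun x => br (Pi r (+) Pi x != Pi (r +^ x))))); first exact: blrE.
  move=> r; rewrite -(E_inj (fun x => br (vote x r != Pi x)) (@xfI _ r)); apply: eq_E => x.
  by rewrite /vote (xfC r x) -xfA xff xf0 (xfC x r); case: (Pi x); case: (Pi r); case: (Pi (r +^ x)).
have h2 : E (fun x => br (Pi x != maj x)) <= 2 * E (fun x => E (fun r => br (vote x r != Pi x))).
  rewrite -E_scale; apply: E_le => x.
  case: (eqVneq (Pi x) (maj x)) => [_|ne] /=.
    by rewrite mulr_ge0 // E_ge0 // => r; exact: br_ge0.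
  rewrite (eq_E (G := fun r => 1 - br (vote x r != maj x))); last first.
    by move=> r; rewrite -br_negb negbK; case: (vote x r) (Pi x) (maj x) ne => [] [] [].
  rewrite E_sub (E_const _ UU_gt0) (_ : br true = 1) //.
  apply: (@le_trans _ _ (2 * (1 - 2 * rho))); first by have := rho6; lra.
  by rewrite ler_pM2l // lerD2l lerN2; exact: maj_strong.
by lra.
Qed.

End BLR.

(** * The test of a pair of messages *)

Section Tests.
Variables (S : pred TT) (A B : Sg -> bool) (Pi : UU -> bool).

Definition indS : UU := [ffun p => S p].
Definition WW := (UU * UU * UU * Sg * Sg)%type.

(** The checks force [Pi] to be evaluation at a point: it is additive, multiplicative and equal to 1
    on the indicator of [S]; the last two tie the coordinates of that point to the words [A] and
    [B]. Adding the random mask [h] lets a prescribed position be read through two uniform ones. *)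
Definition gtest (w : WW) : bool :=
  let '(f, g, h, z1, z2) := w in
  [&& Pi f (+) Pi g == Pi (f +^ g), (Pi f && Pi g) == Pi (mulU f g +^ h) (+) Pi h,
      Pi (indS +^ h) (+) Pi h, A z1 == Pi (lin1 z1 +^ h) (+) Pi h
    & B z2 == Pi (lin2 z2 +^ h) (+) Pi h].

Definition rej : rat := E (fun w => br (~~ gtest w)).

Lemma E5 (F : WW -> rat) : E F =
  E (fun f => E (fun g => E (fun h => E (fun z1 => E (fun z2 => F (f, g, h, z1, z2)))))).
Proof. by rewrite !E_pair. Qed.

Lemma Eskip (X : finType) c : (0 < #|X|)%N -> E (fun _ : X => c) = c.
Proof. exact: E_const. Qed.

(** The majority [L] is exactly additive. It is exactly multiplicative too, as a nonzero bilinear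
    form is 1 with probability at least 1/4, whereas the test allows only [9 * rho]; this is why
    [rho] has to stay below 1/36. Since [L] is 1 on the sum of the point indicators in [S], it is 1
    on one of them, and multiplying by that indicator shows that [L] is evaluation there. Reading
    through the mask costs [4 * rho], hence the factor 5. *)
Theorem gadget_sound : rej < 1 / 37 ->
  exists a b, [/\ S (a, b), distA A a <= 5 * rej & distA B b <= 5 * rej].
Proof.
move=> hr; set rho := rej in hr *.
have sub (F : WW -> bool) : (forall w, gtest w -> ~~ F w) -> E (fun w => br (F w)) <= rho.
  move=> h; apply: E_le => w; apply: br_imp => hF; apply/negP => /h; by rewrite hF.
have blr : E (fun p : UU * UU => br (Pi p.1 (+) Pi p.2 != Pi (p.1 +^ p.2))) <= rho.
  have := sub (fun w => Pi w.1.1.1.1 (+) Pi w.1.1.1.2 != Pi (w.1.1.1.1 +^ w.1.1.1.2)).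
  rewrite E5 E_pair => h; apply: le_trans (h _).
    apply: E_le => f; apply: E_le => g /=.
    by rewrite (Eskip _ UU_gt0) (Eskip _ Sg_gt0) (Eskip _ Sg_gt0).
  by move=> [[[[f g] k] z1] z2] /= /and5P [/eqP -> *]; rewrite eqxx.
have rho6 : 6 * rho < 1 by lra.
pose L := maj Pi.
have Llin x y : L (x +^ y) = L x (+) L y by exact: (maj_lin blr rho6).
have Ld : E (fun x => br (Pi x != L x)) <= 2 * rho by exact: (maj_dist blr).
have Ld' x : E (fun h => br (Pi (x +^ h) != L (x +^ h))) <= 2 * rho.
  by rewrite (E_inj (fun h => br (Pi h != L h)) (@xfI _ x)).
have Lsc x : E (fun h => br (Pi (x +^ h) (+) Pi h != L x)) <= 4 * rho.
  apply: (@le_trans _ _ (E (fun h => br (Pi (x +^ h) != L (x +^ h))) + E (fun h => br (Pi h != L h)))); last first.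
    by have := Ld' x; lra.
  rewrite -E_add; apply: E_le => h; rewrite Llin.
  by case: (Pi (x +^ h)); case: (Pi h); case: (L x); case: (L h).
have L0 : L (zf _) = false by have := Llin (zf _) (zf _); rewrite xf0; case: (L _).
have Lmul f g : L (mulU f g) = L f && L g.
  pose Bf f g := L (mulU f g) (+) (L f && L g).
  have mulDl x y z : mulU (x +^ y) z = mulU x z + mulU y z.
    by apply/ffunP => t; rewrite !ffunE; case: (x t); case: (y t); case: (z t).
  have mulDr x y z : mulU z (x +^ y) = mulU z x + mulU z y.
    by apply/ffunP => t; rewrite !ffunE; case: (x t); case: (y t); case: (z t).
  have BDl x y z : Bf (x +^ y) z = Bf x z (+) Bf y z.
    rewrite /Bf mulDl !Llin.
    by case: (L (mulU x z)); case: (L (mulU y z)); case: (L x); case: (L y); case: (L z).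
  have BDr x y z : Bf z (x +^ y) = Bf z x (+) Bf z y.
    rewrite /Bf mulDr !Llin.
    by case: (L (mulU z x)); case: (L (mulU z y)); case: (L x); case: (L y); case: (L z).
  apply/eqP; apply: contraT => ne.
  have nB : Bf f g by move: ne; rewrite /Bf; case: (L (mulU f g)); case: (L f && L g).
  have big : 1 / 4 <= E (fun x => E (fun y => br (Bf x y))).
    have h1 : E (fun y => br (Bf f y)) = 1 / 2.
      by apply: (halves (x0 := g)) => // x y; exact: BDr.
    rewrite E_swap.
    apply: (@le_trans _ _ (E (fun y => 1 / 2 * br (Bf f y)))).
      by rewrite E_scale h1; lra.
    apply: E_le => y; case hy : (Bf f y); last first.
      by rewrite mulr0 E_ge0 // => x; exact: br_ge0.
    have -> : E (fun x => br (Bf x y)) = 1 / 2 by apply: (halves (x0 := f)) => // u v; exact: BDl.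
    by rewrite mulr1.
  have small : E (fun x => E (fun y => br (Bf x y))) <= rho + 8 * rho.
    have hm := sub (fun w => (Pi w.1.1.1.1 && Pi w.1.1.1.2) != Pi (mulU w.1.1.1.1 w.1.1.1.2 +^ w.1.1.2) (+) Pi w.1.1.2).
    have {}hm := hm ltac:(by move=> [[[[f1 g1] k1] z1] z2] /= /and5P [_ /eqP -> *]; rewrite eqxx).
    pose M x y h := br ((Pi x && Pi y) != Pi (mulU x y +^ h) (+) Pi h).
    pose W x y h := br (Pi x != L x) + (br (Pi y != L y) + br (Pi (mulU x y +^ h) (+) Pi h != L (mulU x y))).
    have hm' : E (fun x => E (fun y => E (M x y))) <= rho.
      by rewrite E5 /= in hm; apply: le_trans hm; do 3!(apply: E_le => ?); rewrite (Eskip _ Sg_gt0) (Eskip _ Sg_gt0).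
    have e1 : E (fun x => E (fun y => br (Bf x y))) <= E (fun x => E (fun y => E (fun h => M x y h + W x y h))).
      apply: E_le => x; apply: E_le => y; rewrite -[X in X <= _](Eskip _ UU_gt0); apply: E_le => h.
      rewrite /Bf /M /W; case: (Pi x); case: (L x); case: (Pi y); case: (L y); case: (L (mulU x y)); case: (Pi (mulU x y +^ h)); by case: (Pi h).
    have e2 : E (fun x => E (fun y => E (W x y))) <= 8 * rho.
      apply: (@le_trans _ _ (E (fun x => br (Pi x != L x) + (2 * rho + 4 * rho)))); last first.
        by rewrite E_add (Eskip _ UU_gt0); lra.
      apply: E_le => x; apply: (@le_trans _ _ (E (fun y => br (Pi x != L x) + (br (Pi y != L y) + 4 * rho)))).
        by apply: E_le => y; rewrite /W !E_add !(Eskip _ UU_gt0); have := Lsc (mulU x y); lra.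
      by rewrite !E_add !(Eskip _ UU_gt0); lra.
    have e3 : E (fun x => E (fun y => E (fun h => M x y h + W x y h))) =
      E (fun x => E (fun y => E (M x y))) + E (fun x => E (fun y => E (W x y))).
      by do 2!(rewrite -E_add; apply: eq_E => ?); rewrite -E_add.
    by rewrite e3 in e1; lra.
  by lra.
have LS : L indS.
  have hm := sub (fun w => ~~ (Pi (indS +^ w.1.1.2) (+) Pi w.1.1.2)).
  have {}hm := hm ltac:(by move=> [[[[f1 g1] k1] z1] z2] /= /and5P [_ _ -> *]).
  rewrite E5 /= (Eskip _ UU_gt0) (Eskip _ UU_gt0) in hm.
  have hm' : E (fun h => br (~~ (Pi (indS +^ h) (+) Pi h))) <= rho.
    apply: le_trans hm; apply: E_le => h; by rewrite (Eskip _ Sg_gt0) (Eskip _ Sg_gt0).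
  have h1 : E (fun h => br (~~ (Pi (indS +^ h) (+) Pi h)) + br (Pi (indS +^ h) (+) Pi h != L indS)) < 1.
    by rewrite E_add; have := Lsc indS; lra.
  have [h] := E_exists UU_gt0 h1.
  by case: (Pi (indS +^ h)); case: (Pi h); case: (L indS).
pose es s : UU := [ffun t => t == s].
have [[a b] Ss Les] : exists2 s, S s & L (es s).
  apply/exists_inP; apply: contraTT LS; rewrite negb_exists_in => /forall_inP hS.
  have -> : indS = \big[@xf _/zf _]_(s | S s) es s.
    apply/ffunP => t; rewrite ffunE.
    have -> : (\big[@xf _/zf _]_(s | S s) es s) t = \big[addb/false]_(s | S s) es s t.
      by elim/big_rec2 : _ => [|s x y hs <-]; rewrite !ffunE.
    case hSt : (S t); last first.
      by rewrite big1 // => s hs; rewrite ffunE; case: eqP => // e; rewrite e hs in hSt.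
    rewrite (bigD1 t) //= ffunE eqxx big1 // => s /andP [_ /negPf hs].
    by rewrite ffunE eq_sym hs.
  elim/big_ind : _ => [|x y hx hy|s hs]; [by rewrite L0 | by rewrite Llin (negPf hx) (negPf hy) | exact: hS].
have Lev f : L f = f (a, b).
  have : L (mulU f (es (a, b))) = L f by rewrite Lmul Les andbT.
  move=> <-; have -> : mulU f (es (a, b)) = if f (a, b) then es (a, b) else zf _.
    apply/ffunP => t; rewrite !ffunE; case: eqP => [->|ne].
      by rewrite andbT; case: (f (a, b)); rewrite !ffunE ?eqxx.
    by rewrite andbF; case: (f (a, b)); rewrite !ffunE //; case: eqP.
  by case: (f (a, b)).
have cons (Q : Sg -> bool) ln c : (forall z, L (ln z) = had c z) ->
    E (fun z => E (fun h => br (Q z != Pi (ln z +^ h) (+) Pi h))) <= rho -> distA Q c <= 5 * rho.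
  move=> hl hq; apply: (@le_trans _ _ (E (fun z => E (fun h => br (Q z != Pi (ln z +^ h) (+) Pi h)) + 4 * rho))); last first.
    by rewrite E_add (Eskip _ Sg_gt0); lra.
  apply: E_le => z; apply: (@le_trans _ _ (E (fun h => br (Q z != Pi (ln z +^ h) (+) Pi h) + br (Pi (ln z +^ h) (+) Pi h != L (ln z))))).
    rewrite -[X in X <= _](Eskip _ UU_gt0); apply: E_le => h; rewrite hl.
    by case: (Q z); case: (had c z); case: (Pi (ln z +^ h)); case: (Pi h).
  by rewrite E_add; have := Lsc (ln z); lra.
exists a, b; split=> //.
- have hm := sub (fun w => A w.1.2 != Pi (lin1 w.1.2 +^ w.1.1.2) (+) Pi w.1.1.2).
  have {}hm := hm ltac:(by move=> [[[[f1 g1] k1] z1] z2] /= /and5P [_ _ _ /eqP -> _]; rewrite eqxx).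
  rewrite E5 /= (Eskip _ UU_gt0) (Eskip _ UU_gt0) E_swap in hm.
  apply: (cons _ lin1) => [z|]; first by rewrite Lev ffunE.
  apply: le_trans hm; apply: E_le => z; apply: E_le => h; by rewrite (Eskip _ Sg_gt0).
- have hm := sub (fun w => B w.2 != Pi (lin2 w.2 +^ w.1.1.2) (+) Pi w.1.1.2).
  have {}hm := hm ltac:(by move=> [[[[f1 g1] k1] z1] z2] /= /and5P [_ _ _ _ /eqP ->]; rewrite eqxx).
  rewrite E5 /= (Eskip _ UU_gt0) (Eskip _ UU_gt0) in hm.
  apply: (cons _ lin2) => [z|]; first by rewrite Lev ffunE.
  rewrite E_swap; apply: le_trans hm; apply: E_le => h; by rewrite (Eskip _ Sg_gt0).
Qed.

End Tests.

Lemma gadget_complete (S : pred TT) (a b : Sg) (w : WW) : S (a, b) ->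
  gtest S (had a) (had b) (fun f : UU => f (a, b)) w.
Proof.
case: w => [[[[f g] h] z1] z2] hS; rewrite /gtest !ffunE hS /=.
by case: (f _); case: (g _); case: (h _); case: (had a z1); case: (had b z2).
Qed.

End Gadget.

Local Open Scope ring_scope.
(** * Gap amplification by random walks *)

Lemma E_sum (X J : finType) (F : J -> X -> rat) :
  E (fun x => \sum_j F j x) = \sum_j E (F j).
Proof. by rewrite /E exchange_big /= mulr_suml. Qed.

(** Besides the end vertex it returns the labels of the walk back, by which the end vertex can
    address the starting vertex. *)
Fixpoint wk (V Lb : Type) (rot : V * Lb -> V * Lb) (v : V) (ls : seq Lb) : V * seq Lb :=
  if ls is l :: ls' then
    let r := rot (v, l) in let w := wk rot r.1 ls' in (w.1, rcons w.2 r.2)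
  else (v, [::]).

(** * Random walks and their reversal *)

Section Walks.
Variables (V Lb : finType) (rot : V * Lb -> V * Lb).
Hypothesis rotK : involutive rot.
Hypothesis Lb0 : (0 < #|Lb|)%N.

Notation wk := (wk rot).

Lemma wk_cat v p s : wk v (p ++ s) =
  ((wk (wk v p).1 s).1, (wk (wk v p).1 s).2 ++ (wk v p).2).
Proof.
elim: p v => [|l p IH] v /=; first by rewrite cats0 -surjective_pairing.
by rewrite IH /= rcons_cat.
Qed.

Lemma size_wk v ls : size (wk v ls).2 = size ls.
Proof. by elim: ls v => //= l ls IH v; rewrite size_rcons IH. Qed.

Fixpoint EW (n : nat) (F : seq Lb -> rat) : rat :=
  if n is n'.+1 then E (fun l => EW n' (fun ls => F (l :: ls))) else F [::].

Lemma EW_le n F G : (forall ls, size ls = n -> F ls <= G ls) -> EW n F <= EW n G.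
Proof.
elim: n F G => [|n IH] F G h /=; first exact: h.
by apply: E_le => l; apply: IH => ls hs; apply: h; rewrite /= hs.
Qed.

Lemma eq_EW n F G : (forall ls, size ls = n -> F ls = G ls) -> EW n F = EW n G.
Proof. by move=> h; apply/eqP; rewrite eq_le !EW_le // => ls hs; rewrite h. Qed.

Lemma EW_add n F G : EW n (fun ls => F ls + G ls) = EW n F + EW n G.
Proof. by elim: n F G => //= n IH F G; rewrite -E_add; apply: eq_E => l; rewrite IH. Qed.

Lemma EW_scale n c F : EW n (fun ls => c * F ls) = c * EW n F.
Proof. by elim: n F => //= n IH F; rewrite -E_scale; apply: eq_E => l; rewrite IH. Qed.

Lemma EW_const n c : EW n (fun=> c) = c.
Proof. by elim: n => //= n IH; rewrite IH E_const. Qed.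

Lemma EW_ge0 n F : (forall ls, 0 <= F ls) -> 0 <= EW n F.
Proof. by move=> h; rewrite -(EW_const n 0); apply: EW_le => ls _. Qed.

Lemma EW_sum n (J : finType) (F : J -> seq Lb -> rat) :
  EW n (fun ls => \sum_j F j ls) = \sum_j EW n (F j).
Proof.
by elim: n F => //= n IH F; rewrite -E_sum; apply: eq_E => l; rewrite IH.
Qed.

Lemma EW_cat m n F : EW (m + n) F = EW m (fun p => EW n (fun s => F (p ++ s))).
Proof. by elim: m F => //= m IH F; apply: eq_E => l; rewrite IH. Qed.

Lemma EW_take m n F : (n <= m)%N -> EW m (fun ls => F (take n ls)) = EW n F.
Proof.
move=> h; rewrite -{1}(subnKC h) EW_cat; apply: eq_EW => p hp.
rewrite -(EW_const (m - n) (F p)); apply: eq_EW => s _; by rewrite -hp take_size_cat.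
Qed.

Lemma EW_rcons n F : EW n.+1 F = EW n (fun p => E (fun l => F (rcons p l))).
Proof.
elim: n F => //= n IH F; apply: eq_E => l; exact: (IH (fun ls => F (l :: ls))).
Qed.

Lemma EW_E n (X : finType) (F : X -> seq Lb -> rat) :
  EW n (fun p => E (fun x => F x p)) = E (fun x => EW n (F x)).
Proof. by elim: n F => //= n IH F; rewrite E_swap; apply: eq_E => l; rewrite IH. Qed.

Lemma EW_tuple n F : E (fun t : n.-tuple Lb => F (val t)) = EW n F.
Proof.
elim: n F => [|n IH] F /=.
  rewrite (eq_E (G := fun=> F [::])); last by move=> t; rewrite (tuple0 t).
  by rewrite E_const // card_tuple expn0.
pose h (p : Lb * n.-tuple Lb) : n.+1.-tuple Lb := [tuple of p.1 :: p.2].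
have hb : bijective h.
  exists (fun t => (thead t, [tuple of behead t])) => [[l t]|t].
    by rewrite theadE; congr (_, _); apply: val_inj.
  by rewrite /h -tuple_eta.
rewrite -(E_bij (fun t : n.+1.-tuple Lb => F (val t)) hb) E_pair; apply: eq_E => l.
by rewrite -IH.
Qed.

(** Reversal permutes the pairs of a vertex and a word of [n] labels, so a reversed uniform walk is
    a uniform walk. *)
Lemma EW_rev n (F : V -> seq Lb -> rat) :
  E (fun v => EW n (F v)) = E (fun v => EW n (fun ls => F (wk v ls).1 (wk v ls).2)).
Proof.
elim: n F => // n IH F.
transitivity (E (fun v => E (fun l => EW n (fun ls => F (wk v ls).1 (rcons (wk v ls).2 l))))).
  rewrite [RHS]E_swap.
  rewrite (eq_E (G := fun v => EW n (fun p => E (fun l => F v (rcons p l))))); last by move=> v; exact: EW_rcons.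
  rewrite (eq_E (G := fun v => E (fun l => EW n (fun p => F v (rcons p l))))); last by move=> v; exact: EW_E.
  by rewrite E_swap; apply: eq_E => l; rewrite (IH (fun v p => F v (rcons p l))).
rewrite -(E_pair (fun p : V * Lb => EW n (fun ls => F (wk p.1 ls).1 (rcons (wk p.1 ls).2 p.2)))).
by rewrite -(E_inj _ (inv_inj rotK)) E_pair.
Qed.

Lemma wkK v p : wk (wk v p).1 (wk v p).2 = (v, p).
Proof.
elim: p v => //= l p IH v; rewrite -cats1 wk_cat IH /=.
by rewrite -surjective_pairing rotK.
Qed.

Lemma EW_end n (F : V -> rat) : E (fun v => EW n (fun ls => F (wk v ls).1)) = E F.
Proof.
rewrite -(EW_rev n (fun v _ => F v)); apply: eq_E => v; exact: EW_const.
Qed.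

Lemma EW_nth n m (F : V -> Lb -> rat) (l0 : Lb) :
  E (fun v => EW (n + m.+1) (fun ls => F (wk v (take n ls)).1 (nth l0 ls n)))
  = E (fun v => E (F v)).
Proof.
rewrite -[RHS](EW_end n (fun v => E (F v))); apply: eq_E => v; rewrite EW_cat.
apply: eq_EW => p hp /=; apply: eq_E => l.
rewrite -[RHS](EW_const m); apply: eq_EW => s _.
by rewrite -hp take_size_cat // nth_cat ltnn subnn.
Qed.

End Walks.

(** * Soundness of powering *)

Section Power.
Variables (V Lb Sig : finType) (rot : V * Lb -> V * Lb).
Hypothesis rotK : involutive rot.
Hypothesis Lb0 : (0 < #|Lb|)%N.
Variables (lam : rat).
Hypotheses (lam0 : 0 < lam) (lam1 : lam < 1).
Hypothesis hlam : forall f : V -> rat, \sum_v f v = 0 -> nrm (avg rot f) <= lam ^+ 2 * nrm f.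
Variables (c : V * Lb -> Sig -> Sig -> bool) (M : nat) (l0 : Lb).
Hypothesis M0 : (0 < M)%N.
Variable op : V -> seq Lb -> Sig.
Variable sg0 : Sig.

Notation wk := (wk rot).
Notation EW := (@EW Lb).

(** [op v p] is the opinion of [v] about the vertex reached from it by [p]. The edge after [M + k]
    steps is judged by the opinion of the start about its near end and the opinion of the end of the
    walk about its far end. *)
Definition passE (v : V) (ls : seq Lb) (k j : nat) : bool :=
  c ((wk v (take (M + k) ls)).1, nth l0 ls (M + k))
    (op v (take (M + k) ls)) (op (wk v ls).1 (take (M + j) (wk v ls).2)).
Definition passV (v : V) (ls : seq Lb) (k j : nat) : bool :=
  op v (take (M + k) ls) == op (wk v ls).1 (take (M + j) (wk v ls).2).

Definition pass (v : V) (ls : seq Lb) : bool :=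
  [forall k : 'I_M, forall j : 'I_M,
    ((M + k + (M + j).+1 == size ls)%N ==> passE v ls k j)
    && ((M + k + (M + j) == size ls)%N ==> passV v ls k j)].

Definition prej : rat :=
  E (fun i : 'I_(2 * M) => E (fun v => EW (2 * M + i) (fun ls => br (~~ pass v ls)))).

(* how often the walks of lengths in [M, 2M) ending at [v] report [a] *)
Definition weight (v : V) (a : Sig) : rat :=
  E (fun i : 'I_M => EW (M + i) (fun p => br (op (wk v p).1 (wk v p).2 == a))).

Definition dec (v : V) : Sig := [arg max_(a > sg0) weight v a]%O.

Lemma dec_max v a : weight v a <= weight v (dec v).
Proof. by rewrite /dec; case: Order.TotalTheory.arg_maxP => // b _; apply. Qed.

Lemma IM0 : (0 < #|'I_M|)%N. Proof. by rewrite card_ord. Qed.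

Lemma weight_sum v : \sum_a weight v a = 1.
Proof.
rewrite /weight -E_sum (eq_E (G := fun=> 1)) ?(E_const _ IM0) // => i.
rewrite -EW_sum -(EW_const Lb0 (M + i) 1); apply: eq_EW => p _.
rewrite (bigD1 (op (wk v p).1 (wk v p).2)) //= eqxx big1 ?addr0 // => a.
by rewrite eq_sym => /negPf ->.
Qed.

Lemma weight_ge0 v a : 0 <= weight v a.
Proof. by apply: E_ge0 => i; apply: EW_ge0 => // p; exact: br_ge0. Qed.

Lemma dec_weight v : 1 <= #|Sig|%:R * weight v (dec v).
Proof.
rewrite -[X in X <= _](weight_sum v) mulr_natl -sumr_const.
by apply: ler_sum => a _; exact: dec_max.
Qed.

Definition Fv (e : V * Lb) : bool := ~~ c e (dec e.1) (dec (nb rot e.1 e.2)).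
Definition phi : rat := E (fun e => br (Fv e)).
Definition Bad (v : V) : rat := 1 - weight v (dec v).

(** For each [k] the values [k + j + b] form a block of [M] consecutive integers below [2 * M]. *)
Lemma sum_window (b : nat) (Q : nat -> rat) : (forall i, 0 <= Q i) -> (b < 2)%N ->
  \sum_(k < M) \sum_(j < M) Q (k + j + b)%N <= M%:R * \sum_(i < 2 * M) Q i.
Proof.
move=> Q0 hb; rewrite mulr_natl -[X in _ *+ X](card_ord M) -sumr_const; apply: ler_sum => k _.
have hk := ltn_ord k.
have -> : \sum_(j < M) Q (k + j + b)%N = \sum_(k + b <= i < k + b + M) Q i.
  rewrite -{1}(add0n (k + b)%N) big_addn addKn big_mkord; apply: eq_bigr => j _.
  by congr Q; lia.
rewrite -(big_mkord xpredT Q) [X in _ <= X](big_cat_nat _ (n := (k + b)%N)) //=; last by lia.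
rewrite [X in _ <= _ + X](big_cat_nat _ (n := (k + b + M)%N)) /=; [|lia|lia].
by rewrite ler_wpDl ?sumr_ge0 // ler_wpDr ?sumr_ge0.
Qed.

Definition Qi (i : nat) : rat := E (fun v => EW (2 * M + i) (fun ls => br (~~ pass v ls))).

Lemma Qi_ge0 i : 0 <= Qi i.
Proof. by apply: E_ge0 => v; apply: EW_ge0 => // p; exact: br_ge0. Qed.

Lemma MR : 0 < M%:R :> rat. Proof. by rewrite ltr0n. Qed.

Lemma prejE : M%:R * (2 * prej) = \sum_(i < 2 * M) Qi i.
Proof.
rewrite /prej /E card_ord natrM -/(Qi _) mulrC mulrA mulrC invfM; have := MR.
by move=> h; field; rewrite gt_eqF.
Qed.

Definition alpha k (u : V) (a : Sig) : rat :=
  EW (M + k) (fun p => br (op (wk u p).1 (wk u p).2 == a)).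

(* consistency: two independent walks from [v] report the same value *)
Lemma bad_bound : E Bad <= 2 * prej.
Proof.
have h1 : E (fun k : 'I_M => E (fun j : 'I_M => E (fun v =>
     EW (M + k) (fun p => EW (M + j) (fun s =>
      br (op (wk v p).1 (wk v p).2 != op (wk v s).1 (wk v s).2)))))) <= 2 * prej.
  have hX (k j : 'I_M) : E (fun v => EW (M + k) (fun p => EW (M + j) (fun s =>
      br (op (wk v p).1 (wk v p).2 != op (wk v s).1 (wk v s).2)))) <= Qi (k + j + 0)%N.
    rewrite (EW_rev rotK (M + k) (fun v p => EW (M + j) (fun s => br (op (wk v p).1 (wk v p).2 != op (wk v s).1 (wk v s).2)))).
    apply: E_le => v; rewrite (_ : 2 * M + (k + j + 0) = (M + k) + (M + j))%N; last by lia.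
    rewrite [X in _ <= X]EW_cat; apply: EW_le => p hp; apply: EW_le => s hs.
    apply: br_imp; apply: contraNN => /forallP /(_ k) /forallP /(_ j) /andP [_].
    rewrite size_cat hp hs eqxx /= /passV -hp take_size_cat // wk_cat /= -hs.
    by rewrite -(size_wk rot (wk v p).1 s) take_size_cat // (wkK rotK) => /eqP ->.
  have := sum_window Qi_ge0 (isT : (0 < 2)%N); rewrite -prejE => h.
  rewrite -(ler_pM2l MR) -(ler_pM2l MR); apply: le_trans h.
  have -> (X : 'I_M -> 'I_M -> rat) : M%:R * (M%:R * E (fun k => E (X k))) = \sum_k \sum_j X k j.
    rewrite /E card_ord -mulr_suml; have := MR => h; field; by rewrite gt_eqF.
  by apply: ler_sum => k _; apply: ler_sum => j _; exact: hX.
apply: le_trans h1.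
rewrite (eq_E (G := fun k : 'I_M => E (fun v => E (fun j : 'I_M => EW (M + k) (fun p => EW (M + j) (fun s =>
      br (op (wk v p).1 (wk v p).2 != op (wk v s).1 (wk v s).2))))))); last by move=> k; rewrite E_swap.
rewrite E_swap; apply: E_le => v.
have e1 : E (fun k : 'I_M => E (fun j : 'I_M => EW (M + k) (fun p => EW (M + j) (fun s =>
      br (op (wk v p).1 (wk v p).2 != op (wk v s).1 (wk v s).2))))) = 1 - \sum_a weight v a * weight v a.
  transitivity (E (fun k : 'I_M => EW (M + k) (fun p => 1 - weight v (op (wk v p).1 (wk v p).2)))).
    apply: eq_E => k; rewrite -EW_E; apply: eq_EW => p _.
    rewrite /weight -[X in X - _](E_const 1 IM0) -E_sub; apply: eq_E => j.
    rewrite -[X in X - _](EW_const Lb0 (M + j)) -[X in _ - X]mul1r -mulNr -EW_scale -EW_add.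
    by apply: eq_EW => s _; rewrite eq_sym br_negb mulN1r.
  rewrite (eq_E (G := fun k : 'I_M => 1 - \sum_a weight v a * alpha k v a)); last first.
    move=> k; rewrite -[X in X - _](EW_const Lb0 (M + k)) -[X in _ - X]mul1r -mulNr /alpha.
    rewrite (eq_bigr (fun a => EW (M + k) (fun p => weight v a * br (op (wk v p).1 (wk v p).2 == a)))); last first.
      by move=> a _; rewrite EW_scale.
    rewrite -EW_sum -EW_scale -EW_add; apply: eq_EW => p _; congr (_ + _); rewrite mulN1r; congr (- _).
    rewrite (bigD1 (op (wk v p).1 (wk v p).2)) //= eqxx mulr1 big1 ?addr0 // => a.
    by rewrite eq_sym => /negPf ->; rewrite mulr0.
  rewrite E_sub (E_const _ IM0) E_sum; congr (_ - _); apply: eq_bigr => a _.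
  by rewrite E_scale.
rewrite e1 /Bad lerD2l lerN2 -[X in _ <= X]mul1r -(weight_sum v) mulr_suml.
by apply: ler_sum => a _; rewrite ler_wpM2l ?weight_ge0 // dec_max.
Qed.

Definition evt (v : V) (ls : seq Lb) (k j : nat) : bool :=
  let u := (wk v (take (M + k) ls)).1 in let l := nth l0 ls (M + k) in
  [&& Fv (u, l), op v (take (M + k) ls) == dec u
    & op (wk v ls).1 (take (M + j) (wk v ls).2) == dec (nb rot u l)].

Lemma evt_rej v ls (k j : 'I_M) : (size ls = M + k + (M + j).+1)%N -> evt v ls k j -> ~~ pass v ls.
Proof.
move=> hs /and3P [hF /eqP h1 /eqP h2]; apply/negP => /forallP /(_ k) /forallP /(_ j) /andP [].
by rewrite hs eqxx /= /passE h1 h2 => h _; move: hF; rewrite /Fv h.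
Qed.

Lemma br_and a b : br (a && b) = br a * br b.
Proof. by case: a; case: b; rewrite /br ?mulr1 ?mulr0 ?mul0r. Qed.

Lemma take_rcons_cat (T : Type) n (a : seq T) x y : size a = n -> take n (rcons a x ++ y) = a.
Proof. by move=> <-; rewrite -cats1 -catA take_size_cat. Qed.

(** Cut the walk at the edge: given the edge, the reversed first part and the second part are
    independent walks, so the two reports contribute a product. *)
Lemma evt_prob (k j : nat) :
  E (fun v => EW (M + k + (M + j).+1) (fun ls => br (evt v ls k j))) =
  E (fun u => E (fun l => br (Fv (u, l)) * (alpha k u (dec u) * alpha j (nb rot u l) (dec (nb rot u l))))).
Proof.
pose G u p := E (fun l => br (Fv (u, l)) * (br (op (wk u p).1 (wk u p).2 == dec u)
     * alpha j (nb rot u l) (dec (nb rot u l)))).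
transitivity (E (fun u => EW (M + k) (G u))).
  rewrite (EW_rev rotK (M + k) G); apply: eq_E => v; rewrite EW_cat; apply: eq_EW => p hp /=.
  rewrite /G (wkK rotK) /=; apply: eq_E => l.
  rewrite /alpha mulrA -EW_scale; apply: eq_EW => s hs.
  rewrite /evt -hp take_size_cat // nth_cat ltnn subnn /= wk_cat /= take_rcons_cat; last by rewrite size_wk.
  by rewrite !br_and mulrA.
apply: eq_E => u; rewrite EW_E; apply: eq_E => l.
rewrite EW_scale; congr (_ * _); rewrite mulrC -EW_scale; apply: eq_EW => p _; exact: mulrC.
Qed.

Lemma geo_sum (k n : nat) :
  (1 - lam) * (\sum_(i < n) (if (k < i)%N then lam ^+ (i - k - 1) else 0)) = 1 - lam ^+ (n - k - 1).
Proof.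
elim: n => [|n IH]; first by rewrite big_ord0 mulr0 expr0 subrr.
rewrite big_ord_recr /= mulrDr IH; case: ltnP => h.
  have -> : (n.+1 - k - 1 = (n - k - 1).+1)%N by lia.
  by rewrite exprS; ring.
have -> : (n - k - 1 = 0)%N by lia.
have -> : (n.+1 - k - 1 = 0)%N by lia.
by rewrite mulr0 addr0.
Qed.

Lemma avgE f v : avg rot f v = E (fun l => f (nb rot v l)).
Proof. by rewrite /avg /E mulrC. Qed.

Lemma EW_iter m (H : V -> rat) w : EW m (fun s => H (wk w s).1) = iter m (avg rot) H w.
Proof.
elim: m w => //= m IH w; rewrite avgE; apply: eq_E => l; exact: IH.
Qed.

Lemma iter_avg_nrm m f : \sum_v f v = 0 ->
  nrm (iter m (avg rot) f) <= lam ^+ m ^+ 2 * nrm f /\ \sum_v iter m (avg rot) f v = 0.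
Proof.
move=> hf; elim: m => [|m [IH1 IH2]] /=; first by rewrite expr0 expr1n mul1r.
split; last by rewrite avg_sum.
apply: le_trans (hlam IH2) _; rewrite [lam ^+ m.+1]exprS exprMn -[X in _ <= X]mulrA.
by apply: ler_wpM2l => //; exact: sqr_ge0.
Qed.

Lemma phi_ge0 : 0 <= phi. Proof. by apply: E_ge0 => e; exact: br_ge0. Qed.

(** Two violated edges separated by [m] steps are almost independent: beyond [phi ^+ 2] there is
    only the correlation with a function of sum zero, which [m] averaging steps shrink by
    [lam ^+ m]. *)
Lemma two_edges m : (0 < #|V|)%N ->
  E (fun u => E (fun l => br (Fv (u, l)) * iter m (avg rot) (fun v => E (fun l' => br (Fv (v, l')))) (nb rot u l)))
  <= phi ^+ 2 + lam ^+ m * phi.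
Proof.
move=> V0; pose h v := E (fun l' => br (Fv (v, l'))); rewrite -[fun v => E (fun l' => br (Fv (v, l')))]/h.
pose g w := E (fun l => br (Fv (rot (w, l)))).
have VR : 0 < #|V|%:R :> rat by rewrite ltr0n.
have lm0 : 0 < lam ^+ m by rewrite exprn_gt0 // lam0.
have -> : E (fun u => E (fun l => br (Fv (u, l)) * iter m (avg rot) h (nb rot u l)))
   = E (fun w => g w * iter m (avg rot) h w).
  rewrite -(E_pair (fun p : V * Lb => br (Fv p) * iter m (avg rot) h (rot p).1)).
  rewrite -(E_inj _ (inv_inj rotK)) (eq_E (G := fun p => br (Fv (rot p)) * iter m (avg rot) h p.1)); last first.
    by move=> p; rewrite rotK.
  rewrite E_pair; apply: eq_E => w; rewrite /g mulrC -E_scale; apply: eq_E => l; exact: mulrC.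
pose h0 v := h v - phi.
have Eh : E h = phi by rewrite /phi E_pair.
have Eg : E g = phi.
  by rewrite /phi -(E_inj _ (inv_inj rotK)) [RHS]E_pair.
have sh0 : \sum_v h0 v = 0.
  have : E h0 = 0 by rewrite /h0 E_sub (E_const _ V0) Eh subrr.
  by rewrite /E => /eqP; rewrite mulf_eq0 invr_eq0 (gt_eqF VR) orbF => /eqP.
have eh w : iter m (avg rot) h w = phi + iter m (avg rot) h0 w.
  elim: m w {lm0} => [|m IH] w /=; first by rewrite /h0; ring.
  rewrite !avgE -[X in X + _](E_const phi Lb0) -E_add; apply: eq_E => l; exact: IH.
have [hn _] := iter_avg_nrm m sh0.
set H := iter m (avg rot) h0 in eh hn.
have -> : E (fun w => g w * iter m (avg rot) h w) = phi ^+ 2 + E (fun w => g w * H w).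
  rewrite expr2 -{1}Eg mulrC -E_scale -E_add; apply: eq_E => w; rewrite eh; ring.
rewrite lerD2l.
have ng : nrm g <= #|V|%:R * phi.
  have -> : #|V|%:R * phi = \sum_v g v by rewrite -Eg /E mulrC mulfVK // gt_eqF.
  apply: ler_sum => w _.
  have g0 : 0 <= g w by apply: E_ge0 => l; exact: br_ge0.
  have g1 : g w <= 1 by rewrite -(E_const 1 Lb0); apply: E_le => l; exact: br_le1.
  by nra.
have nh : nrm h0 <= #|V|%:R * phi.
  have -> : nrm h0 = nrm h - #|V|%:R * phi ^+ 2.
    have e : \sum_v h v = #|V|%:R * phi by rewrite -Eh /E mulrC mulfVK // gt_eqF.
    rewrite /nrm /ip (eq_bigr (fun v => h v * h v - (2 * phi * h v - phi ^+ 2))); last first.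
      by move=> v _; rewrite /h0; ring.
    rewrite sumrB; congr (_ - _); rewrite sumrB -mulr_sumr e sumr_const -[_ *+ #|_|]mulr_natl; ring.
  have : nrm h <= #|V|%:R * phi.
    have -> : #|V|%:R * phi = \sum_v h v by rewrite -Eh /E mulrC mulfVK // gt_eqF.
    apply: ler_sum => w _.
    have g0 : 0 <= h w by apply: E_ge0 => l; exact: br_ge0.
    have g1 : h w <= 1 by rewrite -(E_const 1 Lb0); apply: E_le => l; exact: br_le1.
    by nra.
  have : 0 <= #|V|%:R * phi ^+ 2 by rewrite mulr_ge0 ?sqr_ge0 // ltW.
  by lra.
have hy := ip_young g H lm0.
have hy' : 2 * ip g H <= lam ^+ m * nrm g + nrm H / lam ^+ m.
  by apply: le_trans hy; rewrite ler_pM2l // ler_norm.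
have hH : nrm H / lam ^+ m <= lam ^+ m * nrm h0.
  by rewrite ler_pdivrMr // mulrAC -expr2.
have h1 : lam ^+ m * nrm g <= lam ^+ m * (#|V|%:R * phi) by rewrite ler_pM2l.
have h2 : lam ^+ m * nrm h0 <= lam ^+ m * (#|V|%:R * phi) by rewrite ler_pM2l.
have : ip g H <= lam ^+ m * (#|V|%:R * phi) by lra.
by rewrite /E ler_pdivrMr // -/(ip g H) mulrAC mulrA.
Qed.

Definition NF (v : V) (ls : seq Lb) : rat :=
  \sum_(k < M) br (Fv ((wk v (take (M + k) ls)).1, nth l0 ls (M + k))).

(** The constant of the second moment: 1 from the diagonal, and the two geometric series in [lam] on
    either side of it. *)
Definition B0 : rat := 1 + 2 / (1 - lam).

Lemma pair_edges (k k' i : nat) : (k < k')%N -> (k' < M)%N -> (0 < #|V|)%N ->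
  E (fun v => EW (2 * M + i) (fun ls => br (Fv ((wk v (take (M + k) ls)).1, nth l0 ls (M + k)))
     * br (Fv ((wk v (take (M + k') ls)).1, nth l0 ls (M + k'))))) <= phi ^+ 2 + lam ^+ (k' - k - 1) * phi.
Proof.
move=> hk hk' V0; apply: le_trans (two_edges _ V0).
pose m := (k' - k - 1)%N; pose rr := (2 * M + i - (M + k) - m - 2)%N.
apply: eqW.
rewrite -[RHS](EW_end rotK Lb0 (M + k)); apply: eq_E => v.
have -> : (2 * M + i = (M + k) + (m + rr.+1).+1)%N by rewrite /rr /m; lia.
rewrite EW_cat; apply: eq_EW => p hp /=; apply: eq_E => l.
rewrite EW_cat -EW_iter -EW_scale; apply: eq_EW => s hs /=.
rewrite -[RHS]E_scale; apply: eq_E => l'.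
rewrite -[RHS](EW_const Lb0 rr); apply: eq_EW => t _.
have e1 : take (M + k) (p ++ l :: s ++ l' :: t) = p by rewrite -hp take_size_cat.
have e2 : nth l0 (p ++ l :: s ++ l' :: t) (M + k) = l by rewrite -hp nth_cat ltnn subnn.
have sz : size (p ++ l :: s) = (M + k')%N by rewrite size_cat hp /= hs /m; lia.
have e3 : take (M + k') (p ++ l :: s ++ l' :: t) = p ++ l :: s.
  by rewrite -sz -cat_cons catA take_size_cat.
have e4 : nth l0 (p ++ l :: s ++ l' :: t) (M + k') = l'.
  by rewrite -sz -cat_cons catA nth_cat ltnn subnn.
by rewrite e1 e2 e3 e4 wk_cat /=.
Qed.

Lemma NF2 i : (0 < #|V|)%N ->
  E (fun v => EW (2 * M + i) (fun ls => NF v ls * NF v ls)) <= M%:R * phi * (B0 + M%:R * phi).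
Proof.
move=> V0.
pose P (k k' : nat) := E (fun v => EW (2 * M + i) (fun ls => br (Fv ((wk v (take (M + k) ls)).1, nth l0 ls (M + k)))
     * br (Fv ((wk v (take (M + k') ls)).1, nth l0 ls (M + k'))))).
have -> : E (fun v => EW (2 * M + i) (fun ls => NF v ls * NF v ls)) = \sum_(k < M) \sum_(k' < M) P k k'.
  rewrite /P; under [RHS]eq_bigr do rewrite -E_sum.
  rewrite -E_sum; apply: eq_E => v.
  under [RHS]eq_bigr do rewrite -EW_sum.
  rewrite -EW_sum; apply: eq_EW => ls _; rewrite /NF mulr_suml; apply: eq_bigr => k _.
  by rewrite mulr_sumr.
have Pd (k : 'I_M) : P k k = phi.
  rewrite /P /phi E_pair -(EW_nth rotK Lb0 (M + k) (2 * M + i - (M + k) - 1) (fun u l => br (Fv (u, l))) l0).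
  have -> : ((M + k) + (2 * M + i - (M + k) - 1).+1 = 2 * M + i)%N by have := ltn_ord k; lia.
  by apply: eq_E => v; apply: eq_EW => ls _; case: (Fv _); rewrite /br ?mulr1 ?mul0r.
have Pb (k k' : 'I_M) : P k k' <= phi *+ (k == k') + phi ^+ 2 +
    ((if (k < k')%N then lam ^+ (k' - k - 1) else 0) + (if (k' < k)%N then lam ^+ (k - k' - 1) else 0)) * phi.
  have p2 : 0 <= phi ^+ 2 by exact: sqr_ge0.
  case: (ltngtP k k') => h.
  - have -> : (k == k') = false by apply/eqP => e; rewrite e ltnn in h.
    by have := pair_edges i h (ltn_ord k') V0; rewrite -/(P k k') mulr0n; lra.
  - have -> : (k == k') = false by apply/eqP => e; rewrite e ltnn in h.
    have := pair_edges i h (ltn_ord k) V0.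
    rewrite (_ : E _ = P k k'); last by apply: eq_E => v; apply: eq_EW => ls _; rewrite mulrC.
    by rewrite mulr0n; lra.
  - by rewrite (val_inj h) eqxx Pd mulr1n; lra.
have l1 : 0 < 1 - lam by have := lam1; lra.
have gs (k : nat) : \sum_(k' < M) (if (k < k')%N then lam ^+ (k' - k - 1) else 0) <= (1 - lam)^-1.
  rewrite -[X in _ <= X]mulr1 ler_pdivlMl // geo_sum lerBlDr lerDl ltW // exprn_gt0 //; exact: lam0.
apply: (@le_trans _ _ (\sum_(k < M) \sum_(k' < M) (phi *+ (k == k') + phi ^+ 2 +
    ((if (k < k')%N then lam ^+ (k' - k - 1) else 0) + (if (k' < k)%N then lam ^+ (k - k' - 1) else 0)) * phi))).
  by apply: ler_sum => k _; apply: ler_sum => k' _; exact: Pb.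
have -> : \sum_(k < M) \sum_(k' < M) (phi *+ (k == k') + phi ^+ 2 +
    ((if (k < k')%N then lam ^+ (k' - k - 1) else 0) + (if (k' < k)%N then lam ^+ (k - k' - 1) else 0)) * phi)
  = \sum_(k < M) (phi + M%:R * phi ^+ 2) + (\sum_(k < M) \sum_(k' < M) (if (k < k')%N then lam ^+ (k' - k - 1) else 0)) * phi
   + (\sum_(k < M) \sum_(k' < M) (if (k' < k)%N then lam ^+ (k - k' - 1) else 0)) * phi.
  rewrite !mulr_suml -!big_split; apply: eq_bigr => k _ /=.
  rewrite !mulr_suml big_split big_split /= -[RHS]addrA; congr (_ + _); last first.
    by rewrite -big_split; apply: eq_bigr => k' _; rewrite mulrDl.
  congr (_ + _); last by rewrite sumr_const card_ord mulr_natl.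
  by rewrite (bigD1 k) //= eqxx mulr1n big1 ?addr0 // => k' /negPf; rewrite eq_sym => ->; rewrite mulr0n.
have s1 : \sum_(k < M) \sum_(k' < M) (if (k < k')%N then lam ^+ (k' - k - 1) else 0) <= M%:R * (1 - lam)^-1.
  rewrite mulr_natl -[X in _ *+ X](card_ord M) -sumr_const; apply: ler_sum => k _; exact: gs.
have s2 : \sum_(k < M) \sum_(k' < M) (if (k' < k)%N then lam ^+ (k - k' - 1) else 0) <= M%:R * (1 - lam)^-1.
  rewrite exchange_big /=; exact: s1.
have s1' := ler_wpM2r phi_ge0 s1; have s2' := ler_wpM2r phi_ge0 s2.
rewrite sumr_const card_ord -[_ *+ M]mulr_natl /B0.
have -> : M%:R * phi * (1 + 2 / (1 - lam) + M%:R * phi) =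
   M%:R * (phi + M%:R * phi ^+ 2) + M%:R * (1 - lam)^-1 * phi + M%:R * (1 - lam)^-1 * phi by ring.
by rewrite lerD // lerD.
Qed.

(** The plurality value has weight at least [1 / #|Sig|], so a violated edge is recognised by both
    reporters with probability at least the square of this. *)
Lemma first_moment : phi <= #|Sig|%:R ^+ 2 *
  E (fun k : 'I_M => E (fun j : 'I_M => E (fun u => E (fun l =>
     br (Fv (u, l)) * (alpha k u (dec u) * alpha j (nb rot u l) (dec (nb rot u l))))))).
Proof.
pose T (k j : 'I_M) u l := br (Fv (u, l)) * (alpha k u (dec u) * alpha j (nb rot u l) (dec (nb rot u l))).
have -> : E (fun k => E (fun j => E (fun u => E (T k j u)))) = E (fun u => E (fun l => E (fun k => E (fun j => T k j u l)))).
  rewrite (eq_E (G := fun k => E (fun u => E (fun l => E (fun j => T k j u l))))); last first.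
    by move=> k; rewrite (E_swap (fun j u => E (T k j u))); apply: eq_E => u; exact: (E_swap (fun j l => T k j u l)).
  rewrite (E_swap (fun k u => E (fun l => E (fun j => T k j u l)))); apply: eq_E => u.
  exact: (E_swap (fun k l => E (fun j => T k j u l))).
rewrite /phi E_pair -E_scale; apply: E_le => u; rewrite -E_scale; apply: E_le => l; rewrite /T.
have -> : E (fun k : 'I_M => E (fun j : 'I_M => br (Fv (u, l)) * (alpha k u (dec u) * alpha j (nb rot u l) (dec (nb rot u l)))))
   = br (Fv (u, l)) * (weight u (dec u) * weight (nb rot u l) (dec (nb rot u l))).
  rewrite (eq_E (G := fun k : 'I_M => br (Fv (u, l)) * weight (nb rot u l) (dec (nb rot u l)) * alpha k u (dec u))).
    by rewrite E_scale -/(weight u (dec u)); ring.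
  move=> k; rewrite E_scale E_scale -/(weight (nb rot u l) _); ring.
have h1 := dec_weight u; have h2 := dec_weight (nb rot u l).
have w1 := weight_ge0 u (dec u).
case: (Fv _); rewrite /br ?mul0r ?mulr0 // mul1r expr2.
set s : rat := #|Sig|%:R in h1 h2 *.
rewrite mulrACA -[X in X <= _](mulr1 1); apply: ler_pM => //.
Qed.

(** A second-moment argument. On a rejected walk with [X] recognised and [Y >= X] violated edges,
    [2 t X <= t ^+ 2 * Y ^+ 2 + 1] follows from [(t Y - 1) ^+ 2 >= 0]; on an accepted walk [X] is
    zero. Averaging bounds [M * phi] by the rejection rate, with no division by the second
    moment. *)
Theorem powering : (0 < #|V|)%N -> 8 * #|Sig|%:R ^+ 4 * prej <= 1 ->
  M%:R * phi <= 8 * #|Sig|%:R ^+ 4 * B0 * prej.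
Proof.
move=> V0 hP; set s : rat := #|Sig|%:R in hP *.
have s0 : 0 < s by rewrite ltr0n; apply/card_gt0P; exists sg0.
have l1 : 0 < 1 - lam by have := lam1; lra.
have B00 : 0 < B0 by rewrite /B0 ltr_pwDl // divr_ge0 // ltW.
have p0 := phi_ge0; have M1 := MR.
have Mp0 : 0 <= M%:R * phi by rewrite mulr_ge0 // ltW.
have key t : 0 < t -> t * (M%:R * phi) <= s ^+ 2 * (t ^+ 2 * (M%:R * phi * (B0 + M%:R * phi)) + prej).
  move=> t0.
  have hi (i : 'I_(2 * M)) : 2 * t * \sum_(k < M) \sum_(j < M) (if (k + j + 1 == i)%N then
       E (fun v => EW (2 * M + i) (fun ls => br (evt v ls k j))) else 0)
      <= t ^+ 2 * (M%:R * phi * (B0 + M%:R * phi)) + Qi i.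
    apply: (@le_trans _ _ (t ^+ 2 * E (fun v => EW (2 * M + i) (fun ls => NF v ls * NF v ls)) + Qi i)); last first.
      by rewrite lerD2r ler_wpM2l ?sqr_ge0 // NF2.
    have -> : \sum_(k < M) \sum_(j < M) (if (k + j + 1 == i)%N then
       E (fun v => EW (2 * M + i) (fun ls => br (evt v ls k j))) else 0)
      = E (fun v => EW (2 * M + i) (fun ls => \sum_(k < M) \sum_(j < M) (if (k + j + 1 == i)%N then br (evt v ls k j) else 0))).
      under [RHS]eq_E => v do rewrite EW_sum.
      rewrite E_sum; apply: eq_bigr => k _.
      under [RHS]eq_E => v do rewrite EW_sum.
      rewrite E_sum; apply: eq_bigr => j _; case: ifP => // _.
      rewrite (eq_E (G := fun=> 0)) ?E_const // => v; exact: EW_const.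
    rewrite -E_scale -E_scale -E_add; apply: E_le => v.
    rewrite -EW_scale -EW_scale -EW_add; apply: EW_le => ls hls.
    have nf0 : 0 <= NF v ls by apply: sumr_ge0 => k _; exact: br_ge0.
    have le1 : \sum_(k < M) \sum_(j < M) (if (k + j + 1 == i)%N then br (evt v ls k j) else 0) <= NF v ls.
      apply: ler_sum => k _; case: (boolP [exists j : 'I_M, (k + j + 1 == i)%N]) => [/existsP [j0 hj0]|hn].
        rewrite (bigD1 j0) //= hj0 big1 ?addr0; last first.
          move=> j hj; case: eqP => // e; case/eqP: hj; apply: val_inj; move/eqP: hj0; rewrite /= in e *; move: e; clear; lia.
        by apply: br_imp => /and3P [].
      rewrite big1 ?br_ge0 // => j _; case: ifP => // h; case/negP: hn; apply/existsP; by exists j.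
    case hp : (pass v ls); rewrite /br /=; last first.
      rewrite mulr1n; have h1 : t * \sum_(k < M) \sum_(j < M) (if (k + j + 1 == i)%N then br (evt v ls k j) else 0) <= t * NF v ls.
        by rewrite ler_pM2l.
      have : 0 <= (t * NF v ls - 1) ^+ 2 by exact: sqr_ge0.
      rewrite !expr2; nra.
    rewrite big1 ?mulr0 ?addr0; first by rewrite mulr_ge0 ?sqr_ge0 ?mulr_ge0.
    move=> k _; rewrite big1 // => j _; case: eqP => // e.
    have hsz : (size ls = M + k + (M + j).+1)%N by rewrite hls; move: e; clear; lia.
    by case he : (evt v ls k j) => //; have := evt_rej hsz he; rewrite hp.
  have hsum : \sum_(i < 2 * M) (2 * t * \sum_(k < M) \sum_(j < M) (if (k + j + 1 == i)%N then
       E (fun v => EW (2 * M + i) (fun ls => br (evt v ls k j))) else 0))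
      <= \sum_(i < 2 * M) (t ^+ 2 * (M%:R * phi * (B0 + M%:R * phi)) + Qi i).
    by apply: ler_sum => i _; exact: hi.
  rewrite -mulr_sumr big_split /= -prejE sumr_const card_ord -[_ *+ (2 * M)]mulr_natl natrM in hsum.
  have eS : \sum_(i < 2 * M) \sum_(k < M) \sum_(j < M) (if (k + j + 1 == i)%N then
       E (fun v => EW (2 * M + i) (fun ls => br (evt v ls k j))) else 0)
     = M%:R * M%:R * E (fun k : 'I_M => E (fun j : 'I_M => E (fun u => E (fun l =>
     br (Fv (u, l)) * (alpha k u (dec u) * alpha j (nb rot u l) (dec (nb rot u l))))))).
    have -> (X : 'I_M -> 'I_M -> rat) : M%:R * M%:R * E (fun k => E (X k)) = \sum_k \sum_j X k j.
      by rewrite /E card_ord -mulr_suml; field; rewrite gt_eqF.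
    rewrite exchange_big; apply: eq_bigr => k _; rewrite exchange_big; apply: eq_bigr => j _ /=.
    have hkj : (k + j + 1 < 2 * M)%N by have := ltn_ord k; have := ltn_ord j; clear; lia.
    rewrite (bigD1 (Ordinal hkj)) //= eqxx big1 ?addr0; last first.
      move=> i hi'; case: eqP => // e; case/eqP: hi'; exact: val_inj.
    rewrite (_ : 2 * M + (k + j + 1) = M + k + (M + j).+1)%N; last by clear; lia.
    exact: evt_prob.
  rewrite eS in hsum.
  have fm := first_moment; set X := E _ in hsum fm; rewrite -/s in fm.
  have h3 : t * (M%:R * X) <= t ^+ 2 * (M%:R * phi * (B0 + M%:R * phi)) + prej.
    rewrite -(ler_pM2l (_ : 0 < 2 * M%:R :> rat)); last by rewrite mulr_gt0.
    by move: hsum; set y := _ * (B0 + _); nra.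
  have h4 : t * (M%:R * phi) <= t * (M%:R * (s ^+ 2 * X)).
    by rewrite ler_pM2l // ler_pM2l.
  apply: (le_trans h4).
  have -> : t * (M%:R * (s ^+ 2 * X)) = s ^+ 2 * (t * (M%:R * X)) by ring.
  by rewrite ler_wpM2l ?sqr_ge0.
set D := B0 + M%:R * phi.
have D0 : 0 < D by rewrite /D ltr_pwDl.
(* For this [t] the quadratic term is exactly half of the linear one. *)
have hk := key (1 / (2 * s ^+ 2 * D)) _.
have {}hk : M%:R * phi <= 4 * s ^+ 4 * D * prej.
  have t0 : 0 < 1 / (2 * s ^+ 2 * D) by rewrite divr_gt0 // !mulr_gt0 // exprn_gt0.
  have := hk t0; rewrite -/D; set m := M%:R * phi.
  have -> : s ^+ 2 * ((1 / (2 * s ^+ 2 * D)) ^+ 2 * (m * D) + prej) =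
    m / (4 * s ^+ 2 * D) + s ^+ 2 * prej by field; rewrite !gt_eqF.
  have -> : 1 / (2 * s ^+ 2 * D) * m = 2 * (m / (4 * s ^+ 2 * D)) by field; rewrite !gt_eqF.
  move=> h; have h5 : m / (4 * s ^+ 2 * D) <= s ^+ 2 * prej by lra.
  move: h5; rewrite ler_pdivrMr; last by rewrite !mulr_gt0 // exprn_gt0.
  by move=> h5; apply: (le_trans h5); apply: eqW; ring.
rewrite /D in hk.
have pr0 : 0 <= prej by apply: E_ge0 => i; exact: Qi_ge0.
(* [D] still contains [M * phi]; the smallness of [prej] lets half of the left side absorb it. *)
have : 4 * s ^+ 4 * prej * (M%:R * phi) <= 1 / 2 * (M%:R * phi).
  by apply: ler_wpM2r => //; lra.
have e : 4 * s ^+ 4 * (B0 + M%:R * phi) * prej = 4 * s ^+ 4 * B0 * prej + 4 * s ^+ 4 * prej * (M%:R * phi) by ring.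
rewrite e in hk; set a := 4 * s ^+ 4 * B0 * prej in hk *.
have -> : 8 * s ^+ 4 * B0 * prej = 2 * a by rewrite /a; ring.
by lra.
Qed.

End Power.

Local Close Scope ring_scope.
(** * From constraint lists to constraint graphs *)

Section Graph.
Variable q : nat.
Hypothesis q0 : 0 < q.

Definition Sig : finType := {ffun 'I_q -> bool}.
Definition TTq : finType := {ffun Sig -> bool}.
(* cloud expander edges, edges inside a constraint, global expander edges *)
Definition Lb1 : finType := (('I_Dex + 'I_q) + 'I_Dex)%type.
(* the right summand consists of self-loops, which make the walk lazy *)
Definition Lb2 : finType := (Lb1 + Lb1)%type.

Definition cstr := (seq nat * TTq)%type.

Lemma Dex_gt0 : 0 < Dex.
Proof. by rewrite /Dex muln_gt0 KH_gt0 (ltnW VH_gt1). Qed.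

Definition inDex (i : nat) : 'I_Dex := insubd (Ordinal Dex_gt0) i.
Definition inq (i : nat) : 'I_q := insubd (Ordinal q0) i.

Lemma inDexK i : i < Dex -> inDex i = i :> nat.
Proof. by move=> h; rewrite /inDex insubdK. Qed.
Lemma inqK i : i < q -> inq i = i :> nat.
Proof. by move=> h; rewrite /inq insubdK. Qed.
Lemma inDex_ord (i : 'I_Dex) : inDex i = i.
Proof. by apply: val_inj; rewrite /= inDexK. Qed.
Lemma inq_ord (i : 'I_q) : inq i = i.
Proof. by apply: val_inj; rewrite /= inqK. Qed.

Variable cs : seq cstr.
Notation n := (size cs).
Notation N := (n * q).

Definition c0 : cstr := ([::], [ffun=> true]).
(** Vertex [c * q + s] is slot [s] of constraint [c], and its value is an assignment to all [q]
    slots of [c]. The default of [nth] pads short constraints with variable 0. *)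
Definition vvar (v : nat) : nat := nth 0 (nth c0 cs (v %/ q)).1 (v %% q).
Definition vtt (v : nat) : TTq := (nth c0 cs (v %/ q)).2.
Definition vslot (v : nat) : 'I_q := inq (v %% q).
Definition occ (x : nat) : seq nat := [seq w <- iota 0 N | vvar w == x].

Definition rotn (v : nat) (l : Lb2) : nat * Lb2 :=
  match l with
  | inr _ => (v, l)
  | inl (inl (inl i)) =>
      let o := occ (vvar v) in let e := exN (size o) (index v o) i in
      (nth 0 o e.1, inl (inl (inl (inDex e.2))))
  | inl (inl (inr t)) => (v %/ q * q + t, inl (inl (inr (vslot v))))
  | inl (inr i) => let e := exN N v i in (e.1, inl (inr (inDex e.2)))
  end.

Lemma mem_occ v : v < N -> v \in occ (vvar v).
Proof. by move=> hv; rewrite mem_filter eqxx mem_iota. Qed.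

Lemma occ_uniq x : uniq (occ x). Proof. exact: filter_uniq (iota_uniq _ _). Qed.

Lemma rotn_inv v l : v < N ->
  (rotn v l).1 < N /\ rotn (rotn v l).1 (rotn v l).2 = (v, l).
Proof.
move=> hv; case: l => [[[i|t]|i]|l] //=.
- have hm := mem_occ hv; set o := occ (vvar v) in hm *.
  have hi : index v o < size o by rewrite index_mem.
  have [h1 h2 h3] := exN_inv hi (ltn_ord i).
  set e := exN _ _ _ in h1 h2 h3 *.
  have hw : nth 0 o e.1 \in o by rewrite mem_nth.
  have : nth 0 o e.1 \in occ (vvar v) by [].
  rewrite mem_filter mem_iota => /andP [/eqP hvw /andP [_ hwN]].
  split => //; rewrite hvw -/o index_uniq ?occ_uniq // inDexK // h3 /=.
  by rewrite nth_index // inDex_ord.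
- have hc : v %/ q < n by rewrite ltn_divLR.
  split; first exact: lt_pair hc (ltn_ord t).
  rewrite divnMDl // (divn_small (ltn_ord t)) addn0 /vslot modnMDl (modn_small (ltn_ord t)) inq_ord.
  by rewrite inqK ?ltn_mod // -divn_eq.
- have [h1 h2 h3] := exN_inv hv (ltn_ord i).
  by split => //; rewrite inDexK // h3 /= inDex_ord.
Qed.

Hypothesis N0 : 0 < N.

Definition inN (i : nat) : 'I_N := insubd (Ordinal N0) i.
Lemma inNK i : i < N -> inN i = i :> nat.
Proof. by move=> h; rewrite /inN insubdK. Qed.
Lemma inN_ord (i : 'I_N) : inN i = i.
Proof. by apply: val_inj; rewrite /= inNK. Qed.

Definition rotF (p : 'I_N * Lb2) : 'I_N * Lb2 :=
  let r := rotn p.1 p.2 in (inN r.1, r.2).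

Lemma rotFK : involutive rotF.
Proof.
case=> v l; rewrite /rotF /=; have [h1 h2] := rotn_inv l (ltn_ord v).
by rewrite inNK // h2 /= inN_ord.
Qed.

Lemma nbF v l : nb rotF v l = (rotn v l).1 :> nat.
Proof. by rewrite /nb /rotF /= inNK //; have [] := rotn_inv l (ltn_ord v). Qed.

Lemma Lb2_gt0 : 0 < #|Lb2|.
Proof. by apply/card_gt0P; exists (inr (inr (Ordinal Dex_gt0))). Qed.

Local Open Scope ring_scope.

Definition lamF : rat := 1 - (2 * #|Lb2|%:R)^-1.

Lemma Lb2R : 1 <= #|Lb2|%:R :> rat. Proof. by rewrite ler1n Lb2_gt0. Qed.

Lemma lamF_bounds : 0 < lamF /\ lamF < 1.
Proof.
have h := Lb2R; have h2 : 0 < (2 * #|Lb2|%:R)^-1 :> rat by rewrite invr_gt0; lra.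
have h3 : (2 * #|Lb2|%:R)^-1 <= 1 / 2 :> rat.
  by rewrite div1r lef_pV2 ?posrE //; lra.
rewrite /lamF; split; lra.
Qed.

Lemma sum_Lb2 (F : Lb2 -> rat) : \sum_l F l = \sum_(l : Lb1) F (inl l) + \sum_(l : Lb1) F (inr l).
Proof. exact: big_sumType. Qed.
Lemma sum_Lb1 (F : Lb1 -> rat) : \sum_l F l =
  \sum_(i < Dex) F (inl (inl i)) + \sum_(i < q) F (inl (inr i)) + \sum_(i < Dex) F (inr i).
Proof. by rewrite big_sumType /= big_sumType. Qed.

(** The global expander edges give the gap at the top of the spectrum, [1 / (2 d)] for degree [d];
    the self-loops, which are half of the labels, make the quadratic form nonnegative and so exclude
    negative eigenvalues. *)
Lemma specF : spec rotF lamF.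
Proof.
move=> f hf; have d1 := Lb2R; set d : rat := #|Lb2|%:R in d1.
have d0 : d != 0 by rewrite gt_eqF //; lra.
have expand s : s ^+ 2 = 1 ->
   \sum_v \sum_l (f v + s * f (nb rotF v l)) ^+ 2 = d * (2 * nrm f + 2 * s * ip f (avg rotF f)).
  move=> hs.
  have -> : \sum_v \sum_l (f v + s * f (nb rotF v l)) ^+ 2 =
     \sum_(p : 'I_N * Lb2) (f p.1 ^+ 2 + f (rotF p).1 ^+ 2 + 2 * s * (f p.1 * f (rotF p).1)).
    rewrite sum_pair; apply: eq_bigr => v _; apply: eq_bigr => l _; rewrite /nb /=.
    move: (f v) (f (rotF (v, l)).1) => a b; transitivity (a ^+ 2 + s ^+ 2 * b ^+ 2 + 2 * s * (a * b)); first by ring.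
    by rewrite hs mul1r.
  rewrite big_split /= -mulr_sumr big_split /=.
  have -> : \sum_(p : 'I_N * Lb2) f (rotF p).1 ^+ 2 = \sum_(p : 'I_N * Lb2) f p.1 ^+ 2.
    by rewrite [RHS](reindex_inj (inv_inj rotFK)).
  have -> : \sum_(p : 'I_N * Lb2) f p.1 ^+ 2 = d * nrm f.
    rewrite sum_pair /= /nrm /ip mulr_sumr.
    by apply: eq_bigr => v _; rewrite sumr_const -[_ *+ #|_|]mulr_natl expr2.
  have -> : \sum_(p : 'I_N * Lb2) f p.1 * f (rotF p).1 = d * ip f (avg rotF f).
    rewrite sum_pair /= /ip mulr_sumr.
    apply: eq_bigr => v _; rewrite /avg -mulr_sumr mulrCA; congr (_ * _).
    by rewrite mulrA divff // mul1r.
  by ring.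
have up : nrm f <= d * (2 * nrm f - 2 * ip f (avg rotF f)).
  pose F (i : nat) := f (inN i).
  have [c hc] := exN_gap F N0.
  have e2 := expand (-1) (sqrrN 1 : (-1) ^+ 2 = 1 ^+ 2 :> rat).
  have -> : d * (2 * nrm f - 2 * ip f (avg rotF f)) = \sum_v \sum_l (f v + -1 * f (nb rotF v l)) ^+ 2.
    by rewrite e2; ring.
  apply: (@le_trans _ _ (\sum_(v < N) (F v - c) ^+ 2)).
    have -> : \sum_(v < N) (F v - c) ^+ 2 = nrm f + c ^+ 2 *+ N.
      have h0 : \sum_(v < N) 2 * c * f v = 0 by rewrite -mulr_sumr hf mulr0.
      transitivity (\sum_(v < N) (f v * f v + c ^+ 2 - 2 * c * f v)).
        by apply: eq_bigr => v _ /=; rewrite /F inN_ord; ring.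
      by rewrite sumrB h0 subr0 big_split /= sumr_const card_ord.
    by rewrite lerDl mulrn_wge0 // sqr_ge0.
  apply: (le_trans hc); apply: ler_sum => v _; rewrite sum_Lb2 sum_Lb1.
  apply: (@le_trans _ _ (\sum_(i < Dex) (f v + -1 * f (nb rotF v (inl (inr i)))) ^+ 2)).
    apply: ler_sum => i _; rewrite /F inN_ord mulN1r.
    by rewrite (_ : inN (exN N v i).1 = nb rotF v (inl (inr i))) //; apply: val_inj.
  have sq (x : rat) : 0 <= x ^+ 2 by exact: sqr_ge0.
  by rewrite ler_wpDr ?sumr_ge0 // ler_wpDl ?addr_ge0 ?sumr_ge0.
have low : 0 <= ip f (avg rotF f).
  have e2 := expand 1 (expr1n _ _).
  have h : 2 * d * nrm f <= \sum_v \sum_l (f v + 1 * f (nb rotF v l)) ^+ 2.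
    rewrite /nrm /ip mulr_sumr; apply: ler_sum => v _; rewrite sum_Lb2.
    have -> : 2 * d * (f v * f v) = \sum_(l : Lb1) (f v + 1 * f (nb rotF v (inr l))) ^+ 2.
      rewrite (eq_bigr (fun=> 4 * (f v * f v))); last first.
        move=> l _; rewrite (_ : nb rotF v (inr l) = v); first by ring.
        by apply: val_inj; rewrite /= nbF.
      rewrite sumr_const -[_ *+ #|_|]mulr_natl (_ : d = #|Lb1|%:R + #|Lb1|%:R); first by ring.
      by rewrite /d card_sum natrD.
    by rewrite ler_wpDl // sumr_ge0 // => l _; exact: sqr_ge0.
  move: h; rewrite e2 => h; have : 0 <= d * (2 * ip f (avg rotF f)) by lra.
  rewrite pmulr_rge0; [lra | lra].
rewrite ger0_norm // /lamF -/d mulrBl mul1r.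
have : (2 * d)^-1 * nrm f <= nrm f - ip f (avg rotF f).
  rewrite mulrC ler_pdivrMr; lra.
by lra.
Qed.

Lemma hlamF f : \sum_v f v = 0 -> nrm (avg rotF f) <= lamF ^+ 2 * nrm f.
Proof.
move=> hf; apply: (spec_norm rotFK Lb2_gt0 lamF_bounds.1 specF hf).
Qed.

Definition view := ('I_q * TTq)%type.
Definition vview (v : nat) : view := (vslot v, vtt v).

Definition chk (l : Lb2) (x y : view) (a b : Sig) : bool :=
  match l with
  | inl (inl (inl _)) => a x.1 == b y.1
  | inl (inl (inr _)) => (a == b) && x.2 a
  | _ => true
  end.

Variable sg : nat -> Sig.
Definition viol (v : nat) (l : Lb2) : bool :=
  ~~ chk l (vview v) (vview (rotn v l).1) (sg v) (sg (rotn v l).1).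

Definition nviol : rat := \sum_(v < N) \sum_(l : Lb2) br (viol v l).

Definition vbit (v : nat) : bool := sg v (vslot v).
Definition maj_val (x : nat) : bool := (size (occ x) <= (count vbit (occ x)).*2)%N.

(** Apply the edge inequality of the cloud expander to the indicator of the minority. At most half
    of the cloud is in the minority, so for every [c] the sum of squares is at least half the size
    of the minority, and a cloud edge with different indicators is violated. *)
Lemma cloud_minority x :
  \sum_(w <- occ x) br (vbit w != maj_val x) <=
  2 * \sum_(w <- occ x) \sum_(i < Dex) br (viol w (inl (inl (inl i)))).
Proof.
set o := occ x; set k := size o.
case: (posnP k) => [k0|k0]; first by rewrite (size0nil k0) !big_nil mulr0.
pose b i := vbit (nth 0%N o i) != maj_val x.
have [c hc] := exN_gap (fun i => br (b i)) k0.
have nS (F : nat -> rat) : \sum_(w <- o) F w = \sum_(i < k) F (nth 0%N o i) by rewrite (big_nth 0%N) big_mkord.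
rewrite !nS.
have hmin : \sum_(i < k) br (b i) <= \sum_(i < k) br (~~ b i).
  have cnt (P : pred nat) : \sum_(i < k) br (P (nth 0%N o i)) = (count P o)%:R.
    rewrite -(nS (fun w => br (P w))); elim: o {nS b hc k k0} => [|w o IH]; first by rewrite big_nil.
    by rewrite big_cons IH /= natrD; case: (P w).
  rewrite (cnt (fun w => vbit w != maj_val x)) (cnt (fun w => ~~ (vbit w != maj_val x))) ler_nat.
  have := count_predC vbit o; rewrite /maj_val -/o -/k.
  case: (leqP k (count vbit o).*2) => h hp.
    rewrite (eq_count (a2 := predC vbit)); last by move=> w /=; case: (vbit w).
    rewrite (@eq_count _ (fun w => ~~ (vbit w != true)) vbit); last by move=> w /=; case: (vbit w).
    by rewrite -/k in hp; lia.
  rewrite (eq_count (a2 := vbit)); last by move=> w /=; case: (vbit w).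
  rewrite (@eq_count _ (fun w => ~~ (vbit w != false)) (predC vbit)); last by move=> w /=; case: (vbit w).
  by rewrite -/k in hp; lia.
have hlow : \sum_(i < k) br (b i) <= 2 * \sum_(i < k) (br (b i) - c) ^+ 2.
  rewrite [X in _ <= _ * X](eq_bigr (fun i : 'I_k => (1 - c) ^+ 2 * br (b i) + c ^+ 2 * br (~~ b i))); last first.
    by move=> i _; case: (b i); rewrite /br /=; ring.
  rewrite big_split /= -!mulr_sumr.
  have c2 : 0 <= c ^+ 2 by exact: sqr_ge0.
  have h1 := ler_wpM2l c2 hmin.
  have s0 : 0 <= \sum_(i < k) br (b i) by apply: sumr_ge0 => i _; exact: br_ge0.
  move: h1 s0; set S1 := \sum_(i < k) br (b i); set S2 := \sum_(i < k) _ => h1 s0.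
  have h2 : 0 <= (2 * c - 1) ^+ 2 * S1 by rewrite mulr_ge0 // sqr_ge0.
  have e : (2 * c - 1) ^+ 2 * S1 = 2 * ((1 - c) ^+ 2 * S1) + 2 * (c ^+ 2 * S1) - S1 by ring.
  by rewrite e in h2; lra.
apply: (le_trans hlow); rewrite ler_pM2l //; apply: (le_trans hc).
apply: ler_sum => i _; apply: ler_sum => j _.
have hio : nth 0%N o i \in o by rewrite mem_nth.
have : nth 0%N o i \in occ x by [].
rewrite mem_filter mem_iota => /andP [/eqP hv /andP [_ hN]].
have hidx : index (nth 0%N o i) o = i by rewrite index_uniq ?occ_uniq.
have [h1 _ _] := exN_inv (ltn_ord i) (ltn_ord j).
set e1 := (exN k i j).1 in h1 *.
have hvl : viol (nth 0%N o i) (inl (inl (inl j))) = (vbit (nth 0%N o i) != vbit (nth 0%N o e1)).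
  by rewrite /viol /chk /= hv -/o hidx -/k -/e1.
rewrite hvl /b; case: (vbit (nth 0%N o i)); case: (vbit (nth 0%N o e1)); case: (maj_val x); by rewrite /br /= ?subrr ?expr0n ?sub0r ?subr0 ?sqrrN ?expr1n.
Qed.

Lemma viol_part : \sum_(v < N) \sum_(i < Dex) br (viol v (inl (inl (inl i)))) +
  \sum_(v < N) \sum_(t < q) br (viol v (inl (inl (inr t)))) <= nviol.
Proof.
rewrite -big_split; apply: ler_sum => v _ /=; rewrite sum_Lb2 sum_Lb1 -!addrA lerD2l lerDl.
by rewrite addr_ge0 // sumr_ge0 // => l _; exact: br_ge0.
Qed.

Lemma minority : \sum_(v < N) br (vbit v != maj_val (vvar v)) <=
  2 * \sum_(v < N) \sum_(i < Dex) br (viol v (inl (inl (inl i)))).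
Proof.
pose m := (\max_(v < N) vvar v).+1.
have part (F : nat -> rat) : \sum_(v < N) F v = \sum_(x < m) \sum_(w <- occ x) F w.
  under [RHS]eq_bigr => x _ do rewrite /occ big_filter big_mkcond /=.
  rewrite [RHS]exchange_big /= -(big_mkord xpredT F) /index_iota subn0.
  apply: eq_big_seq => v; rewrite mem_iota => /andP [_ hv].
  have hm : (vvar v < m)%N by rewrite /m ltnS (leq_bigmax (F := fun v : 'I_N => vvar v) (Ordinal hv)).
  rewrite (bigD1 (Ordinal hm)) //= eqxx big1 ?addr0 // => x hx.
  by case: eqP => // e; case/eqP: hx; apply: val_inj.
rewrite (part (fun v => br (vbit v != maj_val (vvar v)))).
rewrite (part (fun v => \sum_(i < Dex) br (viol v (inl (inl (inl i)))))) mulr_sumr.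
apply: ler_sum => x _; apply: le_trans (cloud_minority x).
rewrite big_seq [X in _ <= X]big_seq; apply: ler_sum => w.
by rewrite mem_filter => /andP [/eqP -> _].
Qed.

Definition cval (c : nat) : Sig := [ffun s : 'I_q => maj_val (nth 0%N (nth c0 cs c).1 s)].

Lemma vertex_ok c (s : 'I_q) : (c < n)%N ->
  (forall t : 'I_q, ~~ viol (c * q + s)%N (inl (inl (inr t)))) ->
  (forall t : 'I_q, vbit (c * q + t)%N == maj_val (vvar (c * q + t)%N)) ->
  sg (c * q + s)%N = cval c /\ (nth c0 cs c).2 (cval c).
Proof.
move=> hc h1 h2.
have hd (t : 'I_q) : ((c * q + t) %/ q = c)%N by rewrite divnMDl // (divn_small (ltn_ord t)) addn0.
have hm (t : 'I_q) : ((c * q + t) %% q = t)%N by rewrite modnMDl (modn_small (ltn_ord t)).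
have e (t : 'I_q) : sg (c * q + s)%N = sg (c * q + t)%N /\ (nth c0 cs c).2 (sg (c * q + s)%N).
  by have := h1 t; rewrite negbK /viol /chk /= /vview /vtt /= !hd => /andP [/eqP].
have ec : sg (c * q + s)%N = cval c.
  apply/ffunP => t; have := h2 t; rewrite /vbit /vvar /vslot hd hm inq_ord ffunE => /eqP <-.
  by rewrite (e t).1.
by split => //; have [_] := e s; rewrite ec.
Qed.

Lemma sum_vert (F : nat -> rat) : \sum_(v < N) F v = \sum_(c < n) \sum_(s < q) F (c * q + s)%N.
Proof. exact: sum_mul. Qed.

(** A constraint with a bad vertex is charged to a violated edge inside the constraint or to a slot
    in the minority of its cloud, and minorities cost twice the violated cloud edges: [1 + 2] for
    the constraints, [1 + 2 q] for all their vertices. *)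
Theorem graph_sound : \sum_(c < n) br (~~ (nth c0 cs c).2 (cval c)) <= 3 * nviol /\
  \sum_(c < n) \sum_(s < q) br (sg (c * q + s)%N != cval c) <= (1 + 2 * q%:R) * nviol.
Proof.
set A := \sum_(v < N) \sum_(i < Dex) br (viol v (inl (inl (inl i)))).
set B := \sum_(v < N) \sum_(t < q) br (viol v (inl (inl (inr t)))).
have hAB := viol_part; rewrite -/A -/B in hAB.
have hmin := minority; rewrite -/A in hmin.
have A0 : 0 <= A by do 2!apply: sumr_ge0 => ? _; exact: br_ge0.
have B0' : 0 <= B by do 2!apply: sumr_ge0 => ? _; exact: br_ge0.
rewrite (sum_vert (fun v => br (vbit v != maj_val (vvar v)))) in hmin.
have eB : B = \sum_(c < n) \sum_(s < q) \sum_(t < q) br (viol (c * q + s)%N (inl (inl (inr t)))).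
  exact: (sum_vert (fun v => \sum_(t < q) br (viol v (inl (inl (inr t)))))).
have key (c : 'I_n) (s : 'I_q) (P : bool) : (sg (c * q + s)%N = cval c /\ (nth c0 cs c).2 (cval c) -> ~~ P) ->
   br P <= \sum_(t < q) br (viol (c * q + s)%N (inl (inl (inr t)))) +
     \sum_(t < q) br (vbit (c * q + t)%N != maj_val (vvar (c * q + t)%N)).
  move=> hP; case: (boolP [exists t : 'I_q, viol (c * q + s)%N (inl (inl (inr t)))]) => [/existsP [t ht]|h1].
    apply: (@le_trans _ _ 1); first exact: br_le1.
    rewrite (bigD1 t) //= ht -addrA lerDl addr_ge0 // sumr_ge0 // => i _; exact: br_ge0.
  case: (boolP [exists t : 'I_q, vbit (c * q + t)%N != maj_val (vvar (c * q + t)%N)]) => [/existsP [t ht]|h2].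
    apply: (@le_trans _ _ 1); first exact: br_le1.
    by rewrite addrC (bigD1 t) //= ht -addrA lerDl addr_ge0 // sumr_ge0 // => i _; exact: br_ge0.
  have /negPf -> : ~~ P.
    apply: hP; apply: vertex_ok => // t.
    - by move: h1; rewrite negb_exists => /forallP /(_ t).
    - by move: h2; rewrite negb_exists => /forallP /(_ t); rewrite negbK.
  by rewrite addr_ge0 // sumr_ge0 // => i _; exact: br_ge0.
split.
- apply: (@le_trans _ _ (B + 2 * A)); last by lra.
  apply: le_trans (lerD (lexx _) hmin); rewrite eB -big_split; apply: ler_sum => c _ /=.
  apply: (le_trans (key c (Ordinal q0) _ _)); first by case=> _ ->.
  rewrite lerD2r [X in _ <= X](bigD1 (Ordinal q0)) //= lerDl.
  by do 2!apply: sumr_ge0 => ? _; exact: br_ge0.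
- apply: (@le_trans _ _ (B + q%:R * (2 * A))); last first.
    have qR : 0 <= q%:R :> rat by rewrite ler0n.
    have h3 : A <= nviol by lra.
    have h4 := ler_wpM2l qR h3; lra.
  apply: le_trans (lerD (lexx _) (ler_wpM2l (ler0n _ q) hmin)).
  rewrite eB mulr_sumr -big_split; apply: ler_sum => c _ /=.
  apply: (@le_trans _ _ (\sum_(s < q) (\sum_(t < q) br (viol (c * q + s)%N (inl (inl (inr t)))) +
     \sum_(t < q) br (vbit (c * q + t)%N != maj_val (vvar (c * q + t)%N))))).
    by apply: ler_sum => s _; apply: key => -[-> _]; rewrite eqxx.
  by rewrite big_split /= sumr_const card_ord [q%:R * _]mulr_natl.
Qed.

Lemma graph_complete (y : nat -> bool) :
  (forall v, sg v = [ffun s : 'I_q => y (nth 0%N (nth c0 cs (v %/ q)).1 s)]) ->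
  (forall c, (c < n)%N -> (nth c0 cs c).2 [ffun s : 'I_q => y (nth 0%N (nth c0 cs c).1 s)]) ->
  forall v l, (v < N)%N -> ~~ viol v l.
Proof.
move=> hsg hc v l hv; rewrite negbK /chk; case: l => [[[i|t]|i]|l] //.
- have hw : (rotn v (inl (inl (inl i)))).1 \in occ (vvar v).
    have hm := mem_occ hv; set o := occ (vvar v) in hm *.
    have hi : (index v o < size o)%N by rewrite index_mem.
    have [h1 _ _] := exN_inv hi (ltn_ord i).
    by rewrite /= -/o mem_nth.
  move: hw; rewrite mem_filter => /andP [/eqP hvw _].
  rewrite /vview /= !hsg !ffunE /vslot !inqK ?ltn_mod //.
  by move: hvw; rewrite /vvar /= => ->.
- rewrite /= !hsg divnMDl // (divn_small (ltn_ord t)) addn0 eqxx /vview /= /vtt.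
  by apply: hc; rewrite ltn_divLR.
Qed.

End Graph.

(** * One round of gap amplification *)

Notation "f +^ g" := (xf f g) (at level 50, left associativity).

Section Instance.
Variable q : nat.

Definition link := (nat * (nat * nat))%type.
(* An instance is a list of constraints together with a list of links: the link [(x, (y0, y1))]
   asserts that the exclusive or of the proof bits [y0] and [y1] is bit [x] of the word
   the proof speaks about. *)
Definition inst := (seq (cstr q) * seq link)%type.

Definition sat (y : nat -> bool) (t : cstr q) : bool := t.2 [ffun s : 'I_q => y (nth 0 t.1 s)].
Definition lkok (w y : nat -> bool) (l : link) : bool := (y l.2.1 (+) y l.2.2) == w l.1.

Definition Uns (I : inst) (y : nat -> bool) : rat :=
  ((\sum_(t <- I.1) br (~~ sat y t)) / (size I.1)%:R)%R.
Definition Lkd (I : inst) (w y : nat -> bool) : rat :=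
  ((\sum_(l <- I.2) br (~~ lkok w y l)) / (size I.2)%:R)%R.
(** Equal numbers of tests and links allow one random index to select a test and a link at once. *)
Definition okI (I : inst) := 0 < size I.1 /\ size I.2 = size I.1.

End Instance.

Section StepDef.
Variables (q M : nat).
Hypotheses (q10 : 9 < q) (M0 : 0 < M).

Lemma q0 : 0 < q. Proof. exact: leq_trans q10. Qed.

Notation Lb := (Lb2 q).
Definition l0 : Lb := inr (inr (Ordinal Dex_gt0)).
(** A walk of variable length is an offset of the length together with a tuple of maximal length, of
    which a prefix is taken; a uniform element gives a uniform walk of a uniform length in the
    window. *)
Definition Om2 : finType := ('I_M * (2 * M).-tuple Lb)%type.
Definition Om : finType := ('I_(2 * M) * (4 * M).-tuple Lb)%type.
Definition Ix : finType := (Om2 * 'I_q)%type.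
Definition KK : finType := (Om * Om2 * WW Ix)%type.
Definition KL : finType := ('I_q * bool * KK)%type.

Definition inM (i : nat) : 'I_M := insubd (Ordinal M0) i.
Definition pk (p : seq Lb) : Om2 := (inM (size p - M), [tuple nth l0 p i | i < 2 * M]).
Definition opS (a : Sg Ix) (p : seq Lb) : Sig q := [ffun t : 'I_q => a (pk p, t)].
Definition path1 (o : Om) : seq Lb := take (2 * M + o.1) o.2.
Definition path2 (o : Om2) : seq Lb := take (M + o.1) o.2.

Definition rk (T : finType) (x : T) : nat := enum_rank x.
(** Even proof bits hold the Hadamard words of the vertices' opinions, odd ones the long-code words
    attached to a vertex and a walk. *)
Definition varA (v : nat) (z : Sg Ix) : nat := (v * #|{: Sg Ix}| + rk z).*2.
Definition varP (v : nat) (o : Om) (f : UU Ix) : nat :=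
  (v * #|{: Om * UU Ix}| + rk (o, f)).*2.+1.

(** A link enters the graph as an always satisfied constraint on its two bits. This places the bits
    in their clouds, so that some vertices hold opinions about them. *)
Definition lkc (l : link) : cstr q := ([:: l.2.1; l.2.2], [ffun=> true]).
Definition csI (I : inst q) : seq (cstr q) := I.1 ++ map lkc I.2.
Definition rotP (I : inst q) (p : nat * Lb) : nat * Lb := rotn q0 (csI I) p.1 p.2.

Definition passN (I : inst q) (v : nat) (ls : seq Lb) (p : TT Ix) : bool :=
  [forall k : 'I_M, forall j : 'I_M,
    ((M + k + (M + j).+1 == size ls) ==>
      (let u := (wk (rotP I) v (take (M + k) ls)).1 in let l := nth l0 ls (M + k) in
       chk l (vview q0 (csI I) u) (vview q0 (csI I) (rotP I (u, l)).1)
         (opS p.1 (take (M + k) ls)) (opS p.2 (take (M + j) (wk (rotP I) v ls).2))))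
    && ((M + k + (M + j) == size ls) ==>
      (opS p.1 (take (M + k) ls) == opS p.2 (take (M + j) (wk (rotP I) v ls).2)))].

(** The decision of [gtest] as a table over its ten queried bits, whence the requirement [9 < q]. *)
Definition G10 : TTq q := [ffun a : Sig q => let b k := a (inq q0 k) in
  [&& b 0 (+) b 1 == b 2, (b 0 && b 1) == b 3 (+) b 4, b 5 (+) b 4,
      b 8 == b 6 (+) b 4 & b 9 == b 7 (+) b 4]].

Definition ftest (I : inst q) (v : nat) (k : KK) : cstr q :=
  let o := k.1.1 in let '(f, g, h, z1, z2) := k.2 in
  let P := varP v o in
  ([:: P f; P g; P (f +^ g); P (mulU f g +^ h); P h; P (indS (passN I v (path1 o)) +^ h);
       P (lin1 z1 +^ h); P (lin2 z2 +^ h); varA v z1; varA (wk (rotP I) v (path1 o)).1 z2], G10).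

Definition unit2 (o : Om2) : Sg Ix := [ffun x => (x == (o, inq q0 0)) || (x == (o, inq q0 1))].

(** A vertex of an old link is approached by a random walk, and its far end is asked for its
    opinion: the exclusive or of the first two slots is a Hadamard coordinate, read through two
    uniform positions. The label is inherited, which keeps the distribution of labels. *)
Definition flink (I : inst q) (j : nat) (k : KL) : link :=
  let e := wk (rotP I) ((size I.1 + j) * q + k.1.1) (path2 k.2.1.2) in
  let z := k.2.2.2 in
  ((nth (0, (0, 0)) I.2 j).1, (varA e.1 z, varA e.1 (z +^ unit2 (pk e.2)))).

Definition stepI (I : inst q) : inst q :=
  ([seq ftest I v k | v <- iota 0 (size (csI I) * q), k <- enum KK],
   [seq flink I j k | j <- iota 0 (size I.1), k <- enum KL]).

Lemma size_csI I : okI I -> size (csI I) = size I.1 + size I.1.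
Proof. by case=> _ h; rewrite size_cat size_map h. Qed.

Lemma KK_gt0 : 0 < #|KK|.
Proof.
apply/card_gt0P; have h : 0 < 2 * M by rewrite muln_gt0.
exists (((Ordinal h, [tuple of nseq (4 * M) l0]), (inM 0, [tuple of nseq (2 * M) l0])),
  (zf _, zf _, zf _, zf _, zf _)); by [].
Qed.

Lemma Om_gt0 : 0 < #|Om|.
Proof. by have := KK_gt0; rewrite !card_prod !muln_gt0 => /andP [] /andP []. Qed.
Lemma Om2_gt0 : 0 < #|Om2|.
Proof. by have := KK_gt0; rewrite !card_prod !muln_gt0 => /andP [] /andP []. Qed.
Lemma WW_gt0 : 0 < #|{: WW Ix}|.
Proof. by have := KK_gt0; rewrite !card_prod !muln_gt0 => /andP []. Qed.

Lemma step_size I : okI I -> size (stepI I).1 = size I.1 * (2 * q * #|KK|) /\ okI (stepI I).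
Proof.
move=> hI; have hs := size_csI hI; have [h0 h1] := hI.
have e1 : size (stepI I).1 = size I.1 * (2 * q * #|KK|).
  rewrite size_allpairs size_iota hs (_ : size (enum KK) = #|KK|) ?cardE //.
  by move: (size (enum KK)) => c; ring.
split=> //; split; first by rewrite e1 !muln_gt0 h0 KK_gt0 q0.
rewrite e1 size_allpairs size_iota.
have -> : size (enum KL) = q * 2 * #|KK| by rewrite -cardE /KL !card_prod card_ord card_bool.
by move: #|KK| => c; ring.
Qed.

Lemma flink1 I j k : (flink I j k).1 = (nth (0, (0, 0)) I.2 j).1. Proof. exact: erefl. Qed.

Lemma step_label I l : okI I -> l \in (stepI I).2 -> l.1 \in map fst I.2.
Proof.
move=> [h0 h1]; have -> : (stepI I).2 = [seq flink I j k | j <- iota 0 (size I.1), k <- enum KL] by exact: erefl.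
case/allpairsPdep => j [k [hj _ ->]]; rewrite mem_iota in hj; rewrite flink1 -h1 in hj *.
exact: (map_f fst (mem_nth _ hj)).
Qed.

Lemma unit2E a o : had a (unit2 o) = a (o, inq q0 0) (+) a (o, inq q0 1).
Proof.
have ne : inq q0 0 != inq q0 1.
  by apply/eqP => /(congr1 val) /=; rewrite !inqK //; exact: leq_trans q10.
rewrite /had (bigD1 (o, inq q0 0)) //= (bigD1 (o, inq q0 1)) /=; last first.
  by apply/eqP => -[] /eqP; rewrite eq_sym (negPf ne).
rewrite !ffunE !eqxx orbT !andbT big1 ?addbF // => i /andP [/negPf h1 /negPf h2].
by rewrite ffunE h1 h2 andbF.
Qed.

Lemma sat_ftest I (y : nat -> bool) v k :
  sat y (ftest I v k) = gtest (passN I v (path1 k.1.1)) (fun z => y (varA v z))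
     (fun z => y (varA (wk (rotP I) v (path1 k.1.1)).1 z)) (fun f => y (varP v k.1.1 f)) k.2.
Proof.
case: k => [[o o2] [[[[f g] h] z1] z2]]; rewrite /sat /ftest /= ffunE /= !ffunE.
by rewrite !inqK //=; exact: leq_trans q10.
Qed.

Lemma sum_iota_enum (T : Type) (K : finType) n (f : nat -> K -> T) (F : T -> rat) :
  (\sum_(t <- [seq f v k | v <- iota 0 n, k <- enum K]) F t = \sum_(v < n) \sum_k F (f v k))%R.
Proof.
rewrite -(big_mkord xpredT (fun v => \sum_k F (f v k))%R) /index_iota subn0 big_allpairs_dep /=.
by apply: eq_bigr => v _; rewrite big_enum.
Qed.

End StepDef.

(** * Completeness and soundness of one round *)

Section StepFacts.
Variables (q M : nat).
Hypotheses (q10 : 9 < q) (M0 : 0 < M).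
Variable I : inst q.
Hypothesis hI : okI I.
Notation Lb := (Lb2 q).
Notation q0 := (q0 q10).
Notation cs := (csI I).
Notation m := (size I.1).
Notation N := (size cs * q).
Notation rotP := (rotP q10 I).
Notation Ix := (Ix q M).

Lemma N0 : 0 < N.
Proof. by rewrite size_csI // muln_gt0 q0 addn_gt0 hI.1. Qed.

Notation rotF := (rotF q0 N0).
Notation inN := (inN N0).

Lemma rotPF v l : rotP (nat_of_ord v, l) = (val (rotF (v, l)).1, (rotF (v, l)).2).
Proof.
by rewrite /rotP /rotF /= inNK -?surjective_pairing //; have [] := rotn_inv q0 l (ltn_ord v).
Qed.

Lemma wkF (v : 'I_N) ls : wk rotP v ls = (val (wk rotF v ls).1, (wk rotF v ls).2).
Proof. by elim: ls v => //= l ls IH v; rewrite rotPF /= IH. Qed.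

Lemma sat_test y c : c < m -> (nth (c0 q) cs c).2 [ffun s : 'I_q => y (nth 0 (nth (c0 q) cs c).1 s)] =
  sat y (nth (c0 q) I.1 c).
Proof. by move=> hc; rewrite nth_cat hc. Qed.

Lemma nth_link j : j < m -> nth (c0 q) cs (m + j) = lkc q (nth (0, (0, 0)) I.2 j).
Proof.
move=> hj; rewrite nth_cat ltnNge leq_addr /= addKn (nth_map (0, (0, 0))) //.
by rewrite hI.2.
Qed.

Lemma take_pk (p : seq Lb) : M <= size p < 2 * M -> path2 (pk M0 p) = p.
Proof.
move=> /andP [h1 h2]; have hM : size p - M < M by lia.
rewrite /path2 /pk /= /inM insubdK; last exact: hM.
rewrite subnKC //; apply: (@eq_from_nth _ (l0 q)).
  by rewrite size_take size_map size_enum_ord h2.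
move=> i; rewrite size_take size_map size_enum_ord h2 => hi; rewrite nth_take //.
by rewrite (nth_map (Ordinal (ltn_trans hi h2))) ?size_enum_ord ?nth_enum_ord //; exact: ltn_trans h2.
Qed.

Lemma size_path2 (o : Om2 q M) : M <= size (path2 o) < 2 * M.
Proof.
case: o => i t; have h := ltn_ord i; have e : size t = 2 * M by exact: size_tuple.
by rewrite /path2 /= size_takel ?e; lia.
Qed.

Section Complete.
Variables (w y : nat -> bool).
Hypothesis hy : forall t, t \in I.1 -> sat y t.
Hypothesis hw : forall l, l \in I.2 -> lkok w y l.

Definition csg (v : nat) : Sig q := [ffun s : 'I_q => y (nth 0 (nth (c0 q) cs (v %/ q)).1 s)].
Definition ca (v : nat) : Sg Ix := [ffun x => csg (wk rotP v (path2 x.1)).1 x.2].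
Definition cy (n : nat) : bool :=
  if odd n then
    let d := #|{: Om q M * UU Ix}| in
    if nth None (map some (enum {: Om q M * UU Ix})) (n./2 %% d) is Some (o, f) then
      f (ca (n./2 %/ d), ca (wk rotP (n./2 %/ d) (path1 o)).1) else false
  else
    let d := #|{: Sg Ix}| in
    had (ca (n./2 %/ d)) (nth (zf _) (enum {: Sg Ix}) (n./2 %% d)).

Lemma half_odd (n : nat) : n.*2.+1./2 = n. Proof. by rewrite /= uphalf_double. Qed.

Lemma rk_lt (T : finType) (x : T) : rk x < #|T|. Proof. exact: ltn_ord. Qed.

Lemma cyA v z : cy (varA v z) = had (ca v) z.
Proof.
have h := rk_lt z; have h0 : 0 < #|{: Sg Ix}| by exact: leq_ltn_trans h.
rewrite /cy odd_double /= doubleK divnMDl // (divn_small h) addn0 modnMDl (modn_small h).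
by rewrite /rk -(enum_val_nth (zf _) (enum_rank z)) enum_rankK.
Qed.

Lemma cyP v o f : cy (varP v o f) = f (ca v, ca (wk rotP v (path1 o)).1).
Proof.
have h := rk_lt (o, f); have h0 : 0 < #|{: Om q M * UU Ix}| by exact: leq_ltn_trans h.
rewrite /cy /varP half_odd oddS odd_double.
rewrite divnMDl // (divn_small h) addn0 modnMDl (modn_small h).
rewrite (nth_map (o, f)) -?cardE //.
by rewrite /rk -(enum_val_nth (o, f) (enum_rank (o, f))) enum_rankK.
Qed.

Lemma ca_op v p : M <= size p < 2 * M -> opS M0 (ca v) p = csg (wk rotP v p).1.
Proof. by move=> hp; apply/ffunP => t; rewrite !ffunE /= take_pk // ffunE. Qed.

Lemma cs_ok c : c < size cs -> (nth (c0 q) cs c).2 [ffun s : 'I_q => y (nth 0 (nth (c0 q) cs c).1 s)].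
Proof.
move=> hc; case: (ltnP c m) => h; first by rewrite sat_test //; apply: hy; rewrite mem_nth.
by rewrite -(subnKC h) nth_link ?ffunE //; move: hc; rewrite size_csI //; lia.
Qed.

Lemma ca_pass v ls : v < N -> passN q10 M0 I v ls (ca v, ca (wk rotP v ls).1).
Proof.
move=> hv; have -> : v = val (inN v) by rewrite /= inNK.
move: (inN v) => {hv} {}v.
have key (k j b : nat) : k < M -> j < M -> M + k + (M + j) + b = size ls ->
  [/\ opS M0 (ca v) (take (M + k) ls) = csg (wk rotP v (take (M + k) ls)).1 &
  opS M0 (ca (wk rotP v ls).1) (take (M + j) (wk rotP v ls).2) = csg (wk rotP v (take (M + k + b) ls)).1].
  move=> hk hj hs; split; rewrite ca_op //; first by rewrite size_takel; lia.
    set d := drop (M + k + b) ls; set p1 := take (M + k + b) ls.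
    have -> : wk rotP v ls = wk rotP v (p1 ++ d) by rewrite cat_take_drop.
    rewrite wkF wk_cat /=; set u := (wk rotF v p1).1.
    have hd : size d = M + j by rewrite size_drop; lia.
    rewrite take_size_cat; last by rewrite size_wk hd.
    by rewrite !wkF /= (wkK (@rotFK _ q0 _ N0)).
  have e : size (wk rotF v ls).2 = size ls by exact: size_wk.
  by rewrite wkF /= size_takel ?e; lia.
apply/forallP => k; apply/forallP => j; apply/andP; split; apply/implyP => /eqP hs.
  have hb : M + k + (M + j) + 1 = size ls by lia.
  have [-> ->] := key _ _ 1 (ltn_ord k) (ltn_ord j) hb.
  have hk : M + k < size ls by lia.
  rewrite addn1 (take_nth (l0 q)) // -cats1 !wkF /= wk_cat /=.
  set u := (wk rotF v _).1; set l := nth _ _ _.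
  have := graph_complete q0 (sg := csg) (fun v => erefl) cs_ok l (ltn_ord u).
  by rewrite negbK /rotP /= inNK //; have [] := rotn_inv q0 l (ltn_ord u).
have hb : M + k + (M + j) + 0 = size ls by lia.
by have [-> ->] := key _ _ 0 (ltn_ord k) (ltn_ord j) hb; rewrite addn0.
Qed.

Theorem step_complete : exists y', (forall t, t \in (stepI q10 M0 I).1 -> sat y' t) /\
  (forall l, l \in (stepI q10 M0 I).2 -> lkok w y' l).
Proof.
exists cy; split.
  move=> t /allpairsP [[v k] [hv _ ->]]; rewrite sat_ftest.
  have hp : v < N by move: hv; rewrite mem_iota.
  have := gadget_complete k.2 (ca_pass (path1 k.1.1) hp).
  by rewrite /gtest; case: (k.2) => [[[[f g] h] z1] z2]; rewrite !cyP !cyA.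
move=> l /allpairsP [[v k] [hv _ ->]].
have hj : v < m by move: hv; rewrite mem_iota.
rewrite /lkok /flink !cyA hadD addbA addbb addFb unit2E.
set e := wk _ _ _; set u := (_ + _)%N in e *.
have hu : u < N by rewrite size_csI //; apply: lt_pair; rewrite ?ltn_ord // ltn_add2l.
set p := path2 _ in e *; have hp : M <= size p < 2 * M by exact: size_path2.
have ee : (opS M0 (ca e.1) e.2) = csg u.
  rewrite /e; have -> : u = val (inN u) by rewrite /= inNK.
  rewrite ca_op wkF /=; last by rewrite size_wk.
  by rewrite wkF /= (wkK (@rotFK _ q0 _ N0)).
have e0 (t : 'I_q) : ca e.1 (pk M0 e.2, t) = csg u t by rewrite -ee [RHS]ffunE.
have ud : u %/ q = m + v by rewrite /u divnMDl ?q0 // (divn_small (ltn_ord _)) addn0.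
rewrite !e0 !ffunE ud nth_link //= !inqK ?q0 //; last exact: leq_trans q10.
by have := hw (mem_nth (0, (0, 0)) (_ : v < size I.2)); rewrite hI.2; apply.
Qed.

End Complete.

Section Sound.
Local Open Scope ring_scope.
Variable y' : nat -> bool.

Definition Av (v : nat) (z : Sg Ix) : bool := y' (varA v z).
(** Below distance 1/4 the Hadamard word is unique, so the decoded opinions of [v] do not depend on
    the walk on which [v] was tested. *)
Definition av (v : nat) : Sg Ix := odflt (zf _) [pick a | distA (Av v) a < 1 / 4].
Definition rho (v : nat) (o : Om q M) : rat :=
  rej (passN q10 M0 I v (path1 o)) (Av v) (Av (wk rotP v (path1 o)).1) (fun f => y' (varP v o f)).

Lemma av_eq v a : distA (Av v) a < 1 / 4 -> av v = a.
Proof.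
move=> h; rewrite /av; case: pickP => [b hb|/(_ a)] /=; last by rewrite h.
exact: had_unique hb h.
Qed.

Lemma rho_ge0 v o : 0 <= rho v o.
Proof. by apply: E_ge0 => ?; exact: br_ge0. Qed.

Lemma distA_le1 (A : Sg Ix -> bool) a : distA A a <= 1 :> rat.
Proof.
rewrite -(E_const 1 (Sg_gt0 Ix)); apply: E_le => z; exact: br_le1.
Qed.

(** If [rho v o] is at least 1/37 both bounds are trivial; otherwise [gadget_sound] provides a
    passing pair that must coincide with the decoded opinions. *)
Lemma local_sound v o :
  distA (Av v) (av v) <= 37 * rho v o /\
  br (~~ passN q10 M0 I v (path1 o) (av v, av (wk rotP v (path1 o)).1)) <= 37 * rho v o.
Proof.
have r0 := rho_ge0 v o; case: (ltP (rho v o) (1 / 37)) => h; last first.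
  have h1 : 1 <= 37 * rho v o by lra.
  by split; apply: le_trans h1; rewrite ?br_le1 ?distA_le1.
have [a [b [hS ha hb]]] := gadget_sound h; rewrite -/(rho v o) in ha hb.
have ea : av v = a by apply: av_eq; lra.
have eb : av (wk rotP v (path1 o)).1 = b by apply: av_eq; lra.
split; first by rewrite ea; lra.
by rewrite ea eb hS /br /= mulr_ge0.
Qed.

Lemma Uns_step : Uns (stepI q10 M0 I) y' = E (fun v : 'I_N => E (rho v)).
Proof.
rewrite /Uns sum_iota_enum.
have -> : (size (stepI q10 M0 I).1)%:R = N%:R * #|KK q M|%:R :> rat.
  by rewrite size_allpairs size_iota -cardE natrM.
rewrite invfM [_^-1 * _]mulrC mulrA {1}/E card_ord; congr (_ / _).
rewrite mulr_suml; apply: eq_bigr => v _.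
rewrite -[LHS]/(E (fun k : KK q M => br (~~ sat y' (ftest q10 M0 I v k)))).
rewrite E_pair E_pair; apply: eq_E => o.
rewrite (eq_E (G := fun=> rho v o)); first by rewrite E_const // (Om2_gt0 q M0).
by move=> o2; apply: eq_E => w; rewrite sat_ftest.
Qed.

Definition opA (v : 'I_N) (p : seq Lb) : Sig q := opS M0 (av v) p.
Definition cF (e : 'I_N * Lb) : Sig q -> Sig q -> bool :=
  chk e.2 (vview q0 cs e.1) (vview q0 cs (rotP (nat_of_ord e.1, e.2)).1).
Notation passF := (pass rotF cF M (l0 q) opA).
Notation u' := (Uns (stepI q10 M0 I) y').
Definition sg0 : Sig q := zf _.
Notation decF := (dec rotF M opA sg0).
Notation phiF := (phi rotF cF M opA sg0).
Notation BadF := (Bad rotF M opA sg0).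

Lemma passNF (v : 'I_N) ls : passF v ls = passN q10 M0 I v ls (av v, av (wk rotP v ls).1).
Proof.
rewrite /pass /passN; apply: eq_forallb => k; apply: eq_forallb => j.
by rewrite /passE /passV /cF /opA /= !wkF.
Qed.

Lemma E_walk n k (F : seq Lb -> rat) : (n <= k)%N ->
  E (fun t : k.-tuple Lb => F (take n t)) = EW n F.
Proof. by move=> h; rewrite (EW_tuple k (fun ls => F (take n ls))) (EW_take (Lb2_gt0 _)). Qed.

Lemma prejF : prej rotF cF M (l0 q) opA <= 37 * u'.
Proof.
rewrite Uns_step /prej E_swap -E_scale; apply: E_le => v; rewrite -E_scale.
have -> : E (fun i : 'I_(2 * M) => EW (2 * M + i) (fun ls => br (~~ passF v ls)))
   = E (fun o : Om q M => br (~~ passF v (path1 o))).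
  rewrite E_pair; apply: eq_E => i; rewrite /path1 /=.
  rewrite -(E_walk (k := (4 * M)%N) (fun ls => br (~~ passF v ls))) //; by have := ltn_ord i; lia.
by apply: E_le => o; rewrite passNF; exact: (local_sound v o).2.
Qed.

Lemma distF : E (fun v : 'I_N => distA (Av v) (av v)) <= 37 * u'.
Proof.
rewrite Uns_step -E_scale; apply: E_le => v.
rewrite -E_scale -(E_const (distA (Av v) (av v)) (Om_gt0 q M0)); apply: E_le => o.
exact: (local_sound v o).1.
Qed.

Definition sgF (v : nat) : Sig q := decF (inN v).
Definition yF : nat -> bool := maj_val q0 cs sgF.

Lemma nviolF : nviol q0 cs sgF = N%:R * #|Lb|%:R * phiF.
Proof.
have LR : (#|Lb|%:R : rat) != 0 by rewrite pnatr_eq0 -lt0n Lb2_gt0.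
have NR : (N%:R : rat) != 0 by rewrite pnatr_eq0 -lt0n N0.
rewrite [RHS]mulrC /phi /E card_prod card_ord natrM mulfVK ?mulf_neq0 //.
rewrite sum_pair; apply: eq_bigr => v _; apply: eq_bigr => l _; congr (br (~~ _)).
rewrite /cF /sgF /= inN_ord; congr (chk _ _ _ _ (decF _)).
Qed.

Lemma cval_test c : (c < m)%N -> (nth (c0 q) cs c).2 (cval q0 cs sgF c) = sat yF (nth (c0 q) I.1 c).
Proof. by move=> hc; rewrite -sat_test. Qed.

Lemma N_R : N%:R = (m%:R + m%:R) * q%:R :> rat.
Proof. by rewrite natrM size_csI // natrD. Qed.

Lemma Uns_old : Uns I yF <= 6 * q%:R * #|Lb|%:R * phiF.
Proof.
have [h1 _] := graph_sound q0 N0 sgF.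
have mR : 0 < m%:R :> rat by rewrite ltr0n hI.1.
rewrite /Uns ler_pdivrMr //.
have -> : \sum_(t <- I.1) br (~~ sat yF t) = \sum_(c < m) br (~~ (nth (c0 q) cs c).2 (cval q0 cs sgF c)).
  by rewrite (big_nth (c0 q)) big_mkord; apply: eq_bigr => c _; rewrite cval_test.
apply: (@le_trans _ _ (\sum_(c < size cs) br (~~ (nth (c0 q) cs c).2 (cval q0 cs sgF c)))).
  rewrite size_csI // big_split_ord /= lerDl sumr_ge0 // => j _; exact: br_ge0.
apply: (le_trans h1); rewrite nviolF N_R; apply: eqW.
by ring.
Qed.

(** The vertices of the links are one half of all vertices, so an average over them is at most twice
    the overall average. *)
Lemma half_vertices (X : nat -> rat) : (forall v, 0 <= X v) ->
  E (fun j : 'I_m => E (fun s : 'I_q => X ((m + j) * q + s)%N)) <= 2 * E (fun v : 'I_N => X v).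
Proof.
move=> X0; have mR : 0 < m%:R :> rat by rewrite ltr0n hI.1.
have qR : 0 < q%:R :> rat by rewrite ltr0n q0.
rewrite /E !card_ord sum_vert size_csI // big_split_ord /= natrM natrD.
rewrite -mulr_suml -mulrA -invfM.
set S1 := \sum_(i < m) _; set S0 := \sum_(i < m) _.
have h0 : 0 <= S0 by apply: sumr_ge0 => i _; apply: sumr_ge0.
have -> : 2 * ((S0 + S1) / ((m%:R + m%:R) * q%:R)) = (S0 + S1) / (q%:R * m%:R) by field; lra.
by rewrite ler_pM2r ?invr_gt0 ?mulr_gt0 // lerDr.
Qed.

Lemma E_Sg (F : Sg Ix -> rat) : E (fun w : WW Ix => F w.2) = E F.
Proof.
transitivity (E (fun f : UU Ix => E (fun g : UU Ix => E (fun h : UU Ix => E (fun z1 : Sg Ix => E F))))).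
  exact: (E5 (fun w : WW Ix => F w.2)).
rewrite (E_const _ (UU_gt0 _)) (E_const _ (UU_gt0 _)) (E_const _ (UU_gt0 _)).
exact: (E_const _ (Sg_gt0 _)).
Qed.

Section Links.
Variable w : nat -> bool.

Lemma link_point j (s : 'I_q) (z : Sg Ix) v (e : nat * seq Lb) l : (j < m)%N ->
  v = ((m + j) * q + s)%N -> l = nth (0, (0, 0))%N I.2 j ->
  br ((Av e.1 z (+) Av e.1 (z +^ unit2 q10 (pk M0 e.2))) != w l.1) <=
  br (~~ lkok w yF l) + br (sgF v != cval q0 cs sgF (m + j)) + br (opS M0 (av e.1) e.2 != sgF v)
   + br (Av e.1 z != had (av e.1) z)
   + br (Av e.1 (z +^ unit2 q10 (pk M0 e.2)) != had (av e.1) (z +^ unit2 q10 (pk M0 e.2))).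
Proof.
move=> hj hv hl; set u := unit2 _ _.
apply: le_trans (lerD (lerD (lerD (br_or _ _) (lexx _)) (lexx _)) (lexx _)).
apply: le_trans (lerD (lerD (br_or _ _) (lexx _)) (lexx _)).
apply: le_trans (lerD (br_or _ _) (lexx _)).
apply: le_trans (br_or _ _); apply: br_imp; apply: contraNT.
rewrite !negb_or !negbK -!andbA => /and5P [/eqP <- /eqP h1 /eqP h2 /eqP -> /eqP ->].
rewrite hadD addbA addbb addFb unit2E.
have e0 (t : 'I_q) : av e.1 (pk M0 e.2, t) = cval q0 cs sgF (m + j) t by rewrite -h1 -h2 [RHS]ffunE.
have q1 : (1 < q)%N by exact: leq_trans q10.
rewrite !e0 !ffunE nth_link // -hl !inqK ?q0 //=.
Qed.

(** The walk to the reporting vertex ends at a uniform vertex, so the Hadamard errors average to the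
    mean distance of the words; the chance that a report differs from the plurality is [Bad] by
    definition. Restricting to vertices of links costs a factor 2, and the two queries of a link
    another 2. *)
Lemma Lkd_new : Lkd (stepI q10 M0 I) w y' <= Lkd I w yF
  + 2 * (1 + 2 * q%:R) * #|Lb|%:R * phiF + 2 * E BadF
  + 4 * E (fun v : 'I_N => distA (Av v) (av v)).
Proof.
have mR : 0 < m%:R :> rat by rewrite ltr0n hI.1.
have qR : 0 < q%:R :> rat by rewrite ltr0n q0.
pose EB := E BadF; rewrite -[E BadF]/EB.
pose T j (k : KL q M) := br (~~ lkok w y' (flink q10 M0 I j k)).
have -> : Lkd (stepI q10 M0 I) w y' = E (fun j : 'I_m => E (fun k : KL q M => T j k)).
  rewrite /Lkd sum_iota_enum size_allpairs size_iota -cardE natrM invfM [_^-1 * _]mulrC mulrA {1}/E card_ord.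
  by congr (_ / _); rewrite mulr_suml.
pose ed j (s : 'I_q) o := wk rotP ((m + j) * q + s)%N (@path2 q M o).
pose dd v := distA (Av v) (av v).
have hT (j : 'I_m) : E (T j) <= br (~~ lkok w yF (nth (0, (0, 0))%N I.2 j)) +
    E (fun s : 'I_q => br (sgF ((m + j) * q + s)%N != cval q0 cs sgF (m + j))) +
    E (fun s : 'I_q => E (fun o => br (opS M0 (av (ed j s o).1) (ed j s o).2 != sgF ((m + j) * q + s)%N))) +
    2 * E (fun s : 'I_q => E (fun o => dd (ed j s o).1)).
  rewrite E_pair E_pair -(E_const (br (~~ lkok w yF (nth (0, (0, 0))%N I.2 j))) (IM0 q0)).
  rewrite -E_scale -!E_add; apply: E_le => s.
  rewrite -[X in _ <= X](E_const _ (_ : (0 < #|{: bool}|)%N)) ?card_bool //; apply: E_le => b.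
  rewrite E_pair E_pair -[X in _ <= X](E_const _ (Om_gt0 q M0)); apply: E_le => o1.
  rewrite -[X in X + _ + _](E_const _ (Om2_gt0 q M0)).
  rewrite -E_scale -!E_add; apply: E_le => o.
  apply: le_trans (_ : E (fun ww : WW Ix => br (~~ lkok w yF (nth (0, (0, 0))%N I.2 j))
      + br (sgF ((m + j) * q + s)%N != cval q0 cs sgF (m + j))
      + br (opS M0 (av (ed j s o).1) (ed j s o).2 != sgF ((m + j) * q + s)%N)
      + br (Av (ed j s o).1 ww.2 != had (av (ed j s o).1) ww.2)
      + br (Av (ed j s o).1 (ww.2 +^ unit2 q10 (pk M0 (ed j s o).2)) !=
         had (av (ed j s o).1) (ww.2 +^ unit2 q10 (pk M0 (ed j s o).2)))) <= _).
    by apply: E_le => ww; exact: (link_point ww.2 (ed j s o) (ltn_ord j)).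
  rewrite !E_add !E_const ?(WW_gt0 q M0) //.
  rewrite (E_Sg (fun z => br (Av (ed j s o).1 z != had (av (ed j s o).1) z))).
  rewrite (E_Sg (fun z => br (Av (ed j s o).1 (z +^ _) != had (av (ed j s o).1) (z +^ _)))).
  rewrite (eq_E (F := fun z => br (Av _ (z +^ _) != _)) (G := fun z => br (Av (ed j s o).1 (unit2 q10 (pk M0 (ed j s o).2) +^ z) !=
         had (av (ed j s o).1) (unit2 q10 (pk M0 (ed j s o).2) +^ z)))); last by move=> z; rewrite xfC.
  rewrite (E_inj (fun z => br (Av (ed j s o).1 z != had (av (ed j s o).1) z)) (@xfI _ _)).
  by rewrite -/(distA _ _) -/(dd _); lra.
apply: le_trans (E_le hT) _; rewrite !E_add E_scale.
apply: lerD; last first.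
  pose X v := E (fun o : Om2 q M => dd (wk rotP v (path2 o)).1).
  have X0 v : 0 <= X v by apply: E_ge0 => o; apply: E_ge0 => z; exact: br_ge0.
  have h := half_vertices X0; apply: le_trans (ler_wpM2l (ler0n _ 2) h) _.
  rewrite mulrA -natrM; apply: eqW; congr (_ * _).
  transitivity (E (fun i : 'I_M => E (fun v : 'I_N => EW (M + i) (fun ls => dd (wk rotF v ls).1)))).
    rewrite [RHS]E_swap; apply: eq_E => v; rewrite /X E_pair; apply: eq_E => i.
    rewrite -(E_walk (k := (2 * M)%N) (fun ls => dd (wk rotF v ls).1)); last by have := ltn_ord i; lia.
    by apply: eq_E => t; rewrite /path2 /= wkF.
  rewrite (eq_E (G := fun=> E (fun v : 'I_N => dd v))) ?(E_const _ (IM0 M0)) // => i.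
  exact: (EW_end (@rotFK _ q0 _ N0) (Lb2_gt0 _) (M + i) (fun v : 'I_N => dd v)).
apply: lerD; last first.
  pose X v := E (fun o : Om2 q M =>
     br (opS M0 (av (wk rotP v (path2 o)).1) (wk rotP v (path2 o)).2 != sgF v)).
  have X0 v : 0 <= X v by apply: E_ge0 => o; exact: br_ge0.
  have h := half_vertices X0; apply: (le_trans h); rewrite ler_pM2l //; apply: eqW.
  rewrite /EB; apply: eq_E => v; rewrite /Bad /weight -[X in X - _](E_const 1 (IM0 M0)) -E_sub /X [LHS]E_pair; apply: eq_E => i.
  rewrite -(E_walk (k := (2 * M)%N)); last by have := ltn_ord i; lia.
  have ht : (0 < #|{: (2 * M).-tuple Lb}|)%N by rewrite card_tuple expn_gt0 Lb2_gt0.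
  rewrite -[X in X - _](E_const 1 ht) -E_sub.
  by apply: eq_E => t; rewrite /path2 /= wkF /sgF inN_ord /opA br_negb.
apply: lerD; last first.
  have [_ h1] := graph_sound q0 N0 sgF.
  rewrite /E !card_ord -mulr_suml ler_pdivrMr // ler_pdivrMr //.
  apply: le_trans (_ : \sum_(c < size cs) \sum_(s < q) br (sgF (c * q + s)%N != cval q0 cs sgF c) <= _).
    rewrite size_csI // big_split_ord /= lerDr.
    by do 2!apply: sumr_ge0 => ? _; exact: br_ge0.
  apply: (le_trans h1); rewrite nviolF N_R; apply: eqW.
  by ring.
by rewrite /E card_ord /Lkd (big_nth (0, (0, 0))%N) hI.2 big_mkord.
Qed.

End Links.

Definition cP : rat := 8 * #|Sig q|%:R ^+ 4 * B0 (lamF q).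
Definition Cst : rat := 74 * (1 + 2 * q%:R) * #|Lb|%:R * cP + 296.

Lemma cP_ge0 : 0 <= cP.
Proof.
have [_ h] := lamF_bounds q; rewrite /cP mulr_ge0 ?mulr_ge0 ?exprn_ge0 ?ler0n //.
by rewrite /B0 addr_ge0 // divr_ge0 //; lra.
Qed.

(** Here [296 = 8 * 37] makes [powering] applicable, and [444 = 2 * 6 * 37] makes the bound of
    [Uns_old] at most half of the new rejection rate. In [Cst] the term 296 collects 148 from [Bad]
    and 148 from the distance to Hadamard words. *)
Theorem step_sound : 296 * #|Sig q|%:R ^+ 4 * u' <= 1 -> 444 * q%:R * #|Lb|%:R * cP <= M%:R ->
  exists y, Uns I y <= u' / 2 /\ forall w, Lkd (stepI q10 M0 I) w y' <= Lkd I w y + Cst * u'.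
Proof.
move=> hu hM; have hp := prejF; set S := #|Sig q|%:R ^+ 4 in hu.
have S0 : 0 <= S by rewrite exprn_ge0 // ler0n.
have [la lb] := lamF_bounds q; have c0 := cP_ge0.
have hpow : M%:R * phiF <= cP * prej rotF cF M (l0 q) opA.
  apply: (powering (@rotFK _ q0 _ N0) (Lb2_gt0 q) la lb (@hlamF _ q0 _ N0) M0).
    by rewrite card_ord N0.
  rewrite -/S; have h := ler_wpM2l S0 hp; lra.
have hb := bad_bound (@rotFK _ q0 _ N0) (Lb2_gt0 q) la lb cF (l0 q) M0 opA sg0.
have hd := distF.
have u0 : 0 <= u' by rewrite Uns_step; apply: E_ge0 => v; apply: E_ge0 => o; exact: rho_ge0.
have M1 : 1 <= M%:R :> rat by rewrite ler1n.
have p0 : 0 <= phiF by exact: phi_ge0.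
have hphi : M%:R * phiF <= 37 * cP * u'.
  by apply: (le_trans hpow); have := ler_wpM2l c0 hp; lra.
have L0 : 0 <= q%:R * #|Lb|%:R :> rat by rewrite mulr_ge0 ?ler0n.
have K0 : 0 <= (1 + 2 * q%:R) * #|Lb|%:R :> rat.
  by apply: mulr_ge0; [apply: addr_ge0; [| apply: mulr_ge0; exact: ler0n] | exact: ler0n].
have h3 : phiF <= M%:R * phiF by rewrite ler_peMl.
have h1 := ler_wpM2l L0 hphi; have h2 := ler_wpM2r u0 hM.
have h5 := ler_wpM2l K0 (le_trans h3 hphi).
have Mp : 0 < M%:R :> rat by rewrite ltr0n.
exists yF; split.
  apply: (le_trans Uns_old); rewrite -(ler_pM2l Mp).
  move: h1 h2; clear; move: phiF u' cP (#|Lb|%:R : rat) (q%:R : rat) (M%:R : rat) => x u c L r t; lra.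
move=> w; apply: (le_trans (Lkd_new w)); rewrite /Cst.
move: hb hd hp h5; clear; move: (prej _ _ _ _ _) (E _) (E _) (Lkd I w yF) => p e1 e2 l.
move: phiF u' cP (#|Lb|%:R : rat) (q%:R : rat) => x u c L r; lra.
Qed.

End Sound.
End StepFacts.

(** * Polynomial time of one round *)

#[export] Instance enc_Dex : enc 'I_Dex := enc_fin 'I_Dex.
#[export] Instance enc_ord n : enc 'I_n := enc_fin 'I_n.
#[export] Instance enc_Sig q : enc (Sig q) := enc_fin (Sig q).
#[export] Instance enc_TTq q : enc (TTq q) := enc_fin (TTq q).
#[export] Instance enc_Lb2 q : enc (Lb2 q) := enc_fin (Lb2 q).
#[export] Instance enc_cstr q : enc (cstr q) := @enc_pair _ _ _ (enc_TTq q).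
#[export] Instance enc_link : enc link := @enc_pair _ _ _ _.
#[export] Instance enc_inst q : enc (inst q) := @enc_pair _ _ _ _.

Lemma PT_insubd n (i0 : 'I_n) : PT (fun i => insubd i0 i : 'I_n).
Proof.
apply: (@PT_nat_fin _ _ _ n i0) => i hi; rewrite /insubd insubF //.
by apply/negbTE; rewrite -leqNgt.
Qed.

Section PTgraph.
Variables (q : nat) (q0 : 0 < q).

Lemma PT_exN : PT (fun p : nat * nat * nat => exN p.1.1 p.1.2 p.2).
Proof. by have h := PT_expd; rewrite /exN; pt. Qed.

Lemma PT_vvar : PT (fun p : seq (cstr q) * nat => vvar p.1 p.2).
Proof. by rewrite /vvar; pt. Qed.

Lemma PT_occ : PT (fun p : seq (cstr q) * nat => occ p.1 p.2).
Proof. by have h := PT_vvar; rewrite /occ; pt. Qed.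

Lemma PT_rotn l : PT (fun p : seq (cstr q) * nat => rotn q0 p.1 p.2 l).
Proof.
have h1 := PT_vvar; have h2 := PT_occ; have h3 := PT_exN.
have hD : PT inDex by exact: PT_insubd.
have hq : PT (inq q0) by exact: PT_insubd.
case: l => [[[i|t]|i]|l]; rewrite /rotn /vslot.
- apply: PT_pair; first by pt.
  apply: (PT_fin (fun d : 'I_Dex => inl (inl (inl d)) : Lb2 q)); by pt.
- apply: PT_pair; first by pt.
  apply: (PT_fin (fun d : 'I_q => inl (inl (inr d)) : Lb2 q)); by pt.
- apply: PT_pair; first by pt.
  apply: (PT_fin (fun d : 'I_Dex => inl (inr d) : Lb2 q)); by pt.
- by pt.
Qed.

Lemma PT_vview : @PT _ _ (@enc_pair _ _ (@enc_seq _ (enc_cstr q)) enc_nat) (enc_fin (view q))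
   (fun p : seq (cstr q) * nat => vview q0 p.1 p.2).
Proof.
have hq : PT (inq q0) by exact: PT_insubd.
apply: (@PT_comp _ ('I_q * TTq q) _ _ _ _ (fun p => (vslot q0 p.2, vtt p.1 p.2)) id); last exact: PT_finite.
by rewrite /vslot /vtt; pt.
Qed.

End PTgraph.

Section PTstep.
Variables (q M : nat).
Hypotheses (q10 : 9 < q) (M0 : 0 < M).
Notation q0 := (q0 q10).
Notation Lb := (Lb2 q).

Lemma PT_csI : PT (@csI q).
Proof.
have h : PT (fun l : link => lkc q l) by rewrite /lkc; pt.
by rewrite /csI; pt.
Qed.

Lemma PT_rotP l : PT (fun p : inst q * nat => rotP q10 p.1 (p.2, l)).
Proof. have h1 := PT_rotn q0 l; have h2 := PT_csI; exact: (PT_comp (PT_pair (PT_comp PT_fst_ h2) PT_snd_) h1). Qed.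

(** Label words, random choices and opinions range over fixed finite sets, so each of them gets a
    program of its own; only the instance and the vertex are data. *)
Lemma PT_wk ls : PT (fun p : inst q * nat => wk (rotP q10 p.1) p.2 ls).
Proof.
elim: ls => [|l ls IH] /=; first by pt.
have hr := PT_rotP l.
have hw : PT (fun p : inst q * nat => wk (rotP q10 p.1) (rotP q10 p.1 (p.2, l)).1 ls).
  exact: (PT_comp (PT_pair PT_fst_ (PT_fst hr)) IH).
apply: PT_pair; first by pt.
apply: (@PT_ext _ _ _ _ (fun p : inst q * nat =>
  (wk (rotP q10 p.1) (rotP q10 p.1 (p.2, l)).1 ls).2 ++ [:: (rotP q10 p.1 (p.2, l)).2])).
  by move=> p; rewrite cats1.
apply: PT_cat; first by pt.
by apply: PT_cons; pt.
Qed.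

Lemma PT_opS (a : Sg (Ix q M)) : PT (opS M0 a).
Proof.
rewrite /opS; apply: PT_ffun => t.
pose e2 := enc_fin ((2 * M).-tuple Lb).
pose e3 := @enc_pair 'I_M _ (enc_ord M) e2.
have h : @PT _ _ _ e3 (pk M0 : seq Lb -> 'I_M * (2 * M).-tuple Lb).
  have hi : PT (inM M0) by exact: PT_insubd.
  apply: PT_pair; first by pt.
  by apply: PT_mktuple => i; pt.
exact: (PT_comp h (@PT_finite ('I_M * (2 * M).-tuple Lb)%type e3 _ _ (fun o : Om2 q M => a (o, t)))).
Qed.

Lemma PT_passN ls pp : PT (fun p : inst q * nat => passN q10 M0 p.1 p.2 ls pp).
Proof.
rewrite /passN; apply: PT_forall => k; apply: PT_forall => j.
have h1 := PT_wk (take (M + k) ls); have h2 := PT_wk ls; have h3 := PT_opS pp.2.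
have h4 := PT_csI; set l := nth _ _ _; have h5 := PT_rotP l.
have h6 : PT (fun p : inst q * nat => opS M0 pp.2 (take (M + j) (wk (rotP q10 p.1) p.2 ls).2)).
  by apply: (PT_comp2 h3); apply: PT_take; pt.
apply: PT_andb.
  apply: (@PT_ext _ _ _ _ (fun p : inst q * nat => ~~ (M + k + (M + j).+1 == size ls) ||
      (let u := (wk (rotP q10 p.1) p.2 (take (M + k) ls)).1 in
       chk l (vview q0 (csI p.1) u) (vview q0 (csI p.1) (rotP q10 p.1 (u, l)).1)
         (opS M0 pp.1 (take (M + k) ls)) (opS M0 pp.2 (take (M + j) (wk (rotP q10 p.1) p.2 ls).2))))).
    by move=> p; rewrite implybE.
  apply: PT_orb; first exact: PT_const.
  pose ev := enc_fin (view q).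
  pose F (t : view q * view q * Sig q) := chk l t.1.1 t.1.2 (opS M0 pp.1 (take (M + k) ls)) t.2.
  have hF : @PT _ _ (@enc_pair _ _ (@enc_pair _ _ ev ev) (enc_Sig q)) _ F by exact: (@PT_finite (view q * view q * Sig q)%type).
  have hA : PT (fun p : inst q * nat => csI p.1) by pt.
  have hr := PT_fst (PT_comp (PT_pair PT_fst_ (PT_fst h1)) h5).
  exact: (PT_comp (PT_pair (PT_pair (PT_comp (PT_pair hA (PT_fst h1)) (PT_vview q0)) (PT_comp (PT_pair hA hr) (PT_vview q0))) h6) hF).
apply: (@PT_ext _ _ _ _ (fun p : inst q * nat => ~~ (M + k + (M + j) == size ls) ||
   (opS M0 pp.1 (take (M + k) ls) == opS M0 pp.2 (take (M + j) (wk (rotP q10 p.1) p.2 ls).2)))).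
  by move=> p; rewrite implybE.
apply: PT_orb; first exact: PT_const.
exact: (PT_fin (fun s : Sig q => opS M0 pp.1 (take (M + k) ls) == s) h6).
Qed.

Lemma PT_ftest k : PT (fun p : inst q * nat => ftest q10 M0 p.1 p.2 k).
Proof.
rewrite /ftest; case: (k.2) => [[[[f g] h] z1] z2]; rewrite /varP /varA.
apply: PT_pair; last exact: PT_const.
have h1 := PT_wk (path1 k.1.1).
pose eU := enc_fin (UU (Ix q M)).
have h2 : @PT _ _ _ eU (fun p : inst q * nat => indS (passN q10 M0 p.1 p.2 (path1 k.1.1))).
  by apply: PT_ffun => pp; exact: PT_passN.
have h3 : PT (fun p : inst q * nat => rk (k.1.1, indS (passN q10 M0 p.1 p.2 (path1 k.1.1)) +^ h)).
  exact: (PT_fin (fun u : UU (Ix q M) => rk (k.1.1, u +^ h)) h2).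
by pt.
Qed.

Lemma PT_flink k : PT (fun p : inst q * nat => flink q10 M0 p.1 p.2 k).
Proof.
rewrite /flink /varA; have h1 := PT_wk (path2 k.2.1.2).
have hw : PT (fun p : inst q * nat => wk (rotP q10 p.1) ((size p.1.1 + p.2) * q + k.1.1) (path2 k.2.1.2)).
  have hn : PT (fun p : inst q * nat => (size p.1.1 + p.2) * q + k.1.1) by pt.
  exact: (PT_comp (PT_pair PT_fst_ hn) h1).
pose e2 := enc_fin ((2 * M).-tuple Lb).
pose e3 := @enc_pair 'I_M _ (enc_ord M) e2.
have h2 : @PT _ _ _ e3 (pk M0 : seq Lb -> 'I_M * (2 * M).-tuple Lb).
  have hi : PT (inM M0) by exact: PT_insubd.
  apply: PT_pair; first by pt.
  by apply: PT_mktuple => i; pt.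
apply: PT_pair; first by pt.
apply: PT_pair; first by pt.
have h3 := PT_comp (PT_comp (PT_snd hw) h2) (@PT_finite ('I_M * (2 * M).-tuple Lb)%type e3 _ _ (fun o : Om2 q M => rk (k.2.2.2 +^ unit2 q10 o))).
by pt; apply: h3.
Qed.

Theorem PT_stepI : PT (stepI q10 M0).
Proof.
rewrite /stepI; have h := PT_csI; apply: PT_pair; apply: PT_flatten.
  apply: PT_map2; first by pt.
  by apply: PT_enum_map => k; exact: PT_ftest.
apply: PT_map2; first by pt.
by apply: PT_enum_map => k; exact: PT_flink.
Qed.

End PTstep.

(** * Iterated amplification *)

(** The distribution of the link labels, expressed through averages. Since rounds preserve it,
    disagreement of links can be read as Hamming distance of words. *)
Definition Lavg q (I : inst q) (G : nat -> rat) : rat :=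
  ((\sum_(l <- I.2) G l.1) / (size I.2)%:R)%R.

Section Amplify.
Variables (q M : nat).
Hypotheses (q10 : 9 < q) (M0 : 0 < M).
Notation stepI := (stepI q10 M0).

(** Halving the counter makes the number of effective rounds logarithmic: just enough for [2 ^ t] to
    exceed the number of tests. *)
Definition roundI (s : inst q * nat) := if s.2 == 0 then s else (stepI s.1, s.2 %/ 2).
Definition ampl (I : inst q) : inst q := (iter (size I.1) roundI (I, size I.1)).1.

Lemma round_iter (I : inst q) m i : 0 < m -> exists t,
  [/\ iter i roundI (I, m) = (iter t stepI I, m %/ 2 ^ t), 2 ^ t <= 2 * m & m < 2 ^ t \/ t = i].
Proof.
move=> m0; elim: i => [|i [t [e h1 h2]]].
  by exists 0; rewrite expn0 divn1; split => //; [lia | right].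
rewrite iterS e /roundI; case: eqP => /= [h|/eqP h].
  exists t; split => //; left; have := divn_eq m (2 ^ t); rewrite h mul0n add0n => ->.
  by rewrite ltn_mod expn_gt0.
exists t.+1; rewrite iterS expnSr divnMA; split => //; last first.
  case: h2 => [h2|->]; [by rewrite divn_small in h | by right].
have : 1 * 2 ^ t <= m by rewrite -leq_divRL ?expn_gt0 // lt0n.
lia.
Qed.

Lemma amplE (I : inst q) : 0 < size I.1 ->
  exists t, [/\ ampl I = iter t stepI I, 2 ^ t <= 2 * size I.1 & size I.1 < 2 ^ t].
Proof.
move=> h0; have [t [e h1 h2]] := round_iter I (size I.1) h0; exists t; split => //; first by rewrite /ampl e.
by case: h2 => [//|->]; exact: ltn_expl.
Qed.

Definition cf : nat := 2 * q * #|KK q M|.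

Lemma iter_size I t : okI I -> size (iter t stepI I).1 = size I.1 * cf ^ t /\ okI (iter t stepI I).
Proof.
move=> hI; elim: t => [|t [e h]]; first by rewrite expn0 muln1.
have [e1 h1] := step_size q10 M0 h; split => //.
by rewrite iterS e1 e -mulnA -/cf -expnSr.
Qed.

(** From [cf <= 2 ^ cf]: a constant factor per round, over logarithmically many rounds, is a
    polynomial factor. *)
Lemma iter_poly (I : inst q) t : 2 ^ t <= 2 * size I.1 -> cf ^ t <= (2 * size I.1) ^ cf.
Proof.
move=> h; apply: (@leq_trans ((2 ^ cf) ^ t)).
  by case: t h => // t _; rewrite leq_exp2r // ltnW // ltn_expl.
by rewrite -expnM mulnC expnM; case: cf => // c; rewrite leq_exp2r.
Qed.

Lemma step_Lavg I G : okI I -> Lavg (stepI I) G = Lavg I G.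
Proof.
move=> hI; have [e [h0' h1']] := step_size q10 M0 hI; have [h0 h1] := hI.
rewrite /Lavg h1' e -/cf sum_iota_enum.
have -> : (\sum_(v < size I.1) \sum_(k : KL q M) G (flink q10 M0 I v k).1 =
   cf%:R * \sum_(l <- I.2) G l.1)%R.
  rewrite (big_nth (0, (0, 0))) big_mkord h1 mulr_sumr; apply: eq_bigr => j _.
  rewrite (eq_bigr (fun=> G (nth (0, (0, 0)) I.2 j).1)) //.
  rewrite sumr_const -[(_ *+ _)%R]mulr_natl; congr (_%:R * _)%R.
  by rewrite /cf !card_prod card_ord card_bool; move: #|KK q M| => c; ring.
have hc : (cf%:R != 0 :> rat)%R.
  by rewrite pnatr_eq0 -lt0n; move: h0'; rewrite e -/cf muln_gt0 => /andP [].
have hm : ((size I.1)%:R != 0 :> rat)%R by rewrite pnatr_eq0 -lt0n.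
by rewrite natrM h1; move: (\sum_(l <- I.2) G l.1)%R => S; field; rewrite hm hc.
Qed.

Lemma iter_Lavg I G t : okI I -> Lavg (iter t stepI I) G = Lavg I G.
Proof.
by move=> hI; elim: t => // t IH; rewrite iterS step_Lavg ?IH //; exact: (iter_size t hI).2.
Qed.

Lemma iter_label I t l : okI I -> l \in (iter t stepI I).2 -> l.1 \in map fst I.2.
Proof.
move=> hI; elim: t l => [|t IH] l; first exact: map_f.
rewrite iterS => h; have /mapP [l' hl ->] := step_label (iter_size t hI).2 h; exact: IH.
Qed.

Lemma iter_complete I w y t : okI I -> (forall t, t \in I.1 -> sat y t) ->
  (forall l, l \in I.2 -> lkok w y l) ->
  exists y', (forall c, c \in (iter t stepI I).1 -> sat y' c) /\ (forall l, l \in (iter t stepI I).2 -> lkok w y' l).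
Proof.
move=> hI h1 h2; elim: t => [|t [y' [g1 g2]]]; first by exists y.
exact: (step_complete q10 M0 (iter_size t hI).2 g1 g2).
Qed.

Section Sound.
Local Open Scope ring_scope.
Variables (al C : rat).
Hypotheses (al1 : al <= 1) (C0 : 0 <= C).
Hypothesis hstep : forall I y', okI I -> Uns (stepI I) y' <= al ->
  exists y, Uns I y <= Uns (stepI I) y' / 2 /\
    forall w, Lkd (stepI I) w y' <= Lkd I w y + C * Uns (stepI I) y'.

Lemma Uns_ge0 (I : inst q) y : 0 <= Uns I y.
Proof.
apply: mulr_ge0; last by rewrite invr_ge0 ler0n.
by apply: sumr_ge0 => t _; exact: br_ge0.
Qed.

(** Going back one round halves the rejection rate, so the link errors form a geometric series with
    sum at most [2 * C] times the first rate. *)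
Lemma iter_sound I t y' : okI I -> Uns (iter t stepI I) y' <= al ->
  exists y, Uns I y <= Uns (iter t stepI I) y' / 2 ^+ t /\
    forall w, Lkd (iter t stepI I) w y' <= Lkd I w y + 2 * C * Uns (iter t stepI I) y'.
Proof.
have hC := C0; move=> hI; elim: t y' => [|t IH] y' hu.
  exists y'; rewrite expr0 divr1 -[iter 0 stepI I]/I; split; first exact: lexx.
  by move=> w; rewrite lerDl; apply: mulr_ge0; [apply: mulr_ge0 | exact: Uns_ge0].
rewrite iterS in hu *; set It := iter t stepI I in hu IH *.
have hIt : okI It by exact: (iter_size t hI).2.
set u := Uns _ y' in hu *.
have u0 : 0 <= u by exact: Uns_ge0.
have [y1 [g1 g2]] := hstep hIt hu.
have g3 : Uns It y1 <= al by apply: (le_trans g1); rewrite -/u; lra.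
have [y [f1 f2]] := IH y1 g3; exists y; split.
  apply: (le_trans f1); rewrite exprS invfM mulrA; apply: ler_wpM2r; last exact: g1.
  by rewrite invr_ge0; apply: exprn_ge0.
move=> w; apply: (le_trans (g2 w)); apply: (le_trans (lerD (f2 w) (lexx _))).
by have h := ler_wpM2l hC g1; rewrite -/u in h *; lra.
Qed.

(** After all rounds the original rejection rate is below one over the number of tests, so it is
    zero. *)
Theorem ampl_sound I y' : okI I -> Uns (ampl I) y' <= al ->
  exists y, (forall c, c \in I.1 -> sat y c) /\
    forall w, Lkd (ampl I) w y' <= Lkd I w y + 2 * C * Uns (ampl I) y'.
Proof.
move=> hI; have [t [-> _ ht]] := amplE hI.1 => hu.
have [y [h1 h2]] := iter_sound hI hu; exists y; split; last exact: h2.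
move=> c hc; apply: contraT => hs.
have m0 : 0 < (size I.1)%:R :> rat by rewrite ltr0n hI.1.
have hA : 1 / (size I.1)%:R <= Uns I y.
  rewrite /Uns ler_pM2r ?invr_gt0 //; rewrite (big_rem c hc) /= hs lerDl.
  by apply: sumr_ge0 => i _; exact: br_ge0.
have t0 : 0 < 2 ^+ t :> rat by rewrite exprn_gt0.
have hB : Uns (iter t stepI I) y' / 2 ^+ t < 1 / (size I.1)%:R.
  rewrite ltr_pdivrMr // mulrAC ltr_pdivlMr // mul1r.
  apply: (@le_lt_trans _ _ (1 * (size I.1)%:R)).
    by apply: ler_wpM2r; [exact: ltW | exact: le_trans al1].
  by rewrite mul1r -natrX ltr_nat.
by have := le_lt_trans (le_trans hA h1) hB; rewrite ltxx.
Qed.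

End Sound.

Lemma esz_natlist (s : seq nat) B : (forall x, x \in s -> x <= B) -> esz s <= 1 + size s * (2 * B + 2).
Proof.
elim: s => // x s IH h; rewrite esz_cons esz_nat /=.
have h1 := h x (mem_head _ _); have h2 : esz s <= 1 + size s * (2 * B + 2).
  by apply: IH => z hz; apply: h; rewrite inE hz orbT.
by move: h1 h2; clear; nia.
Qed.

Lemma esz_list A `{enc A} (s : seq A) B : (forall i, i < size s -> forall d, esz (nth d s i) <= B) ->
  esz s <= 1 + size s * (B + 1).
Proof.
elim: s => // x s IH h; rewrite esz_cons /=.
have h1 := h 0 (ltn0Sn _) x; have h2 : esz s <= 1 + size s * (B + 1).
  by apply: IH => i hi d; exact: (h i.+1).
by move: h1 h2 => /=; clear; nia.
Qed.

Lemma all_cons_leq B x s : x <= B -> all (fun x => x <= B) s -> all (fun x => x <= B) (x :: s).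
Proof. by rewrite /= => -> ->. Qed.

Lemma varA_lt N v (z : Sg (Ix q M)) : v < N -> varA v z <= 2 * (N * #|{: Sg (Ix q M)}|).
Proof.
move=> hv; have := lt_pair hv (ltn_ord (enum_rank z)); rewrite /varA /rk.
by move: #|{: Sg _}| (nat_of_ord _) => a b; lia.
Qed.

Lemma varP_lt N v o (f : UU (Ix q M)) : v < N -> varP v o f <= 2 * (N * #|{: Om q M * UU (Ix q M)}|).
Proof.
move=> hv; have := lt_pair hv (ltn_ord (enum_rank (o, f))); rewrite /varP /rk.
by move: #|{: _ * _}| (nat_of_ord _) => a b; lia.
Qed.

Lemma step_esz : exists k, forall I X, okI I -> (forall l, l \in I.2 -> l.1 <= X) ->
  esz (stepI I) <= pb k (size I.1 + X).
Proof.
pose G := #|{: Sg (Ix q M)}| + #|{: Om q M * UU (Ix q M)}|.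
pose gz := @esz _ (enc_TTq q) (G10 q10).
pose Bd n := 2 * (2 * n * q * G).
have [k hk] : polyb (fun n => 1 + ((1 + n * cf * (1 + 10 * (2 * Bd n + 2) + gz + 1 + 1)) +
    (1 + n * cf * (2 * n + 1 + (2 * Bd n + 1 + (2 * Bd n + 1) + 1) + 1 + 1)))) by rewrite /Bd; poly.
exists k => I X hI hX; apply: leq_trans (hk _).
have [h0 h1] := hI; have [e [h2 h3]] := step_size q10 M0 hI; rewrite -/cf in e.
set n := size I.1 + X; set N := size (csI I) * q.
have N0 : 0 < N by exact: N0.
have hN : N <= 2 * n * q by rewrite /N size_csI // /n; nia.
have hA v (z : Sg (Ix q M)) : v < N -> varA v z <= Bd n.
  move=> hv; apply: (leq_trans (varA_lt z hv)); rewrite /Bd /G leq_mul2l /=.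
  by apply: leq_mul => //; rewrite leq_addr.
have hP v o (f : UU (Ix q M)) : v < N -> varP v o f <= Bd n.
  move=> hv; apply: (leq_trans (varP_lt o f hv)); rewrite /Bd /G leq_mul2l /=.
  by apply: leq_mul => //; rewrite leq_addl.
have hw v ls : v < N -> (wk (rotP q10 I) v ls).1 < N.
  move=> hv; have -> : v = val (inN (q := q) N0 v) by rewrite /= inNK.
  by rewrite (wkF q10 hI) /=.
have hn : size I.1 <= n by rewrite leq_addr.
have hs1 : size (stepI I).1 <= n * cf by rewrite e leq_mul2r hn orbT.
have hs2 : size (stepI I).2 <= n * cf by rewrite h3.
have hl (vs : seq nat) : size vs = 10 -> all (fun x => x <= Bd n) vs ->
    @esz _ (enc_cstr q) (vs, G10 q10) <= 1 + 10 * (2 * Bd n + 2) + gz + 1.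
  move=> h10 /allP h; have := esz_natlist h; rewrite h10 [@esz _ (enc_cstr q) _]esz_pair -/gz.
  by rewrite addn1 ltnS leq_add2r.
have gA : esz (stepI I).1 <= 1 + n * cf * (1 + 10 * (2 * Bd n + 2) + gz + 1 + 1).
  apply: (leq_trans (esz_list (B := 1 + 10 * (2 * Bd n + 2) + gz + 1) _)); last first.
    by rewrite leq_add2l; apply: leq_mul.
  move=> i hi d; have := mem_nth d hi; move: (nth d _ i) => c /allpairsP [[v k'] [hv _ ->]].
  have hvN : v < N by move: hv; rewrite mem_iota.
  rewrite /ftest; case: (k'.2) => [[[[f g] h] z1] z2].
  apply: hl; first by [].
  do 8!(apply: all_cons_leq; first exact: hP).
  apply: all_cons_leq; first exact: hA.
  by apply: all_cons_leq; first exact: hA (hw _ _ hvN).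
have gB : esz (stepI I).2 <= 1 + n * cf * (2 * n + 1 + (2 * Bd n + 1 + (2 * Bd n + 1) + 1) + 1 + 1).
  apply: (leq_trans (esz_list (B := 2 * n + 1 + (2 * Bd n + 1 + (2 * Bd n + 1) + 1) + 1) _)); last first.
    by rewrite leq_add2l; apply: leq_mul.
  move=> i hi d; have := mem_nth d hi; move: (nth d _ i) => c /allpairsP [[j k'] [hj _ ->]].
  have hjm : j < size I.1 by move: hj; rewrite mem_iota.
  rewrite /flink; set ee := wk _ _ _.
  have he : ee.1 < N by apply: hw; rewrite /N size_csI //; apply: lt_pair; rewrite ?ltn_ord // ltn_add2l.
  have b1 := hA _ k'.2.2.2 he; have b2 := hA _ (k'.2.2.2 +^ unit2 q10 (pk M0 ee.2)) he.
  have b3 : (nth (0, (0, 0)) I.2 j).1 <= n.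
    by apply: (leq_trans (hX _ (mem_nth _ _))); rewrite ?h1 // leq_addl.
  rewrite 2!esz_pair !esz_nat -![(j, k').1]/j -![(j, k').2]/k'.
  move: (varA ee.1 (_ +^ _)) b2 => x2 b2; move: (varA ee.1 _) b1 => x1 b1.
  by move: (nth _ _ _).1 (Bd n) b1 b2 b3 => x3 D; clear; lia.
have -> : esz (stepI I) = (esz (stepI I).1 + esz (stepI I).2).+1.
  by rewrite -esz_pair -surjective_pairing.
by rewrite add1n ltnS; exact: leq_add.
Qed.

Lemma size_inst (I : inst q) : size I.1 < esz I.
Proof.
case: I => a b; rewrite [X in _ < X]esz_pair /=; have h : size a < esz a by exact: size_esz.
by rewrite ltnS; apply: (leq_trans (ltnW h)); rewrite leq_addr.
Qed.

Lemma esz_inst2 (I : inst q) : esz I.2 <= esz I.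
Proof. by case: I => a b; rewrite [X in _ <= X]esz_pair leqW // leq_addl. Qed.

Lemma esz_mem (A : eqType) (eA : enc A) (a : A) (s : seq A) : a \in s -> esz a <= esz s.
Proof.
elim: s => // b s IH; rewrite inE [X in _ <= X]esz_cons => /orP [/eqP ->|/IH h]; first by rewrite leqW // leq_addr.
by apply: (leq_trans h); rewrite leqW // leq_addl.
Qed.

(** The size bound for the iterates is proved for [okI] instances; the test, part of the computed
    map, makes it polynomial on all inputs. *)
Theorem PT_ampl : PT (fun I : inst q => if (0 < size I.1) && (size I.2 == size I.1) then ampl I else I).
Proof.
apply: (@PT_ext _ _ _ _ (fun I : inst q => if (0 < size I.1) && (size I.2 == size I.1) then
   (iter (if (0 < size I.1) && (size I.2 == size I.1) then size I.1 else 0) roundI (I, size I.1)).1 else I)).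
  by move=> I; case: (_ && _).
have hS := PT_stepI q10 M0.
have hr : PT roundI by rewrite /roundI; pt.
have hi : PT (fun I : inst q => iter (if (0 < size I.1) && (size I.2 == size I.1) then size I.1 else 0) roundI (I, size I.1)).
  apply: PT_iter => //; [by pt | by pt |].
  have [k hk] := step_esz.
  have hx : polyb (fun n => (2 * n) ^ cf).
    apply: (@polyb_le _ (fun n => pb cf (2 * n))); last by apply: polyb_comp; poly.
    by move=> n; rewrite /pb; case: cf => // c; rewrite leq_exp2r //; lia.
  have [k' hk'] : polyb (fun n => n + pb k (n * (2 * n) ^ cf + n) + (2 * n + 1) + 1).
    apply: polyb_add; last by poly.
    apply: polyb_add; last by poly.
    apply: polyb_add; first by poly.
    by apply: polyb_comp; apply: polyb_add; [apply: polyb_mul => //; poly | poly].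
  exists k' => I i hi; apply: leq_trans (hk' _).
  have e1 : size I.1 < esz I by exact: size_inst.
  move: hi; case: ifP => [/andP [h0 /eqP h1] _|_]; last first.
    by rewrite leqn0 => /eqP -> /=; rewrite [X in X <= _]esz_pair esz_nat; lia.
  have hI : okI I by [].
  have [t [-> ht _]] := round_iter I i h0; rewrite [X in X <= _]esz_pair esz_nat.
  have hd : size I.1 %/ 2 ^ t <= esz I by apply: (leq_trans (leq_div _ _)); exact: ltnW.
  have hs : esz (iter t stepI I) <= esz I + pb k (esz I * (2 * esz I) ^ cf + esz I).
    case: t ht {hd} => [|t] ht; first by rewrite leq_addr.
    apply: leq_trans (leq_addl _ _); rewrite iterS.
    have [e2 hIt] := iter_size t hI.
    apply: (leq_trans (hk _ (esz I) hIt _)).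
      move=> l /(iter_label hI) /mapP [l' hl ->].
      apply: leq_trans (esz_inst2 I); apply: leq_trans (@esz_mem link enc_link _ _ hl).
      by case: (l') => x yy; rewrite [X in _ <= X]esz_pair esz_nat /=; lia.
    apply: leq_pb => //; rewrite leq_add2r e2; apply: leq_mul; first exact: ltnW.
    have ht' : 2 ^ t <= 2 * size I.1 by apply: leq_trans ht; rewrite leq_exp2l.
    apply: (leq_trans (iter_poly ht')); case: cf => // c; rewrite leq_exp2r // leq_mul2l; exact: ltnW.
  by move: hd hs; move: (pb _ _) (_ %/ _) => a b; lia.
by pt.
Qed.

End Amplify.

Theorem amplification q : 9 < q -> exists (amp : inst q -> inst q) (al C : rat),
  [/\ PT amp, (0 < al)%R, (0 <= C)%R & forall I, okI I ->
   [/\ okI (amp I), forall G, Lavg (amp I) G = Lavg I G, forall l, l \in (amp I).2 -> l.1 \in map fst I.2,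
      forall w y, (forall t, t \in I.1 -> sat y t) -> (forall l, l \in I.2 -> lkok w y l) ->
        exists y', (forall t, t \in (amp I).1 -> sat y' t) /\ (forall l, l \in (amp I).2 -> lkok w y' l)
    & forall y', (Uns (amp I) y' <= al)%R -> exists y, (forall c, c \in I.1 -> sat y c) /\
        forall w, (Lkd (amp I) w y' <= Lkd I w y + C * Uns (amp I) y')%R]].
Proof.
move=> q10; pose X : rat := (444 * q%:R * #|Lb2 q|%:R * cP q)%R.
pose M := (Num.bound X).+1; have M0 : 0 < M by [].
have hM : (X <= M%:R)%R.
  apply: (@le_trans _ _ (Num.bound X)%:R%R); last by rewrite ler_nat.
  apply: ltW; apply: archi_boundP; apply: mulr_ge0; last exact: cP_ge0.
  by apply: mulr_ge0; [apply: mulr_ge0; exact: ler0n | exact: ler0n].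
have [kap ek k1] : exists2 k : rat, k = (296 * #|Sig q|%:R ^+ 4)%R & (1 <= k)%R.
  by eexists; first reflexivity; rewrite -natrX -natrM ler1n muln_gt0 expn_gt0 xf_gt0.
have k0 : (0 < kap)%R by apply: lt_le_trans k1; exact: ltr01.
have a1 : (kap^-1 <= 1)%R by rewrite invf_le1.
have [C eC C0] : exists2 C, C = Cst q & (0 <= C)%R.
  eexists; first reflexivity; rewrite /Cst; apply: addr_ge0; last exact: ler0n.
  apply: mulr_ge0; last exact: cP_ge0.
  apply: mulr_ge0; last exact: ler0n.
  apply: mulr_ge0; first exact: ler0n.
  by apply: addr_ge0; [exact: ler01 | apply: mulr_ge0; exact: ler0n].
have hstep I y' : okI I -> (Uns (stepI q10 M0 I) y' <= kap^-1)%R ->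
  exists y, (Uns I y <= Uns (stepI q10 M0 I) y' / 2)%R /\
    forall w, (Lkd (stepI q10 M0 I) w y' <= Lkd I w y + C * Uns (stepI q10 M0 I) y')%R.
  move=> hI hu; rewrite eC; apply: (step_sound hI _ hM).
  by rewrite -ek mulrC -ler_pdivlMr ?div1r.
pose amp (I : inst q) := if (0 < size I.1) && (size I.2 == size I.1) then ampl q10 M0 I else I.
have eamp I : okI I -> amp I = ampl q10 M0 I by case=> h1 h2; rewrite /amp h1 h2 eqxx.
exists amp, (kap^-1)%R, (2 * C)%R; split.
- exact: PT_ampl.
- by rewrite invr_gt0.
- by apply: mulr_ge0; [exact: ler0n | exact: C0].
move=> I hI; rewrite (eamp I hI); have [t [et _ _]] := amplE q10 M0 hI.1; split.
- by rewrite et; exact: (iter_size q10 M0 t hI).2.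
- by move=> G; rewrite et iter_Lavg.
- by move=> l; rewrite et; exact: iter_label.
- by move=> w y h1 h2; rewrite et; exact: iter_complete h1 h2.
- by move=> y' hu; exact: ampl_sound a1 C0 hstep _ _ hI hu.
Qed.

(** * Computations as constraint lists *)

Section Tableau.
Variable M : TM.

(* Tapes are described relative to the head: column [k] holds the state, the [k]-th cell to the left
   of the head and the [k]-th cell to its right. *)
Definition Gam : finType := (tm_Q M * option bool * option bool)%type.
Definition colf (c : config M) (k : nat) : Gam :=
  let '(s, l, a, r) := c in (s, nth None l k, nth None (a :: r) k).

(* [kd] tells whether the column is the first, the second, or the last one *)
Definition Phi (kd : bool * bool * bool) (c0 cm cc cp : Gam) : Gam :=
  if @tm_halt M c0.1.1 then cc else
  let '(s, b, mv) := @tm_delta M c0.1.1 c0.2 in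
  let pL := if kd.2 then None else cp.1.2 in let pR := if kd.2 then None else cp.2 in
  if mv then (s, if kd.1.1 then b else cm.1.2, pR)
  else (s, pL, if kd.1.1 then c0.1.2 else if kd.1.2 then b else cm.2).

Lemma col_step c k (la : bool) : (la -> (colf c k.+1).1.2 = None /\ (colf c k.+1).2 = None) ->
  colf (step c) k = Phi (k == 0, k == 1, la) (colf c 0) (colf c k.-1) (colf c k) (colf c k.+1).
Proof.
case: c => [[[s l] a] r]; rewrite /Phi /step /colf; cbn [fst snd]; rewrite [nth None (a :: r) 0]/=.
case: (tm_halt s) => //; case: (tm_delta s a) => [[s' b] mv] hla.
have -> : (if la then None else nth None l k.+1) = nth None l k.+1 by case: la hla => // /(_ isT) [->].
have -> : (if la then None else nth None (a :: r) k.+1) = nth None r k by case: la hla => // /(_ isT) [_ /= ->].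
case: mv; case: k {hla} => [|[|k]]; case: l => [|x l]; case: r => [|y r]; rewrite /= ?nth_nil //.
Qed.

Definition blank_from (c : config M) (W : nat) := forall k, W <= k -> (colf c k).1.2 = None /\ (colf c k).2 = None.

Lemma blank_run x t : blank_from (run M t x) (maxn 1 (size x) + t).
Proof.
have hi : size (run M 0 x).1.1.2 = 0 /\ size (run M 0 x).2 <= (size x).-1.
  by case: x => //= b x; rewrite size_map.
have h : size (run M t x).1.1.2 <= t /\ size (run M t x).2 <= (size x).-1 + t.
  elim: t => [|t [h1 h2]]; first by rewrite addn0; case: hi => -> ->.
  rewrite /run iterS -/(run M t x); move: h1 h2; case: (run M t x) => [[[s l] a] r] /= h1 h2.
  case: (tm_halt s) => /=; first by lia.
  case: (tm_delta s a) => [[s' b] mv]; case: mv; [case: r h2 | case: l h1] => /=; lia.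
move: h; case: (run M t x) => [[[s l] a] r] /= [h1 h2] k hk.
rewrite /colf; cbn [fst snd]; split; first by rewrite nth_default //; lia.
by rewrite nth_default //=; lia.
Qed.

Notation g := #|Gam|.
(** Columns are written in one-hot code. *)
Definition gcode (c : Gam) (i : nat) : bool := i == rk c.
Definition gam0 : Gam := (@tm_start M, None, None).
Definition gdec (b : nat -> bool) : Gam := odflt gam0 [pick c | b (rk c)].

Lemma gdecK b c : (forall i, i < g -> b i = gcode c i) -> gdec b = c.
Proof.
move=> h; rewrite /gdec; case: pickP => [c' /=|/(_ c)]; rewrite h ?rk_lt // /gcode ?eqxx //.
by move/eqP => e; apply: enum_rank_inj; apply: val_inj.
Qed.

(** A step constraint reads five columns; the summand 10 provides the arity that a round of
    amplification requires. *)
Definition qM := 5 * g + 10.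
Lemma qM_gt9 : 9 < qM. Proof. exact: leq_addl. Qed.
Lemma qM_gt0 : 0 < qM. Proof. exact: ltn_trans qM_gt9. Qed.
Notation iq := (inq qM_gt0).

Definition bitsA (a : Sig qM) (j : nat) : nat -> bool := fun i => a (iq (j * g + i)).
Definition ttstep (kd : bool * bool * bool) : TTq qM := [ffun a : Sig qM =>
  [forall i : 'I_g, bitsA a 4 i == gcode (Phi kd (gdec (bitsA a 0)) (gdec (bitsA a 1))
      (gdec (bitsA a 2)) (gdec (bitsA a 3))) i]].
Definition initok (u : option (option bool)) (c : Gam) : bool :=
  if u is Some s then c == (@tm_start M, None, s)
  else (c == (@tm_start M, None, Some true)) || (c == (@tm_start M, None, Some false)).
Definition ttinit (u : option (option bool)) : TTq qM := [ffun a : Sig qM =>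
  [exists c : Gam, initok u c && [forall i : 'I_g, bitsA a 0 i == gcode c i]]].
Definition ttout : TTq qM := [ffun a : Sig qM => a (iq g) == ((gdec (bitsA a 0)).2 == Some true)].
Definition ttbit (b : bool) : TTq qM := [ffun a : Sig qM => a (iq 0) == b].

Lemma nth_blocks d (bs : seq (seq nat)) j i : all (fun b => size b == d) bs -> i < d -> j < size bs ->
  nth 0 (flatten bs) (j * d + i) = nth 0 (nth [::] bs j) i.
Proof.
elim: bs j => // b bs IH [|j] /= /andP [/eqP hb hbs] hi hj; first by rewrite add0n nth_cat hb hi.
by rewrite nth_cat hb mulSn -addnA ltnNge leq_addr /= addKn IH.
Qed.

Section Inst.
Variables (p : str) (n K T : nat).
(** Wide enough for everything the head can reach in [T] steps and for the [K.+1] output cells;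
    beyond the last column both half-tapes are blank. *)
Definition Wd := size p + n + T + K + 3.
Definition vcol (t k : nat) : seq nat := [seq ((t * Wd + k) * g + i).+1 | i <- iota 0 g].
Definition vout (k : nat) : nat := (T.+1 * Wd * g + k).+1.
Definition isym (k : nat) : option (option bool) :=
  if k < size p then Some (Some (nth false p k)) else if k < size p + n then None else Some None.

Definition cstep (t k : nat) : cstr qM :=
  (flatten [:: vcol t 0; vcol t k.-1; vcol t k; vcol t k.+1; vcol t.+1 k], ttstep (k == 0, k == 1, k.+1 == Wd)).
Definition cinit (k : nat) : cstr qM := (vcol 0 k, ttinit (isym k)).
Definition cout (k : nat) : cstr qM := (vcol T k ++ [:: vout k], ttout).

(** Bit 0 is forced to be false, so that a link with second bit 0 reads a single proof bit. The
    first output bit is forced to be true: it is the verdict, and the remaining output bits are the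
    word. *)
Definition tests0 : seq (cstr qM) :=
  ([:: 0], ttbit false) :: ([:: vout 0], ttbit true) ::
  [seq cinit k | k <- iota 0 Wd] ++ [seq cout k | k <- iota 0 K.+1] ++
  flatten [seq [seq cstep t k | k <- iota 0 Wd] | t <- iota 0 T].
Definition links0 : seq link := [seq (k, (vout k.+1, 0)) | k <- iota 0 K].
(** Repeating each list as often as the other is long equalises their lengths and leaves the labels
    uniform. *)
Definition inst0 : inst qM := (flatten [seq tests0 | _ <- iota 0 K], flatten [seq links0 | _ <- tests0]).

Lemma size_flat (A B : Type) (s : seq A) (l : seq B) : size (flatten [seq s | _ <- l]) = size l * size s.
Proof. by elim: l => //= x l IH; rewrite size_cat IH mulSn. Qed.

Lemma size_vcol t k : size (vcol t k) = g. Proof. by rewrite size_map size_iota. Qed.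
Lemma nth_vcol t k i : i < g -> nth 0 (vcol t k) i = ((t * Wd + k) * g + i).+1.
Proof. by move=> h; rewrite (nth_map 0) ?size_iota // nth_iota. Qed.

Lemma ok_inst0 : 0 < K -> okI inst0.
Proof.
move=> hK; rewrite /okI !size_flat !size_iota size_map size_iota mulnC; split=> //.
by rewrite muln_gt0 hK.
Qed.

Lemma sum_flat (A B : Type) (s : seq A) (l : seq B) (F : A -> rat) :
  (\sum_(x <- flatten [seq s | _ <- l]) F x = (size l)%:R * \sum_(x <- s) F x)%R.
Proof.
elim: l => [|b l IH]; first by rewrite big_nil mul0r.
by rewrite /= big_cat /= IH -add1n natrD mulrDl mul1r.
Qed.

Lemma Lavg_inst0 G : 0 < K -> Lavg inst0 G = E (fun k : 'I_K => G k).
Proof.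
move=> hK; rewrite /Lavg sum_flat size_flat; move: (size tests0) (isT : 0 < size tests0) => m hm.
rewrite size_map size_iota big_map.
have -> : (\sum_(j <- iota 0 K) G (j, (vout j.+1, 0)).1 = \sum_(k < K) G k)%R.
  by rewrite -(big_mkord xpredT G) /index_iota subn0.
have h : (m%:R != 0 :> rat)%R by rewrite pnatr_eq0 -lt0n.
have hk : (K%:R != 0 :> rat)%R by rewrite pnatr_eq0 -lt0n.
by rewrite /E card_ord natrM; move: (\sum_(k < K) _)%R => S; field; rewrite h hk.
Qed.

Lemma mem_flat (A : eqType) B (s : seq A) (l : seq B) x : x \in flatten [seq s | _ <- l] -> x \in s.
Proof. by elim: l => //= b l IH; rewrite mem_cat => /orP []. Qed.

Lemma flat_mem (A : eqType) B (s : seq A) (l : seq B) x : 0 < size l -> x \in s -> x \in flatten [seq s | _ <- l].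
Proof. by case: l => //= b l _ h; rewrite mem_cat h. Qed.

Variable y : nat -> bool.
Definition ycol (t k : nat) : nat -> bool := fun i => y ((t * Wd + k) * g + i).+1.

Lemma iq_lt j i : j < 5 -> i < g -> j * g + i < qM.
Proof. by move=> hj hi; rewrite /qM; move: #|_| hi => c hi; nia. Qed.

Lemma sat_step t k : sat y (cstep t k) = [forall i : 'I_g, ycol t.+1 k i ==
  gcode (Phi (k == 0, k == 1, k.+1 == Wd) (gdec (ycol t 0)) (gdec (ycol t k.-1)) (gdec (ycol t k)) (gdec (ycol t k.+1))) i].
Proof.
rewrite /sat ffunE.
have h j i : j < 5 -> i < g -> bitsA [ffun s : 'I_qM => y (nth 0 (cstep t k).1 s)] j i =
    ycol (nth 0 [:: t; t; t; t; t.+1] j) (nth 0 [:: 0; k.-1; k; k.+1; k] j) i.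
  move=> hj hi; rewrite /bitsA ffunE inqK ?iq_lt // /cstep /ycol -nth_vcol //; congr y.
  rewrite nth_blocks //; last by apply/allP => b; rewrite !inE => /or4P [||| /orP []] /eqP ->; rewrite size_vcol.
  by case: j hj => [|[|[|[|[|]]]]].
have hd j : j < 5 -> gdec (bitsA [ffun s : 'I_qM => y (nth 0 (cstep t k).1 s)] j) =
    gdec (ycol (nth 0 [:: t; t; t; t; t.+1] j) (nth 0 [:: 0; k.-1; k; k.+1; k] j)).
  by move=> hj; rewrite /gdec; congr (odflt _ _); apply: eq_pick => c; rewrite h ?rk_lt.
apply: eq_forallb => i; rewrite h // !hd //.
Qed.

Lemma sat_init k : sat y (cinit k) -> exists2 c, initok (isym k) c & forall i, i < g -> ycol 0 k i = gcode c i.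
Proof.
rewrite /sat ffunE => /existsP [c /andP [h1 /forallP h2]]; exists c => // i hi.
have /eqP := h2 (Ordinal hi); rewrite /bitsA ffunE inqK ?(@iq_lt 0) //= mul0n add0n nth_vcol //.
Qed.

Lemma init_sat k c : initok (isym k) c -> (forall i, i < g -> ycol 0 k i = gcode c i) -> sat y (cinit k).
Proof.
move=> h1 h2; rewrite /sat ffunE; apply/existsP; exists c; rewrite h1; apply/forallP => i.
rewrite /bitsA ffunE inqK ?(@iq_lt 0) //= mul0n add0n nth_vcol //; apply/eqP; exact: h2.
Qed.

Lemma sat_out k : sat y (cout k) = (y (vout k) == ((gdec (ycol T k)).2 == Some true)).
Proof.
rewrite /sat ffunE ffunE inqK; last by rewrite /qM; move: #|_| => c; lia.
rewrite nth_cat size_vcol ltnn subnn /=; congr (_ == ((_ : Gam).2 == _)).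
rewrite /gdec; congr (odflt _ _); apply: eq_pick => c; rewrite /bitsA ffunE inqK ?(@iq_lt 0) ?rk_lt //=.
by rewrite mul0n add0n nth_cat size_vcol rk_lt nth_vcol ?rk_lt.
Qed.

Lemma sat_bit v b : sat y ([:: v], ttbit b) = (y v == b).
Proof. by rewrite /sat ffunE ffunE inqK ?qM_gt0. Qed.

End Inst.

Lemma Phi_last (kd : bool * bool * bool) c0 cm cc cp cp' : kd.2 -> Phi kd c0 cm cc cp = Phi kd c0 cm cc cp'.
Proof. by rewrite /Phi => ->. Qed.

Lemma col_init x k : colf (init_config M x) k = (@tm_start M, None, nth None (map Some x) k).
Proof. by case: x => [|b x]; [case: k => [|[|k]] | rewrite /colf /= nth_nil]. Qed.

Lemma read_out_nth s k : k < size (read_out s) -> nth None s k = Some (nth false (read_out s) k).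
Proof. by elim: s k => //= -[b|] s IH [|k] //= hk; exact: IH. Qed.

Section Runs.
Variables (p : str) (n K T : nat).
Notation Wd := (Wd p n K T).
Notation g := #|Gam|.

Lemma col_run x t k : size x = size p + n -> t <= T -> k < Wd ->
  colf (run M t.+1 x) k = Phi (k == 0, k == 1, k.+1 == Wd) (colf (run M t x) 0) (colf (run M t x) k.-1)
     (colf (run M t x) k) (colf (run M t x) k.+1).
Proof.
move=> hx ht hk; rewrite /run iterS; apply: col_step => /eqP e.
by apply: (blank_run (t := t) (x := x)); rewrite hx e /Wd; lia.
Qed.

(** The word is read off the first row; each further row is then determined by the step
    constraints. *)
Lemma tab_sound y : (forall c, c \in tests0 p n K T -> sat y c) ->
  exists2 w, size w = n & forall t k, t <= T -> k < Wd -> forall i, i < g ->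
    ycol p n K T y t k i = gcode (colf (run M t (p ++ w)) k) i.
Proof.
move=> hy; pose w := mkseq (fun j => (gdec (ycol p n K T y 0 (size p + j))).2 == Some true) n.
have hw : size w = n by rewrite size_mkseq.
exists w => //; elim=> [|t IH] k ht hk.
  have hc : cinit p n K T k \in tests0 p n K T.
    by rewrite /tests0 !inE mem_cat map_f ?orbT // mem_iota.
  have [c h1 h2] := sat_init (hy _ hc).
  have -> : colf (run M 0 (p ++ w)) k = c; last exact: h2.
  rewrite /run /= col_init map_cat nth_cat size_map; move: h1; rewrite /initok /isym.
  case: ltnP => hp; first by rewrite (nth_map false) // => /eqP ->.
  case: ltnP => hn; last by move=> /eqP ->; rewrite nth_default // size_map hw; lia.
  have hj : k - size p < n by lia.
  have -> : nth None (map Some w) (k - size p) = Some (nth false w (k - size p)) by rewrite (nth_map false) ?hw.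
  rewrite nth_mkseq // subnKC // (gdecK h2).
  by case/orP => /eqP ->.
have ht' : t < T by []; have {}IH := IH _ (ltnW ht').
have hc : cstep p n K T t k \in tests0 p n K T.
  rewrite /tests0 !inE !mem_cat; do !(apply/orP; right); apply/flattenP.
  exists [seq cstep p n K T t k | k <- iota 0 Wd]; last by rewrite map_f // mem_iota.
  by apply/mapP; exists t; rewrite ?mem_iota.
have := hy _ hc; rewrite sat_step => /forallP h i hi.
rewrite (eqP (h (Ordinal hi))) /= (col_run _ (ltnW ht') hk) ?size_cat ?hw //; congr gcode.
have W0 : 0 < Wd by rewrite /Wd addn3.
rewrite (gdecK (IH 0 W0)) (gdecK (IH k hk)) (gdecK (IH k.-1 _)); last by lia.
case: (eqVneq k.+1 Wd) => e; first exact: Phi_last.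
by rewrite (gdecK (IH k.+1 _)) //; lia.
Qed.

Lemma tab_complete x : size x = size p + n -> take (size p) x = p -> (colf (run M T x) 0).2 = Some true ->
  exists y, (forall c, c \in tests0 p n K T -> sat y c) /\
    y 0 = false /\ forall k, y (vout p n K T k) = ((colf (run M T x) k).2 == Some true).
Proof.
move=> hx hp hacc.
have g0 : 0 < g by apply/card_gt0P; exists gam0.
have W0 : 0 < Wd by rewrite /Wd addn3.
pose y v := if v is v'.+1 then
    if v' < T.+1 * Wd * g then gcode (colf (run M (v' %/ g %/ Wd) x) (v' %/ g %% Wd)) (v' %% g)
    else (colf (run M T x) (v' - T.+1 * Wd * g)).2 == Some true else false.
have yo k : y (vout p n K T k) = ((colf (run M T x) k).2 == Some true).
  by rewrite /vout /y ltnNge leq_addr addKn.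
have yc t k i : t <= T -> k < Wd -> i < g -> ycol p n K T y t k i = gcode (colf (run M t x) k) i.
  move=> ht hk hi; rewrite /ycol /y lt_pair ?lt_pair //.
  have -> : ((t * Wd + k) * g + i) %/ g = t * Wd + k by rewrite divnMDl // (divn_small hi) addn0.
  have -> : ((t * Wd + k) * g + i) %% g = i by rewrite modnMDl modn_small.
  by rewrite divnMDl // (divn_small hk) addn0 modnMDl (modn_small hk).
have gd t k : t <= T -> k < Wd -> gdec (ycol p n K T y t k) = colf (run M t x) k.
  by move=> ht hk; apply: gdecK => i; exact: yc.
exists y; split; last by split.
move=> c; rewrite !inE => /orP [/eqP ->|/orP [/eqP ->|]]; first by rewrite sat_bit.
  by rewrite sat_bit yo hacc.
rewrite !mem_cat => /orP [/mapP [k hk ->]|/orP [/mapP [k hk ->]|/flattenP [s /mapP [t ht ->] /mapP [k hk ->]]]].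
- move: hk; rewrite mem_iota => hk; apply: (@init_sat _ _ _ _ _ k (colf (run M 0 x) k)); last by move=> i; exact: yc.
  rewrite /run /= col_init /initok /isym; case: ltnP => h1.
    have -> : nth false p k = nth false x k by rewrite -hp nth_take.
    by rewrite (nth_map false) ?hx //; lia.
  case: ltnP => h2; last by rewrite nth_default // size_map hx.
  by rewrite (nth_map false) ?hx //; case: (nth false x k); rewrite eqxx ?orbT.
- move: hk; rewrite mem_iota => hk; rewrite sat_out yo gd //; rewrite /Wd; lia.
- move: ht hk; rewrite !mem_iota => ht hk; rewrite sat_step; apply/forallP => i.
  have tT : t <= T by exact: ltnW.
  rewrite yc // (col_run hx tT hk) (gd t 0) // (gd t k.-1) ?(gd t k) //; last by lia.
  case: (eqVneq k.+1 Wd) => e; last by rewrite gd //; lia.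
  by rewrite (@Phi_last _ _ _ _ _ (colf (run M t x) k.+1)).
Qed.

End Runs.

Lemma PT_inst0 kk : PT (fun a : str * nat * nat =>
  inst0 a.1.1 a.1.2 a.2 (poly_bound kk (size a.1.1 + a.1.2))).
Proof.
pose D := (str * nat * nat)%type.
have hT : PT (fun a : D => poly_bound kk (size a.1.1 + a.1.2)) by apply: PT_poly_bound; pt.
pose Tf (a : D) := poly_bound kk (size a.1.1 + a.1.2).
have hW : PT (fun a : D => Wd a.1.1 a.1.2 a.2 (Tf a)) by rewrite /Wd /Tf; pt.
have hv : PT (fun a : D * nat * nat => vcol a.1.1.1.1 a.1.1.1.2 a.1.1.2 (Tf a.1.1) a.1.2 a.2).
  rewrite /vcol; apply: PT_map2; first by pt.
  by apply: PT_S; apply: PT_add; [apply: PT_mul; [apply: PT_add; [apply: PT_mul; [pt | exact: (PT_comp (PT_fst (PT_fst PT_fst_)) hW)] | pt] | pt] | pt].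
have hvc (A : Type) (eA : enc A) (d : A -> D) (t k : A -> nat) : PT d -> PT t -> PT k ->
   PT (fun a => vcol (d a).1.1 (d a).1.2 (d a).2 (Tf (d a)) (t a) (k a)).
  by move=> h1 h2 h3; exact: (PT_comp (PT_pair (PT_pair h1 h2) h3) hv).
have ho (A : Type) (eA : enc A) (d : A -> D) (k : A -> nat) : PT d -> PT k ->
   PT (fun a => vout (d a).1.1 (d a).1.2 (d a).2 (Tf (d a)) (k a)).
  move=> h1 h2; rewrite /vout; have h3 := PT_comp h1 hT; have h4 := PT_comp h1 hW.
  by apply: PT_S; apply: PT_add => //; apply: PT_mul; [apply: PT_mul; [exact: PT_S | exact: h4] | pt].
have hcs : PT (fun a : D * nat * nat => cstep a.1.1.1.1 a.1.1.1.2 a.1.1.2 (Tf a.1.1) a.1.2 a.2).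
  rewrite /cstep; apply: PT_pair.
    by apply: PT_flatten; do !(apply: PT_cons; first (apply: hvc; pt)); pt.
  have h4 := PT_comp (PT_fst (PT_fst PT_id)) hW.
  apply: (@PT_fin _ _ (bool * bool * bool)%type _ _ _ _ ttstep); apply: PT_pair; first by pt.
  by apply: PT_eqn; [pt | exact: h4].
have hci : PT (fun a : D * nat => cinit a.1.1.1 a.1.1.2 a.1.2 (Tf a.1) a.2).
  rewrite /cinit /isym; apply: PT_pair; first by apply: hvc; pt.
  pose eo := enc_fin (option (option bool)).
  apply: (@PT_fin _ _ (option (option bool)) eo _ _ _ ttinit); apply: PT_if; first by pt.
    by apply: (@PT_fin _ _ bool _ _ eo _ (fun b => Some (Some b))); pt.
  by apply: PT_if; pt.
have hco : PT (fun a : D * nat => cout a.1.1.1 a.1.1.2 a.1.2 (Tf a.1) a.2).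
  rewrite /cout; apply: PT_pair; last exact: PT_const.
  apply: PT_cat; first by apply: hvc; [pt | exact: (PT_comp (PT_fst PT_id) hT) | pt].
  by apply: PT_cons; [apply: ho; pt | pt].
have ht : PT (fun a : D => tests0 a.1.1 a.1.2 a.2 (Tf a)).
  rewrite /tests0; apply: PT_cons; first exact: PT_const.
  apply: PT_cons; first by apply: PT_pair; [apply: PT_cons; [apply: ho; pt | pt] | pt].
  apply: PT_cat; first by apply: PT_map2; [apply: PT_iota0 | exact: hci].
  apply: PT_cat; first by apply: PT_map2; [pt | exact: hco].
  apply: PT_flatten; apply: PT_map2; first exact: PT_iota0.
  apply: PT_map2; first by apply: PT_iota0; exact: (PT_comp (PT_fst PT_id) hW).
  exact: hcs.
have hl : PT (fun a : D => links0 a.1.1 a.1.2 a.2 (Tf a)).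
  rewrite /links0; apply: PT_map2; first by pt.
  by apply: PT_pair; [pt | apply: PT_pair; [apply: ho; pt | pt]].
rewrite /inst0; apply: PT_pair; apply: PT_flatten; apply: PT_map2; rewrite -/(Tf _).
- by pt.
- exact: (PT_comp PT_fst_ ht).
- exact: ht.
- exact: (PT_comp PT_fst_ hl).
Qed.

End Tableau.

(** An assignment tester for the outputs of [f]: [p] is fixed, [w] is unknown, the first bit of
    [f (p ++ w)] is the verdict and the other [K] bits are the word. A proof rejected rarely comes
    from a genuine computation, up to link errors proportional to the rejection rate. *)
Theorem pcpp (f : str -> str) : PolyTime f ->
  exists (q : nat) (al C : rat) (J : str * nat * nat -> inst q),
  [/\ PT J, (0 < al)%R, (0 <= C)%R & forall p n K, 0 < K ->
    (forall w, size w = n -> size (f (p ++ w)) = K.+1) ->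
  [/\ okI (J (p, n, K)), forall G, Lavg (J (p, n, K)) G = E (fun k : 'I_K => G k),
    forall l, l \in (J (p, n, K)).2 -> l.1 < K,
    forall w, size w = n -> nth false (f (p ++ w)) 0 -> exists y,
      (forall t, t \in (J (p, n, K)).1 -> sat y t) /\
      forall l, l \in (J (p, n, K)).2 -> lkok (fun k => nth false (f (p ++ w)) k.+1) y l
  & forall y, (Uns (J (p, n, K)) y <= al)%R -> exists w, [/\ size w = n, nth false (f (p ++ w)) 0
      & (Lkd (J (p, n, K)) (fun k => nth false (f (p ++ w)) k.+1) y <= C * Uns (J (p, n, K)) y)%R]]].
Proof.
case=> M [kk hM]; have [amp [al [C [hP al0 C0 hamp]]]] := amplification (qM_gt9 M).
pose J0 (a : str * nat * nat) := inst0 M a.1.1 a.1.2 a.2 (poly_bound kk (size a.1.1 + a.1.2)).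
exists (qM M), al, C, (fun a => amp (J0 a)); split => //.
  exact: (PT_comp (PT_inst0 M kk) hP).
move=> p n K K0 hf; set I := J0 (p, n, K); set T := poly_bound kk (size p + n).
have hI : okI I by exact: ok_inst0.
have [h1 h2 h3 h4 h5] := hamp I hI.
have hrun w : size w = n -> forall k, k < K.+1 -> (colf (run M T (p ++ w)) k).2 = Some (nth false (f (p ++ w)) k).
  move=> hw k hk; have [t [ht [hh ho]]] := hM (p ++ w).
  rewrite (run_halted hh) //; last by rewrite /T -hw -size_cat.
  move: ho; rewrite /cfg_output; case: (run M t (p ++ w)) => [[[s l] a] r] e.
  by rewrite -e; apply: read_out_nth; rewrite e hf.
have hlk l : l \in I.2 -> exists2 k, k < K & l = (k, (vout M p n K T k.+1, 0)).
  by move/mem_flat/mapP => [k]; rewrite mem_iota => hk ->; exists k.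
split => //.
- by move=> G; rewrite h2 Lavg_inst0.
- by move=> l /h3 /mapP [l' /hlk [k hk ->] ->].
- move=> w hw hacc; have hx : size (p ++ w) = size p + n by rewrite size_cat hw.
  have hacc' : (colf (run M T (p ++ w)) 0).2 = Some true by rewrite hrun // hacc.
  have [y [g1 [g2 g3]]] := tab_complete K hx (take_size_cat _ erefl) hacc'.
  apply: (h4 _ y) => [t /mem_flat|l /hlk [k hk ->]]; first exact: g1.
  by rewrite /lkok g2 g3 addbF hrun // eqE /=; case: (nth _ _ _).
- move=> y hu; have [y0 [g1 g2]] := h5 y hu.
  have g3 c : c \in tests0 M p n K T -> sat y0 c by move=> hc; apply: g1; apply: flat_mem hc; rewrite size_iota.
  have [w hw hcol] := tab_sound g3; exists w.
  have hWK k : k < K.+1 -> k < Wd p n K T by rewrite /Wd; lia.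
  have yv k : k < K.+1 -> y0 (vout M p n K T k) = nth false (f (p ++ w)) k.
    move=> hk; have hc : cout M p n K T k \in tests0 M p n K T.
      by rewrite /tests0 !inE !mem_cat (map_f _ (_ : k \in iota 0 K.+1)) ?orbT // mem_iota.
    have := g3 _ hc; rewrite sat_out (gdecK (hcol T k (leqnn _) (hWK k hk))) hrun // => /eqP ->.
    by case: (nth _ _ _).
  split => //.
    have := g3 ([:: vout M p n K T 0], ttbit M true); rewrite sat_bit yv // => /(_ _) /eqP; apply.
    by rewrite /tests0 !inE eqxx orbT.
  have y00 : y0 0 = false.
    by have := g3 ([:: 0], ttbit M false); rewrite sat_bit => /(_ _) /eqP; apply; rewrite /tests0 !inE eqxx.
  (* The decoded proof satisfies the tableau exactly, so its own link errors vanish and only the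
     loss of the amplification remains. *)
  apply: (le_trans (g2 _)); rewrite -[X in (_ <= X)%R]add0r lerD2r /Lkd big_seq big1 ?mul0r // => l /hlk [k hk ->].
  by rewrite /lkok y00 yv // addbF eqxx.
Qed.

(** * A binary code of constant relative distance *)

Lemma bin_central m : 2 ^ m <= 'C(m.*2, m).
Proof.
elim: m => // m IH; rewrite expnS doubleS binS.
have h1 : 'C(m.*2, m) <= 'C(m.*2.+1, m.+1) by rewrite binS leq_addl.
have h2 : 'C(m.*2, m) <= 'C(m.*2.+1, m) by case: (m) => [|k]; rewrite ?bin0 // binS leq_addr.
by lia.
Qed.

Lemma double_div a d : 0 < d -> a.*2 %/ d <= (a %/ d).*2 + (d <= a.*2).
Proof.
move=> d0; have e := divn_eq a d; have h := ltn_pmod a d0.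
case: (leqP d a.*2) => hd /=; last by rewrite (divn_small hd).
have h2 : a.*2 %/ d < (a %/ d).*2.+2; last by lia.
by rewrite ltn_divLR //; lia.
Qed.

(** By Legendre's formula each power of [p] contributes at most 1 to the exponent, and only powers
    up to [2 m] contribute. *)
Lemma central_pfactor p m : prime p -> 0 < m -> p ^ logn p 'C(m.*2, m) <= m.*2.
Proof.
move=> hp m0; have p1 := prime_gt1 hp.
have hC : 0 < 'C(m.*2, m) by rewrite bin_gt0 -addnn leq_addr.
have e : logn p 'C(m.*2, m) + (logn p m`!).*2 = logn p (m.*2)`!.
  have hm : m <= m.*2 by rewrite -addnn leq_addr.
  have h2 : m.*2 - m = m by lia.
  have := bin_fact hm; rewrite h2 => <-; rewrite !lognM ?muln_gt0 ?fact_gt0 ?hC //; lia.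
have ext : logn p m`! = \sum_(1 <= k < m.*2.+1) m %/ p ^ k.
  have hle : m.+1 <= m.*2.+1 by rewrite ltnS -addnn leq_addr.
  rewrite logn_fact // [RHS](big_cat_nat _ hle) //=.
  have -> : \sum_(m.+1 <= i < m.*2.+1) m %/ p ^ i = 0; last by rewrite addn0.
  rewrite big_nat_cond big1 // => k /andP [/andP [hk _] _].
  by rewrite divn_small //; apply: leq_trans (ltn_expl k p1); exact: ltnW.
set L := trunc_log p m.*2.
have m20 : 0 < m.*2 by rewrite double_gt0.
have /andP [hL1 hL2] := trunc_log_bounds p1 m20.
apply: leq_trans hL1; rewrite leq_exp2l //.
have hs : logn p (m.*2)`! <= (logn p m`!).*2 + \sum_(1 <= k < m.*2.+1) (p ^ k <= m.*2).
  rewrite logn_fact // ext -[(\sum_(1 <= k < _) _).*2]addnn -!big_split /=; apply: leq_sum => k _.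
  by rewrite addnn; apply: double_div; rewrite expn_gt0 prime_gt0.
have hc : \sum_(1 <= k < m.*2.+1) (p ^ k <= m.*2) <= L.
  apply: (@leq_trans (\sum_(1 <= k < m.*2.+1) (k <= L))).
    apply: leq_sum => k _; case: (leqP (p ^ k) m.*2) => // h.
    by rewrite lt0b /L; apply: trunc_log_max.
  have := sum_nat_const_nat 1 L.+1 1; rewrite subn1 muln1 /= => eL.
  rewrite -{2}eL; elim: (m.*2) => [|n IH]; first by rewrite big_geq.
  rewrite big_nat_recr //=; move: IH; rewrite eL => IH.
  case: (leqP n.+1 L) => h; last by rewrite addn0.
  rewrite addn1; apply: leq_trans h; rewrite ltnS.
  apply: (@leq_trans (\sum_(1 <= i < n.+1) 1)); first by apply: leq_sum => i _; case: (i <= L).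
  by rewrite sum_nat_const_nat subn1 muln1.
by move: e hs hc; lia.
Qed.

(** The argument of Erdős: if all primes up to [2 m = 4 ^ j] were at most [2 ^ j], the central
    binomial coefficient would be a product of at most [2 ^ j + 1] prime powers, each at most [2 m],
    against the lower bound [2 ^ m]. The comparison [2 j + 2 < 2 ^ j.-1] starts at [j = 5]. *)
Lemma prime_between j : 4 < j -> exists p, [/\ prime p, 2 ^ j < p & p <= 2 ^ (2 * j)].
Proof.
move=> hj; pose m := 2 ^ (2 * j).-1.
have m2 : m.*2 = 2 ^ (2 * j) by rewrite -mul2n -expnS prednK //; lia.
have m0 : 0 < m by rewrite expn_gt0.
case: (boolP (has (fun p => prime p && (2 ^ j < p)) (iota 0 m.*2.+1))) => [/hasP [p]|hno].
  by rewrite mem_iota add0n ltnS m2 => h1 /andP [h2 h3]; exists p.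
have hC : 0 < 'C(m.*2, m) by rewrite bin_gt0 -addnn leq_addr.
have pf p : p \in primes 'C(m.*2, m) -> p ^ logn p 'C(m.*2, m) <= m.*2.
  by rewrite mem_primes => /and3P [hp _ _]; exact: central_pfactor.
have small p : p \in primes 'C(m.*2, m) -> p <= 2 ^ j.
  move=> hin; have h1 := pf p hin; move: hin; rewrite -logn_gt0 => hl.
  have hp : prime p by move: hl; rewrite lognE; case: (prime p).
  rewrite leqNgt; apply/negP => h2; case/hasP: hno; exists p; last by rewrite hp.
  rewrite mem_iota add0n ltnS; apply: leq_trans h1.
  by rewrite -{1}(expn1 p) leq_exp2l // prime_gt1.
have hsz : size (primes 'C(m.*2, m)) <= (2 ^ j).+1.
  rewrite -(size_iota 0 (2 ^ j).+1); apply: uniq_leq_size (primes_uniq _) _ => p /small h.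
  by rewrite mem_iota.
have hup : 'C(m.*2, m) <= m.*2 ^ (2 ^ j).+1.
  rewrite {1}(prod_prime_decomp hC) prime_decompE big_map /=.
  apply: (@leq_trans (m.*2 ^ size (primes 'C(m.*2, m)))); last by rewrite leq_exp2l // m2 -{1}(expn0 2) ltn_exp2l //; lia.
  rewrite big_seq; elim: (primes _) pf {small hsz} => [|p s IH] pf; first by rewrite big_pred0.
  rewrite -big_seq big_cons expnS; apply: leq_mul; first by apply: pf; rewrite mem_head.
  by rewrite big_seq; apply: IH => p' h; apply: pf; rewrite inE h orbT.
have := leq_trans (bin_central m) hup; rewrite m2 -expnM leq_exp2l // /m.
have e : 2 ^ (2 * j).-1 = 2 ^ j * 2 ^ j.-1 by rewrite -expnD; congr (_ ^ _); lia.
have hj2 : 2 * j + 2 < 2 ^ j.-1.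
  elim: j hj {m m2 m0 hno hC pf small hsz hup e} => // j IH; rewrite ltnS leq_eqVlt => /orP [/eqP <-//|hj]; have h := IH hj.
  have -> : 2 ^ j.+1.-1 = 2 * 2 ^ j.-1 by rewrite -expnS; congr (_ ^ _); lia.
  by lia.
rewrite e => h1; exfalso; have h2 : 2 ^ j * (2 * j + 3) <= 2 ^ j * 2 ^ j.-1 by rewrite leq_mul2l; lia.
by have := ltn_expl j (isT : 1 < 2); move: h1 h2; move: (2 ^ j) (_ * 2 ^ j.-1) => A B; nia.
Qed.

Lemma prime_exists N : exists p, [/\ prime p, 4 * N + 32 <= p & p <= (8 * N + 64) ^ 2].
Proof.
pose j := up_log 2 (4 * N + 32); have h0 : 1 < 4 * N + 32 by lia.
have /andP [h1 h2] := up_log_bounds (isT : 1 < 2) h0.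
have hj : 4 < j.
  by rewrite ltnNge; apply/negP => h; have : 2 ^ j <= 2 ^ 4 by [rewrite leq_exp2l]; rewrite /j; lia.
have [p [hp hp1 hp2]] := prime_between hj; exists p; split => //; first by rewrite -/j in h2; lia.
apply: (leq_trans hp2); rewrite mulnC expnM leq_exp2r //.
have -> : 2 ^ j = 2 * 2 ^ j.-1 by rewrite -expnS prednK //; lia.
by rewrite -/j in h1; lia.
Qed.

(** * The code and its distance *)

Section Code.
Variable p : nat.

Definition evalp (s : str) (a : nat) : nat := foldr (fun (b : bool) v => (b + a * v) %% p) 0 s.
(** A Reed-Solomon symbol [u] is replaced by the parities of all [u b + c], with representatives
    below [p]. For different symbols [u], [v] the pairs [(u b + c, v b + c)] run through the whole
    plane, so the parities differ nearly half of the time. *)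
Definition ebit (s : str) (t : nat * nat * nat) : bool := odd ((evalp s t.1.1 * t.1.2 + t.2) %% p).
Definition eidx : seq (nat * nat * nat) :=
  flatten [seq flatten [seq [seq (i, j, k) | k <- iota 0 p] | j <- iota 0 p] | i <- iota 0 p].
Definition Enc (s : str) : str := [seq ebit s t | t <- eidx].

Definition hdist (K : nat) (u v : nat -> bool) : rat := E (fun k : 'I_K => br (u k != v k)).

Hypothesis hp : prime p.
Hypothesis p3 : 2 < p.

Lemma sum_iota_ord (F : nat -> rat) : (\sum_(i <- iota 0 p) F i = \sum_(x : 'F_p) F x)%R.
Proof.
rewrite -(big_mkord xpredT F) (Fp_cast hp) /index_iota subn0; by [].
Qed.

Lemma sum_eidx (F : nat * nat * nat -> rat) :
  (\sum_(t <- eidx) F t = \sum_(x : 'F_p) \sum_(y : 'F_p) \sum_(z : 'F_p) F (nat_of_ord x, nat_of_ord y, nat_of_ord z))%R.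
Proof.
rewrite /eidx big_flatten big_map.
rewrite -(sum_iota_ord (fun i => \sum_(y : 'F_p) \sum_(z : 'F_p) F (i, nat_of_ord y, nat_of_ord z))%R); apply: eq_bigr => i _.
rewrite big_flatten big_map -(sum_iota_ord (fun j => \sum_(z : 'F_p) F (i, j, nat_of_ord z))%R); apply: eq_bigr => j _.
by rewrite big_map -(sum_iota_ord (fun k => F (i, j, k))).
Qed.

Lemma size_eidx : size eidx = p ^ 3.
Proof.
have h (T : Type) (f : nat -> seq T) c (l : seq nat) : (forall i, size (f i) = c) ->
    size (flatten [seq f i | i <- l]) = size l * c.
  by move=> hf; elim: l => //= i l IH; rewrite size_cat IH hf mulSn.
rewrite /eidx (h _ _ (p * p)) ?size_iota // => i.
by rewrite (h _ _ p) ?size_iota // => j; rewrite size_map size_iota.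
Qed.

Lemma size_Enc s : size (Enc s) = p ^ 3. Proof. by rewrite size_map size_eidx. Qed.

Local Open Scope ring_scope.
Notation F := 'F_p.
Definition Pl (s : str) : {poly F} := Poly [seq (nat_of_bool b)%:R : F | b <- s].

Lemma evalpE s a : (evalp s a)%:R = (Pl s).[a%:R] :> F.
Proof.
elim: s => [|b s IH] /=; first by rewrite /Pl horner0.
by rewrite (Fp_nat_mod hp) natrD natrM IH /Pl /= horner_cons addrC mulrC.
Qed.

Definition oddF (x : F) : bool := odd (nat_of_ord x).

Lemma ebitE s (x y z : F) : ebit s (nat_of_ord x, nat_of_ord y, nat_of_ord z) = oddF ((Pl s).[x] * y + z).
Proof.
rewrite /ebit /oddF; cbn [fst snd]; congr odd.
have -> : (Pl s).[x] * y + z = (evalp s x * y + z)%N%:R.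
  by rewrite natrD natrM evalpE !natr_Zp.
by rewrite (val_Fp_nat hp).
Qed.

Lemma half_odd_count n (b : bool) : n%:R <= 2 * \sum_(i < n) br (odd i != b) + 1 :> rat.
Proof.
have h2 m : \sum_(i < m.+2) br (odd i != b) = \sum_(i < m) br (odd i != b) + 1.
  rewrite !big_ord_recr /= -addrA; congr (_ + _).
  by case: (odd m); case: b; rewrite /br /= ?addr0 ?add0r.
have [h _] : n%:R <= 2 * \sum_(i < n) br (odd i != b) + 1 :> rat /\
   n.+1%:R <= 2 * \sum_(i < n.+1) br (odd i != b) + 1 :> rat; last exact: h.
elim: n => [|n [IH1 IH2]].
  split; first by rewrite big_ord0; lra.
  by rewrite big_ord1 lerDr mulr_ge0 // br_ge0.
split => //; rewrite h2 -addn2 natrD; lra.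
Qed.

(** The map to the pair of values is injective, hence the pair is uniform. Among the [p] residues at
    least [(p - 1) / 2] have the other parity, which is at least a third of them since [p >= 3]. *)
Lemma inner_dist (a b : F) : a != b ->
  1 / 3 <= E (fun y : F => E (fun z : F => br (oddF (a * y + z) != oddF (b * y + z)))).
Proof.
move=> ab; pose h (t : F * F) := (a * t.1 + t.2, b * t.1 + t.2).
have hi : injective h.
  move=> [y z] [y' z'] e; have e1 : a * y + z = a * y' + z' := congr1 fst e.
  have e2 : b * y + z = b * y' + z' := congr1 snd e.
  have e3 : (a - b) * (y - y') = 0.
    have -> : (a - b) * (y - y') = (a * y + z) - (a * y' + z') - ((b * y + z) - (b * y' + z')) by ring.
    by rewrite e1 e2; ring.
  move/eqP: e3; rewrite mulf_eq0 !subr_eq0 (negPf ab) /= => /eqP ey.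
  by congr (_, _) => //; move: e1; rewrite ey => /addrI.
have -> : E (fun y : F => E (fun z : F => br (oddF (a * y + z) != oddF (b * y + z)))) =
  E (fun t : F * F => br (oddF t.1 != oddF t.2)).
  by rewrite -(E_inj (fun t : F * F => br (oddF t.1 != oddF t.2)) hi) E_pair.
rewrite E_pair -(E_const (1 / 3) (_ : (0 < #|{: F}|)%N)); last by rewrite (card_Fp hp) ltnW // ltnW.
apply: E_le => x; rewrite /E (card_Fp hp).
have pR : 3 <= p%:R :> rat by rewrite ler_nat.
rewrite ler_pdivlMr; last by lra.
have -> : \sum_(v : F) br (oddF (x, v).1 != oddF (x, v).2) = \sum_(i < p) br (odd i != oddF x).
  rewrite -(big_mkord xpredT (fun i => br (odd i != oddF x))) /index_iota subn0 sum_iota_ord.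
  by apply: eq_bigr => v _; rewrite eq_sym.
have := half_odd_count p (oddF x).
lra.
Qed.

(** The polynomials agree on at most a quarter of the field, and elsewhere the inner distance is
    1/3: the product [3/4 * 1/3] is 1/4. *)
Lemma Enc_dist s s' : size s' = size s -> (4 * size s <= p)%N -> s != s' ->
  1 / 4 <= hdist (p ^ 3) (nth false (Enc s)) (nth false (Enc s')).
Proof.
move=> hs hN ne.
have -> : hdist (p ^ 3) (nth false (Enc s)) (nth false (Enc s')) =
   E (fun x : F => E (fun y : F => E (fun z : F => br (oddF ((Pl s).[x] * y + z) != oddF ((Pl s').[x] * y + z))))).
  rewrite -(E_pair (fun t : F * F => E (fun z : F => br (oddF ((Pl s).[t.1] * t.2 + z) != oddF ((Pl s').[t.1] * t.2 + z))))).
  rewrite -(E_pair (fun t : F * F * F => br (oddF ((Pl s).[t.1.1] * t.1.2 + t.2) != oddF ((Pl s').[t.1.1] * t.1.2 + t.2)))).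
  rewrite /hdist /E !card_prod (card_Fp hp) card_ord; congr (_ / _); last by rewrite !expnS expn0 muln1 mulnA.
  rewrite !sum_pair.
  transitivity (\sum_(t <- eidx) br (ebit s t != ebit s' t)).
    rewrite [RHS](big_nth (0, 0, 0)%N) big_mkord size_eidx; apply: eq_bigr => k _.
    by rewrite !(nth_map (0, 0, 0)%N) ?size_eidx.
  rewrite sum_eidx; apply: eq_bigr => x _; apply: eq_bigr => y _; apply: eq_bigr => z _.
  by rewrite !ebitE.
have pR : 3 <= p%:R :> rat by rewrite ler_nat.
have hb (b : bool) : (b < p)%N by have := p3; case: b => /=; lia.
pose eq (x : F) := (Pl s).[x] == (Pl s').[x].
have hroots : (#|[pred x | eq x]| <= size s)%N.
  have D0 : Pl s - Pl s' != 0.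
    apply: contraNneq ne => /eqP; rewrite subr_eq0 => /eqP e; apply/eqP.
    apply: (@eq_from_nth _ false) => // i hi.
    have := congr1 (fun P : {poly F} => P`_i) e; rewrite !coef_Poly !(nth_map false) ?hs //.
    move=> /(congr1 (fun x : F => nat_of_ord x)); rewrite !(val_Fp_nat hp) !(modn_small (hb _)).
    by case: (nth _ s i); case: (nth _ s' i).
  have := max_poly_roots D0 (rs := enum [pred x | eq x]); rewrite -cardE.
  move=> h; have {}h : (#|[pred x | eq x]| < size (Pl s - Pl s')%R)%N.
    apply: h; last exact: enum_uniq.
    apply/allP => x; rewrite mem_enum inE /eq => /eqP h; by rewrite /root hornerD hornerN h subrr.
  apply: ltnW; apply: (leq_trans h); apply: (leq_trans (size_polyD _ _)); rewrite size_polyN geq_max.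
  by apply/andP; split; apply: (leq_trans (size_Poly _)); rewrite size_map ?hs.
have h1 : E (fun x : F => (1 / 3) * br (~~ eq x)) <=
  E (fun x : F => E (fun y : F => E (fun z : F => br (oddF ((Pl s).[x] * y + z) != oddF ((Pl s').[x] * y + z))))).
  apply: E_le => x; case: (boolP (eq x)) => h; last by rewrite mulr1; exact: inner_dist.
  by rewrite mulr0; apply: E_ge0 => y; apply: E_ge0 => z; exact: br_ge0.
apply: le_trans h1; rewrite E_scale.
have h2 : E (fun x : F => br (~~ eq x)) = 1 - #|[pred x | eq x]|%:R / p%:R.
  rewrite (eq_E (G := fun x => 1 - br (eq x))); last by move=> x; rewrite br_negb.
  rewrite E_sub E_const; last by rewrite (card_Fp hp) ltnW // ltnW.
  rewrite /E (card_Fp hp) -sum1_card natr_sum; congr (_ - _ / _); rewrite [RHS]big_mkcond /=.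
  by apply: eq_bigr => x _; rewrite inE; case: (eq x).
rewrite h2; have h3 : #|[pred x | eq x]|%:R / p%:R <= 1 / 4 :> rat.
  rewrite ler_pdivrMr; last by lra.
  have h4 : #|[pred x | eq x]|%:R <= (size s)%:R :> rat by rewrite ler_nat.
  have h5 : 4 * (size s)%:R <= p%:R :> rat by rewrite -natrM ler_nat.
  by move: h4 h5; move: (#|_|%:R : rat) ((size s)%:R : rat) (p%:R : rat) => a b c; lra.
by move: h3; move: (_ / _) => a; lra.
Qed.

End Code.

Lemma hdistC K u v : hdist K u v = hdist K v u.
Proof. by apply: eq_E => k; rewrite eq_sym. Qed.

Lemma hdist_tri K u v w : (hdist K u w <= hdist K u v + hdist K v w)%R.
Proof.
rewrite /hdist -E_add; apply: E_le => k.
by case: (u k); case: (v k); case: (w k).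
Qed.

Definition isprime (p : nat) : bool := (1 < p) && (size [seq d <- iota 0 p | (1 < d) && (p %% d == 0)] == 0).

Lemma isprimeP p : isprime p = prime p.
Proof.
rewrite /isprime size_filter -[_ == 0]negbK -lt0n -has_count; apply/andP/idP => [[h1 h2]|hp].
  apply/primeP; split => // d hd; case: (ltngtP d p) (dvdn_leq (ltnW h1) hd) => // [hdp _|_ _]; last by rewrite orbT.
  apply: contraNT h2; rewrite negb_or => /andP [d1 _]; apply/hasP; exists d; first by rewrite mem_iota.
  by rewrite -/(dvdn _ _) hd andbT; case: d hd d1 {hdp} => [|[|]] //; rewrite dvd0n; lia.
split; first exact: prime_gt1; apply/negP => /hasP [d]; rewrite mem_iota add0n => /= hd /andP [d1 hdv].
by case/primeP: hp => _ /(_ d hdv) /orP [/eqP e|/eqP e]; lia.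
Qed.

(* the modulus for messages of [N] bits *)
Definition pr (N : nat) : nat :=
  head 0 [seq p <- iota 0 ((8 * N + 64) ^ 2).+1 | (4 * N + 32 <= p) && isprime p].

Lemma prP N : [/\ prime (pr N), 4 * N + 32 <= pr N & pr N <= (8 * N + 64) ^ 2].
Proof.
have [p [h1 h2 h3]] := prime_exists N.
have : pr N \in [seq p <- iota 0 ((8 * N + 64) ^ 2).+1 | (4 * N + 32 <= p) && isprime p].
  have : p \in [seq p <- iota 0 ((8 * N + 64) ^ 2).+1 | (4 * N + 32 <= p) && isprime p].
    by rewrite mem_filter h2 isprimeP h1 mem_iota.
  by rewrite /pr; case: [seq _ <- _ | _] => // a l _; rewrite mem_head.
by rewrite mem_filter isprimeP mem_iota add0n ltnS => /andP [/andP [g1 g2] g3].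
Qed.

Lemma PT_pr : PT pr.
Proof. by rewrite /pr /isprime; pt. Qed.

(* the modulus is a successor, since [%% 0] would let the values grow *)
Lemma PT_evalp : PT (fun a : nat * str * nat => evalp a.1.1.+1 a.1.2 a.2).
Proof.
apply: (@PT_ext _ _ _ _ (fun a : nat * str * nat =>
   foldl (fun v (b : bool) => (b + a.2 * v) %% a.1.1.+1) 0 (rev a.1.2))).
  by move=> a; rewrite foldl_rev.
apply: (@PT_foldl (nat * str * nat)%type nat bool _ _ _ (fun a => rev a.1.2) (fun=> 0)
  (fun t => (t.2.2 + t.1.2 * t.2.1) %% t.1.1.1.+1)).
- by pt.
- by pt.
- have hb : PT nat_of_bool by exact: PT_finite.
  by pt.
- have [k hk] : polyb (fun n => 2 * n + 5) by poly.
  exists k => a i _; apply: leq_trans (hk _); rewrite esz_nat.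
  set X := foldl _ _ _; have : X <= a.1.1.
    rewrite /X; elim/last_ind: (take i _) => // l b IH; rewrite foldl_rcons -ltnS ltn_mod; by [].
  have : a.1.1 <= esz a; last by lia.
  by case: (a) => [[p s] x]; rewrite !esz_pair esz_nat /=; lia.
Qed.

Lemma PT_Enc : PT (fun a : nat * str => Enc a.1.+1 a.2).
Proof.
have h := PT_evalp; rewrite /Enc /eidx /ebit.
have ho : PT odd.
  by apply: (@PT_ext _ _ _ _ (fun n => n %% 2 == 1)); [move=> n; rewrite modn2; case: odd | pt].
apply: PT_map2; first by pt.
apply: (PT_comp2 ho); apply: PT_mod; last by pt.
apply: PT_add; last by pt.
apply: PT_mul; last by pt.
exact: (PT_comp (PT_pair (PT_pair (PT_fst PT_fst_) (PT_snd PT_fst_)) (PT_fst (PT_fst PT_snd_))) h).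
Qed.

(** * Space-bounded computations as functional graphs on bit strings *)

Section Graphs.
Variable M : TM.
Notation Q := (tm_Q M).
Notation d := #|tm_Q M|.

Definition cellb (o : option bool) : str := if o is Some b then [:: true; b] else [:: false; false].
Definition bcell (s : str) (j : nat) : option bool :=
  if nth false s j then Some (nth false s j.+1) else None.
Definition stb (s : Q) : str := [seq s == s' | s' <- enum Q].
Definition cells (c : config M) (S : nat) : seq (option bool) :=
  [seq (colf c i).2 | i <- iota 0 S.+1] ++ [seq (colf c i).1.2 | i <- iota 0 S].
Definition cfgb (S : nat) (c : config M) : str :=
  stb (cfg_state c) ++ flatten [seq cellb o | o <- cells c S].
Definition Nb (S : nat) : nat := d + (S.+1 + S) * 2.
Definition bcfg (S : nat) (s : str) : config M :=
  (nth (@tm_start M) (enum Q) (index true (take d s)),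
   [seq bcell s (d + (S.+1 + i) * 2) | i <- iota 0 S], bcell s d,
   [seq bcell s (d + i.+1 * 2) | i <- iota 0 S]).
Definition goalb (S : nat) : str := nseq (Nb S) false.
(* strings without a state bit, in particular the goal, are fixed points *)
Definition nextb (S : nat) (s : str) : str :=
  if ~~ has id (take d s) then s else
  let c := bcfg S s in
  if @tm_halt M (cfg_state c) then if @tm_accept M (cfg_state c) then goalb S else s
  else cfgb S (step c).

Lemma size_cells s : size (flatten [seq cellb o | o <- s]) = size s * 2.
Proof. by elim: s => //= -[b|] s IH; rewrite /= IH mulSn. Qed.

Lemma size_cfgb S c : size (cfgb S c) = Nb S.
Proof.
by rewrite /cfgb size_cat size_map -cardE size_cells /cells size_cat !size_map !size_iota.
Qed.

Lemma size_nextb S s : size s = Nb S -> size (nextb S s) = Nb S.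
Proof.
by rewrite /nextb => hs; case: ifP => // _; case: ifP => _; rewrite ?size_cfgb //; case: ifP; rewrite ?size_nseq.
Qed.

Lemma next_goal S : nextb S (goalb S) = goalb S.
Proof.
rewrite /nextb; case: ifP => // /negbFE /hasP [b]; rewrite /goalb => /mem_take.
by rewrite mem_nseq => /andP [_ /eqP ->].
Qed.

Lemma bcell_cells u s k : k < size s -> bcell (u ++ flatten [seq cellb o | o <- s]) (size u + k * 2) = nth None s k.
Proof.
have h1 i : nth false (u ++ flatten [seq cellb o | o <- s]) (size u + i) = nth false (flatten [seq cellb o | o <- s]) i.
  by rewrite nth_cat ltnNge leq_addr /= addKn.
rewrite /bcell -addnS !h1 => {h1}; elim: s k => // o s IH [|k] hk; first by case: (o) => [[]|].
by have h := IH k hk; rewrite mulSn; case: (o) => [[]|]; exact: h.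
Qed.

Lemma cfgb_state S c : nth (@tm_start M) (enum Q) (index true (take d (cfgb S c))) = cfg_state c.
Proof.
rewrite /cfgb take_size_cat; last by rewrite size_map -cardE.
have -> : index true (stb (cfg_state c)) = index (cfg_state c) (enum Q).
  by rewrite /stb; elim: (enum Q) => //= s l ->; rewrite eqb_id [s == _]eq_sym.
by rewrite nth_index // mem_enum.
Qed.

Lemma colf_state (c : config M) k : (colf c k).1.1 = cfg_state c.
Proof. by case: c => [[[q l] a] r]. Qed.

(** Decoding pads both half-tapes with blanks up to length [S], so a configuration is recovered only
    up to [colf]; by [step_ext] and [cfgb_ext] nothing else matters. *)
Lemma cfgbK S (c : config M) : blank_from c S.+1 -> (colf c S).1.2 = None -> forall k, colf (bcfg S (cfgb S c)) k = colf c k.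
Proof.
move=> hb hS k; have hd : size (stb (cfg_state c)) = d by rewrite size_map -cardE.
have hc j : j < S.+1 + S -> bcell (cfgb S c) (d + j * 2) = nth None (cells c S) j.
  by move=> hj; rewrite -hd bcell_cells // size_cat !size_map !size_iota.
have hR i : i < S.+1 -> bcell (cfgb S c) (d + i * 2) = (colf c i).2.
  move=> hi; rewrite hc ?ltn_addr // nth_cat size_map size_iota hi (nth_map 0) ?size_iota //.
  by rewrite nth_iota.
have hL i : i < S -> bcell (cfgb S c) (d + (S.+1 + i) * 2) = (colf c i).1.2.
  move=> hi; rewrite hc ?ltn_add2l // nth_cat size_map size_iota ltnNge leq_addr /= addKn.
  by rewrite (nth_map 0) ?size_iota // nth_iota.
have -> : colf c k = (cfg_state c, (colf c k).1.2, (colf c k).2) by rewrite -(colf_state c k); case: (colf c k) => [[]].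
rewrite /bcfg /colf cfgb_state -/(colf c k); congr (_, _, _).
  case: (ltnP k S) => hk; first by rewrite (nth_map 0) ?size_iota // nth_iota // hL.
  rewrite nth_default ?size_map ?size_iota //; case: (ltngtP k S) hk => // [h|->] _; last by rewrite hS.
  by rewrite (hb k h).1.
case: (ltnP k S.+1) => hk; last first.
  by rewrite nth_default ?(hb k hk).2 //= size_map size_iota.
case: k hk => [|k] hk /=; first by have := hR 0 isT; rewrite mul0n addn0 => ->.
by rewrite (nth_map 0) ?size_iota // nth_iota // hR.
Qed.

Lemma cfgb_ext S (c c' : config M) : colf c =1 colf c' -> cfgb S c = cfgb S c'.
Proof.
move=> h; have hs : cfg_state c = cfg_state c' by rewrite -(colf_state c 0) h colf_state.
by rewrite /cfgb hs; congr (_ ++ flatten (map _ _)); congr (_ ++ _); apply: eq_map => i; rewrite h.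
Qed.

Lemma step_ext (c c' : config M) : colf c =1 colf c' -> colf (step c) =1 colf (step c').
Proof. by move=> h k; rewrite !(@col_step _ _ _ false) // !h. Qed.

Lemma space_blank S (c : config M) : cfg_space c <= S -> blank_from c S.+1 /\ (colf c S).1.2 = None.
Proof.
case: c => [[[q l] a] r] /= h; split=> [k hk|]; last by rewrite /colf /= nth_default //; lia.
by rewrite /colf; cbn [fst snd]; rewrite !nth_default //=; lia.
Qed.

Section Run.
Variables (x : str) (S T : nat).
Hypothesis hT : @tm_halt M (cfg_state (run M T x)).
Hypothesis hS : forall t, t <= T -> cfg_space (run M t x) <= S.

Lemma next_run t : t <= T -> nextb S (cfgb S (run M t x)) =
  if @tm_halt M (cfg_state (run M t x)) then if @tm_accept M (cfg_state (run M t x)) then goalb S else cfgb S (run M t x)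
  else cfgb S (run M t.+1 x).
Proof.
move=> ht; have [h1 h2] := space_blank (hS ht).
have hs : has id (take d (cfgb S (run M t x))).
  rewrite /cfgb take_size_cat; last by rewrite size_map -cardE.
  apply/hasP; exists true => //; apply/mapP; exists (cfg_state (run M t x)); by rewrite ?mem_enum ?eqxx.
have e := cfgbK h1 h2.
rewrite /nextb hs -[~~ true]/false; cbv iota zeta; have -> : cfg_state (bcfg S (cfgb S (run M t x))) = cfg_state (run M t x).
  by rewrite -(colf_state _ 0) e colf_state.
by case: ifP => // _; rewrite /run iterS; apply: cfgb_ext; exact: step_ext.
Qed.

Lemma cfgb_neq_goal c : cfgb S c != goalb S.
Proof.
apply/eqP => e; have := next_goal S; rewrite /nextb.
have : true \in cfgb S c by rewrite mem_cat; apply/orP; left; apply/mapP; exists (cfg_state c); rewrite ?mem_enum ?eqxx.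
by rewrite e /goalb mem_nseq andbF.
Qed.

(** Up to the first halting time the graph follows the run. There it moves to the goal or stays
    forever at a configuration, whose one-hot state distinguishes it from the all-zero goal. *)
Lemma reach_goal : (exists t, iter t (nextb S) (cfgb S (init_config M x)) = goalb S) <->
  @tm_accept M (cfg_state (run M T x)).
Proof.
have [T0 hT0 minT0] : exists2 T0, @tm_halt M (cfg_state (run M T0 x)) &
    forall t, @tm_halt M (cfg_state (run M t x)) -> T0 <= t.
  have ex : exists t, @tm_halt M (cfg_state (run M t x)) by exists T.
  by case: (ex_minnP ex) => T0 h1 h2; exists T0.
have hle : T0 <= T by exact: minT0.
have hI t : t <= T0 -> iter t (nextb S) (cfgb S (init_config M x)) = cfgb S (run M t x).
  elim: t => // t IH ht; rewrite iterS IH ?(ltnW ht) // next_run; last by apply: leq_trans hle; exact: ltnW.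
  case: ifP => // /minT0; lia.
rewrite (run_halted hT0 hle); split=> [[t ht]|ha]; last first.
  by exists T0.+1; rewrite iterS hI // next_run // hT0 ha.
case: (leqP t T0) => htt; first by have := cfgb_neq_goal (run M t x); rewrite -hI // ht eqxx.
case: (boolP (@tm_accept M (cfg_state (run M T0 x)))) => // na.
have hfix k : iter (k + T0) (nextb S) (cfgb S (init_config M x)) = cfgb S (run M T0 x).
  elim: k => [|k IH]; first by rewrite add0n hI.
  by rewrite addSn iterS IH next_run // hT0 (negPf na).
by have := cfgb_neq_goal (run M T0 x); rewrite -ht -(subnKC (ltnW htt)) addnC hfix eqxx.
Qed.

End Run.

Lemma PT_cfgb : PT (fun a : nat * config M => cfgb a.1 a.2).
Proof.
have h1 : PT stb by exact: PT_finite.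
have h2 : PT cellb by exact: PT_finite.
have hL : PT (fun a : config M * nat => (colf a.1 a.2).1.2).
  by apply: (@PT_ext _ _ _ _ (fun a : config M * nat => nth None a.1.1.1.2 a.2)); [case=> [[[[q l] b] r] k] | pt].
have hR : PT (fun a : config M * nat => (colf a.1 a.2).2).
  by apply: (@PT_ext _ _ _ _ (fun a : config M * nat => nth None (a.1.1.2 :: a.1.2) a.2)); [case=> [[[[q l] b] r] k] | pt].
have h3 : PT (fun a : nat * config M => cells a.2 a.1).
  rewrite /cells; apply: PT_cat; (apply: PT_map2; first by pt).
    exact: (PT_comp (PT_pair (PT_snd PT_fst_) PT_snd_) hR).
  exact: (PT_comp (PT_pair (PT_snd PT_fst_) PT_snd_) hL).
rewrite /cfgb /cfg_state; apply: PT_cat; first by pt.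
apply: PT_flatten; exact: (@PT_map2 _ _ _ _ _ _ (fun a : nat * config M => cells a.2 a.1) (fun _ o => cellb o) h3 (PT_comp PT_snd_ h2)).
Qed.

Lemma PT_nextb : PT (fun a : nat * str => nextb a.1 a.2).
Proof.
have hb : PT (fun a : str * nat => bcell a.1 a.2).
  have hs : PT (Some : bool -> option bool) by exact: PT_finite.
  by rewrite /bcell; pt.
have hh : PT (fun s : str => has id s).
  apply: (@PT_ext _ _ _ _ (fun s : str => 0 < size [seq b <- s | b])); last by pt.
  by move=> s; rewrite size_filter -has_count.
have hi : PT (fun s : str => index true s).
  apply: (@PT_ext _ _ _ _ (fun s : str => index 1 [seq nat_of_bool b | b <- s])).
    by elim=> //= -[] s IH //=; rewrite IH.
  have hn : PT nat_of_bool by exact: PT_finite.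
  by pt.
have hq : PT (fun n => nth (@tm_start M) (enum Q) n) by pt.
have hc : PT (fun a : nat * str => bcfg a.1 a.2).
  rewrite /bcfg; apply: PT_pair; last by pt.
  apply: PT_pair; last by pt.
  apply: PT_pair; last by pt.
  by apply: (PT_comp2 hq); pt.
have hst : PT (fun a : nat * str => cfg_state (bcfg a.1 a.2)) by rewrite /cfg_state; pt.
have hcf := PT_cfgb; have hstep := PT_step M.
rewrite /nextb; apply: PT_if; first by pt.
  by pt.
apply: PT_if; first exact: (PT_fin (@tm_halt M) hst).
  apply: PT_if; first exact: (PT_fin (@tm_accept M) hst).
    apply: (@PT_ext _ _ _ _ (fun a : nat * str => [seq false | _ <- iota 0 (Nb a.1)])).
      by move=> a; rewrite /goalb; elim: (Nb a.1) 0 => //= n IH m; rewrite IH.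
    by rewrite /Nb; pt.
  by pt.
exact: (PT_comp (PT_pair PT_fst_ (PT_comp hc hstep)) hcf).
Qed.

End Graphs.

Theorem pspace_graph L : inPSPACE L -> exists (F : nat -> str -> str) (Nf Sf : nat -> nat)
    (s0 : str -> str),
  [/\ [/\ PT (fun a : nat * str => F a.1 a.2), PT Nf, PT Sf & PT s0],
   forall S s, size s = Nf S -> size (F S s) = Nf S,
   forall S, F S (nseq (Nf S) false) = nseq (Nf S) false,
   forall x, size (s0 x) = Nf (Sf (size x)) &
   forall x, L x <-> exists t, iter t (F (Sf (size x))) (s0 x) = nseq (Nf (Sf (size x))) false].
Proof.
case=> M [k hM]; pose Sf n := poly_bound k n.
exists (@nextb M), (Nb M), Sf, (fun x => cfgb (Sf (size x)) (init_config M x)); split.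
- have hS : PT Sf by apply: PT_poly_bound; pt.
  split => //; [exact: PT_nextb | by rewrite /Nb; pt |].
  by have h1 := PT_init M; have h2 := PT_cfgb M; apply: (PT_app2 h2); [apply: (PT_comp2 hS); pt | pt].
- exact: size_nextb.
- exact: next_goal.
- by move=> x; rewrite size_cfgb.
- move=> x; have [T [h1 [h2 h3]]] := hM x; rewrite -h3.
  by have := reach_goal h1 h2; rewrite /goalb; tauto.
Qed.

(** * Reconfiguration of encoded states *)

Section Strings.
Variables (q : nat) (I : inst q) (N K B : nat) (F : str -> str) (s0 gl : str).
Variables (ec : str -> nat -> bool) (al C : rat).
Definition adj (s1 s2 : str) : bool := [|| s2 == s1, s2 == F s1 | s1 == F s2].
Definition word (s1 s2 : str) (k : nat) : bool := if k < K then ec s1 k else ec s2 (k - K).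

Hypothesis hI : okI I.
Hypothesis hL : forall G, Lavg I G = E (fun k : 'I_(2 * K) => G k).
Hypothesis hlab : forall l, l \in I.2 -> l.1 < 2 * K.
Hypothesis K20 : 20 <= K.
Hypothesis B0 : 0 < B.
Hypothesis hBt : forall t v, t \in I.1 -> v \in t.1 -> v < B.
Hypothesis hBl : forall l, l \in I.2 -> l.2.1 < B /\ l.2.2 < B.
Hypothesis hF : forall s, size s = N -> size (F s) = N.
Hypothesis hgl : F gl = gl.
Hypotheses (hs0 : size s0 = N) (hgN : size gl = N).
Hypothesis hdis : forall s s', size s = N -> size s' = N -> s != s' -> (1 / 4 <= hdist K (ec s) (ec s'))%R.
Hypothesis hcom : forall s1 s2, size s1 = N -> size s2 = N -> adj s1 s2 ->
  exists y, (forall t, t \in I.1 -> sat y t) /\ forall l, l \in I.2 -> lkok (word s1 s2) y l.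
Hypothesis hsnd : forall y, (Uns I y <= al)%R -> exists s1 s2, [/\ size s1 = N, size s2 = N, adj s1 s2
  & (Lkd I (word s1 s2) y <= C * Uns I y)%R].
Hypotheses (C0 : (0 <= C)%R) (al0 : (0 < al)%R).

Notation m := (size I.1).
Definition oY := 4 + 2 * K.
Definition oZ := oY + B.
Definition Len := oZ + B.

(* The flags are start, goal, free 1 and free 2; the rest is the two encoded states [X1], [X2],
   a proof [Y] for the pair [(X1, X2)] and a proof [Z] for [(X2, X2)] or [(X1, X1)]. *)
Definition prf (y wd : nat -> bool) (r : nat) : bool :=
  sat y (nth (c0 q) I.1 r) && lkok wd y (nth (0, (0, 0)) I.2 r).
(** The label of a uniform link, reduced modulo [K], is a uniform position of a block; this way all
    modes share the index [r]. *)
Definition chkX (s : str) (g : nat -> bool) (r : nat) : bool :=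
  let k := (nth (0, (0, 0)) I.2 r).1 %% K in g (4 + k) == ec s k.
(** A single block is validated by the pair tester applied to the block written twice, hence the
    indices modulo [K]; this is sound and complete because a state is adjacent to itself. More than
    one flag is always rejected. *)
Definition goodr (g : nat -> bool) (r : nat) : bool :=
  match g 0, g 1, g 2, g 3 with
  | false, false, false, false => prf (fun v => g (oY + v)) (fun k => g (4 + k)) r
  | false, false, true, false => prf (fun v => g (oZ + v)) (fun k => g (4 + (K + k %% K))) r
  | false, false, false, true => prf (fun v => g (oZ + v)) (fun k => g (4 + k %% K)) r
  | true, false, false, false => chkX s0 g r
  | false, true, false, false => chkX gl g r
  | _, _, _, _ => false
  end.
Definition rhog (g : nat -> bool) : rat := E (fun r : 'I_m => br (~~ goodr g r)).

Section Sound.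
Local Open Scope ring_scope.
Variable ep : rat.
Hypotheses (ep1 : ep <= al) (ep2 : (1 + C) * ep <= 1 / 40) (ep3 : ep <= 1 / 40).

Lemma E_list (T : Type) (s : seq T) (d : T) (G : T -> rat) : (\sum_(t <- s) G t) / (size s)%:R = E (fun r : 'I_(size s) => G (nth d s r)).
Proof. by rewrite /E card_ord (big_nth d) big_mkord. Qed.

Lemma Uns_E y : Uns I y = E (fun r : 'I_m => br (~~ sat y (nth (c0 q) I.1 r))).
Proof. exact: E_list. Qed.

Lemma links_E (G : link -> rat) : (\sum_(l <- I.2) G l) / (size I.2)%:R =
  E (fun r : 'I_m => G (nth (0, (0, 0))%N I.2 r)).
Proof. by rewrite (E_list _ (0, (0, 0))%N) hI.2. Qed.

(** Links compare the actual word and the decoded word with the same proof bits, so their distance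
    is at most the sum of the two link errors, [(1 + C) * ep]. *)
Lemma prf_sound y wd : E (fun r : 'I_m => br (~~ prf y wd r)) <= ep ->
  exists s1 s2, [/\ size s1 = N, size s2 = N, adj s1 s2 & hdist (2 * K) wd (word s1 s2) <= 1 / 40].
Proof.
move=> h.
have h1 : Uns I y <= ep.
  apply: le_trans h; rewrite Uns_E; apply: E_le => r; apply: br_imp; rewrite /prf negb_and => ->; by [].
have h2 : Lkd I wd y <= ep.
  apply: le_trans h; rewrite /Lkd links_E; apply: E_le => r; apply: br_imp; rewrite /prf negb_and => ->.
  by rewrite orbT.
have [s1 [s2 [g1 g2 g3 g4]]] := hsnd (le_trans h1 ep1); exists s1, s2; split; [exact: g1 | exact: g2 | exact: g3 |].
have h3 : hdist (2 * K) wd (word s1 s2) <= Lkd I wd y + Lkd I (word s1 s2) y.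
  rewrite /hdist -(hL (fun k => br (wd k != word s1 s2 k))) /Lavg /Lkd !links_E -E_add; apply: E_le => r.
  rewrite /lkok; move: (_ (+) _) (wd _) (word _ _ _) => a b c; by case: a; case: b; case: c.
have h4 := ler_wpM2l C0 h1; have := ep2; lra.
Qed.

Lemma hdist_half u v : hdist K u v + hdist K (fun k => u (K + k)%N) (fun k => v (K + k)%N) = 2 * hdist (2 * K) u v.
Proof.
have K0 : 0 < K%:R :> rat by rewrite ltr0n; exact: leq_trans K20.
rewrite /hdist /E !card_ord mul2n -addnn big_split_ord /= natrD.
set a := \sum_(i < K) _; set b := \sum_(i < K) _; field; lra.
Qed.

Lemma hdist_ge0 n u v : 0 <= hdist n u v.
Proof. by apply: E_ge0 => k; exact: br_ge0. Qed.

Definition close (X : nat -> bool) (s : str) : Prop := size s = N /\ hdist K X (ec s) <= 1 / 20.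

Lemma eq_hdist n u u' v v' : (forall k, (k < n)%N -> u k = u' k) -> (forall k, (k < n)%N -> v k = v' k) ->
  hdist n u v = hdist n u' v'.
Proof. by move=> h1 h2; apply: eq_E => k; rewrite h1 // h2. Qed.

(** A distance of 1/40 on the double block is at most 1/20 on either half. *)
Lemma prf_close y wd : E (fun r : 'I_m => br (~~ prf y wd r)) <= ep ->
  exists s1 s2, [/\ adj s1 s2, close wd s1 & close (fun k => wd (K + k)%N) s2].
Proof.
move=> /prf_sound [s1 [s2 [h1 h2 h3 h4]]]; exists s1, s2; have := hdist_half wd (word s1 s2).
have := hdist_ge0 K wd (word s1 s2); have := hdist_ge0 K (fun k => wd (K + k)%N) (fun k => word s1 s2 (K + k)%N).
have -> : hdist K wd (word s1 s2) = hdist K wd (ec s1) by apply: eq_hdist => // k hk; rewrite /word hk.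
have -> : hdist K (fun k => wd (K + k)%N) (fun k => word s1 s2 (K + k)%N) = hdist K (fun k => wd (K + k)%N) (ec s2).
  by apply: eq_hdist => // k hk; rewrite /word ltnNge leq_addr /= addKn.
move=> a b c; split; [exact: h3 | split; [exact: h1 | lra] | split; [exact: h2 | lra]].
Qed.

Lemma chk_close s g : size s = N -> E (fun r : 'I_m => br (~~ chkX s g r)) <= ep -> close (fun k => g (4 + k)%N) s.
Proof.
move=> hs h; split; first exact: hs.
apply: le_trans (_ : ep <= _); last by have := ep3; lra.
apply: le_trans h; pose G k := br (g (4 + k %% K)%N != ec s (k %% K)).
rewrite -(links_E (fun l => G l.1)) -[X in _ <= X]/(Lavg I G) hL.
have e : 2 * hdist K (fun k => g (4 + k)%N) (ec s) = 2 * E (fun k : 'I_(2 * K) => G k).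
  rewrite -(hdist_half (fun k => g (4 + k %% K)%N) (fun k => ec s (k %% K))).
  have -> : hdist K (fun k => g (4 + k %% K)%N) (fun k => ec s (k %% K)) = hdist K (fun k => g (4 + k)%N) (ec s).
    by apply: eq_hdist => k hk; rewrite modn_small.
  have -> : hdist K (fun k => g (4 + (K + k) %% K)%N) (fun k => ec s ((K + k) %% K)) = hdist K (fun k => g (4 + k)%N) (ec s).
    by apply: eq_hdist => k hk; rewrite modnDl modn_small.
  by rewrite mulr_natl mulr2n.
lra.
Qed.

(** Three distances of 1/20 stay below the code distance 1/4. *)
Lemma close_uniq X X' s s' : close X s -> close X' s' -> hdist K X X' <= 1 / 20 -> s = s'.
Proof.
move=> [h1 h2] [h3 h4] h5; apply/eqP; apply: contraT => ne.
have := hdis h1 h3 ne; have := hdist_tri K (ec s) X (ec s'); have := hdist_tri K X X' (ec s').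
by rewrite (hdistC K (ec s) X); lra.
Qed.

Definition live (s : str) := exists t, iter t F s = gl.

Lemma live_F s : live s <-> live (F s).
Proof.
split=> [[[|t] h]|[t h]]; last by exists t.+1; rewrite iterSr.
  by exists 0%N; rewrite /= in h *; rewrite h hgl.
by exists t; rewrite -h iterSr.
Qed.

Lemma live_adj s s' : adj s s' -> live s <-> live s'.
Proof.
by case/or3P => /eqP ->; [| exact: live_F | symmetry; exact: live_F].
Qed.

(* the encoded states whose validity is checked in the current mode are not connected to the goal *)
Definition inv (g : nat -> bool) : Prop :=
  (~~ g 2 -> exists2 s, close (fun k => g (4 + k)%N) s & ~ live s) /\
  (~~ [|| g 0, g 1 | g 3]%N -> exists2 s, close (fun k => g (4 + (K + k))%N) s & ~ live s).

Definition modes (g : nat -> bool) := (g 0 + g 1 + g 2 + g 3 <= 1)%N.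

Lemma good_modes g : rhog g <= ep -> modes g.
Proof.
move=> h; rewrite /modes.
case: (boolP (g 0 + g 1 + g 2 + g 3 <= 1)%N) => // hm.
have e : rhog g = 1.
  rewrite /rhog (eq_E (G := fun=> 1)); first by rewrite E_const // card_ord hI.1.
  by move=> r; rewrite /goodr; move: hm; case: (g 0); case: (g 1); case: (g 2); case: (g 3).
by have := ep3; lra.
Qed.

Lemma good_close g : rhog g <= ep ->
  [/\ ~~ g 2 -> exists s, close (fun k => g (4 + k)%N) s,
      ~~ [|| g 0, g 1 | g 3]%N -> exists s, close (fun k => g (4 + (K + k))%N) s &
      ~~ [|| g 0, g 1, g 2 | g 3]%N -> exists s1 s2,
        [/\ adj s1 s2, close (fun k => g (4 + k)%N) s1 & close (fun k => g (4 + (K + k))%N) s2]].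
Proof.
move=> h; have := good_modes h; move: h; rewrite /modes /rhog /goodr.
have K0 : (0 < K)%N by exact: leq_trans K20.
have hmod k : (k < K)%N -> (k %% K = k)%N by exact: modn_small.
case: (g 0); case: (g 1); case: (g 2); case: (g 3) => //= h _.
- by split => // _; exists s0; exact: chk_close.
- by split => // _; exists gl; exact: chk_close.
- split=> [//|_|//]; have [s1 [s2 [_ [hs h1] _]]] := prf_close h; exists s1; split; first exact: hs.
  by rewrite (eq_hdist (u' := fun k => g (4 + (K + k %% K))%N) (v' := ec s1)) // => k hk; rewrite hmod.
- split=> [_|//|//]; have [s1 [s2 [_ [hs h1] _]]] := prf_close h; exists s1; split; first exact: hs.
  by rewrite (eq_hdist (u' := fun k => g (4 + k %% K)%N) (v' := ec s1)) // => k hk; rewrite hmod.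
- have [s1 [s2 [h1 h2 h3]]] := prf_close h.
  by split => // _; [exists s1 | exists s2 | exists s1, s2].
Qed.

(** This is where [20 <= K] is used: a single bit is at most a fraction 1/20 of a block. *)
Lemma hdist_one (X X' : nat -> bool) j : (forall k, k != j -> X k = X' k) -> hdist K X X' <= 1 / 20.
Proof.
move=> h; have KR : 20 <= K%:R :> rat by rewrite ler_nat.
rewrite /hdist /E card_ord ler_pdivrMr; last by lra.
apply: (@le_trans _ _ 1); last by lra.
case: (ltnP j K) => hj.
  rewrite (bigD1 (Ordinal hj)) //= big1 ?addr0 ?br_le1 // => k hk.
  by rewrite h ?eqxx //; apply: contraNneq hk => e; apply/eqP; apply: val_inj.
by rewrite big1 // => k _; rewrite h ?eqxx //; apply/eqP => e; have := ltn_ord k; lia.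
Qed.

(** A block checked before and after the change decodes to the same state. A block that becomes
    checked does so because its flag, or a flag freeing it, was the changed bit; then no flag is
    left, so the adjacency test ties it to the other block, which was checked all along. *)
Lemma inv_step g g' j : rhog g <= ep -> rhog g' <= ep -> (forall k, k != j -> g k = g' k) -> inv g -> inv g'.
Proof.
move=> h h' hj [i1 i2].
have [c1 c2 c3] := good_close h'; have m1 := good_modes h; have m2 := good_modes h'.
have move1 : ~~ g 2 -> ~~ g' 2 -> exists2 s, close (fun k => g' (4 + k)%N) s & ~ live s.
  move=> /i1 [s hs nl] /c1 [s' hs']; exists s' => //.
  have hd : hdist K (fun k => g (4 + k)%N) (fun k => g' (4 + k)%N) <= 1 / 20.
    apply: (@hdist_one _ _ (j - 4)%N) => k hk; apply: hj.
    by apply: contraNneq hk => <-; rewrite addKn.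
  by rewrite -(close_uniq hs hs' hd).
have move2 : ~~ [|| g 0, g 1 | g 3]%N -> ~~ [|| g' 0, g' 1 | g' 3]%N ->
   exists2 s, close (fun k => g' (4 + (K + k))%N) s & ~ live s.
  move=> /i2 [s hs nl] /c2 [s' hs']; exists s' => //.
  have hd : hdist K (fun k => g (4 + (K + k))%N) (fun k => g' (4 + (K + k))%N) <= 1 / 20.
    apply: (@hdist_one _ _ (j - 4 - K)%N) => k hk; apply: hj.
    by apply: contraNneq hk => <-; rewrite addKn addKn.
  by rewrite -(close_uniq hs hs' hd).
have dXX X : hdist K X X <= 1 / 20 by apply: (@hdist_one _ _ 0%N).
split=> hg'.
- case: (boolP (g 2)) => hg; last exact: move1.
  have ej : j = 2 by apply/eqP; apply: contraNT hg' => nj; rewrite -hj // eq_sym.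
  have [e0 e1 e3] : [/\ g 0 = g' 0, g 1 = g' 1 & g 3 = g' 3] by split; apply: hj; rewrite ej.
  have z : ~~ [|| g 0, g 1 | g 3]%N by move: m1; rewrite /modes hg; case: (g 0); case: (g 1); case: (g 3).
  have z' : ~~ [|| g' 0, g' 1 | g' 3]%N by rewrite -e0 -e1 -e3.
  have z'' : ~~ [|| g' 0, g' 1, g' 2 | g' 3]%N by move: z' hg'; case: (g' 0); case: (g' 1); case: (g' 2); case: (g' 3).
  have [s1 [s2 [ha h1 h2]]] := c3 z''; have [s hs nl] := move2 z z'.
  by exists s1 => //; rewrite (close_uniq hs h2 (dXX _)) in nl => /(live_adj ha).
- case: (boolP [|| g 0, g 1 | g 3]%N) => hg; last exact: move2.
  have nj : (2 != j)%N.
    apply: contraTneq hg => ej; have [-> -> ->] : [/\ g 0 = g' 0, g 1 = g' 1 & g 3 = g' 3] by split; apply: hj; rewrite -ej.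
    exact: hg'.
  have z : ~~ g 2 by move: m1 hg; rewrite /modes; case: (g 0); case: (g 1); case: (g 2); case: (g 3).
  have z' : ~~ g' 2 by rewrite -hj.
  have z'' : ~~ [|| g' 0, g' 1, g' 2 | g' 3]%N by move: z' hg'; case: (g' 0); case: (g' 1); case: (g' 2); case: (g' 3).
  have [s1 [s2 [ha h1 h2]]] := c3 z''; have [s hs nl] := move1 z z'.
  by exists s2 => //; rewrite (close_uniq hs h1 (dXX _)) in nl => /(live_adj ha).
Qed.

End Sound.

Definition mk (fl : str) (X1 X2 Y Z : nat -> bool) : str := mkseq (fun k =>
  if k < 4 then nth false fl k else if k < 4 + K then X1 (k - 4) else if k < oY then X2 (k - (4 + K))
  else if k < oZ then Y (k - oY) else Z (k - oZ)) Len.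
Definition zro (k : nat) := false.
Definition pst : str := mk [:: true] (ec s0) zro zro zro.
Definition pgl : str := mk [:: false; true] (ec gl) zro zro zro.

Lemma size_mk fl X1 X2 Y Z : size (mk fl X1 X2 Y Z) = Len. Proof. exact: size_mkseq. Qed.

Section MkNth.
Variables (fl : str) (X1 X2 Y Z : nat -> bool).
Notation g := (nth false (mk fl X1 X2 Y Z)).
Lemma mk_fl k : k < 4 -> g k = nth false fl k.
Proof. by move=> h; rewrite nth_mkseq ?h // /Len /oZ /oY; lia. Qed.
Lemma mk_X1 k : k < K -> g (4 + k) = X1 k.
Proof. by move=> h; rewrite nth_mkseq /Len /oZ /oY; [do !case: ltnP => ?; try lia; congr X1; lia | lia]. Qed.
Lemma mk_X2 k : k < K -> g (4 + (K + k)) = X2 k.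
Proof. by move=> h; rewrite nth_mkseq /Len /oZ /oY; [do !case: ltnP => ?; try lia; congr X2; lia | lia]. Qed.
Lemma mk_Y v : v < B -> g (oY + v) = Y v.
Proof. by move=> h; rewrite nth_mkseq /Len /oZ /oY; [do !case: ltnP => ?; try lia; congr Y; lia | lia]. Qed.
Lemma mk_Z v : v < B -> g (oZ + v) = Z v.
Proof. by move=> h; rewrite nth_mkseq /Len /oZ /oY; [do !case: ltnP => ?; try lia; congr Z; lia | lia]. Qed.
End MkNth.

Lemma hamming0 (u v : str) : size u = size v -> hamming u v = 0 -> u = v.
Proof.
elim: u v => [|a u IH] [|b v] //= [hs]; rewrite /hamming /=; case: eqP => // -> /= h.
by rewrite (IH v hs h).
Qed.

Lemma hamming1 (u v : str) : size u = size v -> hamming u v <= 1 ->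
  exists j, forall k, k != j -> nth false u k = nth false v k.
Proof.
elim: u v => [|a u IH] [|b v] //=; first by exists 0.
case=> hs; rewrite /hamming /=; case: eqP => [-> /= h|_ /= h].
  by have [j hj] := IH v hs h; exists j.+1 => -[|k] // hk; exact: hj.
by exists 0 => -[|k] // _ /=; rewrite (@hamming0 u v) //; apply/eqP; rewrite -leqn0; exact: h.
Qed.

Theorem str_sound ep s : (ep <= al)%R -> ((1 + C) * ep <= 1 / 40)%R -> (ep <= 1 / 40)%R ->
  reconf_seq Len pst pgl s -> (forall pi, pi \in s -> (rhog (nth false pi) <= ep)%R) -> live s0.
Proof.
move=> e1 e2 e3 [hne [hh [hl [hsz hham]]]] hr.
have [//|nl] := Classical_Prop.classic (live s0); exfalso.
have d0 X X' : (forall k, k < K -> X k = X' k) -> (hdist K X X' <= 1 / 20)%R.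
  move=> h; apply: (@le_trans _ _ 0%R); last by lra.
  by rewrite /hdist /E big1 ?mul0r // => k _; rewrite h ?eqxx.
have hs1 : 0 < size s by case: (s) hne.
have key t : t < size s -> inv (nth false (nth [::] s t)).
  elim: t => [|t IH] ht.
    rewrite nth0 hh; split; last by rewrite !mk_fl.
    move=> _; exists s0; last exact: nl.
    split; first exact: hs0.
    by apply: d0 => k hk; rewrite mk_X1.
  have ht' : t < size s by exact: ltnW.
  have sz i : i < size s -> size (nth [::] s i) = Len by move=> hi; apply/eqP; exact: (allP hsz _ (mem_nth _ hi)).
  have [j hj] := hamming1 (etrans (sz t ht') (esym (sz t.+1 ht))) (hham t ht).
  exact: (inv_step e1 e2 e3 (hr _ (mem_nth _ ht')) (hr _ (mem_nth _ ht)) hj (IH ht')).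
have hlast : (size s).-1 < size s by lia.
have [h _] := key _ hlast; move: h; rewrite nth_last hl !mk_fl // => /(_ isT) [s' hs' nl'].
apply: nl'; exists 0 => /=; apply: (close_uniq (X := fun k => nth false pgl (4 + k)) hs' (_ : close (ec gl) gl)).
  by split; [exact: hgN | apply: d0].
by apply: d0 => k hk; rewrite mk_X1.
Qed.

Definition okstr (pi : str) := size pi = Len /\ forall r, r < m -> goodr (nth false pi) r.
Definition conn (pi pi' : str) := exists s, reconf_seq Len pi pi' s /\ forall x, x \in s -> okstr x.

Lemma hammingxx u : hamming u u = 0.
Proof. by rewrite /hamming; elim: u => //= a u ->; rewrite eqxx. Qed.

Lemma conn_trans b a c : conn a b -> conn b c -> conn a c.
Proof.
move=> [s [[n1 [h1 [l1 [a1 d1]]]] g1]] [t [[n2 [h2 [l2 [a2 d2]]]] g2]]; exists (s ++ t); split.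
  have s0' : 0 < size s by case: (s) n1.
  have t0 : 0 < size t by case: (t) n2.
  split; first by case: (s) n1.
  split; first by case: (s) n1 h1.
  split; first by rewrite last_cat -l2; case: (t) n2.
  split; first by rewrite all_cat a1.
  move=> i hi; rewrite !nth_cat; case: (ltnP i.+1 (size s)) => hs.
    by rewrite (ltnW hs); exact: d1.
  case: (ltnP i (size s)) => hs'.
    (* The common string appears twice at the seam, where nothing changes. *)
    have ei : i = (size s).-1 by lia.
    have -> : i.+1 - size s = 0 by lia.
    by rewrite ei nth_last nth0 h2 l1 hammingxx.
  rewrite subSn //; apply: d2; move: hi; rewrite size_cat; lia.
by move=> x; rewrite mem_cat => /orP [/g1|/g2].
Qed.

Lemma conn_interp a b : size a = Len -> size b = Len -> (forall i, okstr (take i b ++ drop i a)) -> conn a b.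
Proof.
move=> ha hb hok; pose w i := take i b ++ drop i a; exists [seq w i | i <- iota 0 Len.+1]; split; last first.
  by move=> x /mapP [i _ ->]; exact: hok.
split; first by [].
split; first by rewrite /= /w take0 drop0.
split; first by rewrite -nth_last size_map size_iota (nth_map 0) ?size_iota // nth_iota // /w take_oversize ?hb // drop_oversize ?ha // cats0.
split; first by apply/allP => x /mapP [i _ ->]; rewrite (hok i).1.
move=> t; rewrite size_map size_iota => ht; rewrite !(nth_map 0) ?size_iota //; last exact: ltnW.
rewrite !nth_iota //; last exact: ltnW.
have htL : t < Len by [].
rewrite !add0n /w (take_nth false) ?hb // cat_rcons (drop_nth false) ?ha //.
have hc p u v : hamming (p ++ u) (p ++ v) = hamming u v by rewrite /hamming; elim: p => //= c p ->; rewrite eqxx.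
by rewrite hc /hamming /= -/(hamming _ _) hammingxx addn0; case: eqP.
Qed.

Lemma nth_interp a b i k : size a = Len -> size b = Len ->
  nth false (take i b ++ drop i a) k = if k < i then nth false b k else nth false a k.
Proof.
move=> ha hb; rewrite nth_cat size_take hb; case: (ltnP i Len) => hi.
  by case: (ltnP k i) => hk; [rewrite nth_take | rewrite nth_drop subnKC].
rewrite drop_oversize ?ha // nth_nil; case: (ltnP k Len) => hk.
  by rewrite (leq_trans hk hi) nth_take // (leq_trans hk).
by case: ifP => _; rewrite !nth_default ?ha ?hb.
Qed.

Lemma sat_ext y y' t : t \in I.1 -> (forall v, v < B -> y v = y' v) -> sat y t = sat y' t.
Proof.
move=> ht h; rewrite /sat; congr (t.2 _); apply/ffunP => j; rewrite !ffunE; apply: h.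
case: (ltnP j (size t.1)) => hj; first by apply: (hBt ht); rewrite mem_nth.
by rewrite nth_default.
Qed.

Lemma lk_mem r : r < m -> nth (0, (0, 0)) I.2 r \in I.2.
Proof. by move=> hr; rewrite mem_nth // hI.2. Qed.

Lemma prf_ext y y' wd wd' r : r < m -> (forall v, v < B -> y v = y' v) ->
  (forall k, k < 2 * K -> wd k = wd' k) -> prf y wd r = prf y' wd' r.
Proof.
move=> hr h1 h2; rewrite /prf (sat_ext (mem_nth _ hr) h1) /lkok.
have [b1 b2] := hBl (lk_mem hr); rewrite !h1 // h2 //; exact: hlab (lk_mem hr).
Qed.

(** The positions that [goodr] reads under the flags of [g]; all others may be rewritten bit by bit
    without losing sure acceptance. *)
Definition relv (g : nat -> bool) (k : nat) : bool :=
  [|| k < 4, ~~ g 2 && (4 <= k < 4 + K), ~~ [|| g 0, g 1 | g 3] && (4 + K <= k < oY),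
      ~~ [|| g 0, g 1, g 2 | g 3] && (oY <= k < oZ) | (g 2 || g 3) && (oZ <= k)].

Lemma goodr_ext g g' r : r < m -> (forall k, relv g k -> g' k = g k) -> goodr g' r = goodr g r.
Proof.
move=> hr h.
rewrite /goodr /chkX; have [-> -> -> ->] : [/\ g' 0 = g 0, g' 1 = g 1, g' 2 = g 2 & g' 3 = g 3] by split; apply: h.
have K0 : 0 < K by exact: leq_trans K20.
have hm k : k %% K < K by rewrite ltn_mod.
have h1 k : ~~ g 2 -> k < K -> g' (4 + k) = g (4 + k).
  by move=> e hk; apply: h; rewrite /relv e leq_addr ltn_add2l hk orbT.
have h2 k : ~~ [|| g 0, g 1 | g 3] -> k < K -> g' (4 + (K + k)) = g (4 + (K + k)).
  move=> e hk; apply: h; rewrite /relv e /oY; apply/or4P; constructor 3; rewrite /=; lia.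
have h3 v : ~~ [|| g 0, g 1, g 2 | g 3] -> v < B -> g' (oY + v) = g (oY + v).
  move=> e hv; apply: h; rewrite /relv e leq_addr /oZ ltn_add2l hv; by rewrite !orbT.
have h4 v : g 2 || g 3 -> g' (oZ + v) = g (oZ + v).
  by move=> e; apply: h; rewrite /relv e leq_addr !orbT.
move: h1 h2 h3 h4.
case: (g 0); case: (g 1); case: (g 2); case: (g 3) => //= h1 h2 h3 h4; rewrite ?h1 //.
- by apply: prf_ext => // [v _|k _]; [exact: h4 | exact: h2].
- by apply: prf_ext => // [v _|k _]; [exact: h4 | exact: h1].
- apply: prf_ext => // [v hv|k hk]; first exact: h3.
  by case: (ltnP k K) => hk2; [exact: h1 | rewrite -(subnKC hk2); apply: h2 => //; lia].
Qed.

Lemma conn_free a b : okstr a -> size b = Len -> (forall k, relv (nth false a) k -> nth false b k = nth false a k) -> conn a b.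
Proof.
move=> [ha ga] hb h; apply: conn_interp => // i; split.
  by rewrite size_cat size_take size_drop hb ha; case: ltnP; lia.
move=> r hr; rewrite (goodr_ext (g := nth false a)) ?ga // => k hk; rewrite nth_interp //.
by case: ifP => // _; exact: h.
Qed.

Lemma conn_flag j a b : okstr a -> okstr b -> (forall k, k != j -> nth false a k = nth false b k) -> conn a b.
Proof.
move=> [ha ga] [hb gb] h; apply: conn_interp => // i.
have sz : size (take i b ++ drop i a) = Len by rewrite size_cat size_take size_drop hb ha; case: ltnP; lia.
case: (leqP i j) => hij.
  suff -> : take i b ++ drop i a = a by [].
  apply: (@eq_from_nth _ false); rewrite ?sz // => k _; rewrite nth_interp //; case: ifP => // hk.
  by rewrite h //; lia.
suff -> : take i b ++ drop i a = b by [].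
apply: (@eq_from_nth _ false); rewrite ?sz // => k _; rewrite nth_interp //; case: ltnP => // hk.
by rewrite h //; lia.
Qed.

Definition valid (s1 s2 : str) (y : nat -> bool) :=
  (forall t, t \in I.1 -> sat y t) /\ (forall l, l \in I.2 -> lkok (word s1 s2) y l).

Lemma valid_prf s1 s2 y r : valid s1 s2 y -> r < m -> prf y (word s1 s2) r.
Proof. by move=> [h1 h2] hr; rewrite /prf h1 ?h2 ?lk_mem // mem_nth. Qed.

Lemma word_mod s k : k < 2 * K -> word s s k = ec s (k %% K).
Proof.
move=> hk; rewrite /word; case: ltnP => h; first by rewrite modn_small.
by rewrite -{2}(subnKC h) modnDl modn_small //; lia.
Qed.

Lemma ok_zero s1 s2 y Z : valid s1 s2 y -> okstr (mk [::] (ec s1) (ec s2) y Z).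
Proof.
move=> hv; split; first exact: size_mk; move=> r hr; rewrite /goodr !mk_fl //; cbn [nth].
rewrite (prf_ext (y' := y) (wd' := word s1 s2)) ?(valid_prf hv) // => [v hb|k hk]; first exact: mk_Y.
by rewrite /word; case: ltnP => h; [rewrite mk_X1 | rewrite -{1}(subnKC h) mk_X2 //; lia].
Qed.

Lemma ok_free1 s y X1 Y : valid s s y -> okstr (mk [:: false; false; true] X1 (ec s) Y y).
Proof.
have K0 : 0 < K by exact: leq_trans K20.
move=> hv; split; first exact: size_mk; move=> r hr; rewrite /goodr !mk_fl //; cbn [nth].
rewrite (prf_ext (y' := y) (wd' := word s s)) ?(valid_prf hv) // => [v hb|k hk]; first exact: mk_Z.
by rewrite word_mod // mk_X2 // ltn_mod.
Qed.

Lemma ok_free2 s y X2 Y : valid s s y -> okstr (mk [:: false; false; false; true] (ec s) X2 Y y).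
Proof.
have K0 : 0 < K by exact: leq_trans K20.
move=> hv; split; first exact: size_mk; move=> r hr; rewrite /goodr !mk_fl //; cbn [nth].
rewrite (prf_ext (y' := y) (wd' := word s s)) ?(valid_prf hv) // => [v hb|k hk]; first exact: mk_Z.
by rewrite word_mod // mk_X1 // ltn_mod.
Qed.

Lemma ok_start X2 Y Z : okstr (mk [:: true] (ec s0) X2 Y Z).
Proof.
have K0 : 0 < K by exact: leq_trans K20.
by split; first exact: size_mk; move=> r hr; rewrite /goodr !mk_fl //= /chkX mk_X1 ?ltn_mod.
Qed.

Lemma ok_goal X2 Y Z : okstr (mk [:: false; true] (ec gl) X2 Y Z).
Proof.
have K0 : 0 < K by exact: leq_trans K20.
by split; first exact: size_mk; move=> r hr; rewrite /goodr !mk_fl //= /chkX mk_X1 ?ltn_mod.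
Qed.

Lemma mk_free fl X1 X2 Y Z X1' X2' Y' Z' : okstr (mk fl X1 X2 Y Z) ->
  let f i := nth false fl i in (~~ f 2 -> X1' = X1) -> (~~ [|| f 0, f 1 | f 3] -> X2' = X2) ->
  (~~ [|| f 0, f 1, f 2 | f 3] -> Y' = Y) -> (f 2 || f 3 -> Z' = Z) ->
  conn (mk fl X1 X2 Y Z) (mk fl X1' X2' Y' Z').
Proof.
move=> ok f h1 h2 h3 h4; apply: (conn_free ok); first exact: size_mk.
move=> k; case: (ltnP k Len) => hk; last by rewrite !nth_default ?size_mk.
have e i : i < 4 -> nth false (mk fl X1 X2 Y Z) i = f i by exact: mk_fl.
rewrite /relv (e 0) // (e 1) // (e 2) // (e 3) // /mk !nth_mkseq //.
case: (ltnP k 4) => k4 //=; case: (ltnP k (4 + K)) => k5.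
  have -> : (oY <= k) = false by rewrite /oY; lia.
  have -> : (oZ <= k) = false by rewrite /oZ /oY; lia.
  by rewrite /= !andbF !orbF andbT => /h1 ->.
case: (ltnP k oY) => k6.
  have -> : (oZ <= k) = false by rewrite /oZ; lia.
  by rewrite /= !andbF /= !orbF andbT => /h2 ->.
case: (ltnP k oZ) => k7; first by rewrite /= !andbF /= andbT orbF => /h3 ->.
by rewrite /= !andbF /= andbT => /h4 ->.
Qed.

Lemma mk_flag j fl fl' X1 X2 Y Z : okstr (mk fl X1 X2 Y Z) -> okstr (mk fl' X1 X2 Y Z) ->
  (forall k, k < 4 -> k != j -> nth false fl k = nth false fl' k) -> conn (mk fl X1 X2 Y Z) (mk fl' X1 X2 Y Z).
Proof.
move=> o1 o2 h; apply: (conn_flag (j := j) o1 o2) => k hk.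
case: (ltnP k Len) => hkL; last by rewrite !nth_default ?size_mk.
by rewrite /mk !nth_mkseq //; case: (ltnP k 4) => // h4; exact: h.
Qed.

(** Order matters: [Z] must certify the block that stays before a flag is raised, and while it is
    raised the other block is rewritten together with [Y], so that the pair proof is right when the
    flag drops. The intermediate pair [(F s, s)] is adjacent. *)
Lemma move_step s y Z y' : size s = N -> valid s s y -> valid (F s) (F s) y' ->
  conn (mk [::] (ec s) (ec s) y Z) (mk [::] (ec (F s)) (ec (F s)) y' y').
Proof.
move=> hs hy hy'; have [y1 hy1] : exists y1, valid (F s) s y1.
  by apply: hcom; rewrite ?hF // /adj eqxx !orbT.
apply: (@conn_trans (mk [::] (ec s) (ec s) y y)); first by apply: mk_free => //; exact: ok_zero.
apply: (@conn_trans (mk [:: false; false; true] (ec s) (ec s) y y)).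
  by apply: (@mk_flag 2); [exact: ok_zero | exact: ok_free1 | case=> [|[|[|[|]]]]].
apply: (@conn_trans (mk [:: false; false; true] (ec (F s)) (ec s) y1 y)); first by apply: mk_free => //; exact: ok_free1.
apply: (@conn_trans (mk [::] (ec (F s)) (ec s) y1 y)).
  by apply: (@mk_flag 2); [exact: ok_free1 | exact: ok_zero | case=> [|[|[|[|]]]]].
apply: (@conn_trans (mk [::] (ec (F s)) (ec s) y1 y')); first by apply: mk_free => //; exact: ok_zero.
apply: (@conn_trans (mk [:: false; false; false; true] (ec (F s)) (ec s) y1 y')).
  by apply: (@mk_flag 3); [exact: ok_zero | exact: ok_free2 | case=> [|[|[|[|]]]]].
apply: (@conn_trans (mk [:: false; false; false; true] (ec (F s)) (ec (F s)) y' y')).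
  by apply: mk_free => //; exact: ok_free2.
by apply: (@mk_flag 3); [exact: ok_free2 | exact: ok_zero | case=> [|[|[|[|]]]]].
Qed.

Theorem str_complete : live s0 -> conn pst pgl.
Proof.
case=> t ht.
have sz i : size (iter i F s0) = N by elim: i => //= i IH; exact: hF.
have val i : exists y, valid (iter i F s0) (iter i F s0) y by apply: hcom; rewrite ?sz // /adj eqxx.
have [y0 hy0] := val 0; have [yt hyt] := val t.
have go i : exists y, valid (iter i F s0) (iter i F s0) y /\
   exists Z, conn pst (mk [::] (ec (iter i F s0)) (ec (iter i F s0)) y Z).
  elim: i => [|i [y [hy [Z hc]]]].
    exists y0; split => //; exists zro.
    apply: (@conn_trans (mk [:: true] (ec s0) (ec s0) y0 zro)); first by apply: mk_free => //; exact: ok_start.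
    by apply: (@mk_flag 0); [exact: ok_start | exact: ok_zero | case=> [|[|[|[|]]]]].
  have [y' hy'] := val i.+1; exists y'; split => //; exists y'.
  by apply: conn_trans hc _; exact: move_step.
have [y [hy [Z hc]]] := go t; rewrite ht in hy hc.
apply: (conn_trans hc); apply: (@conn_trans (mk [:: false; true] (ec gl) (ec gl) y Z)).
  by apply: (@mk_flag 1); [exact: ok_zero | exact: ok_goal | case=> [|[|[|[|]]]]].
by apply: mk_free => //; exact: ok_goal.
Qed.

End Strings.

(** * Verifiers that repeat a local test *)

Definition lg (m : nat) : nat :=
  (iter m (fun p => if p.1 < m then (p.1.*2, p.2.+1) else p) (1, 0)).2.

Lemma lg_iter m i : 0 < m -> exists e,
  [/\ iter i (fun p => if p.1 < m then (p.1.*2, p.2.+1) else p) (1, 0) = (2 ^ e, e), 2 ^ e <= 2 * m & m <= 2 ^ e \/ e = i].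
Proof.
move=> m0; elim: i => [|i [e [h1 h2 h3]]]; first by exists 0; split; [| lia | right].
rewrite iterS h1 /=; case: ltnP => h; last by exists e; split => //; left.
exists e.+1; rewrite expnS mul2n; split => //; first by lia.
by case: h3 => [|->]; [lia | right].
Qed.

Lemma lgP m : 0 < m -> m <= 2 ^ lg m /\ 2 ^ lg m <= 2 * m.
Proof.
move=> m0; rewrite /lg; have [e [-> h2 h3]] := lg_iter m m0; split => //=.
by case: h3 => [//|->]; exact: ltnW (ltn_expl _ _).
Qed.

Lemma PT_lg : PT lg.
Proof.
apply: PT_snd; apply: (@PT_iterc nat (nat * nat)%type _ _ id (fun=> (1, 0))
  (fun p => if p.2.1 < p.1 then (p.2.1.*2, p.2.2.+1) else p.2)); [by pt | by pt | by pt |].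
have [k hk] : polyb (fun n => 20 * n + 20) by poly.
exists k => m i _; apply: leq_trans (hk _); rewrite esz_nat; case: (posnP m) => [->|m0].
  have -> : iter i (fun s => if (0, s).2.1 < (0, s).1 then ((0, s).2.1.*2, (0, s).2.2.+1) else (0, s).2) (1, 0) = (1, 0).
    by elim: i => //= i ->.
  by rewrite esz_pair !esz_nat.
have [e [-> h2 _]] := lg_iter i m0; rewrite esz_pair !esz_nat; have := ltn_expl e (isT : 1 < 2); lia.
Qed.

Lemma bin_cat s t : bin_val (s ++ t) = bin_val s + 2 ^ size s * bin_val t.
Proof. by elim: s => [|b s IH] /=; [lia | rewrite IH expnS; lia]. Qed.

Definition binstep (p : nat * str) := if p.1 == 0 then p else (p.1 %/ 2, p.2 ++ [:: p.1 %% 2 == 1]).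
Definition tobin (v : nat) : str := (iter v binstep (v, [::])).2.

Lemma binstep_iter v i : let p := iter i binstep (v, [::]) in
  [/\ p.1 <= v - i, size p.2 <= i & bin_val p.2 + 2 ^ size p.2 * p.1 = v].
Proof.
elim: i => [|i [h1 h2 h3]] /=; first by rewrite subn0 /=; split; lia.
rewrite /binstep; set p := iter i binstep _ in h1 h2 h3 *; case: eqP => h0.
  by rewrite h0 in h3 *; split => //; lia.
rewrite /= size_cat /= bin_cat /= addn1 expnS; split; try lia.
Qed.

Lemma tobinK v : bin_val (tobin v) = v.
Proof. by rewrite /tobin; have [h1 _ h3] := binstep_iter v v; move: h1 h3; rewrite subnn leqn0 => /eqP ->; rewrite muln0 addn0. Qed.

Lemma PT_tobin : PT tobin.
Proof.
apply: PT_snd; apply: PT_iter; [by pt | by pt | by rewrite /binstep; pt |].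
have [k hk] : polyb (fun n => 20 * n + 20) by poly.
exists k => v i hi; apply: leq_trans (hk _); have [h1 h2 _] := binstep_iter v i.
move: h1 h2; case: (iter _ _ _) => a s /= h1 h2; rewrite esz_pair !esz_nat.
by have /andP [_ hs] := size_bool_esz s; lia.
Qed.

Definition toks2 (s : str) : str := flatten [seq [:: false; b] | b <- s].
Definition outenc (Is : seq nat) (D : str) : str :=
  flatten [seq toks2 (tobin v) ++ [:: true; true] | v <- Is] ++ toks2 D.

Lemma decode_out Is D : decode (outenc Is D) = (Is, D).
Proof.
have ht s t : tokens (toks2 s ++ t) = map Some s ++ tokens t.
  by elim: s => //= b s IH; rewrite IH.
have hb s t acc : split_blocks (map Some s ++ t) acc = split_blocks t (acc ++ s).
  by elim: s acc => [|b s IH] acc /=; rewrite ?cats0 // IH cat_rcons.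
have -> : decode (outenc Is D) = (map bin_val (take (size Is) (map tobin Is ++ [:: D])), last [::] (map tobin Is ++ [:: D])).
  rewrite /decode; have -> : split_blocks (tokens (outenc Is D)) [::] = map tobin Is ++ [:: D].
    rewrite /outenc; elim: Is => [|v Is IH] /=.
      by rewrite -[toks2 D]cats0 ht hb /=.
    by rewrite -!catA ht hb /= IH.
  by rewrite size_cat size_map addn1.
rewrite take_size_cat ?size_map // last_cat -map_comp; congr (_, _).
by rewrite -[RHS]map_id; apply: eq_map => v /=; exact: tobinK.
Qed.

Definition bitn (r i : nat) : str := (iter r (fun p => (p.1 %/ 2, p.2 ++ [:: p.1 %% 2 == 1])) (i, [::])).2.

Lemma bitnK s : bitn (size s) (bin_val s) = s.
Proof.
have h a : (iter (size s) (fun p => (p.1 %/ 2, p.2 ++ [:: p.1 %% 2 == 1])) (bin_val s, a)).2 = a ++ s; last exact: (h [::]).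
elim: s a => [|b s IH] a; first by rewrite cats0.
rewrite [size _]/= iterSr [bin_val _]/= -muln2.
have -> : (b + bin_val s * 2) %/ 2 = bin_val s by case: (b) => /=; lia.
have -> : (b + bin_val s * 2) %% 2 == 1 = b by case: (b) => /=; lia.
by rewrite IH -catA.
Qed.

Lemma size_bitn r i : size (bitn r i) = r.
Proof. by rewrite /bitn; elim: r => //= r IH; rewrite size_cat IH addn1. Qed.

Lemma PT_bitn : PT (fun a : nat * nat => bitn a.1 a.2).
Proof.
apply: PT_snd; apply: (@PT_iter _ (nat * str)%type _ _ (fun a : nat * nat => a.1) (fun a => (a.2, [::]))
  (fun p => (p.1 %/ 2, p.2 ++ [:: p.1 %% 2 == 1]))); [by pt | by pt | by pt |].
have [k hk] : polyb (fun n => 5 * n + 5) by poly.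
exists k => -[r n] i hi; apply: leq_trans (hk _); have h1 := size_bitn i n; rewrite /bitn in h1.
have h2 : (iter i (fun p => (p.1 %/ 2, p.2 ++ [:: p.1 %% 2 == 1])) (n, [::])).1 <= n.
  by elim: i {hi h1} => //= i IH; apply: leq_trans IH; exact: leq_div.
move: h1 h2; case: (iter _ _ _) => c s /= h1 h2; rewrite !esz_pair !esz_nat.
by have /andP [_ hs] := size_bool_esz s; move: hi => /=; lia.
Qed.

Lemma bin_lt v : bin_val v < 2 ^ size v.
Proof. by elim: v => //= b v IH; rewrite expnS; case: b => /=; lia. Qed.

(** Evaluating at 2 modulo [m] reads a binary number while every intermediate unary value stays
    below the modulus. *)
Lemma evalp_bin m s : evalp m s 2 = bin_val s %% m.
Proof.
elim: s => [|b s IH] /=; first by rewrite mod0n.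
by rewrite IH -modnDmr modnMmr modnDmr mul2n.
Qed.

Lemma pair_nth x R i : i < size x -> nth false (pair_enc x R) (2 * i) = nth false x i /\
  nth false (pair_enc x R) (2 * i).+1 = nth false x i.
Proof.
elim: x i => // b x IH [|i] hi; first by rewrite muln0.
by rewrite mulnS; exact: (IH i hi).
Qed.

Lemma pair_mid x R : nth false (pair_enc x R) (2 * size x) = false /\ nth false (pair_enc x R) (2 * size x).+1 = true /\
  drop (2 * size x + 2) (pair_enc x R) = R.
Proof. by elim: x => [|b x IH]; [rewrite muln0 /= drop0 | rewrite [size _]/= mulnS; exact: IH]. Qed.

(** Doubled bits never form the pair [01], so its first aligned occurrence is the separator. *)
Definition usz (z : str) : nat :=
  index 1 [seq nat_of_bool (~~ nth false z (2 * i) && nth false z (2 * i).+1) | i <- iota 0 (size z)].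
Definition ux (z : str) : str := [seq nth false z (2 * i) | i <- iota 0 (usz z)].
Definition ur (z : str) : str := drop (2 * usz z + 2) z.

Lemma usz_pair x R : usz (pair_enc x R) = size x.
Proof.
rewrite /usz; have hs : size x < size (pair_enc x R).
  by rewrite /pair_enc !size_cat /=; elim: x => //= b x; lia.
have [d ->] : exists d, size (pair_enc x R) = size x + (1 + d) by exists (size (pair_enc x R) - size x - 1); lia.
rewrite iotaD map_cat index_cat.
have -> : 1 \in [seq nat_of_bool (~~ nth false (pair_enc x R) (2 * i) && nth false (pair_enc x R) (2 * i).+1) | i <- iota 0 (size x)] = false.
  apply/negbTE/mapP => -[i]; rewrite mem_iota => hi; have [-> ->] := pair_nth R hi.
  by case: (nth _ _ _).
by rewrite size_map size_iota add0n iotaD /=; have [-> [-> _]] := pair_mid x R; rewrite addn0.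
Qed.

Lemma ux_pair x R : ux (pair_enc x R) = x.
Proof.
rewrite /ux usz_pair; apply: (@eq_from_nth _ false); first by rewrite size_map size_iota.
move=> i; rewrite size_map size_iota => hi; rewrite (nth_map 0) ?size_iota // nth_iota //.
by have [] := pair_nth R hi.
Qed.

Lemma ur_pair x R : ur (pair_enc x R) = R.
Proof. by rewrite /ur usz_pair; have [_ []] := pair_mid x R. Qed.

Lemma PT_ux : PT ux /\ PT ur.
Proof.
have hb : PT nat_of_bool by exact: PT_finite.
have h : PT usz by rewrite /usz; pt.
by split; rewrite /ux /ur; pt.
Qed.

(** * Sampling an index from random bits *)

Section Probability.
Local Open Scope ring_scope.

Lemma EW_bin b (G : nat -> rat) : EW b (fun u : str => G (bin_val u)) = (\sum_(i < 2 ^ b) G i) / 2 ^+ b.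
Proof.
elim: b G => [|b IH] G /=; first by rewrite big_ord1 expr0 divr1.
have -> : E (fun l : bool => EW b (fun ls => G (l + (bin_val ls).*2)%N)) =
   E (fun l : bool => (\sum_(i < 2 ^ b) G (l + i.*2)%N) / 2 ^+ b).
  by apply: eq_E => l; rewrite (IH (fun i => G (l + i.*2)%N)).
have -> : \sum_(i < 2 ^ b.+1) G i = \sum_(i < 2 ^ b) G (0 + i.*2)%N + \sum_(i < 2 ^ b) G (1 + i.*2)%N.
  rewrite expnSr sum_mul -big_split; apply: eq_bigr => i _.
  by rewrite !big_ord_recl big_ord0 /= addr0 /bump /= !muln2 addn0 addnC.
rewrite /E card_bool big_bool /= exprS addrC; set a := \sum_(i < _) _; set c := \sum_(i < _) _.
have : 2 ^+ b != 0 :> rat by rewrite expf_neq0.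
by move: (2 ^+ b) => t ht; field.
Qed.

Lemma sum_mod m d r (G : nat -> rat) : (forall i, 0 <= G i) -> (0 < m)%N ->
  d%:R * (\sum_(i < m) G i) <= \sum_(i < d * m + r) G (i %% m)%N.
Proof.
move=> G0 m0; rewrite big_split_ord /= ler_wpDr ?sumr_ge0 //.
rewrite (sum_mul d m (fun i => G (i %% m)%N)) mulr_natl -[X in _ *+ X]card_ord -sumr_const.
by apply: ler_sum => i _; apply: ler_sum => j _; rewrite modnMDl modn_small.
Qed.

Lemma mod_bound (T D r M : rat) : 0 <= T -> 1 <= D -> r <= M -> 0 < M -> T / M / 2 * (D * M + r) <= D * T.
Proof.
move=> T0 hd hr M0; have -> : T / M / 2 * (D * M + r) = T / 2 * (D + r / M) by field; lra.
have h1 : r / M <= 1 by rewrite ler_pdivrMr // mul1r.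
have h2 : 0 <= T * (2 * D - (D + r / M)) by apply: mulr_ge0 => //; lra.
by move: h2; move: (r / M) => t; lra.
Qed.

(** Each residue has at least [2 ^ b %/ m] preimages, which is at least half of its fair share
    because [m <= 2 ^ b]. *)
Lemma EW_mod m b (G : nat -> rat) : (forall i, 0 <= G i) -> (0 < m)%N -> (m <= 2 ^ b)%N ->
  E (fun i : 'I_m => G i) / 2 <= EW b (fun u : str => G (bin_val u %% m)%N).
Proof.
move=> G0 m0 hb; rewrite (EW_bin b (fun i => G (i %% m)%N)).
set d := (2 ^ b %/ m)%N; set r := (2 ^ b %% m)%N.
have e : (2 ^ b = d * m + r)%N by exact: divn_eq.
have hr : (r < m)%N by rewrite ltn_mod.
have d1 : (1 <= d)%N by rewrite divn_gt0.
have h := sum_mod d r G0 m0; rewrite -e in h.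
have mR : 0 < m%:R :> rat by rewrite ltr0n.
have bR : 0 < 2 ^+ b :> rat by rewrite exprn_gt0.
have S0 : 0 <= \sum_(i < m) G i by apply: sumr_ge0.
rewrite /E card_ord; pose T : rat := \sum_(i < m) G i; rewrite -/T in h S0 *.
apply: (@le_trans _ _ (d%:R * T / 2 ^+ b)); last by rewrite ler_pM2r ?invr_gt0.
rewrite ler_pdivlMr // -natrX e natrD natrM.
have hd : 1 <= d%:R :> rat by rewrite ler1n.
have hrm : r%:R <= m%:R :> rat by rewrite ler_nat ltnW.
by apply: mod_bound.
Qed.

Lemma EW_blocks k b (P : str -> bool) :
  EW (k * b) (fun R : str => br (all (fun j => P (take b (drop (j * b) R))) (iota 0 k))) = EW b (fun u => br (P u)) ^+ k.
Proof.
elim: k => [|k IH]; first by rewrite expr0.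
rewrite exprS mulSn EW_cat mulrC -EW_scale; apply: eq_EW => p hp.
rewrite -IH mulrC -EW_scale; apply: eq_EW => s _; rewrite -br_and; congr br.
rewrite -[k.+1]/(1 + k)%N iotaD all_cat /= andbT mul0n drop0 -hp take_size_cat //; congr (_ && _).
have -> : iota (0 + 1) k = map (addn 1) (iota 0 k) by rewrite -iotaDl.
rewrite all_map; apply: eq_all => j /=.
by rewrite mulnDl mul1n drop_cat ltnNge leq_addr /= addKn.
Qed.

Lemma bernoulli (x : rat) k : 0 <= x -> x <= 1 -> (1 - x) ^+ k * (1 + k%:R * x) <= 1.
Proof.
move=> x0 x1; elim: k => [|k IH]; first by rewrite expr0; lra.
have h : 0 <= (1 - x) ^+ k by rewrite exprn_ge0 //; lra.
apply: le_trans IH; rewrite exprSr -mulrA; apply: ler_wpM2l => //; rewrite -addn1 natrD.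
have : 0 <= (k%:R + 1) * (x * x) by rewrite mulr_ge0 ?mulr_ge0 ?addr_ge0.
lra.
Qed.

End Probability.

(** * Independent repetition of a local test *)

Section Verifier.
Variables (Q1 kk : nat) (Loc : finType) (eL : enc Loc) (dec1 : Loc -> str -> bool).
Variables (qry : str -> nat -> seq nat) (lc : str -> nat -> Loc) (mf : nat -> nat).
Hypothesis hq : PT (fun a : str * nat => qry a.1 a.2).
Hypothesis hl : PT (fun a : str * nat => lc a.1 a.2).
Hypothesis hm : PT mf.
Hypothesis sq : forall x i, size (qry x i) = Q1.
Hypothesis m0 : forall n, 0 < mf n.

Definition bb (n : nat) : nat := lg (mf n).
Definition rr (n : nat) : nat := kk * bb n.
Definition ridx (x R : str) (j : nat) : nat :=
  evalp (mf (size x)).-1.+1 (take (bb (size x)) (drop (j * bb (size x)) R)) 2.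
Definition qrys (x R : str) : seq nat := flatten [seq qry x (ridx x R j) | j <- iota 0 kk].
Definition locs (x R : str) : {ffun 'I_kk -> Loc} := [ffun j : 'I_kk => lc x (ridx x R j)].
Definition decK (ls : {ffun 'I_kk -> Loc}) (v : str) : bool :=
  [forall j : 'I_kk, dec1 (ls j) (take Q1 (drop (j * Q1) v))].
(** The decision depends on the input only through [kk] elements of a fixed finite type, so this
    table of constant length is obtained by lookup. *)
Definition ttab (ls : {ffun 'I_kk -> Loc}) : str := mkseq (fun i => decK ls (bitn (kk * Q1) i)) (2 ^ (kk * Q1)).
Definition Vf (z : str) : str := outenc (qrys (ux z) (ur z)) (ttab (locs (ux z) (ur z))).
Definition rf (x : str) : str := [seq false | _ <- iota 0 (rr (size x))].
Definition good (x pi : str) (i : nat) : bool := dec1 (lc x i) (map (nth false pi) (qry x i)).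

Lemma ridxE x R j : ridx x R j = bin_val (take (bb (size x)) (drop (j * bb (size x)) R)) %% mf (size x).
Proof. by rewrite /ridx evalp_bin prednK ?m0. Qed.

Lemma size_qrys x R : size (qrys x R) = kk * Q1.
Proof.
have h l : size (flatten [seq qry x (ridx x R j) | j <- l]) = size l * Q1.
  by elim: l => //= j l IH; rewrite size_cat IH sq mulSn.
by rewrite h size_iota.
Qed.

Lemma drop_qrys (g : nat -> bool) x R j : j < kk ->
  take Q1 (drop (j * Q1) (map g (qrys x R))) = map g (qry x (ridx x R j)).
Proof.
rewrite /qrys => hj; have -> : j * Q1 = size (flatten [seq qry x (ridx x R i) | i <- iota 0 j]).
  have {1}-> : j = size (iota 0 j) by rewrite size_iota.
  by elim: (iota 0 j) => //= i l IH; rewrite size_cat sq -IH mulSn.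
rewrite -(subnKC hj) -addn1 -addnA iotaD map_cat flatten_cat map_cat -(size_map g) drop_size_cat //.
by rewrite iotaD /= map_cat take_size_cat // size_map sq.
Qed.

Lemma Vf_accepts x R pi : verifier_accepts Vf x R pi = all (fun j => good x pi (ridx x R j)) (iota 0 kk).
Proof.
rewrite /verifier_accepts /verifier_output /Vf ux_pair ur_pair decode_out.
set v := map _ _; have sv : size v = kk * Q1 by rewrite size_map size_qrys.
rewrite nth_mkseq -?sv ?bin_lt // bitnK /decK; apply/forallP/allP => h j.
  by rewrite mem_iota => hj; have := h (Ordinal hj); rewrite ffunE /v drop_qrys.
by have := h (nat_of_ord j); rewrite mem_iota ltn_ord ffunE /v drop_qrys //; apply.
Qed.

Lemma PT_Vf : PT Vf.
Proof.
have [h1 h2] := PT_ux; have h3 := PT_evalp; have h4 := PT_lg; have h5 := PT_tobin.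
have hb : PT (fun x : str => bb (size x)) by rewrite /bb; pt.
have hr : PT (fun a : str * str * nat => ridx a.1.1 a.1.2 a.2).
  rewrite /ridx.
  have g1 : PT (fun a : str * str * nat => (mf (size a.1.1)).-1) by pt.
  have gb : PT (fun a : str * str * nat => bb (size a.1.1)) by exact: (PT_comp (PT_fst PT_fst_) hb).
  have g2 : PT (fun a : str * str * nat => take (bb (size a.1.1)) (drop (a.2 * bb (size a.1.1)) a.1.2)).
    by apply: PT_take => //; apply: PT_drop; [apply: PT_mul => //; pt | pt].
  exact: (PT_comp (PT_pair (PT_pair g1 g2) (PT_const 2)) h3).
have hqs : PT (fun a : str * str => qrys a.1 a.2).
  rewrite /qrys; apply: PT_flatten; apply: PT_map2; first by pt.
  exact: (PT_comp (PT_pair (PT_fst PT_fst_) hr) hq).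
pose eF := enc_fin {ffun 'I_kk -> Loc}.
have hls : @PT _ _ _ eF (fun a : str * str => locs a.1 a.2).
  apply: PT_ffun => j.
  exact: (PT_comp (PT_pair PT_fst_ (PT_comp (PT_pair PT_id (PT_const (nat_of_ord j))) hr)) hl).
have ht : @PT _ _ eF _ ttab by exact: PT_finite.
have hu : PT (fun z : str => (ux z, ur z)) by exact: PT_pair.
have hD := PT_comp (PT_comp hu hls) ht; have hI := PT_comp hu hqs.
by rewrite /Vf /outenc /toks2; pt.
Qed.

Lemma Vf_shape : verifier_shape Vf rr (fun=> kk * Q1).
Proof.
move=> x R; rewrite /verifier_output /Vf ux_pair ur_pair decode_out /= size_qrys size_mkseq; by [].
Qed.

Lemma PT_rf : PT rf.
Proof. by have h4 := PT_lg; rewrite /rf /rr /bb; pt. Qed.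

Lemma size_rf x : size (rf x) = rr (size x). Proof. by rewrite size_map size_iota. Qed.

(** A polynomial-time number of tests is polynomially large in [n], so its binary length is
    logarithmic. *)
Lemma rr_log : exists c, forall n, rr n <= c * trunc_log 2 n + c.
Proof.
have [k hk] := PT_eszk hm.
exists (kk * (8 * k + 2)) => n; set t := trunc_log 2 n; rewrite /rr; have -> : kk * (8 * k + 2) * t + kk * (8 * k + 2) = kk * ((8 * k + 2) * t.+1) by ring.
rewrite leq_mul2l; apply/orP; right.
 have ht : n < 2 ^ t.+1 by exact: trunc_log_ltn.
have [_ h2] := lgP (m0 n); rewrite -/(bb n) in h2.
have hp : 2 ^ bb n <= 2 ^ (1 + k * (t + 4)).
  apply: (leq_trans h2); rewrite expnD expn1 leq_mul2l /=.
  have := hk n; rewrite !esz_nat /pb => h; apply: (@leq_trans ((n.*2.+1 + 2) ^ k)); first by lia.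
  rewrite mulnC expnM; case: (k) => // k'; rewrite leq_exp2r //.
  have -> : 2 ^ (t + 4) = 8 * 2 ^ t.+1 by rewrite -[8]/(2 ^ 3) -expnD; congr (_ ^ _); lia.
  by lia.
have {hp} : bb n <= 1 + k * (t + 4) by rewrite -(leq_exp2l (m := 2)).
by clear; clearbody t; nia.
Qed.

Local Open Scope ring_scope.

Lemma accE x pi : (acc_count Vf rr x pi)%:R / 2 ^+ rr (size x) =
  EW (bb (size x)) (fun u => br (good x pi (bin_val u %% mf (size x)))) ^+ kk :> rat.
Proof.
rewrite -EW_blocks -EW_tuple /E card_tuple card_bool natrX; congr (_ / _).
rewrite /acc_count -sum1_card natr_sum big_mkcond; apply: eq_bigr => R _.
rewrite inE Vf_accepts; set P := all _ _; set P' := all _ _.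
have -> : P = P' by apply: eq_all => j; rewrite ridxE.
by case: P'.
Qed.

Lemma acc_surely x pi : (forall i, (i < mf (size x))%N -> good x pi i) -> accepts_surely Vf rr x pi.
Proof.
move=> h; have t0 : 2 ^+ rr (size x) != 0 :> rat by rewrite expf_neq0.
apply/eqP; rewrite -(eqr_nat rat) natrX -(mulfK t0 (_%:R)) mulrAC accE.
have -> : EW (bb (size x)) (fun u => br (good x pi (bin_val u %% mf (size x)))) = 1.
  by rewrite -(EW_const (_ : (0 < #|{: bool}|)%N) (bb (size x)) 1) ?card_bool //; apply: eq_EW => u _; rewrite h // ltn_mod.
by rewrite expr1n mul1r.
Qed.

(** Each of the [kk] independent blocks rejects with probability at least [e / 2], half of [e] being
    lost to the reduction modulo the number of tests; [bernoulli] with [kk * e > 2] brings the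
    product below 1/2. *)
Lemma acc_half x pi e : 0 <= e -> e <= E (fun i : 'I_(mf (size x)) => br (~~ good x pi i)) ->
  2 < kk%:R * e -> accepts_lt_half Vf rr x pi.
Proof.
move=> e0 he hk; have t0 : 0 < 2 ^+ rr (size x) :> rat by rewrite exprn_gt0.
set b := bb (size x); set p := EW b (fun u => br (good x pi (bin_val u %% mf (size x)))).
have bc : (0 < #|{: bool}|)%N by rewrite card_bool.
have e1 : e <= 1.
  apply: (le_trans he); rewrite -(E_const 1 (_ : (0 < #|'I_(mf (size x))|)%N)) ?card_ord ?m0 //.
  by apply: E_le => i; exact: br_le1.
have hp : p <= 1 - e / 2.
  have [hlg _] := lgP (m0 (size x)).
  have := EW_mod (fun i => br_ge0 (~~ good x pi i)) (m0 (size x)) hlg; rewrite -/(bb _) -/b.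
  have -> : EW b (fun u => br (~~ good x pi (bin_val u %% mf (size x)))) = 1 - p.
    apply/eqP; rewrite eq_sym subr_eq -EW_add -(EW_const bc b 1); apply/eqP; apply: eq_EW => u _.
    by rewrite br_negb subrK.
  by lra.
have p0 : 0 <= p by apply: EW_ge0 => // u; exact: br_ge0.
have h : p ^+ kk < 1 / 2.
  have h1 : p ^+ kk <= (1 - e / 2) ^+ kk by apply: lerXn2r => //; rewrite nnegrE; lra.
  apply: (le_lt_trans h1); have hb := @bernoulli (e / 2) kk ltac:(lra) ltac:(lra).
  have h2 : 2 < 1 + kk%:R * (e / 2) by lra.
  have h3 : 0 <= (1 - e / 2) ^+ kk by apply: exprn_ge0; lra.
  by move: h3 hb h2; move: ((1 - e / 2) ^+ kk) (1 + kk%:R * (e / 2)) => a c a0 ac c2; nra.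
rewrite -accE ltr_pdivrMr // in h; rewrite /accepts_lt_half -(ltr_nat rat) -muln2 natrM natrX.
by move: h; move: (2 ^+ rr _) => t; lra.
Qed.

End Verifier.

(** * The verifier for a language in PSPACE *)

Lemma PT_eqs A `{enc A} (f g : A -> str) : PT f -> PT g -> PT (fun a => f a == g a).
Proof.
move=> hf hg; apply: (@PT_ext _ _ _ _ (fun a => (size (f a) == size (g a)) &&
  (size [seq i <- iota 0 (size (f a)) | ~~ (nth false (f a) i == nth false (g a) i)] == 0))); last by pt.
move=> a; rewrite size_filter -leqn0 leqNgt -has_count; apply/andP/eqP => [[/eqP h1 h2]|->]; last first.
  by split => //; apply/hasPn => i _; rewrite negbK.
apply: (@eq_from_nth _ false) => // i hi; have := hasPn h2 i; rewrite mem_iota negbK => /(_ hi) /eqP.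
by [].
Qed.

Lemma ltn_nat_esz (n : nat) : n < esz n. Proof. by rewrite esz_nat; lia. Qed.

Definition EncN (N : nat) (s : str) : str := Enc (pr N).-1.+1 s.

Lemma EncNE N s : EncN N s = Enc (pr N) s.
Proof. by rewrite /EncN prednK //; have [h _ _] := prP N; exact: prime_gt0. Qed.

Lemma PT_EncN : PT (fun a : nat * str => EncN a.1 a.2).
Proof.
have h := PT_pr; have hE := PT_Enc; rewrite /EncN.
by apply: (PT_comp (_ : PT (fun a : nat * str => ((pr a.1).-1, a.2))) hE); pt.
Qed.

(** * The tester for pairs of adjacent states *)

Section Pair.
Variables (F : nat -> str -> str) (Nf : nat -> nat).
Hypotheses (hF : PT (fun a : nat * str => F a.1 a.2)) (hN : PT Nf).

Definition hdS (z : str) : nat := index 0 [seq nat_of_bool b | b <- z].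
(** The space parameter in unary, closed by a zero, is the fixed part of the tester's input; the two
    states form the unknown part. *)
Definition pS (S : nat) : str := [seq true | _ <- iota 0 S] ++ [:: false].
Definition fz (z : str) : str :=
  adj (F (hdS z)) (take (Nf (hdS z)) (drop (hdS z).+1 z)) (take (Nf (hdS z)) (drop (Nf (hdS z)) (drop (hdS z).+1 z)))
  :: EncN (Nf (hdS z)) (take (Nf (hdS z)) (drop (hdS z).+1 z)) ++
     EncN (Nf (hdS z)) (take (Nf (hdS z)) (drop (Nf (hdS z)) (drop (hdS z).+1 z))).

Lemma fzE S s1 s2 : size s1 = Nf S -> size s2 = Nf S ->
  fz (pS S ++ (s1 ++ s2)) = adj (F S) s1 s2 :: EncN (Nf S) s1 ++ EncN (Nf S) s2.
Proof.
move=> h1 h2; have h a w : index 0 [seq nat_of_bool b | b <- [seq true | _ <- iota a S] ++ false :: w] = S.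
  by elim: (S) a => //= n IH a; rewrite IH.
have -> : pS S ++ (s1 ++ s2) = [seq true | _ <- iota 0 S] ++ false :: (s1 ++ s2) by rewrite /pS -catA.
have hd w : drop S.+1 ([seq true | _ <- iota 0 S] ++ false :: w) = w.
  by rewrite -cat_rcons drop_size_cat // size_rcons size_map size_iota.
by rewrite /fz /hdS h hd take_size_cat // drop_size_cat // -h2 take_size.
Qed.

Lemma PT_fz : PT fz.
Proof.
have hb : PT nat_of_bool by exact: PT_finite.
have hh : PT hdS by rewrite /hdS; pt.
have hE := PT_EncN; have ha : PT (fun a : nat * str * str => adj (F a.1.1) a.1.2 a.2).
  by rewrite /adj; apply: PT_orb; [| apply: PT_orb]; apply: PT_eqs; pt.
have h1 : PT (fun z => take (Nf (hdS z)) (drop (hdS z).+1 z)) by pt.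
have h2 : PT (fun z => take (Nf (hdS z)) (drop (Nf (hdS z)) (drop (hdS z).+1 z))) by pt.
apply: PT_cons; first exact: (PT_comp (PT_pair (PT_pair hh h1) h2) ha).
by pt.
Qed.

Lemma PT_pS : PT pS. Proof. by rewrite /pS; pt. Qed.

Definition KN (N : nat) : nat := pr N ^ 3.
Definition ecN (N : nat) (s : str) (k : nat) : bool := nth false (EncN N s) k.

Lemma wordE S s1 s2 k : k < 2 * KN (Nf S) -> size s1 = Nf S -> size s2 = Nf S ->
  nth false (fz (pS S ++ (s1 ++ s2))) k.+1 = word (KN (Nf S)) (ecN (Nf S)) s1 s2 k.
Proof.
move=> hk h1 h2; rewrite fzE // -[LHS]/(nth false (EncN (Nf S) s1 ++ EncN (Nf S) s2) k) nth_cat EncNE size_Enc -/(KN _) /word /ecN !EncNE; by [].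
Qed.

(* The proof system for pairs of adjacent encoded states; [B S] bounds the proof length. *)
Lemma pair_inst : exists (q : nat) (al C : rat) (J : nat -> inst q) (B : nat -> nat),
  [/\ PT J, PT B, (0 < al)%R /\ (0 <= C)%R & forall S,
  [/\ [/\ okI (J S), forall G, Lavg (J S) G = E (fun k : 'I_(2 * KN (Nf S)) => G k) &
    forall l, l \in (J S).2 -> l.1 < 2 * KN (Nf S)],
  [/\ 0 < B S, forall t v, t \in (J S).1 -> v \in t.1 -> v < B S & forall l, l \in (J S).2 -> l.2.1 < B S /\ l.2.2 < B S],
  forall s1 s2, size s1 = Nf S -> size s2 = Nf S -> adj (F S) s1 s2 ->
  exists y, (forall t, t \in (J S).1 -> sat y t) /\ forall l, l \in (J S).2 -> lkok (word (KN (Nf S)) (ecN (Nf S)) s1 s2) y l &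
  forall y, (Uns (J S) y <= al)%R -> exists s1 s2, [/\ size s1 = Nf S, size s2 = Nf S, adj (F S) s1 s2
    & (Lkd (J S) (word (KN (Nf S)) (ecN (Nf S)) s1 s2) y <= C * Uns (J S) y)%R]]].
Proof.
have [q [al [C [J [hJ al0 C0 h]]]]] := pcpp (PT_PolyTime PT_fz).
pose Jn S := J (pS S, 2 * Nf S, 2 * KN (Nf S)).
have hJn : PT Jn.
  have h1 := PT_pS; have h2 := PT_pr; apply: (PT_comp (_ : PT (fun S => (pS S, 2 * Nf S, 2 * KN (Nf S)))) hJ).
  by rewrite /KN; pt.
have [k hk] := PT_eszk hJn.
(* Variables are written in unary inside the instance, so the size of its code bounds every proof
   position it mentions and can serve as the proof length. *)
have {}hk S : esz (Jn S) <= (S.*2.+1 + 2) ^ k by have := hk S; rewrite esz_nat.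
exists q, al, C, Jn, (fun S => (S.*2.+1 + 2) ^ k); split; [exact: hJn | by pt | by [] | move=> S].
have K0 : 0 < KN (Nf S) by rewrite /KN expn_gt0; have [/prime_gt0 -> _ _] := prP (Nf S).
have hsp (w : str) : size w = 2 * Nf S -> exists s1 s2, [/\ w = s1 ++ s2, size s1 = Nf S & size s2 = Nf S].
  by move=> hw; exists (take (Nf S) w), (drop (Nf S) w); split; rewrite ?cat_take_drop ?size_drop ?size_takel ?hw //; lia.
have [||g1 g2 g3 g4 g5] := h (pS S) (2 * Nf S) (2 * KN (Nf S)); [by lia | |].
  by move=> w /hsp [s1 [s2 [-> h1 h2]]]; rewrite fzE // -cat1s !size_cat !EncNE !size_Enc addnn -mul2n.
rewrite -/(Jn S) in g1 g2 g3 g4 g5; split.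
- by split; [exact: g1 | exact: g2 | exact: g3].
- split.
  + by rewrite expn_gt0 addn2.
  + move=> t v ht hv; apply: leq_trans (hk S).
    have h1 : v < @esz _ (@enc_seq _ enc_nat) t.1 by exact: (leq_trans (ltn_nat_esz v) (@esz_mem nat enc_nat v t.1 hv)).
    have h2 : esz t.1 <= @esz _ (enc_cstr q) t by case: (t) => a b; rewrite [X in _ <= X]esz_pair leqW // leq_addr.
    apply: (leq_trans h1); apply: (leq_trans h2); apply: (leq_trans (@esz_mem (cstr q) _ _ _ ht)).
    by case: (Jn S) => a b; rewrite [X in _ <= X]esz_pair leqW // leq_addr.
  + move=> l hl; have h1 := leq_trans (leq_trans (@esz_mem link enc_link _ _ hl) (esz_inst2 _)) (hk S).
    by move: h1; case: l hl => a [b c] _; rewrite !esz_pair !esz_nat /=; lia.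
- move=> s1 s2 h1 h2 ha; have [||y [y1 y2]] := g4 (s1 ++ s2); [by rewrite size_cat h1 h2; lia | by rewrite fzE |].
  exists y; split; [exact: y1 | move=> l hl; have := y2 l hl].
  by rewrite /lkok wordE //; exact: g3.
- move=> y /g5 [w [/hsp [s1 [s2 [-> h1 h2]]] ha hk2]]; exists s1, s2; split; [exact: h1 | exact: h2 | by move: ha; rewrite fzE |].
  apply: le_trans hk2; apply: eqW; rewrite /Lkd; congr (_ / _)%R.
  by apply: eq_big_seq => l hl; rewrite /lkok wordE //; exact: g3.
Qed.

End Pair.

Section LocalTest.
Variables (q : nat) (I : inst q) (K B : nat) (s0 gl : str) (ec : str -> nat -> bool).

(** Queries are fixed before the flags are known, so the positions of all modes are read at once. *)
Definition qry1 (t : cstr q) (l : link) : seq nat :=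
  [:: 0; 1; 2; 3; oY K + l.2.1; oY K + l.2.2; oZ K B + l.2.1; oZ K B + l.2.2; 4 + l.1;
      4 + (K + l.1 %% K); 4 + l.1 %% K] ++
  ([seq oY K + nth 0 t.1 i | i <- iota 0 q] ++ [seq oZ K B + nth 0 t.1 i | i <- iota 0 q]).

Lemma size_qry1 t l : size (qry1 t l) = 11 + (q + q).
Proof. by rewrite !size_cat !size_map !size_iota. Qed.

Definition dec1 (L : TTq q * bool * bool) (v : str) : bool :=
  let pf o a b c := L.1.1 [ffun s : 'I_q => nth false v (o + s)] &&
    ((nth false v a (+) nth false v b) == nth false v c) in
  match nth false v 0, nth false v 1, nth false v 2, nth false v 3 with
  | false, false, false, false => pf 11 4 5 8
  | false, false, true, false => pf (11 + q) 6 7 9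
  | false, false, false, true => pf (11 + q) 6 7 10
  | true, false, false, false => nth false v 10 == L.1.2
  | false, true, false, false => nth false v 10 == L.2
  | _, _, _, _ => false
  end.

Lemma dec1E g r : let t := nth (c0 q) I.1 r in let l := nth (0, (0, 0)) I.2 r in
  dec1 (t.2, ec s0 (l.1 %% K), ec gl (l.1 %% K)) (map g (qry1 t l)) = goodr I K B s0 gl ec g r.
Proof.
move=> t l; have e1 : [ffun s : 'I_q => nth false (map g (qry1 t l)) (11 + s)] = [ffun s : 'I_q => g (oY K + nth 0 t.1 s)].
  apply/ffunP => s; rewrite !ffunE /qry1 map_cat nth_cat size_map ltnNge leq_addr /= addKn map_cat nth_cat.
  by rewrite !size_map size_iota ltn_ord -map_comp (nth_map 0) ?size_iota // nth_iota.
have e2 : [ffun s : 'I_q => nth false (map g (qry1 t l)) (11 + q + s)] = [ffun s : 'I_q => g (oZ K B + nth 0 t.1 s)].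
  apply/ffunP => s; rewrite !ffunE /qry1 map_cat nth_cat size_map -addnA ltnNge leq_addr /= addKn map_cat nth_cat.
  by rewrite !size_map size_iota ltnNge leq_addr /= addKn -map_comp (nth_map 0) ?size_iota // nth_iota.
rewrite /dec1 e1 e2 /goodr /prf /chkX /sat /lkok -/t -/l; cbn [qry1 map cat nth fst snd].
by case: (g 0); case: (g 1); case: (g 2); case: (g 3).
Qed.

End LocalTest.

Lemma eps_exists (al C d : rat) : (0 < al)%R -> (0 <= C)%R -> (0 < d)%R ->
  exists (ep : rat) (k : nat), [/\ (0 < ep)%R, (ep <= al)%R, ((1 + C) * ep <= d)%R, (ep <= d)%R & (2 < k%:R * ep)%R].
Proof.
move=> a0 C0 d0; have [e e0 [e1 e2]] : exists2 e : rat, (0 < e)%R & (e <= al)%R /\ ((1 + C) * e <= d)%R.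
  have h : (0 < 1 + C)%R by lra.
  exists (Num.min al (d / (1 + C)))%R; first by rewrite lt_min a0 divr_gt0.
  by split; [rewrite ge_min lexx | rewrite [X in (X <= _)%R]mulrC -ler_pdivlMr // ge_min lexx orbT].
exists e, (Num.bound (2 / e)%R); split => //; first by nra.
by rewrite -ltr_pdivrMr //; apply: archi_boundP; rewrite ltW // divr_gt0.
Qed.

Lemma PT_nseqf : PT (fun n => nseq n false).
Proof.
apply: (@PT_ext _ _ _ _ (fun n => [seq false | _ <- iota 0 n])); last by pt.
by move=> n; elim: n 0 => //= n IH a; rewrite IH.
Qed.

Definition reconf_pcp (L : str -> Prop) : Prop :=
  exists (Vf rf : str -> str) (r q : nat -> nat) (c : nat)
         (pstart pgoal : str -> str),
    PolyTime Vf /\ PolyTime rf /\ PolyTime pstart /\ PolyTime pgoal /\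
    (forall x, size (rf x) = r (size x)) /\
    (forall n, r n <= c * trunc_log 2 n + c) /\
    (forall n, q n <= c) /\
    verifier_shape Vf r q /\
    forall x : str,
      (L x -> exists s, reconf_seq (size (pstart x)) (pstart x) (pgoal x) s /\
                 forall pi, pi \in s -> accepts_surely Vf r x pi) /\
      (~ L x -> forall s, reconf_seq (size (pstart x)) (pstart x) (pgoal x) s ->
                 exists2 pi, pi \in s & accepts_lt_half Vf r x pi).

Theorem PSPACE_verifier L : inPSPACE L -> reconf_pcp L.
Proof.
move=> /pspace_graph [F [Nf [Sf [s0 [[hF hN hS hs0] sF Fg ss0 hL]]]]].
have [q [al [C [J [B [hJ hB [al0 C0] h]]]]]] := pair_inst hF hN.
have d0 : (0 < 1 / 40 :> rat)%R by apply: divr_gt0; [exact: ltr01 | rewrite ltr0n].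
have [ep [kk [e0 e1 e2 e3 hkk]]] := eps_exists al0 C0 d0.
have hE := PT_EncN; have hpr := PT_pr.
have hK : PT KN by rewrite /KN; pt.
pose gl S := nseq (Nf S) false.
have hg : PT gl by rewrite /gl; exact: (PT_comp hN PT_nseqf).
have hec : PT (fun a : nat * str * nat => ecN a.1.1 a.1.2 a.2).
  by rewrite /ecN; apply: PT_nth; [pt | apply: (PT_comp PT_fst_ hE) | pt].
pose S x := Sf (@size bool x); have hSx : PT S by rewrite /S; pt.
have hNx : PT (fun x => Nf (S x)) by pt.
have hgx : PT (fun x => gl (S x)) by pt.
pose tt a := nth (c0 q) (J (S a.1)).1 a.2.
pose ll a := nth (0, (0, 0)) (J (S a.1)).2 a.2.
have hJx : PT (fun a : str * nat => J (S a.1)) by pt.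
have htt : @PT (str * nat)%type _ _ (enc_cstr q) tt.
  by apply: PT_nth; [exact: PT_const | exact: (PT_fst hJx) | exact: PT_snd_].
have hll : @PT (str * nat)%type _ _ enc_link ll.
  by apply: PT_nth; [exact: PT_const | exact: (PT_snd hJx) | exact: PT_snd_].
have hKx : PT (fun a : str * nat => KN (Nf (S a.1))) by pt.
have hl1 : PT (fun a => (ll a).1) by exact: PT_fst hll.
have hl2 : PT (fun a => (ll a).2.1) by exact: PT_fst (PT_snd hll).
have hl3 : PT (fun a => (ll a).2.2) by exact: PT_snd (PT_snd hll).
have ht1 : PT (fun a => (tt a).1) by exact: PT_fst htt.
pose qry x i := qry1 (KN (Nf (S x))) (B (S x)) (tt (x, i)) (ll (x, i)).
have hq : PT (fun a : str * nat => qry a.1 a.2).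
  apply: (@PT_ext _ _ _ _ (fun a => qry1 (KN (Nf (S a.1))) (B (S a.1)) (tt a) (ll a))); first by case.
  have hBx : PT (fun a : str * nat => B (S a.1)) by pt.
  by rewrite /qry1 /oZ /oY; pt.
pose lc x i := ((tt (x, i)).2, ecN (Nf (S x)) (s0 x) ((ll (x, i)).1 %% KN (Nf (S x))),
   ecN (Nf (S x)) (gl (S x)) ((ll (x, i)).1 %% KN (Nf (S x)))).
pose eL : enc (TTq q * bool * bool) := @enc_pair _ _ (@enc_pair _ _ (enc_TTq q) enc_bool) enc_bool.
have hl : @PT _ _ _ eL (fun a : str * nat => lc a.1 a.2).
  apply: (@PT_ext _ _ _ _ (fun a => ((tt a).2, ecN (Nf (S a.1)) (s0 a.1) ((ll a).1 %% KN (Nf (S a.1))),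
   ecN (Nf (S a.1)) (gl (S a.1)) ((ll a).1 %% KN (Nf (S a.1)))))); first by case.
  by apply: PT_pair; [apply: PT_pair; [exact: PT_snd htt |] |]; pt.
pose mf n := size (J (Sf n)).1.
have hm : PT mf by apply: PT_size; apply: PT_fst; pt.
have m0 n : 0 < mf n by have [[[h1 _] _ _] _ _ _] := h (Sf n).
have sq x i : size (qry x i) = 11 + (q + q) by exact: size_qry1.
pose V := Vf (11 + (q + q)) kk (@dec1 q) qry lc mf.
have goodE x pi i : good (@dec1 q) qry lc x pi i =
    goodr (J (S x)) (KN (Nf (S x))) (B (S x)) (s0 x) (gl (S x)) (ecN (Nf (S x))) (nth false pi) i.
  by rewrite -dec1E.
have [c hc] := rr_log kk hm m0.
exists V, (rf kk mf), (rr kk mf), (fun=> kk * (11 + (q + q))), (c + kk * (11 + (q + q))).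
exists (fun x => pst (KN (Nf (S x))) (B (S x)) (s0 x) (ecN (Nf (S x)))).
exists (fun x => pgl (KN (Nf (S x))) (B (S x)) (gl (S x)) (ecN (Nf (S x)))).
have hmk fl (s : str -> str) : PT s ->
    PT (fun x => mk (KN (Nf (S x))) (B (S x)) fl (ecN (Nf (S x)) (s x)) zro zro zro).
  by move=> hs; rewrite /mk /mkseq /zro /Len /oZ /oY; pt.
do 3!(split; [apply: PT_PolyTime; [exact: (@PT_Vf _ _ _ eL) || exact: PT_rf || exact: hmk] |]).
split; first by apply: PT_PolyTime; exact: hmk.
split; first exact: size_rf.
split; first by move=> n; have := hc n; nia.
split; first by move=> n; lia.
split; first exact: Vf_shape.
move=> x; rewrite [size _]size_mk.
have [[g1 g2 g3] [g4 g5 g6] g7 g8] := h (S x).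
have [p1 p2 _] := prP (Nf (S x)).
have K20 : 20 <= KN (Nf (S x)) by apply: (@leq_trans (pr (Nf (S x)))); [exact: leq_trans (isT : 20 <= 32) (leq_trans (leq_addl _ _) p2) | rewrite /KN -{1}(expn1 (pr _)) leq_pexp2l ?prime_gt0].
have hsg : size (gl (S x)) = Nf (S x) by rewrite size_nseq.
split.
  move=> /hL hlv; have [s [hs1 hs2]] := str_complete g1 g3 K20 g4 g5 g6 (sF _) (ss0 x) hsg g7 C0 al0 hlv.
  exists s; split; first exact: hs1.
  move=> pi /hs2 [_ hpi]; apply: (acc_surely kk sq m0) => i hi; rewrite goodE; exact: hpi.
move=> nL s hs; have [//|hn] := Classical_Prop.classic (exists2 pi, pi \in s & accepts_lt_half V (rr kk mf) x pi).
case: nL; apply/hL.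
apply: (str_sound g1 g2 K20 g4 (Fg _) (ss0 x) hsg _ g8 C0 al0 e1 e2 e3 hs).
  move=> s1 s2 h1 h2 ne; have p3 : 2 < pr (Nf (S x)) by exact: leq_trans (isT : 3 <= 32) (leq_trans (leq_addl _ _) p2).
  have hle : 4 * size s1 <= pr (Nf (S x)) by rewrite h1; exact: leq_trans (leq_addr _ _) p2.
  by have := Enc_dist p1 p3 (etrans h2 (esym h1)) hle ne; rewrite -!EncNE; apply.
move=> pi hpi; rewrite leNgt; apply/negP => hlt; apply: hn; exists pi; first exact: hpi.
apply: (acc_half sq m0 (ltW e0) _ hkk); apply: (le_trans (ltW hlt)).
apply: eqW; apply: eq_E => i; by rewrite goodE.
Qed.

(** * Evaluating quantified formulas in polynomial space *)

(** As a quantifier, [true] is universal and [false] existential. *)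
Definition bop (o a b : bool) : bool := if o then a && b else a || b.

Fixpoint QV (phi : str -> bool) (ops hi : str) : bool :=
  if ops is o :: ops' then bop o (QV phi ops' (false :: hi)) (QV phi ops' (true :: hi)) else phi hi.

(* The truth value of a leaf is propagated through a binary counter: a digit is [Some] when its
   left subtree has been evaluated, and then holds the value of that subtree. *)
Definition dig := (bool * option bool)%type.
Definition dstep (c : option bool * dig) : option bool * dig :=
  match c with
  | (Some v, (o, None)) => (None, (o, Some v))
  | (Some v, (o, Some w)) => (Some (bop o w v), (o, None))
  | (None, e) => (None, e)
  end.
Fixpoint carry (c : option bool) (a : seq dig) : seq dig * option bool :=
  if a is e :: a' then ((dstep (c, e)).2 :: (carry (dstep (c, e)).1 a').1, (carry (dstep (c, e)).1 a').2)
  else ([::], c).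
Definition dbits (a : seq dig) : str := [seq isSome e.2 | e <- a].
Definition qstep (phi : str -> bool) (s : seq dig * option bool) : seq dig * option bool :=
  if isSome s.2 then s else carry (Some (phi (dbits s.1))) s.1.
Definition zdig (ops : str) : seq dig := [seq (o, None) | o <- rev ops].

Lemma carry0 a : carry None a = (a, None).
Proof. by elim: a => //= e a ->. Qed.

(** The low digits enumerate the assignments of the quantifiers in [ops]; when both halves are done
    they are back at their initial state and the value is carried into [a]. *)
Lemma qrun phi ops a : exists T, iter T (qstep phi) (zdig ops ++ a, None) =
  (zdig ops ++ (carry (Some (QV phi ops (dbits a))) a).1, (carry (Some (QV phi ops (dbits a))) a).2).
Proof.
elim: ops a => [|o ops IH] a; first by exists 1; rewrite /= -surjective_pairing.
have e b : zdig (o :: ops) ++ b = zdig ops ++ (o, None) :: b by rewrite /zdig rev_cons map_rcons cat_rcons.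
have [T1 h1] := IH ((o, None) :: a).
have [T2 h2] := IH ((o, Some (QV phi ops (false :: dbits a))) :: a).
by exists (T2 + T1); rewrite iterD !e h1 /= carry0 h2.
Qed.

Lemma size_carry c a : size (carry c a).1 = size a.
Proof. by elim: a c => //= e a IH c; rewrite IH. Qed.

Lemma esz_ob (o : option bool) : esz o <= 5.
Proof. by rewrite esz_fin; have := ltn_ord (enum_rank o); rewrite [X in _ < X]card_option card_bool; lia. Qed.

Lemma esz_dig (e : dig) : esz e <= 9.
Proof. by case: e => b o; rewrite esz_pair; have := esz_ob o; have : esz b <= 3; [by case: (b) | lia]. Qed.

Lemma PT_carry : PT (fun a : bool * seq dig => carry (Some a.1) a.2).
Proof.
pose f (p : (bool * seq dig) * ((seq dig * option bool) * dig)) :=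
  ((dstep (p.2.1.2, p.2.2)).2 :: p.2.1.1, (dstep (p.2.1.2, p.2.2)).1).
have hc : @PT _ _ (@enc_pair _ _ _ _) (@enc_pair _ _ _ _) dstep by exact: (@PT_finite (option bool * (bool * option bool))%type).
have hf : PT f.
  have h1 : PT (fun p : (bool * seq dig) * ((seq dig * option bool) * dig) => dstep (p.2.1.2, p.2.2)).
    by apply: (PT_comp _ hc); pt.
  by apply: PT_pair; [apply: PT_cons; [exact: PT_snd h1 | pt] | exact: PT_fst h1].
have h : PT (fun a : bool * seq dig => foldl (fun s e => f (a, (s, e))) ([::], Some a.1) a.2).
  apply: PT_foldl_add => //; first by pt.
    apply: PT_pair; first by pt.
    by apply: (PT_comp PT_fst_); exact: PT_finite.
  exists 4 => a [s c] e; rewrite -[f _]/((dstep (c, e)).2 :: s, (dstep (c, e)).1) !esz_pair esz_cons.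
  have := esz_dig (dstep (c, e)).2; have := esz_ob (dstep (c, e)).1.
  have : 16 <= pb 4 (esz a + esz e) by rewrite /pb -[16]/(2 ^ 4) leq_exp2r // leq_addl.
  by move: (pb 4 _) => P; lia.
have e a s c : foldl (fun s e => f (a, (s, e))) (s, c) a.2 = (rev (carry c a.2).1 ++ s, (carry c a.2).2).
  case: a => b l /=; elim: l s c => //= x l IH s c.
  by rewrite /f /= -/f (IH _ _) rev_cons cat_rcons.
apply: (@PT_ext _ _ _ _ (fun a => (rev (foldl (fun s e => f (a, (s, e))) ([::], Some a.1) a.2).1,
   (foldl (fun s e => f (a, (s, e))) ([::], Some a.1) a.2).2))); last by pt.
by move=> a; rewrite e cats0 revK -surjective_pairing.
Qed.

Theorem QBF_PSPACE (ops : str -> str) (phi : str -> str -> bool) (L : str -> Prop) :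
  PT ops -> PT (fun a : str * str => phi a.1 a.2) ->
  (forall x, QV (phi x) (ops x) [::] <-> L x) -> inPSPACE L.
Proof.
move=> ho hphi hL; pose S := (str * (seq dig * option bool))%type.
have hc := PT_carry.
have hs : PT (fun o : option bool => isSome o) by exact: PT_finite.
have hd : PT dbits.
  have h : PT (fun e : dig => isSome e.2) by pt.
  by rewrite /dbits; pt.
apply: (@PSPACE_loop S _ (fun x => (x, (zdig (ops x), None))) (fun s => (s.1, qstep (phi s.1) s.2))
   (fun s => isSome s.2.2) (fun s => s.2.2 == Some true)).
- have h : @PT _ _ _ (@enc_pair _ _ enc_bool enc_ob) (fun o : bool => (o, None : option bool)) by exact: PT_finite.
  by rewrite /zdig; pt.
- apply: PT_pair; first by pt.
  rewrite /qstep; apply: PT_if; [by pt | by pt |].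
  by apply: (PT_comp (_ : PT (fun s : S => (phi s.1 (dbits s.2.1), s.2.1))) hc); pt.
- by pt.
- by apply: (PT_comp (_ : PT (fun s : S => s.2.2))); [pt | exact: PT_finite].
- by case=> x s; rewrite /qstep /= => ->.
have [k hk] := PT_eszk ho.
have [k' hk'] : polyb (fun n => n + 10 * pb k n + 20) by poly.
exists k' => x; have [T hT] := qrun (phi x) (ops x) [::]; exists T.
have e i : iter i (fun s : S => (s.1, qstep (phi s.1) s.2)) (x, (zdig (ops x), None)) =
    (x, iter i (qstep (phi x)) (zdig (ops x), None)) by elim: i => //= i ->.
rewrite cats0 in hT; split; first by rewrite e hT.
  move=> i _; apply: leq_trans (hk' _); rewrite e.
  have hs1 : size (iter i (qstep (phi x)) (zdig (ops x), None)).1 = size (ops x).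
    elim: i => [|i IH]; first by rewrite size_map size_rev.
    by rewrite iterS /qstep; case: ifP => // _; rewrite size_carry.
  move: hs1; case: (iter _ _ _) => a c /= ha; rewrite !esz_pair.
  have h1 : esz a <= 1 + size a * (9 + 1) by apply: esz_list => j _ d; exact: esz_dig.
  have h2 := leq_trans (size_esz (ops x)) (hk x); have := esz_ob c.
  by move: h1; rewrite ha; lia.
rewrite e hT /=; split; first by move=> /eqP [] /hL.
by move=> /hL ->.
Qed.

Lemma QV_or phi m ops hi : QV phi (nseq m false ++ ops) hi <-> exists w, size w = m /\ QV phi ops (rev w ++ hi).
Proof.
elim: m hi => [|m IH] hi /=.
  by split => [h|[w [/size0nil -> //]]]; exists [::].
split.
  by move=> /orP [] /IH [w [hw h]]; [exists (false :: w) | exists (true :: w)]; rewrite /= hw rev_cons cat_rcons.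
by move=> [[|b w] [//= [hw] h]]; apply/orP; case: b h => h; [right | left]; apply/IH; exists w;
  rewrite rev_cons cat_rcons in h.
Qed.

(** * Reachability by repeated halving *)

Section Savitch.
Variables (m : nat) (e : rel (str)).

Fixpoint RR (k : nat) (u v : str) : Prop :=
  if k is k'.+1 then exists w, [/\ size w = m, RR k' u w & RR k' w v] else e u v.

(** One level of the recursion consumes [m] bits for the guessed midpoint and one universal bit that
    selects the half to be verified. *)
Definition pstep (st : str * (str * str)) :=
  (drop m.+1 st.1, if nth false st.1 m then (take m st.1, st.2.2) else (st.2.1, take m st.1)).

Definition sops (k : nat) : str := flatten [seq nseq m false ++ [:: true] | _ <- iota 0 k].

Lemma QV_RR phi k u v hi :
  (forall s, size s = k * m.+1 -> phi (rev s ++ hi) = e (iter k pstep (s, (u, v))).2.1 (iter k pstep (s, (u, v))).2.2) ->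
  QV phi (sops k) hi <-> RR k u v.
Proof.
rewrite /sops; move: 0 => a; elim: k a u v hi => [|k IH] a u v hi h; first by rewrite /= -(h [::]).
rewrite /= -catA QV_or.
have hb b w : size w = m -> QV phi (flatten [seq nseq m false ++ [:: true] | _ <- iota a.+1 k]) (b :: rev w ++ hi) <->
    (if b then RR k w v else RR k u w).
  move=> hw; have := IH a.+1 (if b then w else u) (if b then v else w) (b :: rev w ++ hi).
  have hst s : pstep (w ++ b :: s, (u, v)) = (s, if b then (w, v) else (u, w)).
    by rewrite /pstep [_.1]/= nth_cat hw ltnn subnn take_size_cat // -cat_rcons drop_size_cat // size_rcons hw.
  move=> H; have {}H := H _; case: b hst H => hst; apply => s hs.
    rewrite (_ : rev s ++ _ = rev (w ++ true :: s) ++ hi); last by rewrite rev_cat rev_cons -cats1 -!catA.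
    by rewrite h ?iterSr ?hst // size_cat /= hs hw; lia.
  rewrite (_ : rev s ++ _ = rev (w ++ false :: s) ++ hi); last by rewrite rev_cat rev_cons -cats1 -!catA.
  by rewrite h ?iterSr ?hst // size_cat /= hs hw; lia.
split.
  by move=> [w [hw /= /andP [/(hb _ _ hw) h1 /(hb _ _ hw) h2]]]; exists w.
by move=> [w [hw h1 h2]]; exists w; split => //=; apply/andP; split; apply/(hb _ _ hw).
Qed.

Lemma RR_path k u v : RR k u v -> exists p, [/\ path e u p, last u p = v & 0 < size p].
Proof.
elim: k u v => [|k IH] u v /=; first by move=> h; exists [:: v]; rewrite /= h.
move=> [w [_ /IH [p [h1 h2 h3]] /IH [p' [h4 h5 h6]]]]; exists (p ++ p').
by rewrite cat_path h1 h2 h4 last_cat h2 h5 size_cat addn_gt0 h3.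
Qed.

Hypothesis hsz : forall u v, e u v -> size v = m.
Hypothesis hre : forall u v, e u v -> e v v.

(** Exactly [2 ^ k] edges are traversed by the recursion; loops at the end points of edges fill up
    shorter paths. *)
Lemma path_RR k u p : e u u -> path e u p -> size p <= 2 ^ k -> RR k u (last u p).
Proof.
elim: k u p => [|k IH] u p hu hp hs.
  by case: p hp hs => [|v [|? ?]] //= /andP [].
rewrite expnS in hs; set q := take (2 ^ k) p.
have hpq : p = q ++ drop (2 ^ k) p by rewrite cat_take_drop.
rewrite hpq cat_path in hp; case/andP: hp => hq hd.
have hl : e (last u q) (last u q).
  by case: (lastP q) hq => // q' v; rewrite rcons_path last_rcons => /andP [_ /hre].
have hm : size (last u q) = m by exact: hsz hl.
exists (last u q); split => //.
  by apply: IH => //; rewrite size_take; case: ltnP; lia.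
by rewrite hpq last_cat; apply: IH => //; rewrite size_drop; lia.
Qed.

(** A path without repetitions visits at most [2 ^ m] strings, so [m] levels suffice. *)
Lemma reach_RR u p : e u u -> path e u p -> RR m u (last u p).
Proof.
move=> hu hp; case/shortenP: hp => p' hp' hun _; apply: path_RR => //.
have hall : {subset u :: p' <= [seq val t | t <- enum {: m.-tuple bool}]}.
  have hh : all (fun v => size v == m) (u :: p').
    rewrite /= (hsz hu) eqxx /=; elim: (p') u hp' {hun hu} => //= v p2 IH u /andP [h1 h2].
    by rewrite (hsz h1) eqxx (IH v).
  move=> v /(allP hh) hv; apply/mapP; exists (Tuple hv) => //; exact: mem_enum.
have := uniq_leq_size hun hall; rewrite size_map -cardE card_tuple card_bool /=; lia.
Qed.

End Savitch.

(** * Deciding whether a verifier accepts surely *)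

(* Query positions are written in binary, so their values are capped to stay polynomial. *)
Definition binc (cap : nat) (s : str) : nat :=
  foldl (fun n (b : bool) => if b + n.*2 <= cap then b + n.*2 else cap) 0 (rev s).

Lemma bincE cap s : binc cap s = minn (bin_val s) cap.
Proof.
rewrite /binc foldl_rev; elim: s => [|b s IH] /=; first by rewrite min0n.
by rewrite IH; case: (b); case: ifP; lia.
Qed.

Lemma PT_binc : PT (fun a : nat * str => binc a.1 a.2).
Proof.
have hb : PT nat_of_bool by exact: PT_finite.
apply: (@PT_foldl _ _ _ _ _ _ (fun a : nat * str => rev a.2) (fun=> 0)
   (fun p => if nat_of_bool p.2.2 + p.2.1.*2 <= p.1.1 then nat_of_bool p.2.2 + p.2.1.*2 else p.1.1)); [by pt | by pt | by pt |].
exists 1 => a i _; rewrite /pb expn1; set n := foldl _ _ _.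
have h : n <= a.1.
  by rewrite /n; elim/last_ind: (take _ _) => // s b IH; rewrite foldl_rcons; case: ifP.
by clearbody n; move: n h; case: a => c s n /= h; rewrite esz_pair !esz_nat; lia.
Qed.

Lemma nth_cap (s : str) v : nth false s (binc (size s) v) = nth false s (bin_val v).
Proof.
by rewrite bincE; case: ltnP => // h; rewrite !nth_default.
Qed.

Lemma tokensE s : tokens s = [seq (if nth false s (2 * i) then None else Some (nth false s (2 * i).+1)) | i <- iota 0 (size s %/ 2)].
Proof.
have [n hn] := ubnP (size s); elim: n s hn => // n IH [|a [|b s]] //; first by case: a.
move=> hn; have -> : size [:: a, b & s] %/ 2 = (size s %/ 2).+1 by rewrite /=; lia.
rewrite [iota _ _]/= [map _ _]/=.
have -> : tokens [:: a, b & s] = (if a then None else Some b) :: tokens s by case: (a).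
rewrite IH; last by move: hn => /=; lia.
congr cons; rewrite -[1]/(1 + 0) iotaDl -map_comp; apply: eq_map => i.
by rewrite /comp mulnDr.
Qed.

Definition blks (t : seq (option bool)) : seq (str) * str :=
  foldl (fun s o => if o is Some b then (s.1, s.2 ++ [:: b]) else (s.2 :: s.1, [::])) ([::], [::]) t.

Lemma decodeE s : decode s = (map bin_val (rev (blks (tokens s)).1), (blks (tokens s)).2).
Proof.
rewrite /decode /blks; have h t bl acc : let st := foldl (fun s o => if o is Some b then (s.1, s.2 ++ [:: b]) else (s.2 :: s.1, [::])) (bl, acc) t in
    rev bl ++ split_blocks t acc = rcons (rev st.1) st.2.
  elim: t bl acc => [|[b|] t IH] bl acc /=; first by rewrite cats1.
    by rewrite -IH cats1.
  by rewrite -IH rev_cons cat_rcons.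
have := h (tokens s) [::] [::]; set st := foldl _ _ _ => /= ->.
by rewrite size_rcons last_rcons -cats1 take_size_cat.
Qed.

Lemma PT_blks : PT (fun s => blks (tokens s)).
Proof.
have hs : PT (fun o : option bool => isSome o) by exact: PT_finite.
pose bo (o : option bool) := o == Some true; have ht : PT bo by exact: PT_finite.
have h1 : PT tokens.
  have hc : PT (fun p : bool * bool => if p.1 then None else Some p.2) by exact: PT_finite.
  apply: (@PT_ext _ _ _ _ (fun s => [seq (fun p : bool * bool => if p.1 then None else Some p.2) (nth false s (2 * i), nth false s (2 * i).+1) | i <- iota 0 (size s %/ 2)])).
    by move=> s; rewrite tokensE.
  apply: PT_map2; first by pt.
  by apply: (PT_comp _ hc); pt.
apply: (PT_comp h1).
apply: (@PT_ext _ _ _ _ (fun t : seq (option bool) => foldl (fun s o =>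
   if isSome o then (s.1, s.2 ++ [:: bo o]) else (s.2 :: s.1, [::])) ([::], [::]) t)).
  move=> t; rewrite /blks; elim: t ([::], [::]) => // o t IH p /=; rewrite IH.
  by case: o => [[]|].
apply: (@PT_foldl_add _ (seq (str) * str)%type _ _ _ _ (fun t : seq (option bool) => t) (fun=> ([::], [::]))
   (fun p => if isSome p.2.2 then (p.2.1.1, p.2.1.2 ++ [:: bo p.2.2]) else (p.2.1.2 :: p.2.1.1, [::]))); [by pt | by pt | by pt |].
exists 3 => a [s1 s2] o; cbn [fst snd].
have h8 : 8 <= pb 3 (esz a + esz o) by rewrite /pb -[8]/(2 ^ 3) leq_exp2r // leq_addl.
move: (pb 3 _) h8 => P h8; case: ifP => _; rewrite !esz_pair ?esz_cons ?esz_nil; last by lia.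
have := @esz_cat bool enc_bool s2 [:: bo o]; rewrite esz_cons esz_nil.
have : esz (bo o) <= 3 by case: (bo o).
lia.
Qed.

Definition ham (u v : str) : nat := size [seq i <- iota 0 (size u) | nth false u i != nth false v i].

Lemma hamE u v : size u = size v -> hamming u v = ham u v.
Proof.
move=> h; rewrite /hamming /ham size_filter.
have -> : zip u v = [seq (nth false u i, nth false v i) | i <- iota 0 (size u)].
  apply: (@eq_from_nth _ (false, false)); first by rewrite size_zip -h minnn size_map size_iota.
  move=> i; rewrite size_zip -h minnn => hi; rewrite nth_zip // (nth_map 0) ?size_iota // nth_iota //.
by rewrite count_map; apply: eq_count.
Qed.

(** * Sure reconfiguration as reachability *)

Section Steps.
Variables (m : nat) (ok : pred (str)).
Definition sure_step (u v : str) := [&& size u == m, size v == m, ok u, ok v & ham u v <= 1].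

Lemma ham0 u : ham u u = 0.
Proof. by apply/eqP; rewrite /ham size_filter -leqn0 leqNgt -has_count; apply/hasPn => i _; rewrite eqxx. Qed.

Lemma reconf_of_path a p : path sure_step a p -> 0 < size p ->
  reconf_seq m a (last a p) (a :: p) /\ forall v, v \in a :: p -> ok v.
Proof.
move=> hp hp0; have hall : all (fun v => (size v == m) && ok v) (a :: p).
  have ha : (size a == m) && ok a by case: (p) hp hp0 => //= v q /andP [/and5P [-> _ -> _ _]].
  rewrite /= ha /=; elim: (p) a hp {hp0 ha} => //= v q IH a /andP [/and5P [_ -> _ -> _] h2].
  exact: IH h2.
split; last by move=> v /(allP hall) /andP [].
do 3!split => //; split; first by apply: sub_all hall => v /andP [].
move=> t ht; have /(pathP [::]) /(_ t ht) /and5P [/eqP h1 /eqP h2 _ _ h3] := hp.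
by rewrite hamE // h1 h2.
Qed.

Lemma path_of_reconf a b s : reconf_seq m a b s -> (forall v, v \in s -> ok v) ->
  exists p, [/\ sure_step a a, path sure_step a p & last a p = b].
Proof.
case: s => [[]|a' p] // [_ [ea [hl [hsz hh]]]] hok; rewrite [head _ _]/= in ea; rewrite {}ea in hl hsz hh hok *; exists p.
have h i : i < size (a :: p) -> size (nth [::] (a :: p) i) == m /\ ok (nth [::] (a :: p) i).
  by move=> hi; split; [exact: (allP hsz _ (mem_nth _ hi)) | exact: hok _ (mem_nth _ hi)].
have [ha1 ha2] := h 0 isT; split => //; first by rewrite /sure_step ha1 ha2 ham0.
apply/(pathP [::]) => i hi; have [h1 h2] := h i (ltnW hi); have [h3 h4] := h i.+1 hi.
rewrite /sure_step h1 h2 h3 h4 /= -hamE ?(eqP h1) ?(eqP h3) //; exact: hh.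
Qed.

End Steps.

Section Check.
Variables (Vf rf : str -> str) (r : nat -> nat) (c : nat).
Hypotheses (hV : PT Vf) (hr : PT rf) (sr : forall x, size (rf x) = r (size x)).
Hypothesis hrc : forall n, r n <= c * trunc_log 2 n + c.

Definition accb (x R pi : str) : bool :=
  let st := blks (tokens (Vf (pair_enc x R))) in
  nth false st.2 (binc (size st.2) [seq nth false pi (binc (size pi) b) | b <- rev st.1]).

Lemma accbE x R pi : accb x R pi = verifier_accepts Vf x R pi.
Proof.
rewrite /accb /verifier_accepts /verifier_output decodeE nth_cap -map_comp.
by congr (nth _ _ (bin_val _)); apply: eq_map => b /=; rewrite nth_cap.
Qed.

(** The range is polynomial and covers all random strings, since [r] is logarithmic; [bitn] keeps
    the [r] low bits, so indices beyond [2 ^ r] only repeat strings. *)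
Definition okb (x pi : str) : bool :=
  size [seq i <- iota 0 (2 ^ c * (size x).+1 ^ c) | ~~ accb x (bitn (size (rf x)) i) pi] == 0.

Lemma two_r n : 2 ^ r n <= 2 ^ c * n.+1 ^ c.
Proof.
apply: (@leq_trans (2 ^ (c * trunc_log 2 n + c))); first by rewrite leq_exp2l.
rewrite expnD mulnC leq_mul2l mulnC expnM; apply/orP; right; case: (c) => // c'; rewrite leq_exp2r //.
case: n => [|n]; first by rewrite trunc_log0.
by apply: leqW; exact: trunc_logP.
Qed.

Lemma okbP x pi : accepts_surely Vf r x pi <-> okb x pi.
Proof.
rewrite /okb size_filter -leqn0 leqNgt -has_count; split.
  rewrite /accepts_surely /acc_count => h; apply/hasPn => i _; rewrite negbK accbE.
  have hs : size (bitn (size (rf x)) i) == r (size x) by rewrite size_bitn sr.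
  have := cardC [pred R : (r (size x)).-tuple bool | verifier_accepts Vf x R pi].
  rewrite h card_tuple card_bool => /eqP; rewrite -[X in _ == X]addn0 eqn_add2l => /eqP /card0_eq /(_ (Tuple hs)).
  by rewrite !inE /= => /negbFE.
move=> /hasPn h; rewrite /accepts_surely /acc_count.
have -> : 2 ^ r (size x) = #|{: (r (size x)).-tuple bool}| by rewrite card_tuple card_bool.
apply: eq_card => R; rewrite !inE -accbE.
have <- : bitn (size (rf x)) (bin_val R) = R by rewrite sr -[RHS]bitnK size_tuple.
have := h (bin_val R); rewrite negbK; apply; rewrite mem_iota /= add0n.
by apply: (leq_trans (bin_lt R)); rewrite size_tuple; exact: two_r.
Qed.

Lemma PT_okb : PT (fun a : str * str => okb a.1 a.2).
Proof.
have h1 := PT_blks; have h2 := PT_binc; have h3 := PT_bitn.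
have hp : PT (fun a : str * str => pair_enc a.1 a.2) by rewrite /pair_enc; pt.
have hst : PT (fun a : str * str * str => blks (tokens (Vf (pair_enc a.1.1 a.1.2)))).
  by apply: (PT_comp (_ : PT (fun a : str * str * str => Vf (pair_enc a.1.1 a.1.2))) h1); pt.
have ha : PT (fun a : str * str * str => accb a.1.1 a.1.2 a.2).
  have hs1 := PT_fst hst; have hs2 := PT_snd hst; rewrite /accb; cbv zeta.
  have hm : PT (fun a : str * str * str => [seq nth false a.2 (binc (size a.2) b) |
      b <- rev (blks (tokens (Vf (pair_enc a.1.1 a.1.2)))).1]) by apply: PT_map2; pt.
  apply: PT_nth; [by pt | exact: hs2 |].
  exact: (PT_comp (PT_pair (PT_size hs2) hm) h2).
by rewrite /okb; pt.
Qed.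

End Check.

Theorem verifier_PSPACE L : reconf_pcp L -> inPSPACE L.
Proof.
move=> [Vf [rf [r [q [c [ps [pg [/PolyTime_PT hV [/PolyTime_PT hr [/PolyTime_PT hs [/PolyTime_PT hg
  [sr [hrc [_ [_ hL]]]]]]]]]]]]]]].
have hok := PT_okb c hV hr; pose ok := okb Vf rf c.
pose e x := sure_step (size (ps x)) (ok x).
have he : PT (fun a : str * str * str => e a.1.1 a.1.2 a.2) by rewrite /e /sure_step /ok /ham; pt.
(* [QV] prepends each choice, so the bits arrive in reverse order of the quantifiers. *)
pose par x bits := iter (size (ps x)) (pstep (size (ps x))) (rev bits, (ps x, pg x)).
pose phi x bits := e x (par x bits).2.1 (par x bits).2.2.
have hsz x u v : e x u v -> size v = size (ps x) by case/and5P => _ /eqP.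
have hre x u v : e x u v -> e x v v by rewrite /e /sure_step ham0 => /and5P [_ -> _ -> _].
apply: (@QBF_PSPACE (fun x => sops (size (ps x)) (size (ps x))) phi).
- apply: (PT_ext (f := fun x => flatten [seq [seq false | _ <- iota 0 (size (ps x))] ++ [:: true] | _ <- iota 0 (size (ps x))])); last by pt.
  move=> x; rewrite /sops; congr flatten; apply: eq_map => _; congr (_ ++ _).
  by elim: (size _) 0 => //= n IH a; rewrite IH.
- have hp : PT (fun a : str * str => par a.1 a.2).
    apply: (@PT_iterc _ (str * (str * str))%type _ _ (fun a : str * str => size (ps a.1))
      (fun a => (rev a.2, (ps a.1, pg a.1))) (fun p => pstep (size (ps p.1.1)) p.2)).
    + by pt.
    + by pt.
    + by rewrite /pstep; pt.
    have [k1 hk1] := PT_eszk (PT_comp PT_fst_ hs : PT (fun a : str * str => ps a.1)).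
    have [k2 hk2] := PT_eszk (PT_comp PT_fst_ hg : PT (fun a : str * str => pg a.1)).
    have [k3 hk3] := PT_eszk (PT_rev PT_snd_ : PT (fun a : str * str => rev a.2)).
    have [k hk] : polyb (fun n => pb k3 n * 3 + pb k1 n + pb k2 n + 3) by poly.
    exists k => a i _; apply: leq_trans (hk _); have := hk1 a; have := hk2 a; have := hk3 a.
    set st := iter _ _ _ => h3 h2 h1.
    enough ([/\ esz st.1 <= esz (rev a.2), esz st.2.1 <= esz (ps a.1) + esz (rev a.2) & esz st.2.2 <= esz (pg a.1) + esz (rev a.2)]) as [g1 g2 g3].
      by move: g1 g2 g3; case: (st) => b [u v] /=; rewrite !esz_pair; lia.
    rewrite /st; elim: i {st} => [|i IH]; first by split; rewrite ?leq_addr.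
    rewrite iterS; move: IH; case: (iter _ _ _) => b [u v] /= [g1 g2 g3]; rewrite /pstep /=.
    have d1 := @esz_drop bool enc_bool (size (ps a.1)).+1 b; have d2 := @esz_take bool enc_bool (size (ps a.1)) b.
    by case: ifP => _; split; cbn [fst snd]; lia.
  rewrite /phi; apply: (PT_comp (_ : PT (fun a : str * str => (a.1, (par a.1 a.2).2.1, (par a.1 a.2).2.2))) he).
  by pt.
move=> x; rewrite (QV_RR (e := e x) (u := ps x) (v := pg x)); last by move=> s _; rewrite /phi /par cats0 revK.
have okP pi : accepts_surely Vf r x pi <-> ok x pi by exact: okbP.
split.
  (* Outside [L], soundness would produce on this path a string accepted with probability below 1/2,
     while every string on it is accepted surely. *)
  move=> /RR_path [p [hp hl hp0]]; apply: NNPP => nL; have [h1 h2] := reconf_of_path hp hp0.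
  have [_ /(_ nL)] := hL x; rewrite hl in h1; move=> /(_ _ h1) [pi /h2 /okP]; rewrite /accepts_surely /accepts_lt_half => ->.
  by lia.
move=> Lx; have [/(_ Lx) [s [h1 h2]] _] := hL x.
have [p [e1 e2 e3]] := path_of_reconf h1 (fun v hv => (okP v).1 (h2 v hv)).
by rewrite -e3; apply: reach_RR; [exact: hsz | exact: hre | |].
Qed.

Theorem mainTheorem1 (L : seq bool -> Prop) :
  inPSPACE L <->
  exists (Vf rf : seq bool -> seq bool) (r q : nat -> nat) (c : nat)
         (pstart pgoal : seq bool -> seq bool),
    PolyTime Vf /\ PolyTime rf /\ PolyTime pstart /\ PolyTime pgoal /\
    (forall x, size (rf x) = r (size x)) /\
    (forall n, r n <= c * trunc_log 2 n + c) /\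
    (forall n, q n <= c) /\
    verifier_shape Vf r q /\
    forall x : seq bool,
      (L x -> exists s, reconf_seq (size (pstart x)) (pstart x) (pgoal x) s /\
                 forall pi, pi \in s -> accepts_surely Vf r x pi) /\
      (~ L x -> forall s, reconf_seq (size (pstart x)) (pstart x) (pgoal x) s ->
                 exists2 pi, pi \in s & accepts_lt_half Vf r x pi).
Proof.
by split; [exact: PSPACE_verifier | exact: verifier_PSPACE].
Qed.
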